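(* Let $X_M=\sum_{n\ge1}\delta_{(X_n,M_n)}$ be a stationary (simple) marked point process on $\mathbb{R}^d$ with Polish mark space $\mathbb{M}$ and intensity $\lambda>0$, satisfying Condition $\beta(\delta)$, and let $\{W_k\}$ be a convex averaging sequence in $\mathbb{R}^d$. For $C\in\mathcal{B}(\mathbb{M})$ put $$Z_k(C)=\sqrt{|W_k|}\,\Bigl(\frac{X_M(W_k\times C)}{X_M(W_k\times\mathbb{M})}-P_M^{\mathbf{o}}(C)\Bigr).$$ Then for any $\ell\ge1$ and any $C_1,\dots,C_\ell\in\mathcal{B}(\mathbb{M})$, as $k\to\infty$, $$\mathbf{Z}_k=\bigl(Z_k(C_1),\dots,Z_k(C_\ell)\bigr)^\top\ \longrightarrow\ \mathcal{N}_\ell(\mathbf{o}_\ell,\lambda^{-2}\mathbf{\Sigma})\quad\text{in distribution},$$ where $\mathbf{o}_\ell=(0,\dots,0)^\top$, $\mathbf{\Sigma}=(\sigma_{ij})_{i,j=1}^\ell$, $\sigma_{ij}=\lim_{k\to\infty}\mathbb{E}\,Y_k(C_i)Y_k(C_j)$ and $$Y_k(C)=\frac{1}{\sqrt{|W_k|}}\sum_{n\ge1}\mathbf{1}_{W_k}(X_n)\bigl(\mathbf{1}_C(M_n)-P_M^{\mathbf{o}}(C)\bigr).$$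
   Context: A marked point process (MPP) $X_M=\sum_{n\ge1}\delta_{(X_n,M_n)}$ is a random counting measure on $\mathcal{B}(\mathbb{R}^d\times\mathbb{M})$, with $\mathbb{M}$ Polish, such that $X_M(B\times\mathbb{M})<\infty$ for all bounded Borel $B\subset\mathbb{R}^d$; it is defined on a probability space $(\Omega,\mathcal{A},\mathbb{P})$. Throughout, $X_M$ is simple: all locations $X_n$ have multiplicity one regardless of their marks. It is stationary if $\sum_n\delta_{(X_n-x,M_n)}$ has the same distribution as $X_M$ for all $x\in\mathbb{R}^d$. The intensity is $\lambda=\mathbb{E}X_M([0,1)^d\times\mathbb{M})$ (finite), and the Palm mark distribution is $P_M^{\mathbf{o}}(C)=\lambda^{-1}\mathbb{E}X_M([0,1)^d\times C)$, $C\in\mathcal{B}(\mathbb{M})$. $|\cdot|$ denotes Lebesgue measure on $\mathbb{R}^d$, and $\mathcal{N}_\ell(a,\mathbf{\Sigma})$ denotes an $\ell$-dimensional Gaussian vector with mean $a$ and (possibly singular) covariance matrix $\mathbf{\Sigma}$. The ratio $X_M(W_k\times C)/X_M(W_k\times\mathbb{M})$ may be given any fixed value (e.g. $0$) when the denominator is $0$. A convex averaging sequence (CAS) is an increasing sequence $\{W_k\}$ of convex compact sets in $\mathbb{R}^d$ with $\varrho(W_k)=\sup\{r>0: B(x,r)\subset W_k\text{ for some }x\in W_k\}\to\infty$, where $B(x,r)$ is the closed Euclidean ball. Mixing: for Borel $B\subset\mathbb{R}^d$, $\mathcal{A}_{X_M}(B)$ is the sub-$\sigma$-algebra of $\mathcal{A}$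 generated by the restriction of $X_M$ to $B\times\mathbb{M}$. The $\beta$-mixing coefficient is $$\beta(\mathcal{A}_{X_M}(B),\mathcal{A}_{X_M}(B'))=\tfrac12\sup\sum_{i,j}|\mathbb{P}(A_i\cap A_j')-\mathbb{P}(A_i)\mathbb{P}(A_j')|,$$ the supremum being over all finite partitions $\{A_i\}$, $\{A'_j\}$ of $\Omega$ with $A_i\in\mathcal{A}_{X_M}(B)$, $A_j'\in\mathcal{A}_{X_M}(B')$. With $K_a=[-a,a]^d$ and $K_a^c=\mathbb{R}^d\setminus K_a$, the mixing rates $\beta^*_{X_M},\beta^{**}_{X_M}:[\frac12,\infty)\to[0,\infty)$ are non-increasing functions such that $$\beta(\mathcal{A}_{X_M}(K_a),\mathcal{A}_{X_M}(K^c_{a+b}))\le\begin{cases}\beta^*_{X_M}(b)&\text{for }\frac12\le a\le b,\\ a^{d-1}\beta^{**}_{X_M}(b)&\text{for }\frac12\le b\le a.\end{cases}$$ Condition $\beta(\delta)$: there exists some $\delta>0$ such that $\mathbb{E}\bigl(X_M([0,1]^d\times\mathbb{M})\bigr)^{2+\delta}<\infty$, $\int_1^\infty r^{d-1}\bigl(\beta^*_{X_M}(r)\bigr)^{\delta/(2+\delta)}\,dr<\infty$, and $r^{2d-1}\beta^{**}_{X_M}(r)\to0$ as $r\to\infty$. *)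

(* Defs.v *)
From HB Require Import structures.
From mathcomp Require Import all_boot all_order all_algebra.
From mathcomp Require Import all_classical all_reals all_analysis.
From mathcomp Require Import measurable_realfun.

Set Implicit Arguments.
Unset Strict Implicit.
Unset Printing Implicit Defensive.

Import Order.TTheory GRing.Theory Num.Theory.
Import numFieldNormedType.Exports.

Local Open Scope classical_set_scope.
Local Open Scope ring_scope.

(* The topological space T equipped with its Borel sigma-algebra. *)
Notation borel T := (g_sigma_algebraType (@open T)).

(* Polish is a topological property: the complete metric is not part of the
   structure, only its existence is required. *)
Definition polish (R : realType) (T : topologicalType) : Prop :=
  (exists dist : T -> T -> R,
    [/\ forall x y, dist x y = 0 <-> x = y,
        forall x y, dist x y = dist y x,
        forall x y z, dist x z <= dist x y + dist y z,
        forall (x : T) (A : set T),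
          nbhs x A <-> exists2 e : R, 0 < e & [set y | dist x y < e] `<=` A
      & forall u : nat -> T,
          (forall e : R, 0 < e ->
             exists N, forall m n, (N <= m)%N -> (N <= n)%N ->
               dist (u m) (u n) < e) ->
          exists x : T, u @ \oo --> x]) /\
  (exists2 D : set T, countable D & dense D).

Section Euclidean.
Context {R : realType} {d : nat}.

(* I^d *)
Definition cube (I : interval R) : set 'rV[R]_d :=
  [set x | forall i, x ord0 i \in I].

Definition eball (x : 'rV[R]_d) (r : R) : set 'rV[R]_d :=
  [set y | Num.sqrt (\sum_i (y ord0 i - x ord0 i) ^+ 2) <= r].

(* d-dimensional Lebesgue outer measure: infimum of the total volume of the
   countable covers by half-open boxes; on Borel sets it is Lebesgue measure. *)
Definition lebesgue_rV (A : set 'rV[R]_d) : \bar R :=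
  ereal_inf [set s | exists a b : nat -> 'rV[R]_d,
    [/\ forall n i, a n ord0 i <= b n ord0 i,
        A `<=` \bigcup_n [set x | forall i, a n ord0 i < x ord0 i <= b n ord0 i]
      & s = (\sum_(n <oo) (\prod_i (b n ord0 i - a n ord0 i))%:E)%E]].

Definition vol (A : set 'rV[R]_d) : R := fine (lebesgue_rV A).

Definition inradius (W : set 'rV[R]_d) : \bar R :=
  ereal_sup [set r%:E | r in
    [set r : R | 0 < r /\ exists2 x, W x & eball x r `<=` W]].

Definition convex_averaging_sequence (W : nat -> set 'rV[R]_d) : Prop :=
  [/\ forall k, W k `<=` W k.+1,
      forall k, convex_set (W k : set (convex_lmodType 'rV[R]_d)),
      forall k, compact (W k)
    & (inradius (W k) @[k --> \oo] --> +oo%E)].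

End Euclidean.

Section MarkedPointProcess.
Context {R : realType} {dO : measure_display} {Omega : measurableType dO}.
Context {d : nat} {M : ptopologicalType}.
Variable P : probability Omega R.

Local Notation E := (borel 'rV[R]_d * borel M)%type.

Definition counting_measure (mu : set E -> \bar R) : Prop :=
  exists (D : set nat) (z : nat -> E),
    forall A, measurable A -> mu A = (\esum_(n in D) \d_(z n) A)%E.

(* A kernel from Omega is a map w |-> X w into measures such that each X w A
   (A measurable) is a random variable. *)
Definition marked_point_process (X : R.-ker Omega ~> E) : Prop :=
  (forall w, counting_measure (X w)) /\
  (forall w (B : set (borel 'rV[R]_d)), measurable B ->
    bounded_set (B : set 'rV[R]_d) -> (X w (B `*` setT) < +oo)%E).

Definition simple_process (X : R.-ker Omega ~> E) : Prop :=
  forall w (x : 'rV[R]_d), (X w ([set x] `*` setT) <= 1)%E.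

(* sigma-algebra on the space of set functions generated by the evaluations
   mu |-> mu A, A measurable; laws of random measures live on it. *)
Definition evaluation_sigma : set_system (set E -> \bar R) :=
  <<s \bigcup_(A in measurable)
        preimage_set_system setT (fun mu : set E -> \bar R => mu A) measurable >>.

Definition shift_marked (x : 'rV[R]_d) (z : E) : E :=
  ((z.1 : 'rV[R]_d) - x, z.2).

Definition stationary (X : R.-ker Omega ~> E) : Prop :=
  forall (x : 'rV[R]_d) (F : set (set E -> \bar R)), evaluation_sigma F ->
    P [set w | F (pushforward (X w) (shift_marked x))] = P [set w | F (X w)].

Definition intensity (X : R.-ker Omega ~> E) : \bar R :=
  (\int[P]_w X w (cube `[0%R, 1%R[ `*` setT))%E.

Definition palm_mark (X : R.-ker Omega ~> E) (C : set (borel M)) : R :=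
  (fine (intensity X))^-1 * fine (\int[P]_w X w (cube `[0%R, 1%R[ `*` C))%E.

(* the sub-sigma-algebra generated by the restriction of X to B x M *)
Definition sigma_restr (X : R.-ker Omega ~> E) (B : set 'rV[R]_d) :
    set_system Omega :=
  preimage_set_system setT
    (fun w => fun A : set E => X w (A `&` (B `*` setT))) evaluation_sigma.

Definition finite_partition_in (G : set_system Omega) (m : nat)
    (A : 'I_m -> set Omega) : Prop :=
  [/\ forall i, G (A i), trivIset setT A & \bigcup_i A i = setT].

Definition beta_mixing (G G' : set_system Omega) : \bar R :=
  ereal_sup [set s | exists (m n : nat)
      (A : 'I_m -> set Omega) (A' : 'I_n -> set Omega),
    [/\ finite_partition_in G A, finite_partition_in G' A'
      & s = (2^-1 * \sum_i \sum_j
          `|fine (P (A i `&` A' j)) - fine (P (A i)) * fine (P (A' j))|)%:E]].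

Definition mixing_rates (X : R.-ker Omega ~> E) (bs bss : R -> R) : Prop :=
  let half_line := `[2^-1, +oo[ in
  let coef (a b : R) := beta_mixing (sigma_restr X (cube `[- a, a]))
                          (sigma_restr X (~` cube `[- (a + b), a + b])) in
  [/\ (forall r, r \in half_line -> 0 <= bs r /\ 0 <= bss r),
      {in half_line &, nonincreasing_fun bs},
      {in half_line &, nonincreasing_fun bss},
      (forall a b, 2^-1 <= a -> a <= b -> (coef a b <= (bs b)%:E)%E)
    & (forall a b, 2^-1 <= b -> b <= a ->
        (coef a b <= (a ^+ d.-1 * bss b)%:E)%E)].

Definition condition_beta (X : R.-ker Omega ~> E) (bs bss : R -> R) : Prop :=
  exists2 delta : R, 0 < delta &
  [/\ (\int[P]_w ((X w (cube `[0%R, 1%R] `*` setT)) `^ (2 + delta)) < +oo)%E,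
      (\int[lebesgue_measure]_(r in `[1%R, +oo[)
         (r ^+ d.-1 * (bs r) `^ (delta / (2 + delta)))%:E < +oo)%E
    & (r ^+ (2 * d).-1 * bss r @[r --> +oo] --> 0)].

(* sum over the points (X_n, M_n) of 1_W(X_n) (1_C(M_n) - P_M^o(C)), written as
   an integral against the counting measure X w *)
Definition Y_stat (X : R.-ker Omega ~> E) (W : set 'rV[R]_d)
    (C : set (borel M)) (w : Omega) : R :=
  (Num.sqrt (vol W))^-1 *
  (\int[X w]_z (\1_W z.1 * (\1_C z.2 - palm_mark X C)))%R.

(* the ratio is 0 when its denominator is 0, since 0^-1 = 0 *)
Definition Z_stat (X : R.-ker Omega ~> E) (W : set 'rV[R]_d)
    (C : set (borel M)) (w : Omega) : R :=
  Num.sqrt (vol W) *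
  (fine (X w (W `*` C)) / fine (X w (W `*` setT)) - palm_mark X C).

Definition cvg_in_distribution (l : nat) (Z : nat -> Omega -> 'rV[R]_l)
    (mu : set (borel 'rV[R]_l) -> \bar R) : Prop :=
  forall f : 'rV[R]_l -> R, continuous f ->
    (exists c, forall x, `|f x| <= c) ->
    'E_P[f \o Z k]%E @[k --> \oo] --> (\int[mu]_x (f x)%:E)%E.

End MarkedPointProcess.

(* N(m, v) on R with variance v; normal_prob takes the standard deviation and
   is not the Dirac mass when this is 0. *)
Definition normal_law (R : realType) (m v : R) : set R -> \bar R :=
  if v == 0 then \d_m else normal_prob m (Num.sqrt v).

(* mu is the law of a Gaussian vector with mean a and (possibly singular)
   covariance matrix S: every linear functional <t, .> is normal, with mean
   <t, a> and variance t S t^T. *)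
Definition gaussian_law (R : realType) (l : nat) (a : 'rV[R]_l) (S : 'M[R]_l)
    (mu : set (borel 'rV[R]_l) -> \bar R) : Prop :=
  [/\ S^T = S, forall t : 'rV[R]_l, 0 <= (t *m S *m t^T) ord0 ord0
    & forall (t : 'rV[R]_l) (A : set R), measurable A ->
        mu [set x : 'rV[R]_l | A ((x *m t^T) ord0 ord0)] =
        normal_law ((a *m t^T) ord0 ord0) ((t *m S *m t^T) ord0 ord0) A].

(* Main.v *)
Require Import Defs.
From HB Require Import structures.
From mathcomp Require Import all_boot all_order all_algebra.
From mathcomp Require Import all_classical all_reals all_analysis.
From mathcomp Require Import measurable_realfun.
From mathcomp Require Import ring lra zify.
Import Order.TTheory GRing.Theory Num.Theory.
Import numFieldNormedType.Exports.
Local Open Scope classical_set_scope.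
Local Open Scope ring_scope.


Set Implicit Arguments.
Unset Strict Implicit.
Unset Printing Implicit Defensive.

(** By the Cramer-Wold principle it suffices to control, for each [t], the characteristic function
    of the combination of the $Y_k(C_i)$ with coefficients [t]. That combination is
    $|W_k|^{-1/2}\sum_j a_j X_M(W_k\times D_j)$, where the $D_j$ are the sets $C_i$ and the whole
    mark space, the latter weighted so that the mean vanishes ([dotr_Y], [kappa0]).

    Cutting $\mathbb{R}^d$ into unit lattice cells turns such counts into sums over a stationary
    random field on $\mathbb{Z}^d$. Truncation of variables with $2+\delta$ moments shows that
    beta-mixing bounds the covariance of two cells at lattice distance $n\ge 2$ by a constant times
    the power $\delta/(2+\delta)$ of [bs] at $n-3/2$ ([beta_cov_moment], [field_cov]). The integral
    in Condition $\beta(\delta)$ makes these bounds summable over $\mathbb{Z}^d$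
    ([lsum_gth_bounded]) and forces $m^d$ times the rate to tend to 0 ([bsn_decay]).

    For a bounded field the central limit theorem follows from Stein's method. Write
    $\varphi(s)=\mathbb{E}\cos(sS+\theta)$. Deleting from $S$ a neighbourhood of each summand,
    expanding to first order and decoupling by mixing gives $\varphi'(s)\approx
    -s\,\mathrm{Var}(S)\,\varphi(s)$, so $\varphi(1)$ is close to its Gaussian value ([stein_sum],
    [charfun_of_stein], [bounded_field_clt]). Unbounded fields are reached by truncation, since the
    covariance bounds make the variance of the tails uniformly small ([field_clt]).

    For convex windows with large inradius, the cells near the boundary are squeezed between two
    dilations of the window and so form a negligible fraction ([boundary_count]). Hence the
    normalised variance converges to the sum of all covariances and the limit theorem passes to the
    windows ([window_clt], [mpp_clt]).

    The same theorem applied to the plain number of points shows that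
    $D_k=X_M(W_k\times\mathbb{M})/|W_k|$ tends to $\lambda$ in mean square. As $Z_k=Y_k/D_k$ away
    from small values of $D_k$, a Slutsky argument replaces $D_k$ by $\lambda$ ([Z_cos_close],
    [Z_tight]).

    Two classical facts close the argument: the continuity theorem, obtained from uniform
    approximation by trigonometric polynomials on compact boxes ([levy_continuity]), and the
    existence of a Gaussian law with any positive semidefinite covariance, obtained by writing the
    quadratic form as a sum of squares ([gaussian_exists]). *)

(** * Expectations of integrable, bounded and square-integrable variables *)

Section expectation.
Context d (T : measurableType d) (R : realType) (P : probability T R).
Implicit Types (f g : T -> R).

Definition ig f := P.-integrable setT (EFin \o f).
Definition Ex f : R := Rintegral P setT f.
Definition bm f := measurable_fun setT f /\ exists c, forall x, `|f x| <= c.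
Definition L2 f := measurable_fun setT f /\ ig (fun x => f x ^+ 2).

Lemma ig_meas f : ig f -> measurable_fun setT f.
Proof. by move=> /measurable_int /measurable_EFinP. Qed.

Lemma ig_le f g : measurable_fun setT f -> ig g -> (forall x, `|f x| <= g x) ->
  ig f.
Proof.
move=> mf ig_g fg; apply: le_integrable ig_g => //.
  exact/measurable_EFinP.
by move=> x _ /=; rewrite lee_fin (le_trans (fg x)) ?ler_norm.
Qed.

Lemma ig_cst (c : R) : ig (cst c).
Proof. exact: finite_measure_integrable_cst. Qed.

Lemma igD f g : ig f -> ig g -> ig (fun x => f x + g x).
Proof. by move=> hf hg; exact: (@integrableD _ _ _ P _ measurableT (EFin \o f) (EFin \o g)). Qed.

Lemma igZ (c : R) f : ig f -> ig (fun x => c * f x).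
Proof. by move=> hf; exact: (@integrableZl _ _ _ P _ measurableT c (EFin \o f)). Qed.

Lemma igB f g : ig f -> ig g -> ig (fun x => f x - g x).
Proof. by move=> hf hg; exact: (@integrableB _ _ _ P _ measurableT (EFin \o f) (EFin \o g)). Qed.

Lemma ig_norm f : ig f -> ig (fun x => `|f x|).
Proof. by move=> hf; apply: integrable_norm. Qed.

Lemma ig_sum (I : Type) (s : seq I) (p : pred I) (F : I -> T -> R) :
  (forall i, ig (F i)) -> ig (fun x => \sum_(i <- s | p i) F i x).
Proof.
move=> hF; elim: s => [|i s IHs].
  by under [X in ig X]funext do rewrite big_nil; exact: ig_cst.
under [X in ig X]funext do rewrite big_cons; case: (p i) => //.
exact: igD.
Qed.

Lemma ExD f g : ig f -> ig g -> Ex (fun x => f x + g x) = Ex f + Ex g.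
Proof. by move=> hf hg; rewrite /Ex RintegralD. Qed.

Lemma ExB f g : ig f -> ig g -> Ex (fun x => f x - g x) = Ex f - Ex g.
Proof. by move=> hf hg; rewrite /Ex RintegralB. Qed.

Lemma ExZ c f : ig f -> Ex (fun x => c * f x) = c * Ex f.
Proof. by move=> hf; rewrite /Ex RintegralZl. Qed.

Lemma Ex_cst (c : R) : Ex (fun=> c) = c.
Proof.
rewrite /Ex Rintegral_cst//.
have -> : (P : {measure set T -> \bar R}) setT = 1%E by exact: probability_setT.
by rewrite /= mulr1.
Qed.

Lemma eq_Ex f g : f =1 g -> Ex f = Ex g.
Proof. by move=> /funext ->. Qed.

Lemma Ex_sum (I : Type) (s : seq I) (p : pred I) (F : I -> T -> R) :
  (forall i, ig (F i)) ->
  Ex (fun x => \sum_(i <- s | p i) F i x) = \sum_(i <- s | p i) Ex (F i).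
Proof.
move=> hF; elim: s => [|i s IHs].
  by under eq_Ex do rewrite big_nil; rewrite Ex_cst big_nil.
under eq_Ex do rewrite big_cons; rewrite big_cons; case: (p i) => //.
by rewrite ExD ?IHs//; exact: ig_sum.
Qed.

Lemma le_Ex f g : ig f -> ig g -> (forall x, f x <= g x) -> Ex f <= Ex g.
Proof. by move=> hf hg fg; apply: le_Rintegral. Qed.

Lemma Ex_ge0 f : (forall x, 0 <= f x) -> 0 <= Ex f.
Proof. by move=> f0; apply: Rintegral_ge0. Qed.

Lemma norm_Ex f : ig f -> `|Ex f| <= Ex (fun x => `|f x|).
Proof. by move=> hf; apply: le_normr_Rintegral. Qed.

Lemma norm_Ex_le f g : ig f -> ig g -> (forall x, `|f x| <= g x) ->
  `|Ex f| <= Ex g.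
Proof.
move=> hf hg fg; apply: le_trans (norm_Ex hf) _.
by apply: le_Ex => //; exact: ig_norm.
Qed.

Lemma bm_ig f : bm f -> ig f.
Proof.
by move=> [mf [c fc]]; apply: ig_le (ig_cst c) _.
Qed.

Lemma norm_Ex_bound c f : measurable_fun setT f -> (forall x, `|f x| <= c) ->
  `|Ex f| <= c.
Proof.
move=> mf fc; rewrite -[leRHS]Ex_cst; apply: norm_Ex_le => //.
  by apply: bm_ig; split => //; exists c.
exact: ig_cst.
Qed.

Lemma bm_cst (c : R) : bm (fun=> c).
Proof. by split; [exact: measurable_cst|exists `|c|]. Qed.

Lemma bmD f g : bm f -> bm g -> bm (fun x => f x + g x).
Proof.
move=> [mf [a fa]] [mg [b gb]]; split; first exact: measurable_funD.
by exists (a + b) => x; rewrite (le_trans (ler_normD _ _))// lerD.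
Qed.

Lemma bmM f g : bm f -> bm g -> bm (fun x => f x * g x).
Proof.
move=> [mf [a fa]] [mg [b gb]]; split; first exact: measurable_funM.
by exists (a * b) => x; rewrite normrM ler_pM.
Qed.

Lemma bmZ c f : bm f -> bm (fun x => c * f x).
Proof. by apply: bmM; exact: bm_cst. Qed.

Lemma bmN f : bm f -> bm (fun x => - f x).
Proof.
by move=> /(bmZ (-1)); under [X in bm X -> _]funext do rewrite mulN1r.
Qed.

Lemma bmB f g : bm f -> bm g -> bm (fun x => f x - g x).
Proof. by move=> hf hg; apply: bmD => //; exact: bmN. Qed.

Lemma bm_norm f : bm f -> bm (fun x => `|f x|).
Proof.
move=> [mf [a fa]]; split; first exact: measurableT_comp.
by exists a => x; rewrite normr_id.
Qed.

Lemma bmX n f : bm f -> bm (fun x => f x ^+ n).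
Proof.
move=> bf; elim: n => [|n IHn].
  by under [X in bm X]funext do rewrite expr0; exact: bm_cst.
by under [X in bm X]funext do rewrite exprS; exact: bmM.
Qed.

Lemma bm_sum (I : Type) (s : seq I) (p : pred I) (F : I -> T -> R) :
  (forall i, bm (F i)) -> bm (fun x => \sum_(i <- s | p i) F i x).
Proof.
move=> hF; elim: s => [|i s IHs].
  by under [X in bm X]funext do rewrite big_nil; exact: bm_cst.
under [X in bm X]funext do rewrite big_cons; case: (p i) => //.
exact: bmD.
Qed.

Lemma bm_comp (u : R -> R) c f : measurable_fun setT u ->
  (forall x, `|u x| <= c) -> measurable_fun setT f -> bm (fun x => u (f x)).
Proof.
by move=> mu uc mf; split; [exact: measurableT_comp|exists c].
Qed.

Lemma bm_L2 f : bm f -> L2 f.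
Proof. by move=> bf; split; [case: bf|apply: bm_ig; exact: bmX]. Qed.

Lemma L2_igM f g : L2 f -> L2 g -> ig (fun x => f x * g x).
Proof.
move=> [mf hf] [mg hg]; apply: (@ig_le _ (fun x => f x ^+ 2 + g x ^+ 2)).
- exact: measurable_funM.
- exact: igD.
- move=> x; rewrite normrM -(real_normK (num_real (f x))).
  rewrite -(real_normK (num_real (g x))).
  by have := sqr_ge0 (`|f x| - `|g x|); nra.
Qed.

Lemma L2_ig f : L2 f -> ig f.
Proof.
move=> hf; have := L2_igM hf (bm_L2 (bm_cst 1)).
by under [X in ig X]funext do rewrite mulr1.
Qed.

Lemma L2Z c f : L2 f -> L2 (fun x => c * f x).
Proof.
move=> [mf hf]; split; first exact: measurable_funM.
by under [X in ig X]funext do rewrite exprMn; exact: igZ.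
Qed.

Lemma L2D f g : L2 f -> L2 g -> L2 (fun x => f x + g x).
Proof.
move=> hf hg; split; first by apply: measurable_funD; [case: hf|case: hg].
under [X in ig X]funext do rewrite sqrrD.
apply: igD; last by case: hg.
apply: igD; first by case: hf.
under [X in ig X]funext do rewrite -mulr_natl.
by apply: igZ; exact: L2_igM.
Qed.

Lemma L2B f g : L2 f -> L2 g -> L2 (fun x => f x - g x).
Proof.
move=> hf /(L2Z (-1)) hg; have := L2D hf hg.
by under [X in L2 X -> _]funext do rewrite mulN1r.
Qed.

Lemma L2_sum (I : Type) (s : seq I) (p : pred I) (F : I -> T -> R) :
  (forall i, L2 (F i)) -> L2 (fun x => \sum_(i <- s | p i) F i x).
Proof.
move=> hF; elim: s => [|i s IHs].
  by under [X in L2 X]funext do rewrite big_nil; exact/bm_L2/bm_cst.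
under [X in L2 X]funext do rewrite big_cons; case: (p i) => //.
exact: L2D.
Qed.

Lemma L2_norm f : L2 f -> L2 (fun x => `|f x|).
Proof.
move=> [mf hf]; split; first exact: measurableT_comp.
by under [X in ig X]funext do rewrite real_normK ?num_real//.
Qed.

Lemma L2_bmM f g : bm f -> L2 g -> L2 (fun x => f x * g x).
Proof.
move=> [mf [c fc]] [mg hg]; split; first exact: measurable_funM.
apply: (ig_le _ (igZ (c ^+ 2) hg)).
  by apply: measurable_funX; exact: measurable_funM.
move=> x; rewrite exprMn normrM ger0_norm ?sqr_ge0// ger0_norm ?sqr_ge0//.
rewrite ler_wpM2r ?sqr_ge0// -(real_normK (num_real (f x))).
by rewrite lerXn2r ?nnegrE// (le_trans _ (fc x)).
Qed.

(** Cauchy-Schwarz, from the sign of the quadratic polynomial [t |-> Ex (f + t g)^2]. *)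
Lemma Ex_sqr_sum_sqr f g : L2 f -> L2 g -> 
  (Ex (fun x => f x * g x)) ^+ 2 <=
  Ex (fun x => f x ^+ 2) * Ex (fun x => g x ^+ 2).
Proof.
move=> hf hg.
set a := Ex (fun x => f x ^+ 2); set b := Ex (fun x => g x ^+ 2).
set c := Ex _.
have quad t : 0 <= a + t * (2 * c) + t ^+ 2 * b.
  have := @Ex_ge0 (fun x => (f x + t * g x) ^+ 2) (fun x => sqr_ge0 _).
  have -> : (fun x => (f x + t * g x) ^+ 2) =
    (fun x => (f x ^+ 2 + (t * 2) * (f x * g x)) + t ^+ 2 * g x ^+ 2).
    by apply/funext => x; ring.
  have i1 := L2_igM hf hg.
  case: hf => _ hf; case: hg => _ hg.
  rewrite ExD ?ExD ?ExZ ?mulrA//; [exact: igZ| |exact: igZ].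
  by apply: igD => //; exact: igZ.
have b0 : 0 <= b by apply: Ex_ge0 => x; exact: sqr_ge0.
have a0 : 0 <= a by apply: Ex_ge0 => x; exact: sqr_ge0.
(* If [b] vanishes the polynomial is affine in [t], and a non-negative affine function is constant.
   Otherwise the minimiser [- c / b] gives the inequality. *)
have [b00|bn0] := eqVneq b 0.
  suff -> : c = 0 by rewrite expr0n b00 mulr0.
  apply/eqP/negPn/negP => cn0.
  have := quad (- (a + 1) / (2 * c)).
  have -> : - (a + 1) / (2 * c) * (2 * c) = - (a + 1).
    by rewrite divfK// mulf_neq0// pnatr_eq0.
  by rewrite b00; lra.
have bp : 0 < b by rewrite lt_def bn0.
have := quad (- c / b).
have -> : - c / b * (2 * c) = - 2 * (c ^+ 2 / b) by field.
have -> : (- c / b) ^+ 2 * b = c ^+ 2 / b by field.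
move=> h; have : c ^+ 2 / b <= a by lra.
by rewrite ler_pdivrMr.
Qed.

Lemma Ex_sqr_le f : L2 f -> (Ex f) ^+ 2 <= Ex (fun x => f x ^+ 2).
Proof.
move=> hf; have := Ex_sqr_sum_sqr hf (bm_L2 (bm_cst 1)).
under eq_Ex do rewrite mulr1.
by under [X in _ * X]eq_Ex do rewrite expr1n; rewrite Ex_cst mulr1.
Qed.

Lemma Ex_norm_le f : L2 f -> Ex (fun x => `|f x|) <= Num.sqrt (Ex (fun x => f x ^+ 2)).
Proof.
move=> hf; have := Ex_sqr_le (L2_norm hf).
under [in leRHS]eq_Ex do rewrite real_normK ?num_real//.
move=> h; rewrite -ler_sqr ?nnegrE ?sqrtr_ge0//; last exact: Ex_ge0.
by rewrite sqr_sqrtr// Ex_ge0// => x; exact: sqr_ge0.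
Qed.

Lemma ExM_le f g : L2 f -> L2 g -> `|Ex (fun x => f x * g x)| <=
  Num.sqrt (Ex (fun x => f x ^+ 2)) * Num.sqrt (Ex (fun x => g x ^+ 2)).
Proof.
move=> hf hg; rewrite -ler_sqr ?nnegrE ?mulr_ge0 ?sqrtr_ge0//.
rewrite real_normK ?num_real// exprMn !sqr_sqrtr ?Ex_ge0//.
- exact: Ex_sqr_sum_sqr.
- by move=> x; exact: sqr_ge0.
- by move=> x; exact: sqr_ge0.
Qed.

End expectation.

(** * Mean value and Taylor estimates on the line *)

Section calculus.
Context (R : realType).
Implicit Types (f df : R -> R).

Lemma is_derive_continuous f df : (forall x : R, is_derive x 1 f (df x)) ->
  continuous f.
Proof.
move=> hf x; apply: differentiable_continuous.
by apply/derivable1_diffP; case: (hf x).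
Qed.

(** The intermediate point is a convex combination, so that the order of [a] and [b] is
    irrelevant. *)
Lemma mean_value f df a b : (forall x : R, is_derive x 1 f (df x)) ->
  exists2 t, 0 <= t <= 1 & f b - f a = df (a + t * (b - a)) * (b - a).
Proof.
move=> hf.
wlog ab : a b / a <= b => [hw|].
  have [/hw//|ba] := leP a b.
  have [t /andP[t0 t1] e] := hw b a (ltW ba); exists (1 - t); first lra.
  rewrite -opprB e -mulrN opprB; congr (df _ * _); ring.
have [|c + ->] := @MVT_segment R f df a b ab (fun x _ => hf x).
  exact/continuous_subspaceT/(is_derive_continuous hf).
rewrite in_itv /= => /andP[ac cb].
have [eab|nab] := eqVneq a b.
  by exists 0; rewrite ?lexx ?ler01// eab subrr !mulr0.
have ba0 : 0 < b - a by rewrite subr_gt0 lt_def eq_sym nab.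
exists ((c - a) / (b - a)).
  by rewrite divr_ge0 ?ler_pdivrMr ?mul1r /=; lra.
by congr (df _ * _); rewrite divfK ?gt_eqF//; ring.
Qed.

Lemma derive_lipschitz f df c a b : (forall x : R, is_derive x 1 f (df x)) ->
  (forall x, `|df x| <= c) -> `|f b - f a| <= c * `|b - a|.
Proof.
by move=> hf hc; have [t _ ->] := mean_value a b hf; rewrite normrM ler_wpM2r.
Qed.

(** A quadratic remainder survives expectation, so this is the tool for differentiating a
    characteristic function under the expectation. *)
Lemma is_derive_quad f (x D C : R) :
  (forall h, `|f (x + h) - f x - h * D| <= C * h ^+ 2) -> is_derive x 1 f D.
Proof.
move=> hf.
have C0 : 0 <= C by have := hf 1; rewrite expr1n mulr1; exact: le_trans.
suff H : h^-1 *: ((f \o shift x) (h *: 1) - f x) @[h --> 0^'] --> D.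
  by split; [exact: cvgP H|exact: cvg_lim H].
apply/cvgrPdist_le => e e0; near=> h.
have hn0 : h != 0 by near: h; exact: nbhs_dnbhs_neq.
rewrite /= distrC -[_%:A]/(h * 1) mulr1.
have -> : h^-1 *: (f (h + x) - f x) - D = h^-1 * (f (x + h) - f x - h * D).
  by rewrite [RHS]mulrBr mulKf// [h + x]addrC.
rewrite normrM normfV ler_pdivrMl ?normr_gt0//.
apply: le_trans (hf h) _; rewrite -(real_normK (num_real h)).
have -> : C * `|h| ^+ 2 = `|h| * (C * `|h|) by ring.
rewrite ler_wpM2l//; apply: (@le_trans _ _ ((C + 1) * `|h|)).
  by rewrite ler_wpM2r// lerDl.
rewrite mulrC -ler_pdivlMr ?ltr_wpDl//.
by near: h; apply: dnbhs0_le; rewrite divr_gt0// ltr_wpDl.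
Unshelve. all: by end_near. Qed.

(* Gronwall for [phi' = - s v phi], the equation of [s |-> phi 0 * exp (- v s^2 / 2)]. *)
Lemma gauss_ode (phi dphi : R -> R) (v eps : R) : 0 <= eps -> 0 <= v ->
  (forall s : R, is_derive s 1 phi (dphi s)) ->
  (forall s, 0 <= s <= 1 -> `|dphi s + s * v * phi s| <= eps) ->
  `|phi 1 - phi 0 * expR (- (v / 2))| <= eps.
Proof.
move=> e0 v0 hphi hd.
pose psi s := phi s * expR (v / 2 * s ^+ 2).
have hpsi (s : R) : is_derive s 1 psi
    ((dphi s + s * v * phi s) * expR (v / 2 * s ^+ 2)).
  have h1 : is_derive s 1 (fun s : R => v / 2 * s ^+ 2) (v * s).
    by apply: is_derive_eq; rewrite /GRing.scale /=; field.
  have h2 := @is_derive1_comp R expR _ s _ _ (is_derive_expR _) h1.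
  have := @is_deriveM R _ phi _ s 1 _ _ (hphi s) h2.
  move=> h; apply: (is_derive_eq h); rewrite /GRing.scale /=; ring.
have [t /andP[t0 t1]] := mean_value 0 1 hpsi.
rewrite subr0 mulr1 add0r mulr1 /psi expr0n /= mulr0 expR0 expr1n !mulr1 => e.
have -> : phi 1 - phi 0 * expR (- (v / 2)) =
   (dphi t + t * v * phi t) * (expR (v / 2 * t ^+ 2) * expR (- (v / 2))).
  rewrite mulrA -e mulrBl -mulrA -expRD subrr expR0 mulr1//.
rewrite normrM -[leRHS]mulr1; apply: ler_pM => //.
  by apply: hd; rewrite t0.
rewrite -expRD ger0_norm ?expR_ge0// -[leRHS]expR0 ler_expR.
have : t ^+ 2 <= 1 by rewrite expr_le1.
nra.
Qed.

Lemma sin_lipschitz (a b : R) : `|sin a - sin b| <= `|a - b|.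
Proof.
rewrite -[leRHS]mul1r; apply: (derive_lipschitz _ (df := cos)) => x.
exact: cos_max.
Qed.

Lemma cos_lipschitz (a b : R) : `|cos a - cos b| <= `|a - b|.
Proof.
rewrite -[leRHS]mul1r; apply: (derive_lipschitz _ (df := fun x => - sin x)) => x.
by rewrite normrN sin_max.
Qed.

Lemma sin_taylor (a h : R) : `|sin (a + h) - sin a - h * cos a| <= h ^+ 2.
Proof.
pose g h := sin (a + h) - h * cos a.
have hg (x : R) : is_derive x 1 g (cos (a + x) - cos a).
  have h1 : is_derive x 1 (fun x : R => a + x) 1.
    have := @is_deriveD R _ _ (cst a) id x 1 _ _ (is_derive_cst a x 1) (is_derive_id x 1).
    by rewrite add0r.
  have h2 := is_derive1_comp (is_derive_sin (a + x)) h1.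
  have h3 : is_derive x 1 (fun h : R => h * cos a) (cos a).
    by apply: is_derive_eq; rewrite scaler0 add0r -[_%:A]/(_ * 1) mulr1.
  by have := is_deriveB h2 h3; rewrite mulr1.
have [t /andP[t0 t1]] := mean_value 0 h hg.
rewrite /g add0r subr0 addr0 mul0r subr0 -addrA [- _ - _]addrC addrA => ->.
rewrite normrM -(real_normK (num_real h)) expr2 ler_wpM2r//.
apply: le_trans (cos_lipschitz _ _) _.
by rewrite addrC addKr normrM ger0_norm// ler_piMl.
Qed.

Lemma cosE_sin (x : R) : cos x = sin (x + pi / 2).
Proof. by rewrite sinD cos_pihalf sin_pihalf mulr0 mulr1 add0r. Qed.

Lemma cos_taylor (a h : R) : `|cos (a + h) - cos a + h * sin a| <= h ^+ 2.
Proof.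
have := sin_taylor (a + pi / 2) h.
have -> : a + pi / 2 + h = (a + h) + pi / 2 by ring.
by rewrite -!cosE_sin [cos (a + pi / 2)]cosD cos_pihalf sin_pihalf mulr0 mulr1 sub0r mulrN opprK.
Qed.

End calculus.

(** * Stein's method for sums of weakly dependent summands *)

Section stein.
Context d (T : measurableType d) (R : realType) (P : probability T R).
Local Notation Ex := (Ex P).
Variables (u u1 : R -> R).
Hypotheses (mu : measurable_fun setT u) (mu1 : measurable_fun setT u1).
Hypotheses (u_le1 : forall x, `|u x| <= 1) (u1_le1 : forall x, `|u1 x| <= 1).
Hypothesis u_taylor : forall x h, `|u (x + h) - u x - h * u1 x| <= h ^+ 2.
Hypothesis u1_lip : forall x y, `|u1 x - u1 y| <= `|x - y|.

Let bmu (f : T -> R) r : bm f -> bm (fun x => u (r * f x)).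
Proof.
move=> /(bmZ r)[mf _]; exact: (@bm_comp _ T R u 1 (fun x => r * f x)).
Qed.

Let bmu1 (f : T -> R) r : bm f -> bm (fun x => u1 (r * f x)).
Proof.
move=> /(bmZ r)[mf _]; exact: (@bm_comp _ T R u1 1 (fun x => r * f x)).
Qed.

(** [A] is the part of the sum [S] near the summand [X], and [B] the part in a wider neighbourhood.
    A first-order expansion of [u (r * S)] around [S - A] leaves [X * u (r * (S - A))], nearly
    centred by [e1], and [r * X * A * u1 (r * S)], in which [X * A] decouples from [S - B] up to
    [e2]. The three replacements each cost at most [r ^+ 2 * L * v]. *)
Lemma stein_term (X A B S : T -> R) (r L v e1 e2 : R) :
  bm X -> bm A -> bm B -> bm S -> 0 <= r -> (forall w, `|X w| <= L) ->
  Ex (fun w => A w ^+ 2) <= v -> Ex (fun w => B w ^+ 2) <= v ->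
  `|Ex (fun w => X w * u (r * (S w - A w)))| <= e1 ->
  `|Ex (fun w => X w * A w * u1 (r * (S w - B w)))
    - Ex (fun w => X w * A w) * Ex (fun w => u1 (r * (S w - B w)))| <= e2 ->
  `|Ex (fun w => X w * u (r * S w))
    - r * Ex (fun w => X w * A w) * Ex (fun w => u1 (r * S w))|
    <= e1 + r * e2 + 3 * r ^+ 2 * L * v.
Proof.
move=> bX bA bB bS r0 XL Av Bv He1 He2.
have L0 : 0 <= L by apply: le_trans (XL point).
have bXA := bmM bX bA.
have buS := bmu r bS; have bu1S := bmu1 r bS.
have buSA := bmu r (bmB bS bA); have bu1SB := bmu1 r (bmB bS bB).
have bA2 := bmX 2 bA; have bB2 := bmX 2 bB.
(* Taylor remainder, of order [(r * A) ^+ 2]. *)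
have K1 : `|Ex (fun w => X w * u (r * S w) - X w * u (r * (S w - A w))
                - r * (X w * A w * u1 (r * S w)))| <= r ^+ 2 * L * v.
  apply: (@le_trans _ _ (Ex (fun w => r ^+ 2 * L * A w ^+ 2))); last first.
    rewrite ExZ; last exact: bm_ig.
    by rewrite ler_wpM2l// mulr_ge0// sqr_ge0.
  apply: norm_Ex_le.
  - apply: bm_ig; apply: bmB; first by apply: bmB; exact: bmM.
    by apply: bmZ; exact: bmM.
  - by apply: bm_ig; exact: bmZ.
  - move=> w; have := u_taylor (r * S w) (- (r * A w)).
    rewrite -mulrBr => h.
    have -> : X w * u (r * S w) - X w * u (r * (S w - A w))
                - r * (X w * A w * u1 (r * S w)) =
      - X w * (u (r * (S w - A w)) - u (r * S w) - - (r * A w) * u1 (r * S w)).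
      by ring.
    rewrite normrM normrN.
    have -> : r ^+ 2 * L * A w ^+ 2 = L * (- (r * A w)) ^+ 2 by ring.
    exact: ler_pM.
have ExB_le : Ex (fun w => `|B w|) ^+ 2 <= v.
  have := Ex_sqr_le (bm_L2 P (bm_norm bB)).
  under [leRHS]eq_Ex do rewrite real_normK ?num_real//.
  by move=> /le_trans; exact.
have ExA_le : Ex (fun w => `|A w|) ^+ 2 <= v.
  have := Ex_sqr_le (bm_L2 P (bm_norm bA)).
  under [leRHS]eq_Ex do rewrite real_normK ?num_real//.
  by move=> /le_trans; exact.
(* Deleting [B] inside the Lipschitz function [u1] costs [r * |A| * |B|], which is split into the
   two second moments. *)
have K2 : `|Ex (fun w => X w * A w * (u1 (r * S w) - u1 (r * (S w - B w))))|
    <= r * L * v.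
  apply: (@le_trans _ _ (Ex (fun w => r * L * (2^-1 * (A w ^+ 2 + B w ^+ 2))))).
    apply: norm_Ex_le.
    - by apply: bm_ig; apply: bmM => //; exact: bmB.
    - by apply: bm_ig; apply: bmZ; apply: bmZ; exact: bmD.
    - move=> w; rewrite -mulrA normrM [r * L]mulrC -mulrA.
      apply: ler_pM => //; rewrite normrM.
      apply: (@le_trans _ _ (`|A w| * (r * `|B w|))).
        rewrite ler_wpM2l//; apply: le_trans (u1_lip _ _) _.
        by rewrite -mulrBr opprB addrC subrK normrM ger0_norm.
      rewrite mulrCA ler_wpM2l//.
      rewrite -(real_normK (num_real (A w))) -(real_normK (num_real (B w))).
      by have := sqr_ge0 (`|A w| - `|B w|); lra.
  rewrite ExZ; last by apply: bm_ig; apply: bmZ; exact: bmD.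
  rewrite ExZ; last by apply: bm_ig; exact: bmD.
  rewrite ExD; [|exact: bm_ig|exact: bm_ig].
  by rewrite ler_wpM2l ?mulr_ge0//; lra.
(* The same deletion inside the separate expectation of [u1]. *)
have K3 : `|Ex (fun w => X w * A w) *
     Ex (fun w => u1 (r * S w) - u1 (r * (S w - B w)))| <= r * L * v.
  rewrite normrM.
  apply: (@le_trans _ _ ((L * Ex (fun w => `|A w|)) * (r * Ex (fun w => `|B w|)))).
    apply: ler_pM => //.
      rewrite -ExZ; last by apply: bm_ig; exact: bm_norm.
      apply: norm_Ex_le; [exact: bm_ig| |].
        by apply: bm_ig; apply: bmZ; exact: bm_norm.
      by move=> w; rewrite normrM ler_wpM2r.
    rewrite -ExZ; last by apply: bm_ig; exact: bm_norm.
    apply: norm_Ex_le; [by apply: bm_ig; exact: bmB| |].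
      by apply: bm_ig; apply: bmZ; exact: bm_norm.
    move=> w; apply: le_trans (u1_lip _ _) _.
    by rewrite -mulrBr opprB addrC subrK normrM ger0_norm.
  rewrite mulrACA [L * r]mulrC ler_wpM2l ?mulr_ge0//.
  have := sqr_ge0 (Ex (fun w => `|A w|) - Ex (fun w => `|B w|)).
  by nra.
have E1 : Ex (fun w => X w * u (r * S w) - X w * u (r * (S w - A w))
                - r * (X w * A w * u1 (r * S w))) =
  Ex (fun w => X w * u (r * S w)) - Ex (fun w => X w * u (r * (S w - A w)))
  - r * Ex (fun w => X w * A w * u1 (r * S w)).
  rewrite ExB ?ExB ?ExZ//.
  - by apply: bm_ig; exact: bmM.
  - by apply: bm_ig; exact: bmM.
  - by apply: bm_ig; exact: bmM.
  - by apply: bm_ig; apply: bmB; exact: bmM.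
  - by apply: bm_ig; apply: bmZ; exact: bmM.
have E2 : Ex (fun w => X w * A w * (u1 (r * S w) - u1 (r * (S w - B w)))) =
  Ex (fun w => X w * A w * u1 (r * S w)) -
  Ex (fun w => X w * A w * u1 (r * (S w - B w))).
  under eq_Ex do rewrite mulrBr.
  by rewrite ExB//; apply: bm_ig; exact: bmM.
have E3 : Ex (fun w => u1 (r * S w) - u1 (r * (S w - B w))) =
  Ex (fun w => u1 (r * S w)) - Ex (fun w => u1 (r * (S w - B w))).
  by rewrite ExB//; exact: bm_ig.
rewrite {}E1 in K1; rewrite {}E2 in K2; rewrite {}E3 in K3.
move: K1 K2 K3 He1 He2.
set a := Ex (fun w => X w * u (r * S w)).
set b := Ex (fun w => X w * u (r * (S w - A w))).
set c := Ex (fun w => X w * A w * u1 (r * S w)).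
set c' := Ex (fun w => X w * A w * u1 (r * (S w - B w))).
set g := Ex (fun w => X w * A w).
set q := Ex (fun w => u1 (r * S w)).
set q' := Ex (fun w => u1 (r * (S w - B w))).
move=> K1 K2 K3 He1 He2.
have -> : a - r * g * q =
  (a - b - r * c) + b + r * (c - c') + r * (c' - g * q') - r * (g * (q - q')).
  by ring.
have K2' : `|r * (c - c')| <= r ^+ 2 * L * v.
  by rewrite normrM ger0_norm// expr2 -!mulrA ler_wpM2l// mulrA.
have K3' : `|r * (g * (q - q'))| <= r ^+ 2 * L * v.
  by rewrite normrM ger0_norm// expr2 -!mulrA ler_wpM2l// mulrA.
have He2' : `|r * (c' - g * q')| <= r * e2.
  by rewrite normrM ger0_norm// ler_wpM2l.
have := ler_normB (a - b - r * c + b + r * (c - c') + r * (c' - g * q')) (r * (g * (q - q'))).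
have := ler_normD (a - b - r * c + b + r * (c - c')) (r * (c' - g * q')).
have := ler_normD (a - b - r * c + b) (r * (c - c')).
have := ler_normD (a - b - r * c) b.
by lra.
Qed.

(** [stein_term] summed over all summands. The factor of [Ex (u1 (r * S))] is the sum of the
    covariances of near pairs, a proxy for the variance of [S]. *)
Lemma stein_sum (I : eqType) (s : seq I) (near near3 : rel I) (X : I -> T -> R)
    (r L v e1 e2 : R) :
  let S w := \sum_(i <- s) X i w in
  let A j w := \sum_(i <- s | near j i) X i w in
  let B j w := \sum_(i <- s | near3 j i) X i w in
  (forall i, bm (X i)) -> 0 <= r -> (forall i w, `|X i w| <= L) ->
  (forall j, Ex (fun w => A j w ^+ 2) <= v) ->
  (forall j, Ex (fun w => B j w ^+ 2) <= v) ->
  (forall j, `|Ex (fun w => X j w * u (r * (S w - A j w)))| <= e1) ->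
  (forall j, `|Ex (fun w => X j w * A j w * u1 (r * (S w - B j w)))
    - Ex (fun w => X j w * A j w) * Ex (fun w => u1 (r * (S w - B j w)))| <= e2) ->
  `|Ex (fun w => r * S w * u (r * S w))
    - r ^+ 2 * (\sum_(j <- s) Ex (fun w => X j w * A j w))
       * Ex (fun w => u1 (r * S w))|
    <= (size s)%:R * (r * (e1 + r * e2 + 3 * r ^+ 2 * L * v)).
Proof.
move=> S A B bX r0 XL Av Bv He1 He2.
have bS : bm S by exact: bm_sum.
have bA j : bm (A j) by exact: bm_sum.
have bB j : bm (B j) by exact: bm_sum.
have -> : Ex (fun w => r * S w * u (r * S w)) =
  \sum_(j <- s) r * Ex (fun w => X j w * u (r * S w)).
  rewrite -big_distrr -Ex_sum/=; last first.
    by move=> i; apply: bm_ig; apply: bmM => //; exact: bmu.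
  rewrite -ExZ; last first.
    by apply: ig_sum => i; apply: bm_ig; apply: bmM => //; exact: bmu.
  by apply: eq_Ex => w; rewrite -big_distrl/= mulrA.
rewrite [X in _ - X]mulrAC big_distrr/= -sumrB.
apply: le_trans (ler_norm_sum _ _ _) _.
have -> : (size s)%:R * (r * (e1 + r * e2 + 3 * r ^+ 2 * L * v)) =
    \sum_(j <- s) r * (e1 + r * e2 + 3 * r ^+ 2 * L * v).
  by rewrite big_const_seq iter_addr_0 count_predT mulr_natl.
apply: ler_sum => j _.
have -> : r * Ex (fun w => X j w * u (r * S w)) -
   r ^+ 2 * Ex (fun w => u1 (r * S w)) * Ex (fun w => X j w * A j w) =
   r * (Ex (fun w => X j w * u (r * S w)) -
     r * Ex (fun w => X j w * A j w) * Ex (fun w => u1 (r * S w))) by ring.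
by rewrite normrM ger0_norm// ler_wpM2l//; exact: (stein_term (B := B j)).
Qed.

End stein.

(** * Characteristic functions out of approximate Stein identities *)

Lemma measurable_sin (R : realType) : measurable_fun setT (@sin R).
Proof. by apply: continuous_measurable_fun; exact: continuous_sin. Qed.

Lemma measurable_cos (R : realType) : measurable_fun setT (@cos R).
Proof. by apply: continuous_measurable_fun; exact: continuous_cos. Qed.

Lemma measurable_affine (R : realType) (a b : R) :
  measurable_fun setT (fun x : R => a * x + b).
Proof. by apply: measurable_funD => //; exact: measurable_funM. Qed.

Section charfun.
Context d (T : measurableType d) (R : realType) (P : probability T R).
Local Notation Ex := (Ex P).

Lemma measurable_cosf (f : T -> R) : measurable_fun setT f ->
  measurable_fun setT (fun w => cos (f w)).
Proof. by move=> mf; apply: measurableT_comp => //; exact: measurable_cos. Qed.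

Lemma measurable_sinf (f : T -> R) : measurable_fun setT f ->
  measurable_fun setT (fun w => sin (f w)).
Proof. by move=> mf; apply: measurableT_comp => //; exact: measurable_sin. Qed.

Lemma bm_cosf (f : T -> R) : measurable_fun setT f -> bm (fun w => cos (f w)).
Proof.
by move=> mf; split; [exact: measurable_cosf|exists 1 => x; exact: cos_max].
Qed.

Lemma bm_sinf (f : T -> R) : measurable_fun setT f -> bm (fun w => sin (f w)).
Proof.
by move=> mf; split; [exact: measurable_sinf|exists 1 => x; exact: sin_max].
Qed.

(** With [phi s] the expectation of [cos (s S + th)], the hypothesis says that [phi' + s v phi] is
    at most [eps] in absolute value, and [gauss_ode] integrates this from 0 to 1. The phase [th]
    lets one real function stand for the complex characteristic function: the phases 0 and
    [- pi / 2] give its real and imaginary parts. *)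
Lemma charfun_of_stein (S : T -> R) (th v eps : R) : L2 P S -> 0 <= eps -> 0 <= v ->
  (forall s, 0 <= s <= 1 ->
    `|Ex (fun w => S w * sin (s * S w + th))
      - v * Ex (fun w => s * cos (s * S w + th))| <= eps) ->
  `|Ex (fun w => cos (S w + th)) - cos th * expR (- (v / 2))| <= eps.
Proof.
move=> S2 e0 v0 hs.
have mS : measurable_fun setT S by case: S2.
have mSa (s : R) : measurable_fun setT (fun w => s * S w + th).
  by apply: measurable_funD => //; exact: measurable_funM.
pose phi s := Ex (fun w => cos (s * S w + th)).
pose dphi s := - Ex (fun w => S w * sin (s * S w + th)).
have igS s : ig P (fun w => S w * sin (s * S w + th)).
  by apply: L2_igM => //; apply: bm_L2; exact: bm_sinf.
have igc s : ig P (fun w => cos (s * S w + th)).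
  by apply: bm_ig; exact: bm_cosf.
have hphi (s : R) : is_derive s 1 phi (dphi s).
  apply: (@is_derive_quad _ _ _ _ (Ex (fun w => S w ^+ 2))) => h.
  rewrite /phi /dphi mulrN opprK -ExB// -ExZ//.
  rewrite -ExD; [|exact: igB|exact: igZ].
  rewrite mulrC -ExZ; last by case: S2.
  apply: norm_Ex_le.
  - by apply: igD; [exact: igB|exact: igZ].
  - by apply: igZ; case: S2.
  move=> w; rewrite -exprMn mulrA.
  have -> : (s + h) * S w + th = s * S w + th + h * S w by ring.
  exact: cos_taylor.
have -> : Ex (fun w => cos (S w + th)) = phi 1.
  by apply: eq_Ex => w; rewrite mul1r.
have -> : cos th = phi 0.
  by rewrite /phi; under eq_Ex do rewrite mul0r add0r; rewrite Ex_cst.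
apply: (gauss_ode e0 v0 hphi) => s s01.
have := hs _ s01; rewrite ExZ// -normrN opprB /dphi -/(phi s).
by congr (`|_| <= _); ring.
Qed.

(** Here [e3] pays for replacing the near covariances by the full variance of the sum. *)
Lemma field_charfun (I : eqType) (s : seq I) (near near3 : rel I)
    (X : I -> T -> R) (r L v e1 e2 e3 th : R) :
  let S w := \sum_(i <- s) X i w in
  let A j w := \sum_(i <- s | near j i) X i w in
  let B j w := \sum_(i <- s | near3 j i) X i w in
  (forall i, bm (X i)) -> 0 <= r -> (forall i w, `|X i w| <= L) ->
  (forall j, Ex (fun w => A j w ^+ 2) <= v) ->
  (forall j, Ex (fun w => B j w ^+ 2) <= v) ->
  (forall (u : R -> R) j, measurable_fun setT u -> (forall x, `|u x| <= 1) ->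
    `|Ex (fun w => X j w * u (r * (S w - A j w)))| <= e1) ->
  (forall (u : R -> R) j, measurable_fun setT u -> (forall x, `|u x| <= 1) ->
    `|Ex (fun w => X j w * A j w * u (r * (S w - B j w)))
    - Ex (fun w => X j w * A j w) * Ex (fun w => u (r * (S w - B j w)))| <= e2) ->
  `|r ^+ 2 * (\sum_(j <- s) Ex (fun w => X j w * A j w) - Ex (fun w => S w ^+ 2))|
     <= e3 ->
  0 <= L -> 0 <= v -> 0 <= e1 -> 0 <= e2 ->
  `|Ex (fun w => cos (r * S w + th))
    - cos th * expR (- (r ^+ 2 * Ex (fun w => S w ^+ 2) / 2))|
  <= (size s)%:R * (r * (e1 + r * e2 + 3 * r ^+ 2 * L * v)) + e3.
Proof.
move=> S A B bX r0 XL Av Bv H1 H2 H3 L0 v0 e10 e20.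
have bS : bm S by exact: bm_sum.
have e30 : 0 <= e3 by apply: le_trans H3.
apply: (@charfun_of_stein (fun w => r * S w)).
- by apply: bm_L2; exact: bmZ.
- by rewrite addr_ge0// mulr_ge0// mulr_ge0// !addr_ge0// !mulr_ge0 ?sqr_ge0.
- by rewrite mulr_ge0 ?sqr_ge0// Ex_ge0// => w; exact: sqr_ge0.
move=> q /andP[q0 q1].
(* As [q] lies between 0 and 1, both functions are bounded by 1, [u1] is 1-Lipschitz and the Taylor
   constant of [u] is at most 1, uniformly in [q]. *)
pose u x := sin (q * x + th); pose u1 x := q * cos (q * x + th).
have mu : measurable_fun setT u.
  by apply: (measurableT_comp (@measurable_sin R)); exact: measurable_affine.
have mu1 : measurable_fun setT u1.
  apply: measurable_funM => //.
  by apply: (measurableT_comp (@measurable_cos R)); exact: measurable_affine.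
have u_le x : `|u x| <= 1 by exact: sin_max.
have u1_le x : `|u1 x| <= 1.
  by rewrite /u1 normrM ger0_norm// mulr_ile1//; exact: cos_max.
have q21 : q ^+ 2 <= 1 by rewrite expr_le1.
have ut x h : `|u (x + h) - u x - h * u1 x| <= h ^+ 2.
  have := sin_taylor (q * x + th) (q * h); rewrite /u /u1.
  have -> : q * (x + h) + th = q * x + th + q * h by ring.
  rewrite mulrCA mulrA => /le_trans; apply.
  by rewrite exprMn ler_piMl// sqr_ge0.
have ul x y : `|u1 x - u1 y| <= `|x - y|.
  rewrite /u1 -mulrBr normrM ger0_norm//.
  apply: (@le_trans _ _ (q * (q * `|x - y|))).
    rewrite ler_wpM2l//; apply: le_trans (cos_lipschitz _ _) _.
    by rewrite opprD addrACA subrr addr0 -mulrBr normrM ger0_norm.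
  by rewrite mulrA -expr2 ler_piMl.
have := stein_sum mu mu1 u_le u1_le ut ul bX r0 XL Av Bv
  (fun j => H1 u j mu u_le) (fun j => H2 u1 j mu1 u1_le).
rewrite -/S.
have bu1 : bm (fun w => u1 (r * S w)).
  exact: (@bm_comp _ _ _ _ 1 (fun w => r * S w) mu1 u1_le (proj1 (bmZ r bS))).
have := norm_Ex_bound P (proj1 bu1) (fun w => u1_le (r * S w)).
rewrite -[Ex (fun w => r * S w * sin _)]/(Ex (fun w => r * S w * u (r * S w))).
rewrite -[Ex (fun w => q * cos _)]/(Ex (fun w => u1 (r * S w))).
move: H3; set a := \sum_(j <- s) _; set b := Ex (fun w => S w ^+ 2).
set c := Ex (fun w => u1 _); set g := Ex _ => H3 c1.
set bound := (X in _ <= X -> _) => K.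
have -> : g - r ^+ 2 * b * c = (g - r ^+ 2 * a * c) + (r ^+ 2 * (a - b)) * c.
  by ring.
apply: le_trans (ler_normD _ _) _; apply: lerD => //.
by rewrite normrM -[leRHS]mulr1; exact: ler_pM.
Qed.

End charfun.

(** * The integer lattice with the sup distance, and sums of radial functions *)

Section lattice.
Context (d : nat).
Implicit Types (i j z : 'rV[int]_d).

Definition zd i j : nat := \max_(k < d) `|(i 0 k - j 0 k)%R|%N.

Lemma zdP i j m : reflect (forall k, (`|(i 0 k - j 0 k)%R| <= m)%N) (zd i j <= m)%N.
Proof. by apply: (iffP (bigmax_leqP _ _ _)) => h k; [exact: h|by move=> _; exact: h]. Qed.

Lemma zdC i j : zd i j = zd j i.
Proof. by apply: eq_bigr => k _; rewrite distnC. Qed.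

Lemma zd_shift i j z : zd (i + z) (j + z) = zd i j.
Proof.
by apply: eq_bigr => k _; rewrite !mxE opprD addrACA subrr addr0.
Qed.

Lemma zdii i : zd i i = 0%N.
Proof. by apply/eqP; rewrite -leqn0; apply/zdP => k; rewrite subrr. Qed.

Lemma zd_triangle i j z : (zd i z <= zd i j + zd j z)%N.
Proof.
apply/zdP => k; apply: leq_trans (leqD_dist _ (j 0 k) _) _.
by apply: leq_add; [apply: (elimT (zdP i j _))|apply: (elimT (zdP j z _))].
Qed.

(** Parametrising the ball by a finite function type makes its enumeration and its cardinality
    immediate. *)
Definition ball_pt (m : nat) (f : {ffun 'I_d -> 'I_(2 * m).+1}) : 'rV[int]_d :=
  \row_k ((f k : nat)%:Z - m%:Z).

Definition zball (m : nat) : seq 'rV[int]_d :=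
  [seq ball_pt f | f : {ffun 'I_d -> 'I_(2 * m).+1}].

Lemma mem_zball m z : (z \in zball m) = (zd z 0 <= m)%N.
Proof.
apply/idP/zdP => [|h].
  move=> /mapP[f _ ->] k.
  rewrite !mxE subr0; have := ltn_ord (f k); move: (nat_of_ord (f k)) => a.
  lia.
apply/mapP; exists [ffun k => inord `|(z 0 k + m%:Z)%R|%N].
  by rewrite mem_enum.
apply/rowP => k; rewrite !mxE ffunE inordK.
  by have := h k; rewrite mxE; move: (z 0 k) => a; lia.
by have := h k; rewrite mxE; move: (z 0 k) => a; lia.
Qed.

Lemma zball_uniq m : uniq (zball m).
Proof.
have inj : injective (@ball_pt m); last by rewrite (map_inj_uniq inj) enum_uniq.
move=> f g fg.
apply/ffunP => k; apply/val_inj => /=.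
by have := congr1 (fun z : 'rV[int]_d => z 0 k) fg; rewrite !mxE /=; lia.
Qed.

Lemma size_zball m : size (zball m) = ((2 * m).+1 ^ d)%N.
Proof. by rewrite size_map -cardE card_ffun !card_ord. Qed.

Lemma size_zd_le i m (s : seq 'rV[int]_d) : uniq s ->
  (forall j, j \in s -> (zd i j <= m)%N) -> (size s <= (2 * m).+1 ^ d)%N.
Proof.
move=> us hs; rewrite -size_zball -(size_map (fun j => j - i)).
apply: uniq_leq_size; first by rewrite map_inj_uniq//; exact: addIr.
move=> _ /mapP[j js ->]; rewrite mem_zball.
by rewrite -(zd_shift _ _ i) subrK add0r zdC hs.
Qed.

Section lsum.
Context (R : realType).
Implicit Type g : nat -> R.

(** Partial sum of the series of [g (|z|)] over the lattice. Summability is expressed throughout as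
    a bound uniform in [N]. *)
Definition lsum g N : R := \sum_(z <- zball N) g (zd 0 z).

Lemma big_seq_sub (I : eqType) (s t : seq I) (p : pred I) (F : I -> R) :
  uniq s -> {subset s <= t} -> (forall x, 0 <= F x) ->
  \sum_(x <- s | p x) F x <= \sum_(x <- t | p x) F x.
Proof.
move=> us st F0.
rewrite big_mkcond [leRHS]big_mkcond /=.
elim: s t us st => [|x s IHs] t /=.
  by move=> _ _; rewrite big_nil; apply: sumr_ge0 => x _; case: (p x).
move=> /andP[xs us] st; rewrite big_cons.
have xt : x \in t by apply: st; rewrite mem_head.
rewrite (perm_big (x :: rem x t) (perm_to_rem xt)) [leRHS]big_cons; apply: lerD => //.
apply: IHs => // y ys.
have yt : y \in t by apply: st; rewrite inE ys orbT.
have := perm_mem (perm_to_rem xt) y.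
rewrite yt inE => /esym/orP[/eqP yx|//].
by move: xs; rewrite -yx ys.
Qed.

Lemma lsum_le_ball g N i (p : pred 'rV[int]_d) (s : seq 'rV[int]_d) :
  uniq s -> (forall n, 0 <= g n) ->
  (forall j, j \in s -> (zd i j <= N)%N) ->
  \sum_(j <- s | p j) g (zd i j) <= \sum_(z <- zball N | p (z + i)) g (zd 0 z).
Proof.
move=> us g0 hs.
have -> : \sum_(j <- s | p j) g (zd i j) =
    \sum_(z <- [seq j - i | j <- s] | p (z + i)) g (zd 0 z).
  rewrite big_map; apply: eq_big => j; first by rewrite /= subrK.
  by move=> _; rewrite -(zd_shift 0 (j - i) i) subrK add0r.
apply: big_seq_sub => //; first by rewrite map_inj_uniq//; exact: addIr.
move=> _ /mapP[j js ->]; rewrite mem_zball.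
by rewrite -(zd_shift _ _ i) subrK add0r zdC hs.
Qed.

Lemma seq_zd_bound i (s : seq 'rV[int]_d) : exists N, forall j, j \in s ->
  (zd i j <= N)%N.
Proof.
exists (\max_(j <- s) zd i j)%N => j js.
by rewrite (big_rem _ js) /= leq_maxl.
Qed.

(** Translating by [- i] carries any finite set of sites into a ball around the origin, so the bound
    depends neither on [i] nor on [s]. *)
Lemma lsum_le g i (p : pred 'rV[int]_d) (s : seq 'rV[int]_d) G :
  uniq s -> (forall n, 0 <= g n) -> (forall N, lsum g N <= G) ->
  \sum_(j <- s | p j) g (zd i j) <= G.
Proof.
move=> us g0 hG; have [N hN] := seq_zd_bound i s.
apply: le_trans (lsum_le_ball _ us g0 hN) _; apply: le_trans (hG N).
by rewrite /lsum big_mkcond ler_sum// => z _; case: ifP.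
Qed.

Lemma lsum_homo g : (forall n, 0 <= g n) -> nondecreasing_seq (lsum g).
Proof.
move=> g0 a b ab; apply: big_seq_sub => //; first exact: zball_uniq.
by move=> z; rewrite !mem_zball => /leq_trans; apply.
Qed.

(** The bounded monotone sequence [lsum g] converges, and its remainder after [m] dominates every
    sum outside a ball of radius [m], uniformly in the centre and in the finite set. *)
Lemma lsum_tail g G (e : R) : (forall n, 0 <= g n) -> (forall N, lsum g N <= G) ->
  0 < e -> exists m0, forall m i (s : seq 'rV[int]_d), (m0 <= m)%N -> uniq s ->
  \sum_(j <- s | (m < zd i j)%N) g (zd i j) <= e.
Proof.
move=> g0 hG e0.
have hc : has_ubound (range (lsum g)) by exists G => _ [N _ <-]; exact: hG.
have cv := nondecreasing_cvgn (lsum_homo g0) hc.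
have /cvgrPdist_le /(_ _ e0) [m0 _ hm0] := cv.
exists m0 => m i s mm us; have [N' hN'] := seq_zd_bound i s.
pose N := maxn N' m.
have hN j : j \in s -> (zd i j <= N)%N.
  by move=> /hN' /leq_trans; apply; exact: leq_maxl.
apply: le_trans (lsum_le_ball _ us g0 hN) _.
have h z : (m < zd i (z + i))%N = ~~ (zd 0 z <= m)%N.
  by rewrite -{1}[i]add0r zd_shift ltnNge.
under eq_bigl do rewrite h.
have : lsum g N <= sup (range (lsum g)) by apply: sup_upper_bound => //; split => //; exists (lsum g 0); exists 0.
rewrite {1}/lsum (bigID (fun z => zd 0 z <= m)%N) /= => h1.
have : lsum g m <= \sum_(z <- zball N | (zd 0 z <= m)%N) g (zd 0 z).
  rewrite -[leRHS]big_filter; apply: big_seq_sub => //; first exact: zball_uniq.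
  move=> z; rewrite mem_filter !mem_zball zdC => zm; rewrite zm /=.
  by rewrite (leq_trans zm)// leq_maxr.
have := hm0 m mm; rewrite ler_norml => /andP[_ h2].
by lra.
Qed.

End lsum.
End lattice.

(** * Variance of sums with summable covariances *)

Section covariance.
Context d (T : measurableType d) (R : realType) (P : probability T R) (D : nat).
Local Notation Ex := (Ex P).
Variables (X : 'rV[int]_D -> T -> R) (g : nat -> R) (G : R).
Hypothesis X2 : forall i, L2 P (X i).
Hypothesis g0 : forall n, 0 <= g n.
Hypothesis gG : forall N, lsum D g N <= G.

Lemma Ex_sum_mul (s t : seq 'rV[int]_D) :
  Ex (fun w => (\sum_(i <- s) X i w) * (\sum_(j <- t) X j w)) =
  \sum_(i <- s) \sum_(j <- t) Ex (fun w => X i w * X j w).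
Proof.
transitivity (\sum_(i <- s) Ex (fun w => X i w * \sum_(j <- t) X j w)).
  rewrite -Ex_sum.
    by apply: eq_Ex => w; rewrite big_distrl.
  by move=> i; apply: L2_igM => //; exact: L2_sum.
apply: eq_bigr => i _; rewrite -Ex_sum.
  by apply: eq_Ex => w; rewrite big_distrr.
by move=> j; exact: L2_igM.
Qed.

(** Every row of the covariance matrix sums to at most [G], so the variance grows at most linearly
    in the number of sites. *)
Lemma var_sum_le (s : seq 'rV[int]_D) : uniq s ->
  (forall i j, `|Ex (fun w => X i w * X j w)| <= g (zd i j)) ->
  Ex (fun w => (\sum_(i <- s) X i w) ^+ 2) <= (size s)%:R * G.
Proof.
move=> us Xg.
under eq_Ex do rewrite expr2.
rewrite Ex_sum_mul.
have -> : (size s)%:R * G = \sum_(i <- s) G.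
  by rewrite big_const_seq iter_addr_0 count_predT mulr_natl.
apply: ler_sum => i _; apply: le_trans (lsum_le i xpredT us g0 gG).
by apply: ler_sum => j _; apply: le_trans (ler_norm _) _.
Qed.

End covariance.

Lemma mul_succ_le (k m : nat) : (0 < m)%N ->
  ((2 * (k.+1 * m.+1)).+1 <= 5 * k.+1 * m)%N.
Proof. by move=> m0; have := leq_pmulr k.+1 m0; nia. Qed.

(** * Central limit theorem for bounded lattice fields *)

Section bounded_field.
Context d (T : measurableType d) (R : realType) (P : probability T R) (D : nat).
Local Notation Ex := (Ex P).
Variables (X : 'rV[int]_D -> T -> R) (L : R) (g b : nat -> R) (G : R) (kp : nat).
Hypothesis D0 : (0 < D)%N.
Hypothesis bX : forall i, bm (X i).
Hypothesis XL : forall i w, `|X i w| <= L.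
Hypothesis g0 : forall n, 0 <= g n.
Hypothesis gG : forall N, lsum D g N <= G.
Hypothesis Xg : forall i j, `|Ex (fun w => X i w * X j w)| <= g (zd i j).
Hypothesis b0 : forall m, 0 <= b m.
Hypothesis hb : forall e, 0 < e -> exists m0, forall m, (m0 <= m)%N ->
  m%:R ^+ D * b m <= e.
Hypothesis M1 : forall j m (s : seq 'rV[int]_D) (u : R -> R),
  measurable_fun setT u -> (forall x, `|u x| <= 1) ->
  (forall i, i \in s -> (m < zd j i)%N) ->
  `|Ex (fun w => X j w * u (\sum_(i <- s) X i w))| <= b m.
Hypothesis M2 : forall j m (s1 s2 : seq 'rV[int]_D) (u : R -> R),
  measurable_fun setT u -> (forall x, `|u x| <= 1) -> uniq s1 ->
  (forall i, i \in s1 -> (zd j i <= m)%N) ->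
  (forall i, i \in s2 -> (kp.+1 * m.+1 < zd j i)%N) ->
  `|Ex (fun w => X j w * (\sum_(i <- s1) X i w) * u (\sum_(i <- s2) X i w))
   - Ex (fun w => X j w * (\sum_(i <- s1) X i w))
     * Ex (fun w => u (\sum_(i <- s2) X i w))| <= (2 * m).+1%:R ^+ D * b m.

Let L0 : 0 <= L. Proof. exact: le_trans (XL 0 point). Qed.
Let G0 : 0 <= G.
Proof. by apply: le_trans (gG 0); apply: sumr_ge0 => i _; exact: g0. Qed.

(** [field_charfun] with neighbourhoods of radii [m] and [kp.+1 * m.+1]. Covariances beyond distance
    [m] weigh at most [tail] per site, and [r ^+ 2 * size s <= 2] turns this into [2 * tail]. *)
Lemma bounded_field_charfun_m (m : nat) (s : seq 'rV[int]_D) (r tail th : R) :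
  uniq s -> 0 <= r -> r ^+ 2 * (size s)%:R <= 2 -> 0 <= tail -> (0 < m)%N ->
  (forall j, \sum_(i <- s | (m < zd j i)%N) g (zd j i) <= tail) ->
  `|Ex (fun w => cos (r * (\sum_(i <- s) X i w) + th))
    - cos th * expR (- (r ^+ 2 * Ex (fun w => (\sum_(i <- s) X i w) ^+ 2) / 2))|
  <= (size s)%:R * (r * (b m + r * ((2 * m).+1%:R ^+ D * b m)
     + 3 * r ^+ 2 * L * ((2 * (kp.+1 * m.+1)).+1%:R ^+ D * G))) + 2 * tail.
Proof.
move=> us r0 rs tail0 m0 htail.
pose S w := \sum_(i <- s) X i w.
have X2 i : L2 P (X i) by exact: bm_L2.
set v := _ ^+ D * G.
have v0 : 0 <= v by rewrite mulr_ge0// exprn_ge0.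
have var_nb (M : nat) j : (M <= kp.+1 * m.+1)%N ->
    Ex (fun w => (\sum_(i <- s | (zd j i <= M)%N) X i w) ^+ 2) <= v.
  move=> hM; under eq_Ex do rewrite -big_filter.
  have us' : uniq [seq i <- s | (zd j i <= M)%N] by exact: filter_uniq.
  apply: le_trans (var_sum_le X2 g0 gG us' Xg) _.
  rewrite ler_wpM2r// -natrX ler_nat.
  apply: (leq_trans (size_zd_le (i := j) (m := M) us' _)).
    by move=> i; rewrite mem_filter => /andP[].
  by rewrite leq_exp2r// ltnS leq_mul2l.
have splitS (p : pred 'rV[int]_D) w : S w - \sum_(i <- s | p i) X i w =
    \sum_(i <- [seq i <- s | ~~ p i]) X i w.
  apply/eqP; rewrite big_filter subr_eq addrC; apply/eqP.
  by rewrite /S [LHS](bigID p).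
have mr (u : R -> R) : measurable_fun setT u ->
    measurable_fun setT (fun x => u (r * x)).
  by move=> mu; apply: (measurableT_comp mu); exact: measurable_funM.
pose near := [rel j i : 'rV[int]_D | (zd j i <= m)%N].
pose near3 := [rel j i : 'rV[int]_D | (zd j i <= kp.+1 * m.+1)%N].
apply: (@field_charfun _ _ _ _ _ s near near3 X r L v) => //.
- move=> j; apply: (var_nb m j).
  by rewrite (leq_trans (leqnSn m))// leq_pmull.
- by move=> j; exact: (var_nb (kp.+1 * m.+1)%N j).
- move=> u j mu u1 /=.
  under eq_Ex do rewrite splitS.
  apply: (M1 (mr u mu)) => // i.
  by rewrite mem_filter => /andP[]; rewrite -ltnNge.
- move=> u j mu u1 /=.
  under eq_Ex do rewrite splitS -big_filter.
  under [X in _ * X]eq_Ex do rewrite splitS.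
  under [X in _ - X * _]eq_Ex do rewrite -big_filter.
  apply: (M2 (mr u mu)) => //.
  + exact: filter_uniq.
  + by move=> i; rewrite mem_filter => /andP[].
  + by move=> i; rewrite mem_filter -ltnNge => /andP[].
- have -> : Ex (fun w => S w ^+ 2) =
     \sum_(j <- s) Ex (fun w => X j w * S w).
    under eq_Ex do rewrite expr2.
    rewrite (@Ex_sum_mul _ _ _ P _ X X2 s s); apply: eq_bigr => j _.
    rewrite -Ex_sum; last by move=> i; exact: L2_igM.
    by apply: eq_Ex => w; rewrite big_distrr.
  rewrite -sumrB.
  have -> : \sum_(j <- s) (Ex (fun w => X j w * (\sum_(i <- s | near j i) X i w))
     - Ex (fun w => X j w * S w)) =
     - \sum_(j <- s) \sum_(i <- s | (m < zd j i)%N) Ex (fun w => X j w * X i w).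
    rewrite -sumrN; apply: eq_bigr => j _.
    rewrite -Ex_sum; last by move=> i; exact: L2_igM.
    rewrite -opprB -ExB; last 2 first.
    + by apply: L2_igM => //; exact: L2_sum.
    + by apply: L2_igM => //; exact: L2_sum.
    congr (- _); apply: eq_Ex => w.
    rewrite -mulrBr splitS big_filter -big_distrr /=; congr (_ * _).
    by apply: eq_bigl => i; rewrite ltnNge.
  rewrite mulrN normrN normrM ger0_norm ?sqr_ge0//.
  apply: (@le_trans _ _ (r ^+ 2 * ((size s)%:R * tail))); last first.
    by rewrite mulrA ler_wpM2r.
  rewrite ler_wpM2l ?sqr_ge0//.
  have -> : (size s)%:R * tail = \sum_(i <- s) tail.
    by rewrite big_const_seq iter_addr_0 count_predT mulr_natl.
  apply: le_trans (ler_norm_sum _ _ _) _; apply: ler_sum => j _.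
  apply: le_trans (htail j); apply: le_trans (ler_norm_sum _ _ _) _.
  by apply: ler_sum => i _; exact: Xg.
- by rewrite mulr_ge0// exprn_ge0.
Qed.

(** With [n] sites and [n r^2 <= 2], the errors are of order [n r b m], [n r^2 m^D b m] and
    [n r^3 m^D]. They vanish together when [m^D] is comparable to [eta / r] for a small [eta],
    because [m^D b m] tends to 0. *)
Lemma bounded_field_clt (e : R) : 0 < e -> exists2 rho, 0 < rho &
  forall (s : seq 'rV[int]_D) (r th : R),
  uniq s -> 0 < r -> r <= rho -> r ^+ 2 * (size s)%:R <= 2 ->
  `|Ex (fun w => cos (r * (\sum_(i <- s) X i w) + th))
    - cos th * expR (- (r ^+ 2 * Ex (fun w => (\sum_(i <- s) X i w) ^+ 2) / 2))| <= e.
Proof.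
move=> e0.
pose C1 : R := (5 * kp.+1)%:R ^+ D * G.
have C10 : 0 <= C1 by rewrite mulr_ge0// exprn_ge0.
have LC : 0 < 6 * L * C1 + 1 by rewrite ltr_wpDl// !mulr_ge0.
pose eta : R := e / (4 * (6 * L * C1 + 1)).
have eta0 : 0 < eta by rewrite divr_gt0// mulr_gt0.
have e8 : 0 < e / 8 by rewrite divr_gt0.
have [m1 hm1] := lsum_tail g0 gG e8.
pose c2 : R := 2 * 2 ^+ D / eta + 2 * 3 ^+ D.
have c20 : 0 < c2 by rewrite addr_gt0// ?divr_gt0// mulr_gt0// exprn_gt0.
have [m2 hm2] := hb (divr_gt0 e0 (mulr_gt0 (ltr0Sn R 3) c20)).
(* Beyond [m1] the covariance tail is at most [e / 8], and beyond [m2] one has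
   [m^D * b m <= e / (4 * c2)]. The value of [rho] makes [m3] an admissible radius for every
   [r <= rho]. *)
pose m3 := (maxn m1 m2).+1.
pose rho := eta / m3%:R ^+ D.
have m3D : 0 < m3%:R ^+ D :> R by rewrite exprn_gt0.
exists rho; first by rewrite divr_gt0.
move=> s r th us r0 rrho rs.
(* The radius is the largest [m] satisfying [p]: the bound itself controls the cubic error, while
   its failure at [m.+1] bounds [1 / r] by a multiple of [m^D / eta]. *)
pose p (m : nat) := m%:R ^+ D * r <= eta.
have pm3 : p m3 by rewrite /p mulrC -ler_pdivlMr.
have pbound m : p m -> (m <= Num.truncn (eta / r))%N.
  rewrite /p -ler_pdivlMr// => h.
  rewrite -(ler_nat R) in h *.
  rewrite -natrX in h.
  have hm : (m <= m ^ D)%N by case: (m) => // n; rewrite -{1}(expn1 n.+1) leq_pexp2l.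
  have : (m ^ D <= Num.truncn (eta / r))%N by rewrite truncn_ge_nat// divr_ge0 ?ltW.
  by rewrite ler_nat; apply: leq_trans.
have [m pm mmax] := ex_maxnP (ex_intro _ m3 pm3) pbound.
have m3m : (m3 <= m)%N by exact: mmax.
have m0 : (0 < m)%N by apply: leq_trans m3m.
have m1m : (m1 <= m)%N.
  by apply: leq_trans m3m; rewrite ltnW// ltnS leq_maxl.
have m2m : (m2 <= m)%N.
  by apply: leq_trans m3m; rewrite ltnW// ltnS leq_maxr.
have npS : eta < m.+1%:R ^+ D * r.
  by rewrite ltNge; apply/negP => /mmax; rewrite ltnn.
have mp : 0 < m%:R :> R by rewrite ltr0n.
have m1R : 1 <= m%:R :> R by rewrite ler1n.
have mD0 : 0 <= m%:R ^+ D :> R by rewrite exprn_ge0.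
have mS : m.+1%:R ^+ D <= 2 ^+ D * m%:R ^+ D :> R.
  rewrite -exprMn lerXn2r ?nnegrE ?mulr_ge0// -natr1; lra.
have m2S : (2 * m).+1%:R ^+ D <= 3 ^+ D * m%:R ^+ D :> R.
  rewrite -exprMn lerXn2r ?nnegrE ?mulr_ge0// -natr1 natrM; lra.
have mkS : (2 * (kp.+1 * m.+1)).+1%:R ^+ D <= (5 * kp.+1)%:R ^+ D * m%:R ^+ D :> R.
  rewrite -exprMn lerXn2r ?nnegrE ?mulr_ge0//.
  have h1 : ((2 * (kp.+1 * m.+1)).+1 <= 5 * kp.+1 * m)%N.
    exact: mul_succ_le.
  by move: h1; rewrite -(ler_nat R) (natrM _ (5 * kp.+1)).
apply: le_trans (bounded_field_charfun_m th us (ltW r0) rs (ltW e8) m0 _) _.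
  by move=> j; exact: hm1.
set n := (size s)%:R in rs *.
have n0 : 0 <= n by rewrite ler0n.
have bm0 := b0 m.
have mb := hm2 m m2m.
have nr : n * r <= 2 / r by rewrite ler_pdivlMr// -mulrA -expr2 mulrC.
have rinv : r^-1 <= 2 ^+ D * m%:R ^+ D / eta.
  rewrite ler_pdivlMr// mulrC ler_pdivrMr//.
  by apply: le_trans (ltW npS) _; rewrite ler_wpM2r// ltW.
(* The most delicate error: [n r] is at most [2 / r], and the maximality of [m] converts [1 / r]
   into [m^D]. *)
have T1 : n * r * b m <= 2 * 2 ^+ D / eta * (m%:R ^+ D * b m).
  apply: (@le_trans _ _ (2 / r * b m)); first by rewrite ler_wpM2r.
  have -> : 2 * 2 ^+ D / eta * (m%:R ^+ D * b m) =
     2 * (2 ^+ D * m%:R ^+ D / eta) * b m by field; rewrite gt_eqF.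
  by rewrite ler_wpM2r// ler_wpM2l.
have T2 : n * r ^+ 2 * ((2 * m).+1%:R ^+ D * b m) <=
    2 * 3 ^+ D * (m%:R ^+ D * b m).
  rewrite -[leRHS]mulrA; apply: ler_pM => //.
  - by rewrite mulr_ge0// sqr_ge0.
  - by rewrite mulr_ge0// exprn_ge0.
  - by rewrite mulrC.
  - by rewrite mulrA ler_wpM2r.
have T3 : n * r ^+ 2 * (r * (3 * L * ((2 * (kp.+1 * m.+1)).+1%:R ^+ D * G))) <= e / 4.
  apply: (@le_trans _ _ (2 * (3 * L * (C1 * eta)))).
    apply: ler_pM => //.
    - by rewrite mulr_ge0// sqr_ge0.
    - by rewrite !mulr_ge0// ?ltW// exprn_gt0.
    - by rewrite mulrC.
    rewrite mulrCA ler_wpM2l ?mulr_ge0//.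
    apply: (@le_trans _ _ (r * ((5 * kp.+1)%:R ^+ D * m%:R ^+ D * G))).
      by rewrite ler_wpM2l ?(ltW r0)// ler_wpM2r.
    have -> : r * ((5 * kp.+1)%:R ^+ D * m%:R ^+ D * G) = C1 * (m%:R ^+ D * r).
      by rewrite /C1; ring.
    by rewrite ler_wpM2l.
  have -> : 2 * (3 * L * (C1 * eta)) = (6 * L * C1) / (6 * L * C1 + 1) * (e / 4).
    by rewrite /eta; field; rewrite gt_eqF.
  by rewrite ler_piMl ?divr_ge0 ?ltW// ltr_pdivrMr// mul1r ltrDl.
have -> : n * (r * (b m + r * ((2 * m).+1%:R ^+ D * b m)
     + 3 * r ^+ 2 * L * ((2 * (kp.+1 * m.+1)).+1%:R ^+ D * G))) =
  n * r * b m + n * r ^+ 2 * ((2 * m).+1%:R ^+ D * b m) +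
  n * r ^+ 2 * (r * (3 * L * ((2 * (kp.+1 * m.+1)).+1%:R ^+ D * G))) by ring.
have T12 : c2 * (m%:R ^+ D * b m) <= e / 4.
  apply: le_trans (ler_wpM2l (ltW c20) mb) _.
  by rewrite le_eqVlt; apply/orP; left; apply/eqP; field; rewrite gt_eqF.
rewrite /c2 mulrDl in T12.
by lra.
Qed.

End bounded_field.

(** * Covariance of bounded variables under beta-mixing *)

Section beta_covariance.
Context dO (Omega : measurableType dO) (R : realType) (P : probability Omega R).
Local Notation Ex := (Ex P).
Implicit Types (G : set_system Omega) (f g : Omega -> R).

Definition measurable_wrt (G : set_system Omega) (f : Omega -> R) := forall B : set R, measurable B -> G (f @^-1` B).

Lemma Ex_indic (A : set Omega) : measurable A -> Ex \1_A = fine (P A).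
Proof. by move=> mA; rewrite /Ex /Rintegral integral_indic// setIT. Qed.

Lemma bm_indic (A : set Omega) : measurable A -> bm (\1_A : Omega -> R).
Proof.
move=> mA; split; first exact: measurable_indic.
by exists 1 => w; rewrite indicE; case: (_ \in _); rewrite ?normr1 ?normr0.
Qed.

Definition step m (A : 'I_m -> set Omega) (x : 'I_m -> R) (w : Omega) : R :=
  \sum_i x i * \1_(A i) w.

Section bounded.
Variables (G G' : set_system Omega) (b : R).
Hypothesis GP : forall A, G A -> measurable A.
Hypothesis G'P : forall A, G' A -> measurable A.
Hypothesis Gb : (beta_mixing P G G' <= b%:E)%E.

(** For simple functions the covariance is the double sum of the mixing coefficient weighted by the
    values; the factor 2 undoes the one half in its definition. *)
Lemma beta_cov_step m n (A : 'I_m -> set Omega) (A' : 'I_n -> set Omega)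
    (x : 'I_m -> R) (y : 'I_n -> R) (cx cy : R) :
  finite_partition_in G A -> finite_partition_in G' A' ->
  (forall i, `|x i| <= cx) -> (forall j, `|y j| <= cy) -> 0 <= cx -> 0 <= cy ->
  `|Ex (fun w => step A x w * step A' y w) - Ex (step A x) * Ex (step A' y)|
    <= 2 * b * cx * cy.
Proof.
move=> pA pA' hx hy cx0 cy0.
pose f := step A x; pose g := step A' y; rewrite -/f -/g.
have [GA _ _] := pA; have [GA' _ _] := pA'.
have mA i : measurable (A i) by exact: GP.
have mA' i : measurable (A' i) by exact: G'P.
have Ef : Ex f = \sum_i x i * fine (P (A i)).
  rewrite /f /step Ex_sum; last by move=> i; apply: bm_ig; apply: bmZ; exact: bm_indic.
  apply: eq_bigr => i _; rewrite ExZ ?Ex_indic//; apply: bm_ig; exact: bm_indic.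
have Eg : Ex g = \sum_i y i * fine (P (A' i)).
  rewrite /g /step Ex_sum; last by move=> i; apply: bm_ig; apply: bmZ; exact: bm_indic.
  apply: eq_bigr => i _; rewrite ExZ ?Ex_indic//; apply: bm_ig; exact: bm_indic.
have Efg : Ex (fun w => f w * g w) =
    \sum_i \sum_j x i * y j * fine (P (A i `&` A' j)).
  transitivity (Ex (fun w => \sum_i \sum_j x i * y j * \1_(A i `&` A' j) w)).
    apply: eq_Ex => w; rewrite /f /step big_distrl /=; apply: eq_bigr => i _.
    rewrite /g /step big_distrr /=; apply: eq_bigr => j _.
    by rewrite indicI /= mulrACA.
  have mI i j : measurable (A i `&` A' j) by exact: measurableI.
  rewrite Ex_sum; last first.
    move=> i; apply: ig_sum => j; apply: bm_ig; apply: bmZ; exact: bm_indic.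
  apply: eq_bigr => i _; rewrite Ex_sum; last first.
    by move=> j; apply: bm_ig; apply: bmZ; exact: bm_indic.
  apply: eq_bigr => j _; rewrite ExZ ?Ex_indic//; apply: bm_ig; exact: bm_indic.
rewrite {}Ef {}Eg {}Efg.
have -> : \sum_i \sum_j x i * y j * fine (P (A i `&` A' j)) -
    (\sum_i x i * fine (P (A i))) * (\sum_j y j * fine (P (A' j))) =
    \sum_i \sum_j (x i * y j * fine (P (A i `&` A' j)) -
       x i * fine (P (A i)) * (y j * fine (P (A' j)))).
  rewrite big_distrl -sumrB /=; apply: eq_bigr => i _.
  by rewrite big_distrr -sumrB.
have : ((2^-1 * \sum_i \sum_j
          `|fine (P (A i `&` A' j)) - fine (P (A i)) * fine (P (A' j))|)%R%:E
   <= b%:E)%E.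
  by apply: le_trans Gb; apply: ereal_sup_ubound; exists m, n, A, A'.
rewrite lee_fin => hb.
have -> : 2 * b * cx * cy = cx * cy * (2 * b) by ring.
apply: (@le_trans _ _ (cx * cy * \sum_i \sum_j
   `|fine (P (A i `&` A' j)) - fine (P (A i)) * fine (P (A' j))|)); last first.
  by rewrite ler_wpM2l ?mulr_ge0//; lra.
rewrite big_distrr /=; apply: le_trans (ler_norm_sum _ _ _) _.
apply: ler_sum => i _; rewrite big_distrr /=.
apply: le_trans (ler_norm_sum _ _ _) _; apply: ler_sum => j _.
have -> : x i * y j * fine (P (A i `&` A' j)) -
  x i * fine (P (A i)) * (y j * fine (P (A' j))) =
  x i * y j * (fine (P (A i `&` A' j)) - fine (P (A i)) * fine (P (A' j))) by ring.
by rewrite !normrM ler_wpM2r// ler_pM.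
Qed.

(** The range is cut into intervals of length [h], and the level sets form a partition inside [H]
    because [f] is measurable with respect to [H]. *)
Lemma step_approx H f (c h : R) : measurable_wrt H f ->
  (forall w, `|f w| <= c) -> 0 < h ->
  exists n (A : 'I_n -> set Omega) (x : 'I_n -> R),
  [/\ finite_partition_in H A, forall i, `|x i| <= c + h &
      forall w, `|f w - step A x w| <= h].
Proof.
move=> mf fc h0.
(* The successor makes the half-open intervals starting at [- c] reach past the endpoint [c]. *)
pose n := (Num.truncn (2 * c / h)).+1.
have c0 : 0 <= c by apply: le_trans (fc point).
have hn : 2 * c / h < n%:R by rewrite /n truncnS_gt.
pose x (i : 'I_n) : R := - c + i%:R * h.
pose A (i : 'I_n) := f @^-1` [set` `[x i, x i + h[].
have idx w : (Num.truncn ((f w + c) / h) < n)%N.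
  have := fc w; rewrite ler_norml => /andP[h1 h2].
  rewrite truncn_lt_nat; last by rewrite divr_ge0// ?(ltW h0)//; lra.
  apply: le_lt_trans hn; rewrite ler_pM2r ?invr_gt0//; lra.
have inA w (i : 'I_n) : A i w <-> i = Ordinal (idx w).
  have := fc w; rewrite ler_norml => /andP[h1 h2].
  rewrite /A /= in_itv /= /x; split.
    move=> /andP[a1 a2]; apply/val_inj => /=.
    apply/esym/eqP; rewrite truncn_eq; last by rewrite divr_ge0// ?(ltW h0)//; lra.
    rewrite ler_pdivlMr// ltr_pdivrMr//; apply/andP; split; first lra.
    by rewrite -natr1; lra.
  move=> -> /=.
  have /truncn_itv/andP[a1 a2] : 0 <= (f w + c) / h.
    by rewrite divr_ge0// ?(ltW h0)//; lra.
  move: a1 a2; rewrite ler_pdivlMr// ltr_pdivrMr// -natr1 => a1 a2.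
  by apply/andP; split; lra.
exists n, A, x; split.
- split.
  + by move=> i; apply: mf; exact: measurable_itv.
  + move=> i j _ _ [w [/inA -> /inA ->]] //.
  + by rewrite -subTset => w _; exists (Ordinal (idx w)) => //; exact/inA.
- move=> i; have := ltn_ord i; rewrite /n ltnS truncn_ge_nat; last first.
    by rewrite divr_ge0 ?mulr_ge0// ltW.
  rewrite ler_pdivlMr// => hi; rewrite ler_norml /x.
  have : 0 <= i%:R * h by rewrite mulr_ge0// ltW.
  by move=> ?; apply/andP; split; lra.
- move=> w; rewrite /step (bigD1 (Ordinal (idx w)))//= big1 => [|i /eqP ni]; last first.
    by rewrite indicE memNset ?mulr0// => /inA.
  have Aw : A (Ordinal (idx w)) w by exact/inA.
  rewrite addr0 indicE mem_set// mulr1.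
  move: Aw; rewrite /A /= in_itv /= => /andP[a1 a2].
  by rewrite ler_norml; apply/andP; split; lra.
Qed.

(** Uniform approximation by simple functions perturbs both sides by a multiple of the mesh [h],
    which then tends to 0. *)
Lemma beta_cov_bounded f g (cf cg : R) : measurable_wrt G f -> measurable_wrt G' g ->
  (forall w, `|f w| <= cf) -> (forall w, `|g w| <= cg) ->
  `|Ex (fun w => f w * g w) - Ex f * Ex g| <= 2 * b * cf * cg.
Proof.
move=> mf mg hf hg.
have cf0 : 0 <= cf by apply: le_trans (hf point).
have cg0 : 0 <= cg by apply: le_trans (hg point).
have bf : bm f.
  by split; [move=> _ B mB; rewrite setTI; apply: GP; exact: mf|exists cf].
have bg : bm g.
  by split; [move=> _ B mB; rewrite setTI; apply: G'P; exact: mg|exists cg].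
(* The estimate for simple functions with all values 0 bounds a non-negative number by [2 * b]. *)
have b0 : 0 <= b.
  have [n [A [x [pA _ _]]]] := step_approx mf hf ltr01.
  have [n' [A' [x' [pA' _ _]]]] := step_approx mg hg ltr01.
  have := @beta_cov_step n n' A A' (fun=> 0) (fun=> 0) 1 1 pA pA'.
  rewrite !normr0 !mulr1 => /(_ (fun=> ler01) (fun=> ler01) ler01 ler01) hh.
  suff : 0 <= 2 * b by lra.
  exact: le_trans hh.
have key h : 0 < h -> h <= 1 ->
  `|Ex (fun w => f w * g w) - Ex f * Ex g| <=
  2 * b * cf * cg + h * (2 * b * (cf + cg + 1) + 2 * (cf + cg + 2)).
  move=> h0 h1.
  have [n [A [x [pA xc fx]]]] := step_approx mf hf h0.
  have [n' [A' [y [pA' yc gy]]]] := step_approx mg hg h0.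
  have := beta_cov_step pA pA' xc yc (addr_ge0 cf0 (ltW h0)) (addr_ge0 cg0 (ltW h0)).
  move: fx gy.
  have [GA _ _] := pA; have [GA' _ _] := pA'.
  set f' := step A x; set g' := step A' y.
  have bf' : bm f' by apply: bm_sum => i; apply: bmZ; apply: bm_indic; exact: GP.
  have bg' : bm g' by apply: bm_sum => i; apply: bmZ; apply: bm_indic; exact: G'P.
  move=> ff' gg' K.
  have D1 : `|Ex f - Ex f'| <= h.
    rewrite -ExB ?bm_ig//; apply: norm_Ex_bound => //.
    by case: (bmB bf bf').
  have D2 : `|Ex g - Ex g'| <= h.
    rewrite -ExB ?bm_ig//; apply: norm_Ex_bound => //.
    by case: (bmB bg bg').
  have g'c w : `|g' w| <= cg + h.
    rewrite -(subrK (g w) (g' w)) addrC; apply: le_trans (ler_normD _ _) _.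
    by rewrite lerD// distrC.
  have D3 : `|Ex (fun w => f w * g w) - Ex (fun w => f' w * g' w)| <=
      cf * h + h * (cg + h).
    rewrite -ExB; [|by apply: bm_ig; exact: bmM|by apply: bm_ig; exact: bmM].
    apply: norm_Ex_bound; first by case: (bmB (bmM bf bg) (bmM bf' bg')).
    move=> w; have -> : f w * g w - f' w * g' w =
      f w * (g w - g' w) + (f w - f' w) * g' w by ring.
    apply: le_trans (ler_normD _ _) _; rewrite !normrM.
    by apply: lerD; apply: ler_pM => //; rewrite -/(g' w) -/(f' w).
  have D4 : `|Ex f * Ex g - Ex f' * Ex g'| <= cf * h + h * (cg + h).
    have -> : Ex f * Ex g - Ex f' * Ex g' =
      Ex f * (Ex g - Ex g') + (Ex f - Ex f') * Ex g' by ring.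
    apply: le_trans (ler_normD _ _) _; rewrite !normrM.
    apply: lerD; apply: ler_pM => //.
      by apply: norm_Ex_bound => //; case: bf.
    by apply: norm_Ex_bound => //; case: bg'.
  have := ler_normD (Ex (fun w => f w * g w) - Ex (fun w => f' w * g' w))
     (Ex (fun w => f' w * g' w) - Ex f' * Ex g').
  have := ler_normD (Ex (fun w => f w * g w) - Ex f' * Ex g')
     (Ex f' * Ex g' - Ex f * Ex g).
  rewrite [`|Ex f' * Ex g' - _|]distrC !addrA !subrK.
  have hh : h * h <= h by rewrite ler_piMl// ltW.
  have bhh : b * (h * h) <= b * h by rewrite ler_wpM2l.
  by nra.
apply/ler_addgt0Pr => e e0.
set c := 2 * b * (cf + cg + 1) + 2 * (cf + cg + 2) in key.
have c0 : 0 < c.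
  by rewrite /c ltr_wpDl ?mulr_ge0// ?addr_ge0// mulr_gt0// ltr_wpDl// addr_ge0.
pose h := Num.min 1 (e / c).
have h0 : 0 < h by rewrite lt_min ltr01 divr_gt0.
apply: le_trans (key h h0 _) _; first by rewrite ge_min lexx.
by rewrite lerD2l -ler_pdivlMr// ge_min lexx orbT.
Qed.

End bounded.
End beta_covariance.

(** * Covariance under a moment of order 2 + delta *)

Section moment_covariance.
Context dO (Omega : measurableType dO) (R : realType) (P : probability Omega R).
Local Notation Ex := (Ex P).
Variable (delta : R).
Hypothesis delta0 : 0 < delta.

Definition mom (f : Omega -> R) (w : Omega) : R := `|f w| `^ (2 + delta).

Lemma mom_ge0 f w : 0 <= mom f w. Proof. exact: powR_ge0. Qed.

(** Markov-type exchange: beyond the level [t], the surplus exponent [delta] buys a factor [t] to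
    the power [- delta]. *)
Lemma sqr_le_mom f w (t : R) : 0 < t -> t <= `|f w| ->
  f w ^+ 2 <= t `^ (- delta) * mom f w.
Proof.
move=> t0 tf; have f0 : 0 < `|f w| by exact: lt_le_trans tf.
rewrite -(real_normK (num_real (f w))) /mom powRD; last by rewrite (gt_eqF f0) implybT.
rewrite powR_mulrn// mulrCA ler_peMr ?sqr_ge0// powRN.
by rewrite ler_pdivlMl ?powR_gt0// mulr1 ge0_ler_powR ?nnegrE// ltW.
Qed.

Lemma norm_le_mom f w (t : R) : 0 < t -> t <= `|f w| ->
  t * `|f w| <= t `^ (- delta) * mom f w.
Proof.
move=> t0 tf; apply: le_trans (sqr_le_mom t0 tf).
by rewrite -(real_normK (num_real (f w))) expr2 ler_wpM2r.
Qed.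

Lemma L2_of_mom f : measurable_fun setT f -> ig P (mom f) -> L2 P f.
Proof.
move=> mf hf; split => //.
apply: (@ig_le _ _ _ _ _ (fun w => 1 + mom f w)).
- exact: measurable_funX.
- by apply: igD => //; exact: ig_cst.
move=> w; rewrite ger0_norm ?sqr_ge0//.
have [h|h] := leP 1 `|f w|.
  apply: le_trans (sqr_le_mom ltr01 h) _.
  by rewrite powR1 mul1r lerDr.
rewrite -(real_normK (num_real (f w))) (@le_trans _ _ 1)//.
  by rewrite expr_le1// ltW.
by rewrite lerDl mom_ge0.
Qed.

Lemma Ex_sqr_le_mom f M : measurable_fun setT f -> ig P (mom f) ->
  Ex (mom f) <= M -> Ex (fun w => f w ^+ 2) <= 1 + M.
Proof.
move=> mf hf hM; have [_ f2] := L2_of_mom mf hf.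
apply: (@le_trans _ _ (Ex (fun w => 1 + mom f w))); last first.
  by rewrite ExD ?Ex_cst ?lerD2l//; exact: ig_cst.
apply: le_Ex => //; first by apply: igD => //; exact: ig_cst.
move=> w; have [h|h] := leP 1 `|f w|.
  apply: le_trans (sqr_le_mom ltr01 h) _.
  by rewrite powR1 mul1r lerDr.
rewrite -(real_normK (num_real (f w))) (@le_trans _ _ 1)//.
  by rewrite expr_le1// ltW.
by rewrite lerDl mom_ge0.
Qed.

(** Values beyond [t] are sent to 0 rather than to the nearest endpoint, so the remainder
    [x - trunc t x] is either 0 or [x] itself. *)
Definition trunc (t x : R) : R := if `|x| <= t then x else 0.

Lemma trunc_le t x : 0 <= t -> `|trunc t x| <= t.
Proof. by move=> t0; rewrite /trunc; case: (leP `|x| t) => h; rewrite ?normr0. Qed.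

Lemma measurable_trunc t : measurable_fun setT (trunc t).
Proof.
apply: measurable_fun_ifT => //.
by apply: measurable_fun_ler => //; exact: normr_measurable.
Qed.

Lemma trunc_norm_le t x : `|trunc t x| <= `|x|.
Proof. by rewrite /trunc; case: (leP `|x| t); rewrite ?normr0. Qed.

Lemma tail_norm_le t x : `|x - trunc t x| <= `|x|.
Proof. by rewrite /trunc; case: (leP `|x| t); rewrite ?subrr ?normr0// subr0. Qed.

Section two.
Variables (G G' : set_system Omega).
Hypothesis GP : forall A, G A -> measurable A.
Hypothesis G'P : forall A, G' A -> measurable A.

Lemma measurable_wrt_comp (H : set_system Omega) (u : R -> R) (f : Omega -> R) : measurable_fun setT u ->
  measurable_wrt H f -> measurable_wrt H (fun w => u (f w)).
Proof.
move=> mu mf B mB; have := mu measurableT _ mB; rewrite setTI => /mf.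
by rewrite -comp_preimage.
Qed.

(** The truncated parts contribute the bounded estimate [2 * b * t ^+ 2]; every term that contains a
    tail carries the factor [t] to the power [- delta]. *)
Lemma beta_cov_trunc f g (b M t : R) :
  (beta_mixing P G G' <= b%:E)%E ->
  measurable_wrt G f -> measurable_wrt G' g ->
  ig P (mom f) -> ig P (mom g) -> Ex (mom f) <= M -> Ex (mom g) <= M ->
  1 <= t ->
  `|Ex (fun w => f w * g w) - Ex f * Ex g| <=
  2 * b * t ^+ 2 + t `^ (- delta) * (6 * M + M ^+ 2).
Proof.
move=> Gb wf wg hf hg fM gM t1.
have t0 : 0 < t by exact: lt_le_trans t1.
have mf : measurable_fun setT f.
  by move=> _ B mB; rewrite setTI; apply: GP; exact: wf.
have mg : measurable_fun setT g.
  by move=> _ B mB; rewrite setTI; apply: G'P; exact: wg.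
have mt := measurable_trunc t.
pose ft w := trunc t (f w); pose gt w := trunc t (g w).
have f2 := L2_of_mom mf hf; have g2 := L2_of_mom mg hg.
have bft : bm ft.
  by apply: (bm_comp mt (fun x => @trunc_le t x (ltW t0)) mf).
have bgt : bm gt.
  by apply: (bm_comp mt (fun x => @trunc_le t x (ltW t0)) mg).
have K := beta_cov_bounded GP G'P Gb (measurable_wrt_comp mt wf)
  (measurable_wrt_comp mt wg) (fun w => @trunc_le t (f w) (ltW t0)) 
  (fun w => @trunc_le t (g w) (ltW t0)).
rewrite -/ft -/gt in K.
have ft2 := bm_L2 P bft; have gt2 := bm_L2 P bgt.
have f'2 := L2B f2 ft2; have g'2 := L2B g2 gt2.
set q := t `^ (- delta) in K *.
have q0 : 0 <= q by exact: powR_ge0.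
have tail (h : Omega -> R) w : t * `|h w - trunc t (h w)| <= q * mom h w.
  rewrite /trunc; case: (leP `|h w| t) => ht.
    by rewrite subrr normr0 mulr0 mulr_ge0// mom_ge0.
  by rewrite subr0; exact: norm_le_mom (ltW ht).
have tail2 (h : Omega -> R) w : `|h w - trunc t (h w)| ^+ 2 <= q * mom h w.
  rewrite /trunc; case: (leP `|h w| t) => ht.
    by rewrite subrr normr0 expr0n mulr_ge0// mom_ge0.
  by rewrite subr0 real_normK ?num_real//; exact: sqr_le_mom (ltW ht).
have Etail (h : Omega -> R) : measurable_fun setT h -> L2 P h -> ig P (mom h) ->
    Ex (mom h) <= M -> t * `|Ex (fun w => h w - trunc t (h w))| <= q * M.
  move=> mh h2 ih hM.
  have bt : bm (fun w => trunc t (h w)).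
    by apply: (bm_comp mt (fun x => @trunc_le t x (ltW t0)) mh).
  have h'2 := L2B h2 (bm_L2 P bt).
  apply: (@le_trans _ _ (t * Ex (fun w => `|h w - trunc t (h w)|))).
    by rewrite ler_wpM2l ?(ltW t0)//; apply: norm_Ex; exact: L2_ig.
  rewrite -ExZ; last by apply: ig_norm; exact: L2_ig.
  apply: (@le_trans _ _ (Ex (fun w => q * mom h w))).
    apply: le_Ex => //; [|exact: igZ].
    by apply: igZ; apply: ig_norm; exact: L2_ig.
  by rewrite ExZ// ler_wpM2l.
(* Where the tail of [f] is nonzero, the larger of [|f|] and [|g|] exceeds [t], and its square
   dominates the product. *)
have D1 : `|Ex (fun w => (f w - ft w) * g w)| <= q * (M + M).
  apply: (@le_trans _ _ (Ex (fun w => q * (mom f w + mom g w)))); last first.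
    by rewrite ExZ ?ExD// ?ler_wpM2l ?lerD//; exact: igD.
  apply: norm_Ex_le; [exact: L2_igM|by apply: igZ; exact: igD|].
  move=> w; rewrite normrM mulrDr.
  have := tail2 f w; rewrite /ft /trunc; case: (leP `|f w| t) => ht.
    rewrite subrr !normr0 mul0r => _.
    by rewrite addr_ge0// mulr_ge0// mom_ge0.
  rewrite subr0 => hh.
  have [fg|/ltW fg] := leP `|g w| `|f w|.
    apply: (@le_trans _ _ (`|f w| ^+ 2)); first by rewrite expr2 ler_wpM2l.
    by apply: le_trans hh _; rewrite lerDl mulr_ge0// mom_ge0.
  apply: (@le_trans _ _ (`|g w| ^+ 2)); first by rewrite expr2 ler_wpM2r.
  rewrite real_normK ?num_real//.
  have tg : t <= `|g w| by apply: le_trans fg; exact: ltW.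
  by apply: le_trans (sqr_le_mom t0 tg) _; rewrite lerDr mulr_ge0// mom_ge0.
have D2 : `|Ex (fun w => ft w * (g w - gt w))| <= q * M.
  apply: (@le_trans _ _ (Ex (fun w => q * mom g w))); last first.
    by rewrite ExZ// ler_wpM2l.
  apply: norm_Ex_le; [exact: L2_igM|exact: igZ|].
  move=> w; rewrite normrM; apply: le_trans (tail g w).
  by apply: ler_pM => //; exact: trunc_le (ltW t0).
have Etf := Etail f mf f2 hf fM; have Etg := Etail g mg g2 hg gM.
rewrite -/(ft _) in Etf; rewrite -/(gt _) in Etg.
have E1 : Ex (fun w => f w * g w) =
    Ex (fun w => ft w * gt w) + Ex (fun w => ft w * (g w - gt w)) +
    Ex (fun w => (f w - ft w) * g w).
  rewrite -ExD; [|exact: L2_igM|exact: L2_igM].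
  rewrite -ExD; [|by apply: igD; exact: L2_igM|exact: L2_igM].
  by apply: eq_Ex => w; ring.
have E2 : Ex f = Ex ft + Ex (fun w => f w - ft w).
  rewrite -ExD; [|exact: L2_ig|exact: L2_ig].
  by apply: eq_Ex => w; ring.
have E3 : Ex g = Ex gt + Ex (fun w => g w - gt w).
  rewrite -ExD; [|exact: L2_ig|exact: L2_ig].
  by apply: eq_Ex => w; ring.
have Eft : `|Ex ft| <= t.
  by apply: norm_Ex_bound => [|w]; [case: bft|exact: trunc_le (ltW t0)].
have Egt : `|Ex gt| <= t.
  by apply: norm_Ex_bound => [|w]; [case: bgt|exact: trunc_le (ltW t0)].
rewrite E1 E2 E3.
move: K D1 D2 Etf Etg Eft Egt.
set a1 := Ex (fun w => ft w * gt w); set a2 := Ex (fun w => ft w * (g w - gt w)).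
set a3 := Ex (fun w => (f w - ft w) * g w).
set c1 := Ex ft; set c2 := Ex gt.
set r1 := Ex (fun w => f w - ft w); set r2 := Ex (fun w => g w - gt w).
move=> K D1 D2 Etf Etg Eft Egt.
have M0 : 0 <= M by apply: le_trans fM; apply: Ex_ge0 => w; exact: mom_ge0.
have q1 : q <= 1.
  by rewrite /q powRN invf_le1 ?powR_gt0// -(powRr0 t) ler_powR// ltW.
have qM0 : 0 <= q * M by exact: mulr_ge0.
have A1 : `|c1 * r2| <= q * M.
  rewrite normrM; apply: le_trans Etg; exact: ler_pM.
have A2 : `|r1 * c2| <= q * M.
  by rewrite normrM mulrC; apply: le_trans Etf; exact: ler_pM.
have r1b : `|r1| <= q * M.
  by apply: le_trans Etf; rewrite ler_peMl.
have r2b : `|r2| <= M.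
  apply: (@le_trans _ _ (q * M)); last by rewrite ler_piMl.
  by apply: le_trans Etg; rewrite ler_peMl.
have A3 : `|r1 * r2| <= q * M ^+ 2.
  by rewrite normrM expr2 mulrA; exact: ler_pM.
have -> : a1 + a2 + a3 - (c1 + r1) * (c2 + r2) =
  (a1 - c1 * c2) + a2 + a3 - c1 * r2 - r1 * c2 - r1 * r2 by ring.
have := ler_normB ((a1 - c1 * c2) + a2 + a3 - c1 * r2 - r1 * c2) (r1 * r2).
have := ler_normB ((a1 - c1 * c2) + a2 + a3 - c1 * r2) (r1 * c2).
have := ler_normB ((a1 - c1 * c2) + a2 + a3) (c1 * r2).
have := ler_normD ((a1 - c1 * c2) + a2) a3.
have := ler_normD (a1 - c1 * c2) a2.
have -> : 2 * b * t ^+ 2 = 2 * b * t * t by ring.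
by rewrite !mulrDr in D1 *; lra.
Qed.

(** The level [t], equal to [b] to the power [- 1 / (2 + delta)], balances the two errors of
    [beta_cov_trunc]: both [b * t ^+ 2] and [t] to the power [- delta] become [b] to the power
    [delta / (2 + delta)]. *)
Lemma beta_cov_moment f g (b M : R) :
  (beta_mixing P G G' <= b%:E)%E -> 0 <= b ->
  measurable_wrt G f -> measurable_wrt G' g ->
  ig P (mom f) -> ig P (mom g) -> Ex (mom f) <= M -> Ex (mom g) <= M ->
  `|Ex (fun w => f w * g w) - Ex f * Ex g| <=
  (2 + 6 * M + M ^+ 2) * b `^ (delta / (2 + delta)).
Proof.
move=> Gb b0 wf wg hf hg fM gM.
have M0 : 0 <= M by apply: le_trans fM; apply: Ex_ge0 => w; exact: mom_ge0.
have d2 : 0 < 2 + delta by rewrite addr_gt0.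
have dd : 0 < delta / (2 + delta) by rewrite divr_gt0.
have C0 : 0 <= 6 * M + M ^+ 2 by rewrite addr_ge0 ?sqr_ge0// mulr_ge0.
(* For [b >= 1] mixing gives nothing and Cauchy-Schwarz suffices. *)
have [b1|b1] := leP 1 b.
  apply: (@le_trans _ _ (2 + 6 * M + M ^+ 2)); last first.
    rewrite ler_peMr//; first by rewrite -addrA addr_ge0.
    have := @ge0_ler_powR R _ (ltW dd) 1 b; rewrite powR1; apply; rewrite ?nnegrE//; exact: ltW.
  have mf : measurable_fun setT f.
    by move=> _ B mB; rewrite setTI; apply: GP; exact: wf.
  have mg : measurable_fun setT g.
    by move=> _ B mB; rewrite setTI; apply: G'P; exact: wg.
  have f2 := L2_of_mom mf hf; have g2 := L2_of_mom mg hg.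
  have := Ex_sqr_le_mom mf hf fM; have := Ex_sqr_le_mom mg hg gM.
  have := Ex_sqr_sum_sqr f2 g2; have := Ex_sqr_le f2; have := Ex_sqr_le g2.
  set A := Ex (fun w => f w ^+ 2); set B := Ex (fun w => g w ^+ 2).
  set C := Ex (fun w => f w * g w) => h1 h2 h3 h4 h5.
  have A0 : 0 <= A by apply: le_trans h2; exact: sqr_ge0.
  have B0 : 0 <= B by apply: le_trans h1; exact: sqr_ge0.
  have hC : `|C| <= 1 + M.
    rewrite -ler_sqr ?nnegrE ?addr_ge0// real_normK ?num_real//.
    by apply: le_trans h3 _; rewrite expr2; exact: ler_pM.
  have hfg : `|Ex f * Ex g| <= 1 + M.
    rewrite -ler_sqr ?nnegrE ?addr_ge0// real_normK ?num_real// exprMn expr2.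
    by apply: ler_pM; rewrite ?sqr_ge0//; [exact: le_trans h2 _|exact: le_trans h1 _].
  have := ler_normB C (Ex f * Ex g); have := sqr_ge0 M; lra.
(* For [b = 0] the balancing level is infinite, so [t] is taken large in terms of an arbitrary error
   [e]. *)
have [b00|bn0] := eqVneq b 0.
  rewrite b00 in Gb *; rewrite powR0 ?gt_eqF// mulr0.
  apply/ler_addgt0Pr => e e0; rewrite add0r.
  pose C := 6 * M + M ^+ 2; pose t := 1 + (C / e) `^ delta^-1.
  have t1 : 1 <= t by rewrite lerDl powR_ge0.
  apply: le_trans (beta_cov_trunc Gb wf wg hf hg fM gM t1) _.
  rewrite mulr0 mul0r add0r powRN ler_pdivrMl ?powR_gt0 ?(lt_le_trans ltr01)//.
  rewrite -ler_pdivrMr// -/C.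
  have Ce : 0 <= C / e by rewrite divr_ge0// ltW.
  rewrite -[leLHS](powRr1 Ce) -(mulVf (negbT (gt_eqF delta0))) powRrM.
  by rewrite ge0_ler_powR ?nnegrE ?powR_ge0 ?(ltW delta0)// ?lerDr// (le_trans _ t1).
have bp : 0 < b by rewrite lt_def bn0.
pose t := b `^ (- (2 + delta)^-1).
have t1 : 1 <= t.
  rewrite /t powRN -[leLHS]invr1 lef_pV2 ?posrE ?powR_gt0//.
  have d2' : 0 <= (2 + delta)^-1 by rewrite invr_ge0 ltW.
  by have := @ge0_ler_powR R _ d2' b 1; rewrite powR1; apply; rewrite ?nnegrE//; exact: ltW.
apply: le_trans (beta_cov_trunc Gb wf wg hf hg fM gM t1) _.
have -> : t `^ (- delta) = b `^ (delta / (2 + delta)).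
  by rewrite /t -powRrM; congr (_ `^ _); field; rewrite gt_eqF.
have -> : 2 * b * t ^+ 2 = 2 * b `^ (delta / (2 + delta)).
  rewrite -mulrA; congr (2 * _).
  rewrite -powR_mulrn ?powR_ge0// /t -powRrM -{1}(powRr1 b0) -powRD; last first.
    by rewrite bn0 implybT.
  by congr (_ `^ _); field; rewrite gt_eqF.
by rewrite le_eqVlt; apply/orP; left; apply/eqP; ring.
Qed.

End two.
End moment_covariance.

(** * Borel measurability in finite-dimensional space *)

Lemma bigcapT_measurable_fin d (T : measurableType d) (I : finType)
    (F : I -> set T) :
  (forall i, measurable (F i)) -> measurable (\bigcap_i F i).
Proof.
move=> mF; rewrite -[X in measurable X]setCK setC_bigcap; apply: measurableC.
by apply: countable_bigcupT_measurable => // i; exact: measurableC.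
Qed.

Section borel_rV.
Context (R : realType) (n : nat).

Lemma measurable_continuous_borel (T U : ptopologicalType) (f : T -> U) :
  continuous f -> measurable_fun setT (f : borel T -> borel U).
Proof.
move=> /continuousP cf; apply: (@measurability _ _ (borel T) (borel U) setT f (@open U) erefl).
by move=> _ [B oB <-]; rewrite setTI; apply: sub_sigma_algebra; exact: cf.
Qed.

Lemma measurable_continuous_R (T : ptopologicalType) (f : T -> R) :
  continuous f -> measurable_fun setT (f : borel T -> R).
Proof.
move=> /continuousP cf.
apply: (@measurability _ _ (borel T) R setT f _ (RGenOInfty.measurableE R)).
move=> _ [_ [x ->] <-]; rewrite setTI; apply: sub_sigma_algebra.
by apply: cf; exact: interval_open.
Qed.

Lemma measurable_coord (i : 'I_n) :
  measurable_fun setT (fun x : borel 'rV[R]_n => (x : 'rV[R]_n) 0 i).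
Proof. by apply: measurable_continuous_R; exact: coord_continuous. Qed.

Lemma borel_closed (T : ptopologicalType) (A : set T) :
  closed A -> measurable (A : set (borel T)).
Proof.
move=> cA; rewrite -(setCK A); apply: measurableC; apply: sub_sigma_algebra.
exact: closed_openC.
Qed.

Lemma borel_compact (A : set 'rV[R]_n) : compact A ->
  measurable (A : set (borel 'rV[R]_n)).
Proof.
by move=> cA; apply: borel_closed; apply: compact_closed => //; exact: norm_hausdorff.
Qed.

Lemma ball_rVE (x : 'rV[R]_n) e : 0 < e ->
  ball x e = [set y | forall i, `|x 0 i - y 0 i| < e].
Proof.
move=> e0; apply/seteqP; split => y /=.
  by move=> [_ h] i; exact: h.
by move=> h; split => // i j; rewrite ord1; exact: h.
Qed.

(** Balls with rational centres and radii [1 / (m + 1)] form a countable base, and a sup-norm ball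
    is a finite intersection of conditions on the coordinates. *)
Lemma measurable_rV d (T : measurableType d) (V : T -> 'rV[R]_n) :
  (forall i, measurable_fun setT (fun w => V w 0 i)) ->
  measurable_fun setT (V : T -> borel 'rV[R]_n).
Proof.
have n1 (a b c : R) : b - c < a -> a < b -> 0 < c -> `|a - b| < c.
  by move=> ? ? ?; rewrite ltr_norml; apply/andP; split; lra.
have n2 (a b c y e : R) : `|a - b| < c -> `|a - y| < c -> c < e / 2 -> `|b - y| < e.
  rewrite !ltr_norml => /andP[? ?] /andP[? ?] ?; apply/andP; split; lra.
have n3 (a b c : R) : `|a - b| < c <-> a - c < b < a + c.
  by rewrite ltr_norml; split => /andP[? ?]; apply/andP; split; lra.
move=> mV; apply: (@measurability _ _ T (borel 'rV[R]_n) setT V (@open 'rV[R]_n) erefl).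
move=> _ [U oU <-]; rewrite setTI.
pose q (k : 'rV[rat]_n * nat) : 'rV[R]_n := map_mx ratr k.1.
pose F (k : 'rV[rat]_n * nat) : set 'rV[R]_n :=
  if `[< ball (q k) k.2.+1%:R^-1 `<=` U >] then ball (q k) k.2.+1%:R^-1 else set0.
have -> : U = \bigcup_k F k.
  apply/seteqP; split => [x Ux|x [k _]]; last first.
    by rewrite /F; case: asboolP => // h; exact: h.
  have : nbhs x U by exact: open_nbhs_nbhs.
  rewrite -nbhs_ballE => -[e /= e0 xeU].
  have [m hm] : exists m : nat, m.+1%:R^-1 < e / 2.
    have /ltr_add_invr[m] : 0 < e / 2 by rewrite divr_gt0.
    by rewrite add0r => ?; exists m.
  have m0 : 0 < m.+1%:R^-1 :> R by rewrite invr_gt0.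
  have /choice[f hf] : forall i : 'I_n, exists r : rat, `|ratr r - x 0 i| < m.+1%:R^-1.
    move=> i.
    have : x 0 i - m.+1%:R^-1 < x 0 i by rewrite gtrBl.
    move=> /rat_in_itvoo[r]; rewrite in_itv /= => /andP[h1 h2].
    by exists r; exact: n1 h1 h2 m0.
  exists (\row_i f i, m) => //; rewrite /F ifT.
    rewrite ball_rVE//= => i; rewrite /q /= !mxE; exact: hf.
  apply/asboolP => y; rewrite ball_rVE//= => hy; apply: xeU.
  rewrite ball_rVE//= => i; have := hf i; have := hy i; rewrite !mxE => h1 h2.
  exact: n2 h2 h1 hm.
rewrite preimage_bigcup; apply: countable_bigcupT_measurable => // k.
rewrite /F; case: asboolP => _; last by rewrite preimage_set0.
rewrite ball_rVE//.
have -> : V @^-1` [set y | forall i, `|q k 0 i - y 0 i| < k.2.+1%:R^-1] =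
  \bigcap_i ((fun w => V w 0 i) @^-1`
    `](q k 0 i - k.2.+1%:R^-1), (q k 0 i + k.2.+1%:R^-1)[).
  apply/seteqP; split => w /= h.
    by move=> i _ /=; rewrite in_itv /=; exact/n3/h.
  by move=> i; have := h i I; rewrite /= in_itv /= => /n3.
apply: bigcapT_measurable_fin => i.
by rewrite -[X in measurable X]setTI; apply: mV => //; exact: measurable_itv.
Qed.

End borel_rV.

(** * Equality in law, local functionals of the process and transfer by stationarity *)

Section equidistribution.
Context d1 d2 d3 (T1 : measurableType d1) (T2 : measurableType d2)
  (U : measurableType d3) (R : realType).
Variables (P1 : probability T1 R) (P2 : probability T2 R).
Variables (f : T1 -> U) (g : T2 -> U).
Hypothesis mf : measurable_fun setT f.
Hypothesis mg : measurable_fun setT g.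
Hypothesis fg : forall B, measurable B -> P1 (f @^-1` B) = P2 (g @^-1` B).

Lemma equi_ge0_integral (h : U -> \bar R) : measurable_fun setT h ->
  (forall x, 0 <= h x)%E ->
  (\int[P1]_w h (f w) = \int[P2]_w h (g w))%E.
Proof.
move=> mh h0.
have inf : f \in mfun by exact: mem_set.
have ing : g \in mfun by exact: mem_set.
pose f' := mfun_Sub inf; pose g' := mfun_Sub ing.
transitivity (\int[distribution P1 f']_x h x)%E.
  by rewrite ge0_integral_pushforward//= preimage_setT.
transitivity (\int[distribution P2 g']_x h x)%E.
  by apply: eq_measure_integral => A mA _; exact: fg.
by rewrite ge0_integral_pushforward//= preimage_setT.
Qed.

Lemma equi_Ex (u : U -> R) : measurable_fun setT u ->
  Ex P1 (fun w => u (f w)) = Ex P2 (fun w => u (g w)).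
Proof.
move=> mu; rewrite /Ex /Rintegral.
have mu' : measurable_fun setT (EFin \o u) by exact/measurable_EFinP.
rewrite integralE [in RHS]integralE; congr (fine (_ - _)%E).
- rewrite (eq_integral (fun x => (EFin \o u)^\+%E (f x))); last first.
    by move=> x _; rewrite !funeposE.
  rewrite [RHS](eq_integral (fun x => (EFin \o u)^\+%E (g x))); last first.
    by move=> x _; rewrite !funeposE.
  exact: (equi_ge0_integral (measurable_funepos mu') (fun x => funepos_ge0 (EFin \o u) x)).
- rewrite (eq_integral (fun x => (EFin \o u)^\-%E (f x))); last first.
    by move=> x _; rewrite !funenegE.
  rewrite [RHS](eq_integral (fun x => (EFin \o u)^\-%E (g x))); last first.
    by move=> x _; rewrite !funenegE.
  exact: (equi_ge0_integral (measurable_funeneg mu') (fun x => funeneg_ge0 (EFin \o u) x)).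
Qed.

Lemma equi_ig (u : U -> R) : measurable_fun setT u ->
  ig P1 (fun w => u (f w)) -> ig P2 (fun w => u (g w)).
Proof.
move=> mu /integrableP[_ h]; apply/integrableP; split.
  by apply/measurable_EFinP; exact: measurableT_comp.
rewrite -(equi_ge0_integral (h := fun x => `|(u x)%:E|%E)) //.
by apply: measurableT_comp => //; exact/measurable_EFinP.
Qed.

End equidistribution.

Section functionals.
Context {R : realType} {dO : measure_display} {Omega : measurableType dO}.
Context {d : nat} {M : ptopologicalType}.
Variable P : probability Omega R.
Local Notation E := (borel 'rV[R]_d * borel M)%type.
Local Notation rV := (borel 'rV[R]_d).

(** The carrier of [evaluation_sigma] as a measurable type. Its points are arbitrary set functions,
    not only measures. *)
Definition EV := g_sigma_algebraType (\bigcup_(A in (measurable : set (set E)))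
  preimage_set_system setT (fun mu : set E -> \bar R => mu A) measurable).

Lemma measurable_eval (A : set E) : measurable A ->
  measurable_fun setT (fun mu : EV => mu A).
Proof.
move=> mA _ B mB; apply: sub_sigma_algebra; exists A => //.
by exists B.
Qed.

Lemma measurable_toEV dT (T : measurableType dT) (h : T -> EV) :
  (forall A : set E, measurable A -> measurable_fun setT (fun w => h w A)) ->
  measurable_fun setT h.
Proof.
move=> mh; apply: (@measurability _ _ T EV setT h _ erefl).
move=> _ [_ [A mA [B mB <-]] <-]; rewrite !setTI.
by have := mh A mA measurableT B mB; rewrite setTI.
Qed.

Definition restr (B : set 'rV[R]_d) (mu : EV) : EV :=
  fun A => mu (A `&` (B `*` setT)).

Definition sh (x : 'rV[R]_d) (mu : EV) : EV := pushforward mu (shift_marked x).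

Lemma measurable_restr (B : set rV) : measurable B ->
  measurable_fun setT (restr B).
Proof.
move=> mB; apply: measurable_toEV => A mA; apply: measurable_eval.
by apply: measurableI => //; exact: measurableX.
Qed.

Lemma continuous_addr (x : 'rV[R]_d) : continuous (fun y : 'rV[R]_d => y + x).
Proof. by move=> y; exact: (cvgD cvg_id (cvg_cst x)). Qed.

Lemma measurable_addr (x : 'rV[R]_d) :
  measurable_fun setT (fun y : rV => (y : 'rV[R]_d) + x : rV).
Proof. by apply: measurable_continuous_borel; exact: continuous_addr. Qed.

Lemma measurable_shift_marked (x : 'rV[R]_d) :
  measurable_fun setT (@shift_marked R d M x : E -> E).
Proof.
apply: measurable_fun_pair => //.
by apply: (measurableT_comp (measurable_addr (- x))).
Qed.

Lemma measurable_sh x : measurable_fun setT (sh x).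
Proof.
apply: measurable_toEV => A mA; apply: measurable_eval.
by have := measurable_shift_marked x measurableT mA; rewrite setTI.
Qed.

Variable X : R.-ker Omega ~> E.

Lemma measurable_XEV : measurable_fun setT (fun w => X w : EV).
Proof. by apply: measurable_toEV => A mA; exact: measurable_kernel. Qed.

Lemma measurable_shX z : measurable_fun setT (fun w => sh z (X w)).
Proof. exact: (measurableT_comp (measurable_sh z) measurable_XEV). Qed.

(** [f] depends only on the points of the process in [z + B], and is presented as a functional of
    the process translated by [- z]. The mixing coefficients involve cubes centred at the origin,
    and this form brings a cube centred at [z] back to them. *)
Definition loc (z : 'rV[R]_d) (B : set 'rV[R]_d) (f : Omega -> R) :=
  exists2 Phi : EV -> R, measurable_fun setT Phi &
    forall w, f w = Phi (restr B (sh z (X w))).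

Lemma loc_comp z B u f : measurable_fun setT u -> loc z B f ->
  loc z B (fun w => u (f w)).
Proof.
move=> mu [Phi mPhi e]; exists (u \o Phi); first exact: measurableT_comp.
by move=> w; rewrite e.
Qed.

Lemma loc_cst z B (c : R) : loc z B (fun=> c).
Proof. by exists (cst c). Qed.

Lemma locD z B f g : loc z B f -> loc z B g -> loc z B (fun w => f w + g w).
Proof.
move=> [Phi mPhi e] [Psi mPsi e']; exists (fun mu => Phi mu + Psi mu).
  exact: measurable_funD.
by move=> w; rewrite e e'.
Qed.

Lemma locM z B f g : loc z B f -> loc z B g -> loc z B (fun w => f w * g w).
Proof.
move=> [Phi mPhi e] [Psi mPsi e']; exists (fun mu => Phi mu * Psi mu).
  exact: measurable_funM.
by move=> w; rewrite e e'.
Qed.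

Lemma locZ z B c f : loc z B f -> loc z B (fun w => c * f w).
Proof. by apply: locM; exact: loc_cst. Qed.

Lemma locB z B f c : loc z B f -> loc z B (fun w => f w - c).
Proof. by move=> hf; apply: locD => //; exact: loc_cst. Qed.

Lemma loc_sum z B (I : eqType) (s : seq I) (F : I -> Omega -> R) :
  (forall i, i \in s -> loc z B (F i)) ->
  loc z B (fun w => \sum_(i <- s) F i w).
Proof.
elim: s => [|i s IHs] hF.
  by under [X in loc _ _ X]funext do rewrite big_nil; exact: loc_cst.
under [X in loc _ _ X]funext do rewrite big_cons.
apply: locD; first by apply: hF; rewrite mem_head.
by apply: IHs => j js; apply: hF; rewrite inE js orbT.
Qed.

Lemma loc_count z (B S : set 'rV[R]_d) (C : set (borel M)) :
  measurable (S : set rV) -> measurable C -> (forall x, S x -> B (x - z)) ->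
  loc z B (fun w => fine (X w (S `*` C))).
Proof.
move=> mS mC SB.
pose A : set E := ((fun y : 'rV[R]_d => y + z) @^-1` S) `*` C.
exists (fun mu => fine (mu A)).
  apply: measurableT_comp => //; apply: measurable_eval.
  apply: measurableX => //.
  by have := measurable_addr z measurableT mS; rewrite setTI.
move=> w; congr (fine (X w _)).
apply/seteqP; split => -[x m] /=; rewrite /shift_marked /=.
  by move=> [Sx Cm]; split; [split => //=; rewrite subrK|split => //=; exact: SB].
by move=> [[/= h1 h2] _]; split => //; move: h1; rewrite subrK.
Qed.

Hypothesis statX : stationary P X.

Lemma loc_measurable z (B : set rV) f : measurable B -> loc z B f ->
  measurable_fun setT f.
Proof.
move=> mB [Phi mPhi e].
have -> : f = Phi \o (restr B \o (sh z \o (fun w => X w : EV))).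
  by apply/funext => w; rewrite e.
apply: (measurableT_comp mPhi); apply: (measurableT_comp (measurable_restr mB)).
exact: measurable_shX.
Qed.

Lemma sigma_restr_measurable (B : set rV) (A : set Omega) : measurable B ->
  sigma_restr X B A -> measurable A.
Proof.
move=> mB [F mF <-].
have := measurableT_comp (measurable_restr mB) measurable_XEV.
by move=> /(_ measurableT F mF).
Qed.

Lemma stat_measure (Theta : EV -> R) z (B : set R) :
  measurable_fun setT Theta -> measurable B ->
  P [set w | B (Theta (sh z (X w)))] = P [set w | B (Theta (X w))].
Proof.
move=> mT mB; apply: (statX z (F := Theta @^-1` B)).
by have := mT measurableT B mB; rewrite setTI.
Qed.

Lemma stat_Ex (Theta : EV -> R) z : measurable_fun setT Theta ->
  Ex P (fun w => Theta (sh z (X w))) = Ex P (fun w => Theta (X w)).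
Proof.
move=> mT.
exact: (equi_Ex (measurableT_comp mT (measurable_shX z))
  (measurableT_comp mT measurable_XEV) (fun B mB => stat_measure z mT mB)
  (@measurable_id _ R setT)).
Qed.

Lemma stat_ig (Theta : EV -> R) z : measurable_fun setT Theta ->
  ig P (fun w => Theta (sh z (X w))) -> ig P (fun w => Theta (X w)).
Proof.
move=> mT.
exact: (equi_ig (measurableT_comp mT (measurable_shX z))
  (measurableT_comp mT measurable_XEV) (fun B mB => stat_measure z mT mB)
  (@measurable_id _ R setT)).
Qed.

Section mixing.
Variables (z : 'rV[R]_d) (B1 B2 : set rV) (b : R).
Hypotheses (mB1 : measurable B1) (mB2 : measurable B2).
Hypothesis hb : (beta_mixing P (sigma_restr X B1) (sigma_restr X B2) <= b%:E)%E.

Let wrt (B : set rV) (Phi : EV -> R) : measurable_fun setT Phi ->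
  measurable_wrt (sigma_restr X B) (fun w => Phi (restr B (X w))).
Proof.
move=> mPhi A mA; exists (Phi @^-1` A); last by rewrite setTI.
by have := mPhi measurableT A mA; rewrite setTI.
Qed.

(** By stationarity the covariance is that of the same functionals of the untranslated process,
    which are measurable for the two sigma-algebras in the mixing hypothesis. *)
Lemma loc_cov_bounded f g (cf cg : R) : loc z B1 f -> loc z B2 g ->
  (forall w, `|f w| <= cf) -> (forall w, `|g w| <= cg) ->
  `|Ex P (fun w => f w * g w) - Ex P f * Ex P g| <= 2 * b * cf * cg.
Proof.
move=> [Phi mPhi ef] [Psi mPsi eg] hf hg.
have cf0 : 0 <= cf by apply: le_trans (hf point).
have cg0 : 0 <= cg by apply: le_trans (hg point).
(* The bounds on [f] and [g] hold along the translated process only; clipping makes the functionals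
   bounded along the untranslated one too, without changing [f] and [g]. *)
pose clip (c x : R) := Num.max (- c) (Num.min c x).
have clipE c x : `|x| <= c -> clip c x = x.
  rewrite ler_norml => /andP[h1 h2]; rewrite /clip.
  by rewrite (min_idPr h2) (max_idPr h1).
have clip_le c x : 0 <= c -> `|clip c x| <= c.
  move=> c0; rewrite ler_norml /clip le_max lexx /= ge_max ge_min lexx /=.
  by rewrite andbT lerNl (le_trans _ c0)// oppr_le0.
have mclip c (F : EV -> R) : measurable_fun setT F ->
    measurable_fun setT (fun mu => clip c (F mu)).
  by move=> mF; apply: measurable_maxr => //; exact: measurable_minr.
pose F mu := clip cf (Phi (restr B1 mu)).
pose G mu := clip cg (Psi (restr B2 mu)).
have mF : measurable_fun setT F.
  by apply: mclip; apply: measurableT_comp => //; exact: measurable_restr.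
have mG : measurable_fun setT G.
  by apply: mclip; apply: measurableT_comp => //; exact: measurable_restr.
have -> : f = fun w => F (sh z (X w)).
  by apply/funext => w; rewrite /F -ef clipE.
have -> : g = fun w => G (sh z (X w)).
  by apply/funext => w; rewrite /G -eg clipE.
rewrite (stat_Ex (Theta := fun mu => F mu * G mu))//; last exact: measurable_funM.
rewrite !stat_Ex//.
apply: (beta_cov_bounded _ _ hb).
- by move=> A; exact: sigma_restr_measurable.
- by move=> A; exact: sigma_restr_measurable.
- exact: wrt (mclip cf Phi mPhi).
- exact: wrt (mclip cg Psi mPsi).
- by move=> w; exact: clip_le.
- by move=> w; exact: clip_le.
Qed.

Lemma loc_cov_moment (delta : R) f g (m : R) : 0 < delta -> 0 <= b ->
  loc z B1 f -> loc z B2 g ->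
  ig P (mom delta f) -> ig P (mom delta g) ->
  Ex P (mom delta f) <= m -> Ex P (mom delta g) <= m ->
  `|Ex P (fun w => f w * g w) - Ex P f * Ex P g| <=
   (2 + 6 * m + m ^+ 2) * b `^ (delta / (2 + delta)).
Proof.
move=> d0 b0 [Phi mPhi ef] [Psi mPsi eg] hf hg fm gm.
pose F mu := Phi (restr B1 mu); pose G mu := Psi (restr B2 mu).
have mF : measurable_fun setT F.
  by apply: measurableT_comp => //; exact: measurable_restr.
have mG : measurable_fun setT G.
  by apply: measurableT_comp => //; exact: measurable_restr.
pose f0 w := F (X w); pose g0 w := G (X w).
have mmom (H : EV -> R) : measurable_fun setT H ->
    measurable_fun setT (fun mu => `|H mu| `^ (2 + delta)).
  move=> mH; exact: (measurableT_comp (measurable_powR (2 + delta))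
    (measurableT_comp (@normr_measurable R setT) mH)).
have momE (h : Omega -> R) (H : EV -> R) : (forall w, h w = H (sh z (X w))) ->
    mom delta h = fun w => (fun mu => `|H mu| `^ (2 + delta)) (sh z (X w)).
  by move=> e; apply/funext => w; rewrite /mom e.
have efm : Ex P (mom delta f) = Ex P (mom delta f0).
  by rewrite (momE f F ef); exact: (stat_Ex z (mmom _ mF)).
have egm : Ex P (mom delta g) = Ex P (mom delta g0).
  by rewrite (momE g G eg); exact: (stat_Ex z (mmom _ mG)).
rewrite efm in fm; rewrite egm in gm.
rewrite (momE f F ef) in hf; rewrite (momE g G eg) in hg.
have {}hf : ig P (mom delta f0) := stat_ig (mmom _ mF) hf.
have {}hg : ig P (mom delta g0) := stat_ig (mmom _ mG) hg.
have eqf : Ex P f = Ex P f0 by rewrite (funext ef); exact: (stat_Ex z mF).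
have eqg : Ex P g = Ex P g0 by rewrite (funext eg); exact: (stat_Ex z mG).
have eqfg : Ex P (fun w => f w * g w) = Ex P (fun w => f0 w * g0 w).
  rewrite (funext ef) (funext eg).
  exact: (stat_Ex z (measurable_funM mF mG)).
rewrite eqf eqg eqfg.
apply: (@beta_cov_moment _ _ _ _ delta d0 (sigma_restr X B1) (sigma_restr X B2)) => //.
- by move=> A; exact: sigma_restr_measurable.
- by move=> A; exact: sigma_restr_measurable.
- exact: wrt.
- exact: wrt.
Qed.

End mixing.
End functionals.

(** * Grid cells and the volume of compact sets *)

Section cells.
Context (R : realType) (d : nat).
Local Notation rV := (borel 'rV[R]_d).

Definition fl (N : nat) (x : 'rV[R]_d) : 'rV[int]_d :=
  \row_i Num.floor (N%:R * x 0 i).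

Definition cell (N : nat) (z : 'rV[int]_d) : set 'rV[R]_d := [set x | fl N x = z].

Lemma floorP (x : R) (m : int) : Num.floor x = m <-> m%:~R <= x < (m + 1)%:~R.
Proof. by split => [<-|/floor_def//]; exact: floor_itv. Qed.

Lemma cellP N z x : cell N z x <->
  forall i, (z 0 i)%:~R <= N%:R * x 0 i < (z 0 i + 1)%:~R.
Proof.
rewrite /cell /=; split => [<- i|h].
  by rewrite mxE; apply/floorP.
by apply/rowP => i; rewrite mxE; apply/floorP.
Qed.

Lemma measurable_cell N z : measurable (cell N z : set rV).
Proof.
have -> : cell N z = \bigcap_i (fun x : 'rV[R]_d => N%:R * x 0 i) @^-1`
    `[(z 0 i)%:~R, (z 0 i + 1)%:~R[.
  apply/seteqP; split => x /=.
    by move=> /cellP h i _ /=; rewrite in_itv /=; exact: h.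
  by move=> h; apply/cellP => i; have := h i I; rewrite /= in_itv.
apply: (@bigcapT_measurable_fin _ rV) => i.
have mf : measurable_fun setT (fun x : rV => N%:R * (x : 'rV[R]_d) 0 i).
  by apply: measurable_funM => //; exact: measurable_coord.
by rewrite -[X in measurable X]setTI; apply: mf => //; exact: measurable_itv.
Qed.

Lemma trivIset_cell N (D : set 'rV[int]_d) : trivIset D (cell N).
Proof. by move=> i j _ _ [x [<- <-]]. Qed.

Lemma cell_shift N z (x : 'rV[R]_d) : (0 < N)%N ->
  cell N z x <-> cell N 0 (x - N%:R^-1 *: map_mx intr z).
Proof.
move=> N0; have Nn : N%:R != 0 :> R by rewrite pnatr_eq0 -lt0n.
split => /cellP h; apply/cellP => i; have := h i; rewrite !mxE.
  by rewrite mulrBr mulrA mulfV// mul1r add0r intrD => /andP[? ?]; apply/andP; split; lra.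
by rewrite mulrBr mulrA mulfV// mul1r add0r intrD => /andP[? ?]; apply/andP; split; lra.
Qed.

(** Dyadic grids are nested. *)
Lemma fl_double k (x y : 'rV[R]_d) :
  fl (2 ^ k.+1) x = fl (2 ^ k.+1) y -> fl (2 ^ k) x = fl (2 ^ k) y.
Proof.
move=> /rowP h; apply/rowP => i; have := h i; rewrite !mxE.
rewrite expnS natrM -!mulrA.
move: (_ * x 0 i) (_ * y 0 i) => r s {h} h.
apply/floorP; have := floor_itv s; have := floor_itv (2 * r).
rewrite h; have := floor_itv (2 * s); set m := Num.floor (2 * s).
set l := Num.floor s; rewrite !intrD => /andP[h1 h2] /andP[h3 h4] /andP[h5 h6].
have l1 : 2 * l <= m.
  have : (2 * l)%:~R < (m + 1)%:~R :> R by rewrite intrM intrD; lra.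
  by rewrite ltr_int ltzD1.
have l2 : m + 1 <= 2 * (l + 1).
  have : m%:~R < (2 * (l + 1))%:~R :> R by rewrite intrM intrD; lra.
  by rewrite ltr_int -lezD1.
have : (2 * l)%:~R <= m%:~R :> R by rewrite ler_int.
have : (m + 1)%:~R <= (2 * (l + 1))%:~R :> R by rewrite ler_int.
rewrite !intrM !intrD => h7 h8; apply/andP; split; lra.
Qed.

Definition ocbox (a b : 'rV[R]_d) : set 'rV[R]_d :=
  [set x | forall i, a ord0 i < x ord0 i <= b ord0 i].

Lemma measurable_ocbox a b : measurable (ocbox a b : set rV).
Proof.
have -> : ocbox a b = \bigcap_i (fun x : 'rV[R]_d => x 0 i) @^-1`
    `](a 0 i), (b 0 i)].
  apply/seteqP; split => x /=.
    by move=> h i _ /=; rewrite in_itv /=; exact: h.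
  by move=> h i; have := h i I; rewrite /= in_itv.
apply: (@bigcapT_measurable_fin _ rV) => i.
by rewrite -[X in measurable X]setTI; apply: measurable_coord => //; exact: measurable_itv.
Qed.

Section outer.
Variable W : set 'rV[R]_d.

(** The union of the cells of mesh [1 / N] that meet [W]. *)
Definition outer N : set 'rV[R]_d := [set x | exists2 y, W y & fl N x = fl N y].

Lemma sub_outer N : W `<=` outer N.
Proof. by move=> x Wx; exists x. Qed.

Hypothesis cW : compact W.

Lemma compact_coord_bounded : exists K : nat, forall x, W x -> forall i, `|x 0 i| <= K%:R.
Proof.
have [K [_ hK]] := compact_bounded cW.
exists (Num.truncn `|K + 1|).+1 => x Wx i.
have := hK (K + 1) (ltr_pwDr ltr01 (lexx K)) x Wx => /= h.
apply: (@le_trans _ _ `|x|).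
  rewrite [leRHS]/Num.norm/= mx_normrE; apply: le_trans _ (le_bigmax _ _ (0, i)).
  by [].
by apply: le_trans h _; apply: le_trans (ler_norm _) _; apply: ltW; exact: truncnS_gt.
Qed.

Lemma outer_seq N : exists s : seq 'rV[int]_d, uniq s /\
  outer N = \bigcup_(z in [set` s]) cell N z.
Proof.
have [K hK] := compact_coord_bounded.
exists [seq z <- zball d (N * K).+1 | `[< exists2 y, W y & fl N y = z >]]; split.
  by rewrite filter_uniq// zball_uniq.
apply/seteqP; split => x /=.
  move=> [y Wy e]; exists (fl N x) => //=.
  rewrite mem_filter; apply/andP; split; first by apply/asboolP; exists y.
  rewrite mem_zball; apply/zdP => i; rewrite e !mxE subr0.
  have := hK y Wy i; rewrite ler_norml => /andP[h1 h2].
  have := floor_itv (N%:R * y 0 i); move: (Num.floor _) => m.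
  rewrite intrD => /andP[h3 h4].
  have n0 : 0 <= N%:R :> R by rewrite ler0n.
  have h5 : N%:R * y 0 i <= N%:R * K%:R by rewrite ler_wpM2l.
  have h6 : - (N%:R * K%:R) <= N%:R * y 0 i by rewrite -mulrN ler_wpM2l.
  have h7 : m%:~R <= (N * K)%N%:~R :> R by rewrite -pmulrn natrM; lra.
  have h8 : (- (N * K).+1%:Z)%:~R <= m%:~R :> R.
    by rewrite rmorphN /= -pmulrn -natr1 natrM; lra.
  by rewrite !ler_int in h7 h8; lia.
move=> [z /=]; rewrite mem_filter => /andP[/asboolP[y Wy <-] _] /= e.
by exists y.
Qed.

Lemma measurable_outer N : measurable (outer N : set rV).
Proof.
have [s [_ ->]] := outer_seq N.
by apply: (@fin_bigcup_measurable _ rV) => // z _; exact: measurable_cell.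
Qed.

Lemma outer_homo : {homo (fun k => outer (2 ^ k)) : n m / (n <= m)%N >-> (m <= n)%O}.
Proof.
apply: homo_leq => [A|A B C h1 h2|k]; first exact: lexx.
  exact: le_trans h2 h1.
by apply/subsetPset => x [y Wy e]; exists y => //; exact: fl_double.
Qed.

(** A point common to all dyadic approximations shares a cell with a point of [W] at every scale,
    hence lies in the closure of [W], and a compact set is closed. *)
Lemma bigcap_outer : \bigcap_k outer (2 ^ k) = W.
Proof.
apply/seteqP; split; last by move=> x Wx k _; exact: sub_outer.
move=> x hx; rewrite (_ : W = closure W); last first.
  by apply/closure_id; apply: compact_closed => //; exact: norm_hausdorff.
move=> A; rewrite -nbhs_ballE => -[e /= e0 eA].
have [k hk] : exists k, (2 ^ k)%:R^-1 < e.
  have /ltr_add_invr[k] := e0; rewrite add0r => hk; exists k.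
  apply: le_lt_trans hk; rewrite lef_pV2 ?posrE ?ltr0n ?expn_gt0//.
  by rewrite ler_nat ltn_expl.
have [y Wy /rowP exy] := hx k I.
exists y; split => //; apply: eA; rewrite ball_rVE//= => i.
have := exy i; rewrite !mxE => ei.
have := floor_itv ((2 ^ k)%:R * x 0 i); have := floor_itv ((2 ^ k)%:R * y 0 i).
rewrite ei intrD => /andP[h1 h2] /andP[h3 h4].
have p0 : 0 < (2 ^ k)%:R :> R by rewrite ltr0n expn_gt0.
apply: lt_trans hk; rewrite -(ltr_pM2l p0) mulfV ?gt_eqF//.
rewrite -{1}(ger0_norm (ltW p0)) -normrM mulrBr ltr_norml.
by apply/andP; split; lra.
Qed.

End outer.

Section cell_measure.
Variables (mu : {measure set rV -> \bar R}) (lam : R).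
Hypothesis mu_cell : forall N z, (0 < N)%N -> mu (cell N z) = (lam / N%:R ^+ d)%:E.

Lemma lam_ge0 : 0 <= lam.
Proof.
have : (0 <= mu (cell 1 0))%E by [].
by rewrite (mu_cell 0 (ltn0Sn 0)) lee_fin expr1n divr1.
Qed.

Lemma mu_cells N (s : seq 'rV[int]_d) : (0 < N)%N -> uniq s ->
  mu (\bigcup_(z in [set` s]) cell N z) = ((size s)%:R * (lam / N%:R ^+ d))%:E.
Proof.
move=> N0 us; rewrite measure_fin_bigcup//.
- rewrite -(fsbig_seq _ _ us) (eq_bigr (fun=> (lam / N%:R ^+ d)%:E)); last first.
    by move=> z _; exact: mu_cell.
  by rewrite sumEFin big_const_seq iter_addr_0 count_predT mulr_natl.
- exact: finite_seq.
- by move=> i j _ _ [x [<- <-]].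
- by move=> z _; exact: measurable_cell.
Qed.

(** The box is covered by cells, at most [N * (b i - a i) + 2] of them in direction [i]. *)
Lemma mu_ocbox_le_aux N (a b : 'rV[R]_d) : (0 < N)%N -> (forall i, a 0 i <= b 0 i) ->
  (mu (ocbox a b) <= (lam * \prod_i (b ord0 i - a ord0 i + 2 / N%:R))%:E)%E.
Proof.
move=> N0 ab.
have Np : 0 < N%:R :> R by rewrite ltr0n.
pose A i := Num.floor (N%:R * a 0 i).
pose n i := (absz (Num.floor (N%:R * b 0 i) - A i)%R).+1.
have Ab i : A i <= Num.floor (N%:R * b 0 i).
  by apply: le_floor; rewrite ler_wpM2l// ltW.
pose K := (\max_i n i)%N.
(* Cells are coded by functions into a common range [K]; the predicate [good] restores the
   individual bound of each coordinate. *)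
pose zf (f : {ffun 'I_d -> 'I_K}) : 'rV[int]_d := \row_i (A i + (f i : nat)%:Z).
pose good (f : {ffun 'I_d -> 'I_K}) := [forall i, (f i < n i)%N].
pose s := [seq zf f | f <- enum good].
have zf_inj : injective zf.
  move=> f g fg; apply/ffunP => i; apply/val_inj => /=.
  have := congr1 (fun z : 'rV[int]_d => z 0 i) fg; rewrite !mxE => /addrI.
  by move=> [].
have us : uniq s by rewrite (map_inj_uniq zf_inj) enum_uniq.
have ss : size s = (\prod_i n i)%N.
  rewrite size_map -cardE -sum1_card big_mkcond /=.
  rewrite (eq_bigr (fun f : {ffun 'I_d -> 'I_K} => \prod_i (f i < n i : nat)))%N; last first.
    move=> f _; case: ifPn => [/forallP h|/forallPn[i]].
      by rewrite big1// => i _; rewrite h.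
    by move=> hi; rewrite (bigD1 i)//= (negbTE hi) mul0n.
  rewrite -(bigA_distr_bigA (fun i (j : 'I_K) => (j < n i : nat)))%N.
  apply: eq_bigr => i _.
  rewrite (eq_bigr (fun j : 'I_K => if (j < n i)%N then 1 else 0)%N); last first.
    by move=> j _; case: (j < n i)%N.
  have nK : (n i <= K)%N by exact: leq_bigmax.
  by rewrite -big_mkcond /= (big_ord_narrow nK) sum_nat_const card_ord muln1.
apply: (@le_trans _ _ (mu (\bigcup_(z in [set` s]) cell N z))).
  apply: le_measure; rewrite ?inE.
  - exact: measurable_ocbox.
  - by apply: (@fin_bigcup_measurable _ rV) => // z _; exact: measurable_cell.
  move=> x hx; exists (fl N x) => //=.
  have h1 i : A i <= Num.floor (N%:R * x 0 i) <= Num.floor (N%:R * b 0 i).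
    have /andP[h1 h2] := hx i.
    by rewrite !le_floor ?ler_wpM2l ?(ltW Np)// ltW.
  have h2 i : (absz (Num.floor (N%:R * x 0 i) - A i)%R < n i)%N.
    by have := h1 i; rewrite /n; move: (Num.floor (_ * x 0 i)) (Num.floor (_ * b 0 i)) (A i) => u v w; lia.
  have h3 i : (absz (Num.floor (N%:R * x 0 i) - A i)%R < K)%N.
    by apply: leq_trans (h2 i) _; exact: leq_bigmax.
  apply/mapP; exists [ffun i => Ordinal (h3 i)].
    by rewrite mem_enum; apply/forallP => i; rewrite ffunE /= h2.
  apply/rowP => i; rewrite !mxE ffunE /=.
  by have := h1 i; move: (Num.floor (_ * x 0 i)) (Num.floor (_ * b 0 i)) (A i) => u v w; lia.
rewrite mu_cells// lee_fin ss natr_prod mulrCA ler_wpM2l ?lam_ge0//.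
have -> : N%:R ^+ d = \prod_(i < d) N%:R :> R by rewrite prodr_const card_ord.
rewrite -prodf_div; apply: ler_prod => i _; rewrite divr_ge0//=.
rewrite ler_pdivrMr// mulrDl mulfVK ?gt_eqF//.
have := floor_itv (N%:R * b 0 i); have := floor_itv (N%:R * a 0 i).
rewrite -/(A i) !intrD => /andP[h1 h2] /andP[h3 h4].
rewrite /n -natr1 -[(absz _)%:R]/((absz _)%:~R : R) gez0_abs ?subr_ge0//.
by rewrite intrB; lra.
Qed.

Lemma mu_ocbox_le (a b : 'rV[R]_d) : (forall i, a 0 i <= b 0 i) ->
  (mu (ocbox a b) <= (lam * \prod_i (b ord0 i - a ord0 i))%:E)%E.
Proof.
move=> ab.
have cv : (lam * \prod_i (b ord0 i - a ord0 i + 2 / n.+1%:R)) @[n --> \oo] -->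
    lam * \prod_i (b ord0 i - a ord0 i).
  apply: cvgM; first exact: cvg_cst.
  apply: cvg_big => [|i _]; first exact: mul_continuous.
  rewrite -[X in _ --> X]addr0; apply: cvgD; first exact: cvg_cst.
  rewrite -(mulr0 (2 : R)); apply: cvgM; first exact: cvg_cst.
  by apply: cvg_harmonic.
have fin : mu (ocbox a b) \is a fin_num.
  rewrite ge0_fin_numE//; apply: le_lt_trans (mu_ocbox_le_aux (ltn0Sn 0) ab) _.
  exact: ltry.
rewrite -(fineK fin) lee_fin.
rewrite -(cvg_lim (@Rhausdorff R) cv); apply: limr_ge; first exact: cvgP cv.
near=> n; rewrite -lee_fin fineK//; exact: mu_ocbox_le_aux.
Unshelve. all: by end_near. Qed.

(** Countable subadditivity over any cover by boxes. This is the lower bound for the Lebesgue outer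
    measure in [lebesgue_compact]. *)
Lemma mu_le_lebesgue (A : set rV) : measurable A -> 0 < lam ->
  (mu A <= lam%:E * lebesgue_rV (A : set 'rV[R]_d))%E.
Proof.
move=> mA l0; rewrite -lee_pdivrMl//.
apply: le_ereal_inf_tmp => _ [a [b [ab Acov ->]]].
rewrite lee_pdivrMl//.
apply: (@le_trans _ _ (\sum_(n <oo) mu (ocbox (a n) (b n)))%E).
  apply: measure_sigma_subadditive => //; move=> n; exact: measurable_ocbox.
rewrite -nneseriesZl//; last first.
  by move=> n _; rewrite lee_fin prodr_ge0// => i _; rewrite subr_ge0.
apply: lee_nneseries => [n _ _//|n _].
by rewrite -EFinM; exact: mu_ocbox_le.
Qed.

End cell_measure.

Lemma lebesgue_outer_le N (W : set 'rV[R]_d) (s : seq 'rV[int]_d) :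
  (0 < N)%N -> (0 < d)%N -> W `<=` \bigcup_(z in [set` s]) cell N z ->
  (lebesgue_rV W <= ((size s)%:R * ((N%:R^-1 + N%:R ^-2) ^+ d))%:E)%E.
Proof.
move=> N0 d0 hW; apply: ereal_inf_lbound.
have Np : 0 < N%:R :> R by rewrite ltr0n.
pose h := N%:R^-1 + N%:R ^-2 : R.
(* Covering boxes are open on the left whereas cells are closed there, so each box starts [1 / N^2]
   too early. Past the end of the list the boxes are degenerate. *)
pose a n : 'rV[R]_d := \row_i ((nth 0 s n 0 i)%:~R / N%:R - N%:R ^-2).
pose b n : 'rV[R]_d := if (n < size s)%N then a n + const_mx h else a n.
have h0 : 0 <= h by rewrite /h addr_ge0// invr_ge0// ?ltW// exprn_gt0.
have ba n i : b n ord0 i - a n ord0 i = if (n < size s)%N then h else 0.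
  rewrite /b; case: ifP => _; last by rewrite subrr.
  by rewrite [X in X - _]mxE [const_mx h _ _]mxE addrAC subrr add0r.
exists a, b; split.
- move=> n i; rewrite /b; case: ifP => // _; rewrite !mxE lerDl.
  by rewrite /h addr_ge0// invr_ge0// ?ltW// exprn_gt0.
- move=> x /hW[z /= zs /cellP hx]; exists (index z s) => //= i.
  rewrite /b index_mem zs !mxE nth_index//.
  have /andP[] := hx i; rewrite -ler_pdivrMl// -ltr_pdivlMl// intrD => h1 h2.
  have Np2 : 0 < N%:R ^- 2 :> R by rewrite invr_gt0 exprn_gt0.
  rewrite /h; apply/andP; split.
    by rewrite mulrC; lra.
  by move: h2; rewrite mulrDr mulr1 mulrC; lra.
- rewrite (nneseries_split 0 (size s)); last first.
    by move=> n _; rewrite lee_fin prodr_ge0// => i _; rewrite ba; case: ifP.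
  rewrite add0n [X in (_ + X)%E]eseries0 ?adde0; last first.
    (* The volume of a degenerate box is 0 because the product of its sides has at least one
       factor. *)
    move=> n hn _; rewrite (bigD1 (Ordinal d0))//= ba ltnNge.
    by rewrite hn mul0r.
  rewrite sumEFin; congr EFin.
  rewrite (eq_big_nat _ _ (F2 := fun=> h ^+ d)); last first.
    move=> n /andP[_ hn].
    by rewrite (eq_bigr (fun=> h)) ?prodr_const ?card_ord// => i _; rewrite ba hn.
  by rewrite big_const_nat iter_addr_0 subn0 mulr_natl.
Qed.

End cells.

Section compact_volume.
Context (R : realType) (d : nat).
Hypothesis d0 : (0 < d)%N.
Local Notation rV := (borel 'rV[R]_d).
Variables (mu0 : {measure set rV -> \bar R}) (lam0 : R).
Hypothesis lam00 : 0 < lam0.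
Hypothesis mu0_cell : forall N z, (0 < N)%N -> mu0 (cell N z) = (lam0 / N%:R ^+ d)%:E.

(** Continuity from above along the decreasing dyadic approximations, whose intersection is [W]. *)
Lemma cvg_outer_density (mu : {measure set rV -> \bar R}) (lam : R)
    (W : set 'rV[R]_d) (c : nat -> R) :
  (forall k, mu (outer W (2 ^ k)) = (c k * lam)%:E) -> compact W ->
  mu W \is a fin_num /\ (c k * lam) @[k --> \oo] --> fine (mu W).
Proof.
move=> hc cW.
have mW : measurable (W : set rV) by exact: borel_compact.
have fW : mu W \is a fin_num.
  rewrite ge0_fin_numE//; apply: (@le_lt_trans _ _ (mu (outer W (2 ^ 0)))).
    apply: le_measure; rewrite ?inE//; first exact: measurable_outer.
    exact: sub_outer.
  by rewrite hc ltry.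
split => //.
have h : (mu \o (fun k => outer W (2 ^ k))) k @[k --> \oo] --> mu W.
  rewrite -[X in _ --> mu X](bigcap_outer cW).
  apply: (@nonincreasing_cvg_mu _ rV).
  - by rewrite hc ltry.
  - by move=> k; exact: measurable_outer.
  - by rewrite bigcap_outer.
  - exact: outer_homo.
suff : (c k * lam)%:E @[k --> \oo] --> (fine (mu W))%:E by move/fine_cvg.
rewrite fineK//; apply: cvg_trans h; apply: near_eq_cvg.
by apply: nearW => k /=; rewrite hc.
Qed.

(** The number of dyadic cells meeting [W], times the volume of a cell, converges to [v], the
    [mu0]-mass of [W] over [lam0]. Covers by slightly enlarged cells bound the outer measure by [v],
    and [mu_le_lebesgue] for [mu0] gives the converse. Any other measure proportional to volume on
    cells has the same limit, up to its density. *)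
Lemma lebesgue_compact (W : set 'rV[R]_d) : compact W ->
  lebesgue_rV W = (vol W)%:E /\
  forall (mu : {measure set rV -> \bar R}) (lam : R),
    (forall N z, (0 < N)%N -> mu (cell N z) = (lam / N%:R ^+ d)%:E) ->
    mu W = (lam * vol W)%:E.
Proof.
move=> cW.
have mW : measurable (W : set rV) by exact: borel_compact.
have [s hs] := choice (fun k => outer_seq cW (2 ^ k)).
pose c k : R := (size (s k))%:R / (2 ^ k)%:R ^+ d.
have pk k : (0 < 2 ^ k)%N by rewrite expn_gt0.
have hc (mu : {measure set rV -> \bar R}) lam :
    (forall N z, (0 < N)%N -> mu (cell N z) = (lam / N%:R ^+ d)%:E) ->
    forall k, mu (outer W (2 ^ k)) = (c k * lam)%:E.
  move=> hmu k; have [us ->] := hs k; rewrite (mu_cells hmu)//.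
  by congr EFin; rewrite /c mulrA mulrAC.
have [f0 cv0] := cvg_outer_density (hc _ _ mu0_cell) cW.
pose v := fine (mu0 W) / lam0.
have cv : c k @[k --> \oo] --> v.
  have : (c k * lam0 * lam0^-1) @[k --> \oo] --> v by apply: cvgM => //; exact: cvg_cst.
  by under eq_fun do rewrite mulfK ?gt_eqF//.
have cvq : (1 + (2 ^ k)%:R^-1 : R) @[k --> \oo] --> (1 : R).
  apply/cvgrPdist_le => e e0.
  have [k0 hk0] : exists k, k.+1%:R^-1 < e.
    by have /ltr_add_invr[k] := e0; rewrite add0r => hk; exists k.
  exists k0 => // k /= k0k; rewrite opprD addNKr normrN ger0_norm ?invr_ge0//.
  apply: ltW; apply: le_lt_trans hk0; rewrite lef_pV2 ?posrE ?ltr0n//.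
  by rewrite ler_nat (leq_ltn_trans k0k)// ltn_expl.
have cvd : ((1 + (2 ^ k)%:R^-1) ^+ d : R) @[k --> \oo] --> (1 ^+ d : R).
  exact: cvg_comp cvq (@exprn_continuous R d 1).
have cv2 : (c k * (1 + (2 ^ k)%:R^-1) ^+ d) @[k --> \oo] --> v.
  by rewrite expr1n in cvd; rewrite -[X in _ --> X]mulr1; apply: cvgM.
have Lle : (lebesgue_rV W <= v%:E)%E.
  apply/lee_addgt0Pr => e e0.
  have : \forall k \near \oo, `|v - c k * (1 + (2 ^ k)%:R^-1) ^+ d| <= e.
    by move/cvgrPdist_le: cv2; apply.
  move=> [k _ /(_ k (leqnn k))]; rewrite ler_norml => /andP[h1 _].
  have [us e1] := hs k.
  have sub : W `<=` \bigcup_(z in [set` s k]) cell (2 ^ k) z.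
    by rewrite -e1; exact: sub_outer.
  apply: le_trans (lebesgue_outer_le (pk k) d0 sub) _.
  rewrite -EFinD lee_fin.
  have -> : (size (s k))%:R * ((2 ^ k)%:R^-1 + (2 ^ k)%:R^-2) ^+ d =
     c k * (1 + (2 ^ k)%:R^-1) ^+ d :> R.
    rewrite /c -mulrA -[X in _ = _ * (X * _)]exprVn -exprMn; congr (_ * _ ^+ d).
    by rewrite mulrDr mulr1 expr2 invfM.
  lra.
have Lge : (v%:E <= lebesgue_rV W)%E.
  rewrite /v mulrC EFinM -lee_pdivlMl ?invr_gt0// invrK fineK//.
  exact: (mu_le_lebesgue mu0_cell mW lam00).
have Lv : lebesgue_rV W = v%:E by apply/eqP; rewrite eq_le Lle Lge.
have vv : vol W = v by rewrite /vol Lv.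
split; first by rewrite vv.
move=> mu lam hmu.
have [f1 cv1] := cvg_outer_density (hc _ _ hmu) cW.
have cv3 : (c k * lam) @[k --> \oo] --> v * lam by apply: cvgM => //; exact: cvg_cst.
by rewrite -(fineK f1) (cvg_unique _ cv1 cv3)// vv mulrC.
Qed.

End compact_volume.

(** * The mean measure of a stationary marked process *)

Section mean_measure.
Context {R : realType} {dO : measure_display} {Omega : measurableType dO}.
Context {d : nat} {M : ptopologicalType}.
Variable P : probability Omega R.
Local Notation E := (borel 'rV[R]_d * borel M)%type.
Local Notation rV := (borel 'rV[R]_d).
Variable X : R.-ker Omega ~> E.

(** The proof [mC] is an argument so that [mean mC] can carry a measure structure in [B]; its total
    mark version serves as reference measure for volumes. *)
Definition mean (C : set (borel M)) (mC : measurable C) (B : set rV) : \bar R :=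
  (\int[P]_w X w (B `*` C))%E.

Section instance.
Variables (C : set (borel M)) (mC : measurable C).

Let mX (B : set rV) : measurable B ->
  measurable_fun setT (fun w => X w (B `*` C)).
Proof. by move=> mB; apply: measurable_kernel; exact: measurableX. Qed.

Let mean0 : mean mC set0 = 0%E.
Proof.
rewrite /mean -[RHS](integral0 P setT); apply: eq_integral => w _.
by rewrite set0X measure0.
Qed.

Let mean_ge0 B : (0 <= mean mC B)%E.
Proof. by apply: integral_ge0. Qed.

Let mean_sigma_additive : semi_sigma_additive (mean mC).
Proof.
move=> F mF tF mUF.
have -> : mean mC (\bigcup_n F n) = (\sum_(n <oo) mean mC (F n))%E.
  rewrite -integral_nneseries//; last by move=> n; exact: mX.
  apply: eq_integral => w _.
  rewrite -(_ : \bigcup_n (F n `*` C) = (\bigcup_n F n) `*` C); last first.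
    apply/seteqP; split => -[x m] /=; first by move=> [n _ [? ?]]; split => //; exists n.
    by move=> [[n _ ?] ?]; exists n.
  apply: measure_semi_bigcup => //.
  - by move=> n; exact: measurableX.
  - move=> i j _ _ [[x m] [[/= Fi _] [/= Fj _]]]; apply: (tF i j) => //.
    by exists x.
  - by apply: bigcupT_measurable => n; exact: measurableX.
apply: is_cvg_nneseries => n _ _; exact: mean_ge0.
Qed.

HB.instance Definition _ := isMeasure.Build _ _ _ (mean mC)
  mean0 mean_ge0 mean_sigma_additive.

End instance.

Hypothesis statX : stationary P X.
Hypothesis intensity_fin : (intensity P X < +oo)%E.

Definition mark_intensity (C : set (borel M)) : R :=
  fine (\int[P]_w X w (cube `[0%R, 1%R[ `*` C))%E.

Lemma stat_integral (A : set E) z : measurable A ->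
  (\int[P]_w X w (shift_marked z @^-1` A) = \int[P]_w X w A)%E.
Proof.
move=> mA.
(* Equality in law transfers integrals of non-negative functionals on [EV], where a set function may
   take negative values; on measures the positive part changes nothing. *)
have e (mu : {measure set E -> \bar R}) B : mu B = maxe (mu B) 0%E.
  by apply/esym/max_idPl.
have mh : measurable_fun setT (fun mu : @EV R d M => maxe (mu A) 0%E).
  by apply: measurable_maxe => //; exact: measurable_eval.
transitivity (\int[P]_w maxe (sh z (X w) A) 0)%E.
  by apply: eq_integral => w _; rewrite [LHS]e.
transitivity (\int[P]_w maxe (X w A) 0)%E; last first.
  by apply: eq_integral => w _; rewrite -e.
apply: (equi_ge0_integral (measurable_shX X z) (measurable_XEV X) _ mh).
  by move=> F mF; exact: (statX z mF).
by move=> mu; rewrite le_max lexx orbT.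
Qed.

Lemma cell1E : cell 1 0 = cube `[0%R, 1%R[ :> set 'rV[R]_d.
Proof.
apply/seteqP; split => x.
  move=> /cellP h i; have := h i; rewrite mxE mul1r in_itv /=.
  by rewrite add0r.
by move=> h; apply/cellP => i; have := h i; rewrite mxE mul1r in_itv /= add0r.
Qed.

Section mark.
Variables (C : set (borel M)) (mC : measurable C).

Lemma mean_shift (B : set rV) (z : 'rV[R]_d) : measurable B ->
  mean mC ((fun y : 'rV[R]_d => y - z) @^-1` B) = mean mC B.
Proof.
move=> mB; rewrite /mean -[RHS](stat_integral z); last exact: measurableX.
by apply: eq_integral => w _; congr (X w _).
Qed.

Lemma mark_intensity_fin : mean mC (cell 1 0) = (mark_intensity C)%:E.
Proof.
rewrite /mark_intensity -cell1E fineK//.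
rewrite ge0_fin_numE; last exact: integral_ge0.
apply: le_lt_trans intensity_fin; apply: ge0_le_integral => //.
- apply: measurable_kernel; apply: measurableX => //; exact: measurable_cell.
- apply: measurable_kernel; apply: measurableX => //.
  by rewrite -cell1E; exact: measurable_cell.
- move=> w _; rewrite -cell1E; apply: le_measure; rewrite ?inE.
  + by apply: measurableX => //; exact: measurable_cell.
  + by apply: measurableX => //; exact: measurable_cell.
  + by move=> x [].
Qed.

(** By stationarity all cells of mesh [1 / N] have the same mean, and [N ^ d] of them tile the unit
    cell. *)
Lemma mean_cell N z : (0 < N)%N ->
  mean mC (cell N z) = (mark_intensity C / N%:R ^+ d)%:E.
Proof.
move=> N0.
have Np : 0 < N%:R :> R by rewrite ltr0n.
have sh z' : mean mC (cell N z') = mean mC (cell N 0).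
  rewrite -(mean_shift (N%:R^-1 *: map_mx intr z') (measurable_cell N 0)).
  by congr (mean mC _); apply/seteqP; split => x hx; apply/(cell_shift z' x N0).
rewrite sh.
pose zf (f : {ffun 'I_d -> 'I_N}) : 'rV[int]_d := \row_i ((f i : nat)%:Z).
have zf_inj : injective zf.
  move=> f g fg; apply/ffunP => i; apply/val_inj => /=.
  have := congr1 (fun z : 'rV[int]_d => z 0 i) fg; rewrite !mxE.
  by move=> [].
pose s := [seq zf f | f : {ffun 'I_d -> 'I_N}].
have us : uniq s by rewrite (map_inj_uniq zf_inj) enum_uniq.
have ss : size s = (N ^ d)%N by rewrite size_map -cardE card_ffun !card_ord.
have e : cell 1 0 = \bigcup_(z in [set` s]) cell N z :> set 'rV[R]_d.
  apply/seteqP; split => x.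
    move=> /cellP h; exists (fl N x) => //=.
    have h1 i : 0 <= N%:R * x 0 i < N%:R.
      have := h i; rewrite mxE mul1r add0r => /andP[? ?].
      by rewrite mulr_ge0 ?(ltW Np)//= gtr_pMr.
    have h2 i : (absz (Num.floor (N%:R * x 0 i)%R) < N)%N.
      have /andP[h3 h4] := h1 i; have := floor_itv (N%:R * x 0 i).
      move: (Num.floor _) => m; rewrite intrD => /andP[h5 h6].
      have : m%:~R < N%:Z%:~R :> R by rewrite -pmulrn; lra.
      have : (-1)%:~R < m%:~R :> R by rewrite mulrN1z; lra.
      by rewrite !ltr_int; lia.
    apply/mapP; exists [ffun i => Ordinal (h2 i)]; first by rewrite mem_enum.
    apply/rowP => i; rewrite !mxE ffunE /=.
    have /andP[h3 h4] := h1 i.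
    by rewrite gez0_abs// floor_ge0.
  move=> [z' /= /mapP[f _ ->] /cellP h]; apply/cellP => i.
  have := h i; rewrite !mxE mul1r add0r -pmulrn intrD -pmulrn => /andP[h1 h2].
  have fN : (f i)%:R + 1 <= N%:R :> R by rewrite natr1 ler_nat.
  have f0 : 0 <= (f i)%:R :> R by rewrite ler0n.
  apply/andP; split; first by rewrite -(pmulr_rge0 _ Np); lra.
  by rewrite -(ltr_pM2l Np); lra.
have vE : mean mC (cell N 0) = (fine (mean mC (cell N 0)))%:E.
  rewrite fineK// ge0_fin_numE//; apply: (@le_lt_trans _ _ (mean mC (cell 1 0))).
    apply: le_measure; rewrite ?inE; [exact: measurable_cell|exact: measurable_cell|].
    rewrite e => x hx; exists 0 => //=; apply/mapP.
    exists [ffun i => Ordinal N0]; first by rewrite mem_enum.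
    by apply/rowP => i; rewrite !mxE ffunE.
  by rewrite mark_intensity_fin ltry.
move: vE; set v := fine _ => vE.
have K : mean mC (cell 1 0) = ((N ^ d)%:R * v)%:E.
  rewrite e measure_fin_bigcup//.
  - rewrite -(fsbig_seq _ _ us) (eq_bigr (fun=> v%:E)); last first.
      by move=> z' _; rewrite -vE; exact: sh.
    by rewrite sumEFin big_const_seq iter_addr_0 count_predT ss mulr_natl.
  - exact: finite_seq.
  - by move=> i j _ _ [x [<- <-]].
  - by move=> z' _; exact: measurable_cell.
have ND : 0 < (N ^ d)%:R :> R by rewrite ltr0n expn_gt0 N0.
move: K; rewrite mark_intensity_fin => -[->].
by rewrite vE natrX mulrAC mulfV ?mul1r// expf_neq0// gt_eqF.
Qed.

End mark.


End mean_measure.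

(** * Lattice cells near the boundary of a convex body *)

Section geometry.
Context (R : realType) (d : nat).
Hypothesis d0 : (0 < d)%N.
Local Notation rV := (borel 'rV[R]_d).
Variables (mu0 : {measure set rV -> \bar R}) (lam0 : R).
Hypothesis lam00 : 0 < lam0.
Hypothesis mu0_cell : forall N z, (0 < N)%N -> mu0 (cell N z) = (lam0 / N%:R ^+ d)%:E.

Lemma convex_combination (W : set 'rV[R]_d) (x y : 'rV[R]_d) (p : R) :
  convex_set (W : set (convex_lmodType 'rV[R]_d)) -> W x -> W y ->
  0 <= p <= 1 -> W (p *: x + (1 - p) *: y).
Proof.
move=> cW Wx Wy p01.
have := cW x y (Itv01 (proj1 (andP p01)) (proj2 (andP p01))).
by rewrite !inE => /(_ Wx Wy).
Qed.

Definition dilate (x0 : 'rV[R]_d) (c : R) (y : 'rV[R]_d) : 'rV[R]_d :=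
  x0 + c *: (y - x0).

Lemma dilate_compact x0 c (W : set 'rV[R]_d) : compact W ->
  compact (dilate x0 c @` W).
Proof.
move=> cW; apply: continuous_compact => //.
apply: continuous_subspaceT => y.
exact: (cvgD (cvg_cst x0) (cvgZl_tmp (k := c) (cvgB cvg_id (cvg_cst x0)))).
Qed.

Lemma lebesgue_dilate_le x0 c (W : set 'rV[R]_d) : 0 < c ->
  (lebesgue_rV (dilate x0 c @` W) <= (c ^+ d)%:E * lebesgue_rV W)%E.
Proof.
move=> c0; rewrite -lee_pdivrMl ?exprn_gt0//.
apply: le_ereal_inf_tmp => _ [a [b [ab Wcov ->]]].
rewrite lee_pdivrMl ?exprn_gt0//; apply: ereal_inf_lbound.
exists (fun n => dilate x0 c (a n)), (fun n => dilate x0 c (b n)); split.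
- move=> n i; rewrite !mxE lerD2l ler_wpM2l ?(ltW c0)// lerD2r; exact: ab.
- move=> _ [y /Wcov[n _ hy] <-]; exists n => // i; have /andP[h1 h2] := hy i.
  rewrite !mxE ltrD2l lerD2l ltr_pM2l// ler_pM2l//.
  by rewrite ltrD2r lerD2r h1.
- rewrite -nneseriesZl; last first.
    by move=> n _; rewrite lee_fin prodr_ge0// => i _; rewrite subr_ge0.
  apply: eq_eseriesr => n _; rewrite -EFinM; congr EFin.
  have -> : c ^+ d = \prod_(i < d) c by rewrite prodr_const card_ord.
  rewrite -big_split /=; apply: eq_bigr => i _; rewrite !mxE; ring.
Qed.

Lemma vol_ge0 (W : set 'rV[R]_d) : 0 <= vol W.
Proof.
apply: fine_ge0; apply: le_ereal_inf_tmp => _ [a [b [ab _ ->]]].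
apply: nneseries_ge0 => n _ _.
by rewrite lee_fin prodr_ge0// => i _; rewrite subr_ge0.
Qed.

Lemma vol_dilate_le x0 c (W : set 'rV[R]_d) : compact W -> 0 < c ->
  vol (dilate x0 c @` W) <= c ^+ d * vol W.
Proof.
move=> cW c0.
have [e1 _] := lebesgue_compact d0 lam00 mu0_cell cW.
have [e2 _] := lebesgue_compact d0 lam00 mu0_cell (@dilate_compact x0 c W cW).
by rewrite -lee_fin EFinM -e1 -e2; exact: lebesgue_dilate_le.
Qed.

(** The missing inequality is [vol_dilate_le] for the inverse dilation. *)
Lemma vol_dilate x0 c (W : set 'rV[R]_d) : compact W -> 0 < c ->
  vol (dilate x0 c @` W) = c ^+ d * vol W.
Proof.
move=> cW c0; apply/eqP; rewrite eq_le vol_dilate_le//=.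
have c0' : 0 < c^-1 by rewrite invr_gt0.
have := vol_dilate_le x0 (@dilate_compact x0 c W cW) c0'.
have -> : dilate x0 c^-1 @` (dilate x0 c @` W) = W.
  have K y : dilate x0 c^-1 (dilate x0 c y) = y.
    by rewrite /dilate [x0 + c *: _]addrC addrK scalerA mulVf ?gt_eqF// scale1r addrC subrK.
  apply/seteqP; split => [_ [_ [y Wy <-] <-]|y Wy]; first by rewrite K.
  by exists (dilate x0 c y) => //; exists y.
by rewrite exprVn ler_pdivlMl// exprn_gt0.
Qed.

Lemma cell_dist (z j : 'rV[int]_d) m (x y : 'rV[R]_d) : (zd z j <= m)%N ->
  cell 1 z x -> cell 1 j y -> forall i, `|x 0 i - y 0 i| <= m.+1%:R.
Proof.
move=> /zdP h /cellP hx /cellP hy i.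
have := hx i; have := hy i; rewrite !mul1r !intrD => /andP[h1 h2] /andP[h3 h4].
have hz : `|(z 0 i)%:~R - (j 0 i)%:~R| <= m%:R :> R.
  rewrite -intrB -intr_norm -[m%:R]/((m%:Z)%:~R) ler_int.
  by have := h i; move: (z 0 i) (j 0 i) => u v; lia.
move: hz; rewrite !ler_norml -natr1 => /andP[h5 h6].
by apply/andP; split; lra.
Qed.

Section boundary.
Variables (W : set 'rV[R]_d) (x0 : 'rV[R]_d) (rho : R) (m : nat).
Hypothesis cW : compact W.
Hypothesis convW : convex_set (W : set (convex_lmodType 'rV[R]_d)).
Hypothesis Wx0 : W x0.
Hypothesis rho0 : 0 < rho.
Hypothesis ballW : eball x0 rho `<=` W.

Let eps : R := m.+1%:R * d%:R / rho.
Hypothesis eps1 : eps < 1.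

Let eps0 : 0 < eps.
Proof. by rewrite divr_gt0// mulr_gt0 ?ltr0n. Qed.

(** The value of [eps] makes [eps * rho / d] equal to [m.+1]; then [u] has coordinates at most
    [rho / d], hence Euclidean norm at most [rho]. *)
Lemma small_ball (v : 'rV[R]_d) : (forall i, `|v 0 i| <= m.+1%:R) ->
  exists2 u, W (x0 + u) & v = eps *: u.
Proof.
move=> hv; exists (eps^-1 *: v); last first.
  by rewrite scalerA mulfV ?scale1r// gt_eqF.
apply: ballW; rewrite /eball /=.
have dR : 1 <= d%:R :> R by rewrite ler1n.
rewrite (eq_bigr (fun i => (eps^-1 * v 0 i) ^+ 2)); last first.
  by move=> i _; rewrite !mxE [x0 0 i + _]addrC addrK.
have hd : (rho / d%:R) ^+ 2 *+ d <= rho ^+ 2.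
  rewrite -mulr_natr exprMn -mulrA ler_piMr ?sqr_ge0//.
  by rewrite expr2 -mulrA mulVf ?mulr1 ?gt_eqF ?invf_le1 ?(lt_le_trans ltr01)//.
apply: (@le_trans _ _ (Num.sqrt (rho ^+ 2))); last by rewrite sqrtr_sqr ger0_norm// ltW.
rewrite ler_sqrt ?sqr_ge0//; apply: le_trans hd.
rewrite -[X in _ <= _ *+ X]card_ord -sumr_const; apply: ler_sum => i _.
rewrite -(real_normK (num_real (_ * _))) lerXn2r ?nnegrE ?divr_ge0 ?(ltW rho0)//.
rewrite normrM ger0_norm ?invr_ge0 ?(ltW eps0)// ler_pdivrMl//.
have -> : eps * (rho / d%:R) = m.+1%:R.
  by rewrite /eps; field; rewrite !gt_eqF// (lt_le_trans ltr01).
exact: hv.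
Qed.

(** Writing [x = y + eps u], the point of [W] dilated onto [x] is the barycentre of [y] and [x0 + u]
    with weights proportional to 1 and [eps]. *)
Lemma near_dilate_out (x y : 'rV[R]_d) : W y -> (forall i, `|x 0 i - y 0 i| <= m.+1%:R) ->
  (dilate x0 (1 + eps) @` W) x.
Proof.
move=> Wy hxy.
have [|u Wu e] := @small_ball (x - y) _; first by move=> i; rewrite !mxE.
have e1 : 0 < 1 + eps by rewrite addr_gt0.
exists ((1 + eps)^-1 *: y + (1 - (1 + eps)^-1) *: (x0 + u)).
  apply: convex_combination => //; apply/andP; split.
    by rewrite invr_ge0 ltW.
  by rewrite invf_le1// lerDl ltW.
have -> : x = y + eps *: u by rewrite -e addrC subrK.
apply/rowP => i; rewrite /dilate !mxE; field; rewrite gt_eqF//.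
Qed.

(** Here [q] itself is the barycentre of two points of [W] with weights [1 - eps] and [eps]. *)
Lemma near_dilate_in (x q : 'rV[R]_d) : (dilate x0 (1 - eps) @` W) x ->
  (forall i, `|q 0 i - x 0 i| <= m.+1%:R) -> W q.
Proof.
move=> [p Wp <-] h.
have [|u Wu e] := @small_ball (q - dilate x0 (1 - eps) p) _.
  by move=> i; have := h i; rewrite !mxE.
have -> : q = (1 - eps) *: p + (1 - (1 - eps)) *: (x0 + u).
  rewrite -[q](subrK (dilate x0 (1 - eps) p)) e.
  by apply/rowP => i; rewrite /dilate !mxE; ring.
by apply: convex_combination => //; rewrite subr_ge0 (ltW eps1)/= gerBl ltW.
Qed.

(** A cell that meets [W] lies in the dilation by [1 + eps]; a cell within distance [m] of the
    complement is disjoint from the dilation by [1 - eps]. The number of such cells is therefore at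
    most the difference of the two volumes. *)
Lemma boundary_count (s : seq 'rV[int]_d) : uniq s ->
  (forall z, z \in s -> (exists2 x, cell 1 z x & W x) /\
     (exists2 j, (zd z j <= m)%N & exists2 q, cell 1 j q & ~ W q)) ->
  (size s)%:R <= ((1 + eps) ^+ d - (1 - eps) ^+ d) * vol W.
Proof.
move=> us hs.
have e1 : 0 < 1 + eps by rewrite addr_gt0.
have e2 : 0 < 1 - eps by rewrite subr_gt0.
pose Wp := dilate x0 (1 + eps) @` W; pose Wm := dilate x0 (1 - eps) @` W.
have cp : compact Wp by exact: dilate_compact.
have cm : compact Wm by exact: dilate_compact.
have [_ volp] := lebesgue_compact d0 lam00 mu0_cell cp.
have [_ volm] := lebesgue_compact d0 lam00 mu0_cell cm.
have mp : measurable (Wp : set rV) by exact: borel_compact.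
have mm : measurable (Wm : set rV) by exact: borel_compact.
pose U : set 'rV[R]_d := \bigcup_(z in [set` s]) cell 1 z.
have mU : measurable (U : set rV).
  by apply: (@fin_bigcup_measurable _ rV) => // z _; exact: measurable_cell.
have UWm : U `&` Wm = set0.
  rewrite -subset0 => x [[z /= zs zx] Wmx].
  have [_ [j zj [q jq nWq]]] := hs z zs; apply: nWq.
  apply: (near_dilate_in Wmx) => i; rewrite distrC; exact: (cell_dist zj zx jq).
have UWp : U `<=` Wp.
  move=> x [z /= zs zx]; have [[y zy Wy] _] := hs z zs.
  apply: (near_dilate_out Wy) => i.
  by apply: (@cell_dist z z m x y) => //; rewrite zdii.
have WmWp : Wm `<=` Wp.
  move=> _ [p Wp' <-].
  exists ((1 - eps) / (1 + eps) *: p + (1 - (1 - eps) / (1 + eps)) *: x0).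
    apply: convex_combination => //; apply/andP; split.
      by rewrite divr_ge0// ltW.
    by rewrite ler_pdivrMr// mul1r lerD2l (le_trans _ (ltW eps0))// oppr_le0 ltW.
  by apply/rowP => i; rewrite /dilate !mxE; field; rewrite gt_eqF.
have : (mu0 (U `|` Wm) <= mu0 Wp)%E.
  apply: le_measure; rewrite ?inE//; first exact: measurableU.
  by move=> x [/UWp|/WmWp].
have eU : mu0 (U `|` Wm) = (mu0 U + mu0 Wm)%E by exact: measureU.
have em : mu0 Wm = (lam0 * vol Wm)%:E := volm _ _ mu0_cell.
have eu : mu0 U = ((size s)%:R * (lam0 / 1%:R ^+ d))%:E by exact: mu_cells.
have ep : mu0 Wp = (lam0 * vol Wp)%:E := volp _ _ mu0_cell.
rewrite eU em eu ep expr1n divr1 -EFinD lee_fin.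
rewrite !vol_dilate// => h.
rewrite -(ler_pM2r lam00).
have -> : ((1 + eps) ^+ d - (1 - eps) ^+ d) * vol W * lam0 =
  lam0 * ((1 + eps) ^+ d * vol W) - lam0 * ((1 - eps) ^+ d * vol W) by ring.
by rewrite lerBrDr.
Qed.

End boundary.
End geometry.

(** * Summability and decay of the mixing rate *)

Lemma exp_superadditive (a b n : nat) : (0 < n)%N ->
  (a ^ n + b ^ n <= (a + b) ^ n)%N.
Proof.
case: n => // n _; elim: n => // n IHn.
rewrite [leqRHS]expnS; apply: leq_trans (leq_mul (leqnn _) IHn).
rewrite mulnDl !mulnDr -!expnS; lia.
Qed.

Section rates.
Context (R : realType) (D : nat).
Hypothesis D0 : (0 < D)%N.
Variables (bs : R -> R) (th : R).
Hypothesis th0 : 0 < th.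
Hypothesis th1 : th <= 1.
Hypothesis bs0 : forall r, 2^-1 <= r -> 0 <= bs r.
Hypothesis bs_mono : forall r s, 2^-1 <= r -> r <= s -> bs s <= bs r.
Hypothesis bs_int : (\int[lebesgue_measure]_(r in `[1%R, +oo[)
         (r ^+ D.-1 * (bs r) `^ th)%:E < +oo)%E.

(* The cells at lattice distance [n.+1] are separated by cubes with gap
   [n - 1/2]; for [n = 0] there is no gap and the trivial rate [1] is used. *)
Definition bsn (n : nat) : R := if n is 0 then 1 else bs (n%:R - 2^-1).

Lemma bsn_ge0 n : 0 <= bsn n.
Proof.
case: n => [|n] //=; apply: bs0; rewrite -[n.+1%:R]natr1.
have h : 0 <= n%:R :> R by exact: ler0n.
lra.
Qed.

Lemma bsn_mono m n : (0 < m)%N -> (m <= n)%N -> bsn n <= bsn m.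
Proof.
case: m => // m _; case: n => // n mn; apply: bs_mono; last first.
  by rewrite lerD2r ler_nat.
rewrite -[m.+1%:R]natr1; have h : 0 <= m%:R :> R by exact: ler0n.
lra.
Qed.

(** The factor counts the lattice points at distance exactly [N.+1]. *)
Lemma lsumS (g : nat -> R) N : lsum D g N.+1 =
  lsum D g N + ((2 * N.+1).+1%:R ^+ D - (2 * N).+1%:R ^+ D) * g N.+1.
Proof.
rewrite /lsum (bigID (fun z => (zd 0 z <= N)%N)) /=.
have e : perm_eq [seq z <- zball D N.+1 | (zd 0 z <= N)%N] (zball D N).
  apply: uniq_perm; first by rewrite filter_uniq ?zball_uniq.
    exact: zball_uniq.
  move=> z; rewrite mem_filter !mem_zball zdC andb_idr// => h.
  exact: leq_trans h _.
rewrite -big_filter (perm_big _ e) /=; congr (_ + _).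
rewrite big_seq_cond (eq_bigr (fun=> g N.+1)); last first.
  move=> z /andP[]; rewrite mem_zball zdC => h1; rewrite -ltnNge => h2.
  by congr g; apply/eqP; rewrite eqn_leq h1.
rewrite -big_seq_cond big_const_seq iter_addr_0 -[LHS]mulr_natl; congr (_ * _).
have := count_predC (fun z => (zd 0 z <= N)%N) (zball D N.+1).
rewrite -size_filter (perm_size e) !size_zball => h.
by rewrite -!natrX -h natrD addrC addKr.
Qed.

Lemma ball_diff_le N : (2 * N.+1).+1%:R ^+ D - (2 * N).+1%:R ^+ D <=
  2 * D%:R * (2 * N.+1).+1%:R ^+ D.-1 :> R.
Proof.
have -> : (2 * N.+1).+1 = ((2 * N).+1 + 2)%N by rewrite mulnS; lia.
rewrite natrD; set y : R := (2 * N).+1%:R.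
have y0 : 0 <= y by rewrite ler0n.
rewrite subrXX [y + 2]addrC addrK -mulrA ler_wpM2l//.
have -> : D%:R * (2 + y) ^+ D.-1 = \sum_(i < D) (2 + y) ^+ D.-1 :> R.
  by rewrite sumr_const card_ord mulr_natl.
apply: ler_sum => i _.
have hi : (i <= D.-1)%N by rewrite -ltnS prednK.
rewrite -[leRHS](_ : (2 + y) ^+ (D.-1 - i) * (2 + y) ^+ i = _); last first.
  by rewrite -exprD subnK.
apply: ler_wpM2l; first by rewrite exprn_ge0// addr_ge0.
by rewrite lerXn2r ?nnegrE ?addr_ge0// lerDr.
Qed.

(** The covariance bound as a function of the lattice distance [n]: cells at distance [n >= 2] are
    separated by cubes with gap [n - 3/2], the argument of [bs] in [bsn n.-1]. *)
Definition gth (Cg : R) (n : nat) : R := Cg * bsn n.-1 `^ th.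

Let F (r : R) : R := r ^+ D.-1 * (bs r) `^ th.

Let F0 r : 0 <= r -> 0 <= F r.
Proof. by move=> r0; rewrite mulr_ge0 ?powR_ge0// exprn_ge0. Qed.

Let mF1 : measurable_fun setT (fun r : R => r ^+ D.-1 * bs (Num.max 1 r) `^ th).
Proof.
apply: measurable_funM; first exact: exprn_measurable.
have mc : measurable_fun setT (fun r : R => bs (Num.max 1 r)).
  apply: nonincreasing_measurable => // x y xy.
  apply: bs_mono; first by rewrite le_max; apply/orP; left; lra.
  by rewrite ge_max le_max lexx /= le_max xy orbT.
exact: (measurableT_comp (measurable_powR th) mc).
Qed.

Let mF (A : set R) : A `<=` `[1, +oo[ -> measurable_fun A (EFin \o F).
Proof.
move=> A1; apply/measurable_EFinP.
apply: eq_measurable_fun (measurable_funTS mF1) => x; rewrite inE => /A1.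
by rewrite /= in_itv /= andbT /F => h; rewrite (max_idPr h).
Qed.

Let J (t : R) : \bar R := (\int[lebesgue_measure]_(r in `[1%R, t]) (F r)%:E)%E.

Let I : \bar R := (\int[lebesgue_measure]_(r in `[1%R, +oo[) (F r)%:E)%E.

Let JI t : (J t <= I)%E.
Proof.
apply: ge0_subset_integral => //=.
- by apply: mF.
- by move=> r; rewrite in_itv /= andbT => h; rewrite lee_fin F0// (le_trans _ h).
- by apply: subset_itvl.
Qed.

(** On the last unit interval the power is at least its value at the left end and the rate at least
    its value at the right end. *)
Let J_step (t : R) : 2 <= t ->
  (J (t - 1) + ((t - 1) ^+ D.-1 * bs t `^ th)%:E <= J t)%E.
Proof.
move=> t2.
have h1 : (\int[lebesgue_measure]_(r in `](t - 1)%R, t]) ((t - 1) ^+ D.-1 * bs t `^ th)%:E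
    = ((t - 1) ^+ D.-1 * bs t `^ th)%:E)%E.
  rewrite integral_cst//= lebesgue_measure_itv/= lte_fin gtrBl ltr01.
  by rewrite -EFinB (_ : t - (t - 1) = 1) ?mule1//; ring.
have e : `[1%R, t]%classic = `[1%R, (t - 1)%R]%classic `|` `](t - 1)%R, t]%classic.
  by apply: itv_bndbnd_setU; rewrite bnd_simp; lra.
rewrite /J e ge0_integral_setU//=.
- rewrite leeD2l// -h1; apply: ge0_le_integral => //=.
  + by move=> r _; rewrite lee_fin mulr_ge0 ?powR_ge0// exprn_ge0//; lra.
  + apply: mF => r /=; rewrite !in_itv /= andbT => /andP[h _].
    by apply: le_trans (ltW h); lra.
  + move=> r; rewrite in_itv /= => /andP[r1 r2]; rewrite lee_fin.
    apply: ler_pM; rewrite ?powR_ge0 ?exprn_ge0//; [lra| |].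
      by rewrite lerXn2r ?nnegrE ?(ltW r1)//; lra.
    rewrite ge0_ler_powR ?nnegrE ?(ltW th0)//; [apply: bs0; lra|apply: bs0; lra|].
    by apply: bs_mono => //; lra.
- by rewrite -e; apply: mF; exact: subset_itvl.
- move=> r hr; have : `[1%R, t]%classic r by rewrite e.
  by rewrite /= in_itv /= => /andP[h _]; rewrite lee_fin F0// (le_trans _ h).
- apply/disj_setPS => r [/=]; rewrite !in_itv /= => /andP[_ h] /andP[h2 _].
  by move: h; rewrite leNgt h2.
Qed.

(** Integral test: a shell of radius [N] has of the order of [N^(D-1)] points, so the lattice sum is
    dominated by the integral of [r^(D-1)] times the rate. *)
Lemma lsum_gth_bounded (Cg : R) : 0 <= Cg ->
  exists G, forall N, lsum D (gth Cg) N <= G.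
Proof.
move=> Cg0.
pose c := 2 * D%:R * 6 ^+ D.-1 * Cg.
have c0 : 0 <= c by rewrite !mulr_ge0// exprn_ge0.
have Ifin : I \is a fin_num.
  rewrite ge0_fin_numE//; apply: integral_ge0 => r /=.
  by rewrite in_itv /= andbT => h; rewrite lee_fin F0// (le_trans _ h).
have Jge0 t : (0 <= J t)%E.
  apply: integral_ge0 => r /=; rewrite in_itv /= => /andP[h _].
  by rewrite lee_fin F0// (le_trans _ h).
have Jfin t : J t \is a fin_num.
  by rewrite ge0_fin_numE//; apply: le_lt_trans (JI t) _; rewrite -ge0_fin_numE// (le_trans (Jge0 t))// JI.
(* Shell [n + 4] involves [bs] at [n + 5/2], which is paid by the integral from [n + 3/2] to
   [n + 5/2]. The factor 6 in [c] comes from [2 (n + 4) + 1 <= 6 (n + 3/2)]. *)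
have key n : lsum D (gth Cg) (n + 3) <= lsum D (gth Cg) 3 + c * fine (J (n%:R + 3 / 2)).
  elim: n => [|n IHn]; first by rewrite lerDl mulr_ge0// fine_ge0.
  rewrite addSn lsumS.
  have t2 : 2 <= n.+1%:R + 3 / 2 :> R.
    rewrite -[n.+1%:R]natr1; have h : 0 <= n%:R :> R by exact: ler0n.
    lra.
  have := J_step t2.
  rewrite -(fineK (Jfin (n.+1%:R + 3 / 2))) -(fineK (Jfin _)) -EFinD lee_fin.
  have -> : n.+1%:R + 3 / 2 - 1 = n%:R + 3 / 2 :> R by rewrite -[n.+1%:R]natr1; ring.
  move=> step.
  apply: (@le_trans _ _ (lsum D (gth Cg) 3 + c * fine (J (n%:R + 3 / 2)) +
     c * ((n%:R + 3 / 2) ^+ D.-1 * bs (n.+1%:R + 3 / 2) `^ th))); last first.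
    by rewrite -addrA lerD2l -mulrDr ler_wpM2l.
  apply: lerD => //.
  have -> : gth Cg (n + 3).+1 = Cg * bs (n.+1%:R + 3 / 2) `^ th.
    rewrite /gth /= addn3 /=; congr (_ * bs _ `^ _).
    by rewrite -[n.+3%:R]natr1 -[n.+2%:R]natr1; field.
  apply: (@le_trans _ _ (2 * D%:R * (2 * (n + 3).+1).+1%:R ^+ D.-1 *
       (Cg * bs (n.+1%:R + 3 / 2) `^ th))).
    by rewrite ler_wpM2r ?mulr_ge0 ?powR_ge0//; exact: ball_diff_le.
  have -> : c * ((n%:R + 3 / 2) ^+ D.-1 * bs (n.+1%:R + 3 / 2) `^ th) =
    2 * D%:R * (6 ^+ D.-1 * (n%:R + 3 / 2) ^+ D.-1) * (Cg * bs (n.+1%:R + 3 / 2) `^ th).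
    by rewrite /c; ring.
  rewrite ler_wpM2r ?mulr_ge0 ?powR_ge0// ler_wpM2l ?mulr_ge0//.
  rewrite -exprMn; apply: lerXn2r.
  - by rewrite nnegrE ler0n.
  - by rewrite nnegrE mulr_ge0// addr_ge0// divr_ge0.
  rewrite -[(2 * (n + 3).+1).+1%:R]natr1 natrM -[(n + 3).+1%:R]natr1 natrD.
  have h : 0 <= n%:R :> R by exact: ler0n.
  lra.
exists (lsum D (gth Cg) 3 + c * fine I) => N.
have gn0 n : 0 <= gth Cg n by rewrite mulr_ge0 ?powR_ge0.
apply: (@le_trans _ _ (lsum D (gth Cg) (N + 3))).
  by apply: (@lsum_homo D R _ gn0); rewrite leq_addr.
apply: le_trans (key N) _; rewrite lerD2l ler_wpM2l// fine_le//.
Qed.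

(** The shells between [n] and [2 * n], with [n] about [m / 2], contain at least [m ^ D] points,
    each contributing at least the rate at [m] by monotonicity; the tail of a convergent series
    bounds their sum. *)
Lemma bsn_decay (e : R) : 0 < e -> exists m0, forall m, (m0 <= m)%N ->
  m%:R ^+ D * bsn m <= e.
Proof.
move=> e0.
have [G hG] := lsum_gth_bounded ler01.
have gn0 n : 0 <= gth 1 n by rewrite mulr_ge0 ?powR_ge0.
(* A bound by 1 forces the rate itself below 1, where raising it to the power [th <= 1] can only
   increase it. *)
pose e' := Num.min e 1.
have e'0 : 0 < e' by rewrite lt_min e0 ltr01.
have [m1 hm1] := lsum_tail gn0 hG e'0.
exists (2 * m1).+1 => m mm.
pose n := (m.+1./2)%N.
have mn : (m <= 2 * n)%N by rewrite /n mul2n; have := odd_double_half m.+1; case: (odd _) => /=; lia.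
have nm : ((2 * n).-1 <= m)%N by rewrite /n mul2n; have := odd_double_half m.+1; lia.
have n0 : (0 < n)%N by rewrite /n; have := odd_double_half m.+1; case: (odd _) => /=; rewrite -mul2n; lia.
have m1n : (m1 <= n)%N by lia.
have m0 : (0 < m)%N by lia.
have key : m%:R ^+ D * bsn m `^ th <= e'.
  apply: le_trans (hm1 n 0 (zball D (2 * n)) m1n (zball_uniq D _)).
  apply: (@le_trans _ _ (lsum D (gth 1) (2 * n) - lsum D (gth 1) n)); last first.
    rewrite lerBlDr {1}/lsum (bigID (fun z => zd 0 z <= n)%N) /= addrC lerD//.
      by rewrite le_eqVlt; apply/orP; left; apply/eqP; apply: eq_bigl => z; rewrite ltnNge.
    rewrite -big_filter; apply: big_seq_sub => //.
      by rewrite filter_uniq ?zball_uniq.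
    by move=> z; rewrite mem_filter !mem_zball zdC => /andP[].
  have inc k : lsum D (gth 1) (n + k) - lsum D (gth 1) n >=
     ((2 * (n + k)).+1%:R ^+ D - (2 * n).+1%:R ^+ D) * bsn m `^ th *+ (k <= n).
    elim: k => [|k IHk]; first by rewrite addn0 !subrr mul0r mul0rn.
    case: (ltnP k n) => kn; last first.
      rewrite mulr0n subr_ge0; apply: (@lsum_homo D R _ gn0); exact: leq_addr.
    rewrite mulr1n addnS lsumS addrAC.
    have kn' : (k <= n)%N by exact: ltnW.
    rewrite kn' mulr1n in IHk.
    apply: le_trans (lerD IHk (lexx _)).
    rewrite /gth mul1r /=.
    set u := (2 * (n + k).+1).+1%:R ^+ D; set v := (2 * (n + k)).+1%:R ^+ D.
    have uv : 0 <= u - v.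
      by rewrite subr_ge0 lerXn2r ?nnegrE// ler_nat ltnS leq_mul2l leqnSn orbT.
    have : bsn m `^ th <= bsn (n + k) `^ th.
      rewrite ge0_ler_powR ?nnegrE ?bsn_ge0 ?(ltW th0)//.
      by apply: bsn_mono; lia.
    move=> h; have := ler_wpM2l uv h; rewrite !mulrBl; lra.
  have := inc n; rewrite leqnn mulr1n addnn -mul2n => h; apply: le_trans h.
  rewrite ler_wpM2r ?powR_ge0// lerBrDr.
  apply: (@le_trans _ _ ((m + (2 * n).+1)%:R ^+ D)); last first.
    by rewrite lerXn2r ?nnegrE// ler_nat; lia.
  rewrite -!natrX -natrD ler_nat.
  exact: exp_superadditive.
have bm0 := bsn_ge0 m.
have mD1 : 1 <= m%:R ^+ D :> R by rewrite exprn_ege1// ler1n.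
have bth1 : bsn m `^ th <= 1.
  apply: (@le_trans _ _ (m%:R ^+ D * bsn m `^ th)).
    by rewrite ler_peMl// powR_ge0.
  by apply: le_trans key _; rewrite ge_min lexx orbT.
have b1 : bsn m <= 1.
  rewrite leNgt; apply/negP => b1; move: bth1; rewrite leNgt => /negP; apply.
  have := @gt0_ltr_powR R th th0 1 (bsn m); rewrite powR1; apply => //.
    by rewrite nnegrE ltW.
have bb : bsn m <= bsn m `^ th.
  have [->|bn0] := eqVneq (bsn m) 0; first exact: powR_ge0.
  have bp : 0 < bsn m by rewrite lt_def bn0.
  rewrite -[leLHS]powRr1// /powR (negbTE bn0) ler_expR.
  by rewrite ler_wnM2r// ln_le0.
apply: le_trans (ler_wpM2l _ bb) _; first by rewrite (le_trans ler01).
by apply: le_trans key _; rewrite ge_min lexx.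
Qed.

End rates.

(** * Cells relative to cubes centred at a cell *)

Section cell_geometry.
Context {R : realType} {d : nat}.
Local Notation rV := (borel 'rV[R]_d).

(** The centre of the unit cell [z]: the cubes in the mixing condition are symmetric about the
    origin. *)
Definition zc (z : 'rV[int]_d) : 'rV[R]_d := map_mx intr z + const_mx 2^-1.

Lemma cell_near j i m (x : 'rV[R]_d) : (zd j i <= m)%N -> cell 1 i x ->
  cube `[- (m%:R + 2^-1), m%:R + 2^-1] (x - zc j).
Proof.
move=> /zdP h /cellP hx k; rewrite in_itv /= !mxE.
have hz : `|(j 0 k)%:~R - (i 0 k)%:~R| <= m%:R :> R.
  rewrite -intrB -intr_norm -[m%:R]/((m%:Z)%:~R) ler_int.
  by have := h k; move: (j 0 k) (i 0 k) => u v; lia.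
move: hz (hx k); rewrite ler_norml mul1r intrD => /andP[h1 h2] /andP[h3 h4].
by apply/andP; split; lra.
Qed.

Lemma cell_far j i m (x : 'rV[R]_d) : (m < zd j i)%N -> cell 1 i x ->
  (~` cube `[- m%:R, m%:R]) (x - zc j).
Proof.
move=> h /cellP hx hc; move: h; rewrite ltnNge => /negP; apply.
apply/zdP => k; have := hc k; rewrite in_itv /= !mxE => /andP[h1 h2].
have := hx k; rewrite mul1r intrD => /andP[h3 h4].
have u1 : (i 0 k)%:~R < (j 0 k + m%:Z + 1)%:~R :> R.
  rewrite !intrD -[m%:Z%:~R]/(m%:R); lra.
have u2 : (j 0 k)%:~R < (i 0 k + m%:Z + 1)%:~R :> R.
  rewrite !intrD -[m%:Z%:~R]/(m%:R); lra.
move: u1 u2; rewrite !ltr_int; move: (j 0 k) (i 0 k) => u v; lia.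
Qed.

Lemma measurable_cube (c : R) : measurable (cube `[- c, c] : set rV).
Proof.
have -> : cube `[- c, c] = \bigcap_i (fun x : 'rV[R]_d => x 0 i) @^-1` `[- c, c].
  by apply/seteqP; split => x /= h i; [move=> _|]; exact: h.
apply: (@bigcapT_measurable_fin _ rV) => i.
by rewrite -[X in measurable X]setTI; apply: measurable_coord => //; exact: measurable_itv.
Qed.

End cell_geometry.

(** * The random field of weighted counts in unit cells *)

Section mpp_field.
Context {R : realType} {dO : measure_display} {Omega : measurableType dO}.
Context {d : nat} {M : ptopologicalType}.
Variable P : probability Omega R.
Local Notation E := (borel 'rV[R]_d * borel M)%type.
Local Notation rV := (borel 'rV[R]_d).
Variable X : R.-ker Omega ~> E.
Hypothesis d0 : (0 < d)%N.
Hypothesis mppX : marked_point_process X.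
Hypothesis statX : stationary P X.
Variables (bs : R -> R) (delta : R).
Hypothesis delta0 : 0 < delta.
Hypothesis hmom :
  (\int[P]_w ((X w (cube `[0%R, 1%R] `*` setT)) `^ (2 + delta)) < +oo)%E.
Hypothesis bs0 : forall r, 2^-1 <= r -> 0 <= bs r.
Hypothesis bs_mono : forall r s, 2^-1 <= r -> r <= s -> bs s <= bs r.
Hypothesis bs_int : (\int[lebesgue_measure]_(r in `[1%R, +oo[)
         (r ^+ d.-1 * (bs r) `^ (delta / (2 + delta)))%:E < +oo)%E.
Hypothesis hcoef : forall a b : R, 2^-1 <= a -> a <= b ->
  (beta_mixing P (sigma_restr X (cube `[(- a)%R, a]))
     (sigma_restr X (~` cube `[(- (a + b))%R, (a + b)%R])) <= (bs b)%:E)%E.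

Local Notation Ex := (Ex P).
Local Notation th := (delta / (2 + delta)).

Let d2 : 0 < 2 + delta. Proof. by rewrite addr_gt0. Qed.
Let th0 : 0 < th. Proof. by rewrite divr_gt0. Qed.

Lemma cell_bounded z : bounded_set (cell 1 z : set 'rV[R]_d).
Proof.
exists (\sum_i (`|(z 0 i)%:~R| + 1)); split; first exact: num_real.
move=> K hK x /cellP hx; rewrite /= [leLHS]/Num.norm/= mx_normrE.
apply/bigmax_leP; split => [|[u i] _ /=].
  apply: le_trans (ltW hK); apply: sumr_ge0 => i _; exact: addr_ge0.
rewrite ord1; apply: le_trans (ltW hK); rewrite (bigD1 i)//=.
have := hx i; rewrite mul1r intrD => /andP[h1 h2].
have h3 : 0 <= \sum_(j < d | j != i) (`|(z 0 j)%:~R| + 1 : R).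
  by apply: sumr_ge0 => j _; exact: addr_ge0.
have := ler_norm ((z 0 i)%:~R : R); have := ler_norm (- (z 0 i)%:~R : R).
rewrite normrN => h4 h5.
by rewrite ler_norml; apply/andP; split; lra.
Qed.

Lemma X_fin w (B : set rV) (C : set (borel M)) z : measurable B -> measurable C ->
  B `<=` cell 1 z -> X w (B `*` C) \is a fin_num.
Proof.
move=> mB mC Bz; rewrite ge0_fin_numE//.
apply: (@le_lt_trans _ _ (X w (cell 1 z `*` setT))).
  apply: le_measure; rewrite ?inE.
  - exact: measurableX.
  - by apply: measurableX => //; exact: measurable_cell.
  - by move=> -[x m] [/= /Bz ? _].
by apply: (proj2 mppX); [exact: measurable_cell|exact: cell_bounded].
Qed.

Definition cnt (B : set rV) (w : Omega) : R := fine (X w (B `*` setT)).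

Lemma measurable_fineX (B : set rV) (C : set (borel M)) : measurable B ->
  measurable C -> measurable_fun setT (fun w => fine (X w (B `*` C))).
Proof.
move=> mB mC; apply: measurableT_comp => //.
by apply: measurable_kernel; exact: measurableX.
Qed.

Lemma measurable_cube01 : measurable (cube `[0%R, 1%R] : set rV).
Proof.
have -> : cube `[0%R, 1%R] = \bigcap_i (fun x : 'rV[R]_d => x 0 i) @^-1` `[0%R, 1%R].
  by apply/seteqP; split => x /= h i; [move=> _|]; exact: h.
apply: (@bigcapT_measurable_fin _ rV) => i.
by rewrite -[X in measurable X]setTI; apply: measurable_coord => //; exact: measurable_itv.
Qed.

Lemma cube01_fin w : X w (cube `[0%R, 1%R] `*` setT) \is a fin_num.
Proof.
rewrite ge0_fin_numE//; apply: (proj2 mppX); first exact: measurable_cube01.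
exists 1; split; first exact: num_real.
move=> K hK x /= hx; rewrite [leLHS]/Num.norm/= mx_normrE.
apply/bigmax_leP; split => [|[u i] _ /=]; first by rewrite ltW// (lt_trans ltr01).
rewrite ord1; apply: le_trans (ltW hK).
by have := hx i; rewrite in_itv /= => /andP[h1 h2]; rewrite ger0_norm.
Qed.

Lemma measurable_mom (f : Omega -> R) : measurable_fun setT f ->
  measurable_fun setT (mom delta f).
Proof.
move=> mf; apply: (measurableT_comp (measurable_powR (2 + delta))).
exact: (measurableT_comp (@normr_measurable R setT)).
Qed.

Lemma mom_le (f g : Omega -> R) (c : R) w : 0 <= c -> `|f w| <= c * g w ->
  mom delta f w <= c `^ (2 + delta) * mom delta g w.
Proof.
move=> c0 fg; rewrite /mom -powRM//.
apply: ge0_ler_powR; rewrite ?nnegrE ?mulr_ge0 ?(ltW d2)//.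
by apply: le_trans fg _; rewrite ler_wpM2l// ler_norm.
Qed.

Lemma mom_cnt0 : ig P (mom delta (cnt (cell 1 0))).
Proof.
have mc : measurable_fun setT (cnt (cube `[0%R, 1%R])).
  by apply: measurable_fineX => //; exact: measurable_cube01.
have mc0 : measurable_fun setT (cnt (cell 1 0)).
  by apply: measurable_fineX => //; exact: measurable_cell.
apply: (@ig_le _ _ _ _ _ (mom delta (cnt (cube `[0%R, 1%R])))).
- exact: measurable_mom.
- apply/integrableP; split; first by apply/measurable_EFinP; exact: measurable_mom.
  apply: le_lt_trans hmom; rewrite le_eqVlt; apply/orP; left; apply/eqP.
  apply: eq_integral => w _.
  rewrite /= ger0_norm ?mom_ge0// /mom ger0_norm ?fine_ge0//.
  by rewrite -poweR_EFin fineK// cube01_fin.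
- move=> w; rewrite ger0_norm ?mom_ge0//.
  rewrite -[leRHS]mul1r -[X in X * _](_ : 1 `^ (2 + delta) = 1); last by rewrite powR1.
  apply: mom_le => //; rewrite mul1r ger0_norm ?fine_ge0//.
  apply: fine_le; [|exact: cube01_fin|].
    by apply: (@X_fin w _ _ 0) => //; exact: measurable_cell.
  apply: le_measure; rewrite ?inE.
  + by apply: measurableX => //; exact: measurable_cell.
  + by apply: measurableX => //; exact: measurable_cube01.
  + move=> -[x m] [/= h _]; split => //= i; move: h; rewrite cell1E => /(_ i).
    by rewrite !in_itv /= => /andP[-> /ltW ->].
Qed.

Definition m0 : R := Ex (mom delta (cnt (cell 1 0))).

Lemma cell1_shift z (x : 'rV[R]_d) :
  cell 1 z x <-> cell 1 0 (x - map_mx intr z).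
Proof. by rewrite (cell_shift z x (ltn0Sn 0)) invr1 scale1r. Qed.

Lemma cnt_shift z w :
  cnt (cell 1 z) w = fine (sh (map_mx intr z) (X w) (cell 1 0 `*` setT)).
Proof.
rewrite /cnt /sh /pushforward; congr (fine (X w _)).
apply/seteqP; split => -[x m] [/= h _]; split => //=.
- exact: (proj1 (cell1_shift z x) h).
- exact: (proj2 (cell1_shift z x) h).
Qed.

Lemma mom_cnt z : ig P (mom delta (cnt (cell 1 z))) /\ Ex (mom delta (cnt (cell 1 z))) = m0.
Proof.
pose Th (mu : @EV R d M) : R := `|fine (mu (cell 1 0 `*` setT))| `^ (2 + delta).
have mTh : measurable_fun setT Th.
  apply: (measurableT_comp (measurable_powR (2 + delta))).
  apply: (measurableT_comp (@normr_measurable R setT)).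
  apply: measurableT_comp => //; apply: measurable_eval.
  by apply: measurableX => //; exact: measurable_cell.
have e : mom delta (cnt (cell 1 z)) = fun w => Th (sh (map_mx intr z) (X w)).
  by apply/funext => w; rewrite /mom cnt_shift.
split; last by rewrite e (stat_Ex statX _ mTh).
rewrite e.
apply: (equi_ig (f := fun w => Th (X w)) (g := fun w => Th (sh (map_mx intr z) (X w))) _ _ _ (@measurable_id _ R setT)).
- exact: (measurableT_comp mTh (measurable_XEV X)).
- exact: (measurableT_comp mTh (measurable_shX X _)).
- by move=> B mB; apply/esym; exact: (stat_measure statX).
- exact: mom_cnt0.
Qed.

Section functional.
Variables (n : nat) (a : 'I_n -> R) (C : 'I_n -> set (borel M)).
Hypothesis mC : forall i, measurable (C i).

Definition Xi (B : set rV) (w : Omega) : R :=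
  \sum_i a i * fine (X w (B `*` C i)).

Definition amax : R := \sum_i `|a i|.

Lemma amax_ge0 : 0 <= amax. Proof. by apply: sumr_ge0. Qed.

Lemma measurable_Xi (B : set rV) : measurable B -> measurable_fun setT (Xi B).
Proof.
move=> mB; apply: measurable_sum => i.
by apply: measurable_funM => //; exact: measurable_fineX.
Qed.

Lemma Xi_le (B : set rV) z w : measurable B -> B `<=` cell 1 z ->
  `|Xi B w| <= amax * cnt (cell 1 z) w.
Proof.
move=> mB Bz; apply: le_trans (ler_norm_sum _ _ _) _.
rewrite /amax big_distrl /=; apply: ler_sum => i _.
rewrite normrM ler_wpM2l// ger0_norm ?fine_ge0//.
apply: fine_le; [exact: (@X_fin w _ _ z)| |].
  by apply: (@X_fin w _ _ z) => //; exact: measurable_cell.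
apply: le_measure; rewrite ?inE.
- exact: measurableX.
- by apply: measurableX => //; exact: measurable_cell.
- by move=> -[x m] [/= /Bz].
Qed.

Definition Mx : R := amax `^ (2 + delta) * m0.

(** Allowing any [u] dominated by the identity treats a count, its truncation and its tail at once;
    allowing [B] inside a cell covers the cells cut by the window. *)
Lemma mom_Xi (B : set rV) (u : R -> R) z : measurable B -> B `<=` cell 1 z ->
  measurable_fun setT u -> (forall x, `|u x| <= `|x|) ->
  ig P (mom delta (fun w => u (Xi B w))) /\ Ex (mom delta (fun w => u (Xi B w))) <= Mx.
Proof.
move=> mB Bz mu ux.
have [i1 e1] := mom_cnt z.
have hle w : mom delta (fun w => u (Xi B w)) w <=
    amax `^ (2 + delta) * mom delta (cnt (cell 1 z)) w.
  apply: mom_le; first exact: amax_ge0.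
  exact: le_trans (ux _) (Xi_le w mB Bz).
have i2 : ig P (mom delta (fun w => u (Xi B w))).
  apply: ig_le (igZ _ i1) _.
    by apply: measurable_mom; apply: measurableT_comp => //; exact: measurable_Xi.
  by move=> w; rewrite ger0_norm ?mom_ge0.
split => //; rewrite /Mx -e1 -ExZ//.
by apply: le_Ex => //; exact: igZ.
Qed.

Lemma Xi_L2 (B : set rV) (u : R -> R) z : measurable B -> B `<=` cell 1 z ->
  measurable_fun setT u -> (forall x, `|u x| <= `|x|) ->
  L2 P (fun w => u (Xi B w)).
Proof.
move=> mB Bz mu ux; have [i1 _] := mom_Xi mB Bz mu ux.
apply: (L2_of_mom delta0) => //.
by apply: measurableT_comp => //; exact: measurable_Xi.
Qed.

Lemma Xi_loc (B : set rV) (S : set 'rV[R]_d) z : measurable B ->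
  (forall x, B x -> S (x - zc z)) -> loc X (zc z) S (Xi B).
Proof.
move=> mB BS; apply: loc_sum => i _.
by apply: locZ; apply: loc_count.
Qed.

(** The mixing condition with [a = m + 1/2] and [b = p - a], that is [b = (p - m) - 1/2]; the gap
    hypothesis is what gives [a <= b]. *)
Lemma hcoef_cells m p : (2 * m < p)%N ->
  (beta_mixing P (sigma_restr X (cube `[(- (m%:R + 2^-1))%R, (m%:R + 2^-1)%R]))
     (sigma_restr X (~` cube `[(- p%:R)%R, p%:R])) <= (bsn bs (p - m))%:E)%E.
Proof.
move=> mp.
have pm : (m + m.+1 <= p)%N by clear -mp; lia.
have e : (p - m)%:R - 2^-1 = p%:R - (m%:R + 2^-1) :> R.
  by rewrite natrB; [ring|clear -mp; lia].
have -> : bsn bs (p - m) = bs (p%:R - (m%:R + 2^-1)).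
  by rewrite -e; case: (p - m)%N (subn_gt0 m p) => //; clear -mp; lia.
have := @hcoef (m%:R + 2^-1) (p%:R - (m%:R + 2^-1)).
rewrite (_ : m%:R + 2^-1 + _ = p%:R); last by rewrite addrC subrK.
apply.
  by have := ler0n R m; lra.
move: pm; rewrite -(ler_nat R) natrD -[m.+1%:R]natr1; lra.
Qed.

Lemma cov_trivial (f g : Omega -> R) m : measurable_fun setT f ->
  measurable_fun setT g -> ig P (mom delta f) -> ig P (mom delta g) ->
  Ex (mom delta f) <= m -> Ex (mom delta g) <= m ->
  `|Ex (fun w => f w * g w) - Ex f * Ex g| <= 2 + 6 * m + m ^+ 2.
Proof.
move=> mf mg hf hg fM gM.
have M0 : 0 <= m by apply: le_trans fM; apply: Ex_ge0 => w; exact: mom_ge0.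
have f2 := L2_of_mom delta0 mf hf; have g2 := L2_of_mom delta0 mg hg.
have := Ex_sqr_le_mom delta0 mf hf fM; have := Ex_sqr_le_mom delta0 mg hg gM.
have := Ex_sqr_sum_sqr f2 g2; have := Ex_sqr_le f2; have := Ex_sqr_le g2.
set A := Ex (fun w => f w ^+ 2); set B := Ex (fun w => g w ^+ 2).
set D := Ex (fun w => f w * g w) => h1 h2 h3 h4 h5.
have A0 : 0 <= A by apply: le_trans h2; exact: sqr_ge0.
have B0 : 0 <= B by apply: le_trans h1; exact: sqr_ge0.
have hC : `|D| <= 1 + m.
  rewrite -ler_sqr ?nnegrE ?addr_ge0// real_normK ?num_real//.
  by apply: le_trans h3 _; rewrite expr2; exact: ler_pM.
have hfg : `|Ex f * Ex g| <= 1 + m.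
  rewrite -ler_sqr ?nnegrE ?addr_ge0// real_normK ?num_real// exprMn expr2.
  by apply: ler_pM; rewrite ?sqr_ge0//; [exact: le_trans h2 _|exact: le_trans h1 _].
by have := ler_normB D (Ex f * Ex g); have := sqr_ge0 m; lra.
Qed.

Definition gX : nat -> R := gth bs th (2 + 6 * Mx + Mx ^+ 2).

Lemma m0_ge0 : 0 <= m0.
Proof. by apply: Ex_ge0 => w; exact: mom_ge0. Qed.

Lemma Mx_ge0 : 0 <= Mx.
Proof. by rewrite mulr_ge0 ?powR_ge0 ?m0_ge0. Qed.

Lemma gX_ge0 k : 0 <= gX k.
Proof.
have h := Mx_ge0.
by rewrite mulr_ge0 ?powR_ge0// addr_ge0 ?sqr_ge0// addr_ge0// mulr_ge0.
Qed.

Lemma gX_bounded : exists G, forall N, lsum d gX N <= G.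
Proof.
apply: lsum_gth_bounded => //.
- by rewrite ler_pdivrMr// mul1r lerDr.
- have h := Mx_ge0.
  by rewrite addr_ge0 ?sqr_ge0// addr_ge0// mulr_ge0.
Qed.

(** Seen from the centre of cell [i], the first variable lives in the cube of radius [1/2] and the
    second outside the cube of radius [zd i j - 1], so [loc_cov_moment] applies. *)
Lemma field_cov (B B' : set rV) (u v : R -> R) i j : measurable B ->
  measurable B' -> B `<=` cell 1 i -> B' `<=` cell 1 j ->
  measurable_fun setT u -> (forall x, `|u x| <= `|x|) ->
  measurable_fun setT v -> (forall x, `|v x| <= `|x|) ->
  `|Ex (fun w => u (Xi B w) * v (Xi B' w))
    - Ex (fun w => u (Xi B w)) * Ex (fun w => v (Xi B' w))| <= gX (zd i j).
Proof.
move=> mB mB' Bi Bj mu hu mv hv.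
have [i1 l1] := mom_Xi mB Bi mu hu; have [i2 l2] := mom_Xi mB' Bj mv hv.
have mf : measurable_fun setT (fun w => u (Xi B w)).
  by apply: measurableT_comp => //; exact: measurable_Xi.
have mg : measurable_fun setT (fun w => v (Xi B' w)).
  by apply: measurableT_comp => //; exact: measurable_Xi.
(* Equal or adjacent cells leave no gap; the bound is then the one from second moments. *)
have [zij|zij] := leqP (zd i j) 1.
  rewrite /gX /gth (_ : (zd i j).-1 = 0%N); last by case: (zd i j) zij => [|[]].
  by rewrite /= powR1 mulr1; exact: cov_trivial.
pose p := (zd i j).-1.
have p0 : (2 * 0 < p)%N by rewrite /p; clear -zij; lia.
have pz : (p < zd i j)%N by rewrite /p; clear -zij; lia.
have := hcoef_cells p0; rewrite subn0 => hb.
apply: (loc_cov_moment (z := zc i) statX _ _ hb delta0 (bsn_ge0 bs0 p)).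
- exact: measurable_cube.
- by apply: measurableC; exact: measurable_cube.
- apply: loc_comp => //; apply: Xi_loc => // x /Bi; apply: cell_near.
  by rewrite zdii.
- by apply: loc_comp => //; apply: Xi_loc => // x /Bj; exact: cell_far.
- exact: i1.
- exact: i2.
- exact: l1.
- exact: l2.
Qed.

End functional.
End mpp_field.

(** * Stability of characteristic functions and variances under small mean square changes *)

Section perturbation.
Context d (T : measurableType d) (R : realType) (P : probability T R).
Local Notation Ex := (Ex P).

Definition ctr (f : T -> R) (w : T) : R := f w - Ex f.

Lemma ctr_L2 f : L2 P f -> L2 P (ctr f).
Proof. by move=> f2; apply: L2B => //; apply: bm_L2; exact: bm_cst. Qed.

Lemma Ex_ctr f : ig P f -> Ex (ctr f) = 0.
Proof. by move=> fi; rewrite /ctr ExB ?Ex_cst ?subrr//; exact: ig_cst. Qed.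

Lemma Ex_ctrM f g : L2 P f -> L2 P g ->
  Ex (fun w => ctr f w * ctr g w) = Ex (fun w => f w * g w) - Ex f * Ex g.
Proof.
move=> f2 g2.
have -> : (fun w => ctr f w * ctr g w) =
  fun w => (f w * g w - Ex g * f w) - Ex f * ctr g w.
  by apply/funext => w; rewrite /ctr; ring.
have fg := L2_igM f2 g2; have fi := L2_ig f2; have gi := L2_ig g2.
have ci := L2_ig (ctr_L2 g2).
rewrite ExB ?ExB ?ExZ ?Ex_ctr//; first ring.
- exact: igZ.
- by apply: igB => //; exact: igZ.
- exact: igZ.
Qed.

Lemma expRN_lipschitz (x y : R) : 0 <= x -> 0 <= y ->
  `|expR (- x) - expR (- y)| <= `|x - y|.
Proof.
wlog xy : x y / x <= y.
  move=> h x0 y0; have [/h|/ltW /h] := leP x y; first exact.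
  by rewrite distrC (distrC x); exact.
move=> x0 y0; rewrite ger0_norm; last by rewrite subr_ge0 ler_expR lerN2.
rewrite distrC ger0_norm ?subr_ge0//.
have -> : - y = - x + (x - y) by ring.
rewrite expRD.
have h1 : expR (- x) <= 1 by rewrite -expR0 ler_expR oppr_le0.
have h2 := expR_ge1Dx (x - y); have h3 := expR_gt0 (- x).
have h4 : expR (x - y) <= 1 by rewrite -expR0 ler_expR subr_le0.
by nra.
Qed.

Lemma charfun_close (S S' : T -> R) (th eta : R) : L2 P S -> L2 P S' ->
  0 <= eta -> Ex (fun w => (S w - S' w) ^+ 2) <= eta ^+ 2 ->
  `|Ex (fun w => cos (S w + th)) - Ex (fun w => cos (S' w + th))| <= eta.
Proof.
move=> S2 S2' eta0 h.
have mS : measurable_fun setT (fun w => S w + th) by apply: measurable_funD => //; exact: S2.1.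
have mS' : measurable_fun setT (fun w => S' w + th) by apply: measurable_funD => //; exact: S2'.1.
have c1 := bm_cosf mS; have c2 := bm_cosf mS'.
rewrite -ExB; [|exact: bm_ig|exact: bm_ig].
apply: (@le_trans _ _ (Ex (fun w => `|S w - S' w|))).
  apply: norm_Ex_le.
  - by apply: bm_ig; exact: bmB.
  - by apply: L2_ig; apply: L2_norm; exact: L2B.
  - move=> w; apply: le_trans (cos_lipschitz _ _) _.
    by rewrite (_ : S w + th - (S' w + th) = S w - S' w)//; ring.
apply: le_trans (Ex_norm_le (L2B S2 S2')) _.
by rewrite -(ger0_norm eta0) -sqrtr_sqr ler_wsqrtr.
Qed.

Lemma second_moment_close (S S' : T -> R) (eta K : R) : L2 P S -> L2 P S' ->
  0 <= eta -> 0 <= K -> Ex (fun w => (S w - S' w) ^+ 2) <= eta ^+ 2 ->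
  Ex (fun w => S w ^+ 2) <= K ^+ 2 -> Ex (fun w => S' w ^+ 2) <= K ^+ 2 ->
  `|Ex (fun w => S w ^+ 2) - Ex (fun w => S' w ^+ 2)| <= 2 * K * eta.
Proof.
move=> S2 S2' eta0 K0 h hS hS'.
have i1 := S2.2; have i2 := S2'.2.
rewrite -ExB//.
have -> : (fun w => S w ^+ 2 - S' w ^+ 2) = fun w => (S w + S' w) * (S w - S' w).
  by apply/funext => w; ring.
apply: le_trans (ExM_le (L2D S2 S2') (L2B S2 S2')) _.
apply: ler_pM; rewrite ?sqrtr_ge0//; last first.
  by rewrite -(ger0_norm eta0) -sqrtr_sqr ler_wsqrtr.
have K20 : 0 <= 2 * K by rewrite mulr_ge0.
rewrite -[leRHS](ger0_norm K20) -sqrtr_sqr ler_wsqrtr//.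
apply: (@le_trans _ _ (Ex (fun w => 2 * S w ^+ 2 + 2 * S' w ^+ 2))).
  apply: le_Ex; first by have [] := L2D S2 S2'.
    by apply: igD; exact: igZ.
  by move=> w; have := sqr_ge0 (S w - S' w); lra.
rewrite ExD ?ExZ//; [|exact: igZ|exact: igZ].
by rewrite exprMn; lra.
Qed.

(** [eta] comes from the cosine, and [K * eta] from the exponential, whose argument is half of a
    variance known up to [2 * K * eta]. *)
Lemma charfun_perturb (S S' : T -> R) (th eta K : R) : L2 P S -> L2 P S' ->
  0 <= eta -> 0 <= K -> Ex (fun w => (S w - S' w) ^+ 2) <= eta ^+ 2 ->
  Ex (fun w => S w ^+ 2) <= K ^+ 2 -> Ex (fun w => S' w ^+ 2) <= K ^+ 2 ->
  `|Ex (fun w => cos (S w + th)) - cos th * expR (- (Ex (fun w => S w ^+ 2) / 2))|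
  <= `|Ex (fun w => cos (S' w + th)) - cos th * expR (- (Ex (fun w => S' w ^+ 2) / 2))|
     + (eta + K * eta).
Proof.
move=> S2 S2' eta0 K0 h hS hS'.
have h1 := charfun_close th S2 S2' eta0 h.
have h2 := second_moment_close S2 S2' eta0 K0 h hS hS'.
have h3 : `|cos th * expR (- (Ex (fun w => S w ^+ 2) / 2)) -
   cos th * expR (- (Ex (fun w => S' w ^+ 2) / 2))| <= K * eta.
  rewrite -mulrBr normrM; apply: (@le_trans _ _ (1 * (K * eta))); last by rewrite mul1r.
  apply: ler_pM => //; first by rewrite ler_norml cos_geN1 cos_le1.
  apply: le_trans (expRN_lipschitz _ _) _.
  - by rewrite divr_ge0// Ex_ge0// => w; exact: sqr_ge0.
  - by rewrite divr_ge0// Ex_ge0// => w; exact: sqr_ge0.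
  rewrite -mulrBl normrM (@ger0_norm _ 2^-1) ?invr_ge0//.
  by rewrite ler_pdivrMr// mulrC mulrA.
move: h1 h3; set a := Ex _; set b := Ex _; set c := cos th * _; set e := cos th * _.
move=> h1 h3.
have -> : a - c = (a - b) + (b - e) - (c - e) by ring.
apply: le_trans (ler_normB _ _) _; have := ler_normD (a - b) (b - e); lra.
Qed.

End perturbation.

(** * From bounded to square-integrable fields *)

Section truncation.
Context d (T : measurableType d) (R : realType) (P : probability T R) (D : nat).
Local Notation Ex := (Ex P).
Variables (xi : 'rV[int]_D -> T -> R) (g : nat -> R) (G delta Mx : R).
Hypothesis delta0 : 0 < delta.
Hypothesis mxi : forall i, measurable_fun setT (xi i).
Hypothesis momxi : forall i, ig P (mom delta (xi i)) /\ Ex (mom delta (xi i)) <= Mx.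
Hypothesis g0 : forall n, 0 <= g n.
Hypothesis gG : forall N, lsum D g N <= G.
Hypothesis cov_g : forall i j (u v : R -> R),
  measurable_fun setT u -> (forall x, `|u x| <= `|x|) ->
  measurable_fun setT v -> (forall x, `|v x| <= `|x|) ->
  `|Ex (fun w => u (xi i w) * v (xi j w))
    - Ex (fun w => u (xi i w)) * Ex (fun w => v (xi j w))| <= g (zd i j).
Hypothesis clt_trunc : forall L e, 0 < L -> 0 < e -> exists2 rho, 0 < rho &
  forall (s : seq 'rV[int]_D) (r th : R),
  uniq s -> 0 < r -> r <= rho -> r ^+ 2 * (size s)%:R <= 2 ->
  `|Ex (fun w => cos (r * (\sum_(i <- s) ctr P (fun w => trunc L (xi i w)) w) + th))
    - cos th * expR (- (r ^+ 2 *
       Ex (fun w => (\sum_(i <- s) ctr P (fun w => trunc L (xi i w)) w) ^+ 2) / 2))| <= e.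

Let G0 : 0 <= G.
Proof. by apply: le_trans (gG 0); apply: sumr_ge0 => i _; exact: g0. Qed.

Let Mx0 : 0 <= Mx.
Proof. by apply: le_trans (momxi 0).2; apply: Ex_ge0 => w; exact: mom_ge0. Qed.

Lemma comp_L2 (u : R -> R) i : measurable_fun setT u -> (forall x, `|u x| <= `|x|) ->
  L2 P (fun w => u (xi i w)).
Proof.
move=> mu ux; have m1 : measurable_fun setT (fun w => u (xi i w)).
  exact: (measurableT_comp mu (mxi i)).
apply: (L2_of_mom delta0) => //; apply: (ig_le _ (momxi i).1).
  apply: (measurableT_comp (measurable_powR (2 + delta))).
  exact: (measurableT_comp (@normr_measurable R setT)).
move=> w; rewrite ger0_norm ?mom_ge0// ge0_ler_powR ?nnegrE//.
by rewrite addr_ge0// ltW.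
Qed.

Lemma field_L2 i : L2 P (xi i).
Proof. exact: (comp_L2 (u := id)). Qed.

Lemma ctr_cov (u v : R -> R) i j :
  measurable_fun setT u -> (forall x, `|u x| <= `|x|) ->
  measurable_fun setT v -> (forall x, `|v x| <= `|x|) ->
  `|Ex (fun w => ctr P (fun w => u (xi i w)) w * ctr P (fun w => v (xi j w)) w)|
  <= g (zd i j).
Proof.
by move=> mu ux mv vx; rewrite Ex_ctrM ?cov_g//; exact: comp_L2.
Qed.

Definition tail (L x : R) : R := x - trunc L x.

Lemma measurable_tail L : measurable_fun setT (tail L).
Proof. by apply: measurable_funB => //; exact: measurable_trunc. Qed.

Lemma tail_sqr L i : 0 < L -> Ex (fun w => tail L (xi i w) ^+ 2) <= L `^ (- delta) * Mx.
Proof.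
move=> L0; have [i1 i2] := momxi i.
have [_ t2] := comp_L2 i (measurable_tail L) (@tail_norm_le _ L).
apply: (@le_trans _ _ (Ex (fun w => L `^ (- delta) * mom delta (xi i) w))); last first.
  by rewrite ExZ// ler_wpM2l// powR_ge0.
apply: le_Ex => //; first exact: igZ.
move=> w; rewrite /tail /trunc; case: (leP `|xi i w| L) => h.
  by rewrite subrr expr0n mulr_ge0 ?powR_ge0 ?mom_ge0.
by rewrite subr0 sqr_le_mom// ltW.
Qed.

(** Two bounds at once: Cauchy-Schwarz makes the covariance of tails small for large [L] at every
    distance, and mixing makes it summable. *)
Lemma tail_cov L i j : 0 < L ->
  `|Ex (fun w => ctr P (fun w => tail L (xi i w)) w * ctr P (fun w => tail L (xi j w)) w)|
  <= Num.min (L `^ (- delta) * Mx) (g (zd i j)).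
Proof.
move=> L0; have mt := measurable_tail L; have ht := @tail_norm_le R L.
rewrite le_min ctr_cov// andbT.
have h2 k := comp_L2 k mt ht.
apply: le_trans (ExM_le (ctr_L2 (h2 i)) (ctr_L2 (h2 j))) _.
have h k : Ex (fun w => ctr P (fun w => tail L (xi k w)) w ^+ 2) <= L `^ (- delta) * Mx.
  under eq_Ex do rewrite expr2.
  rewrite Ex_ctrM//; apply: le_trans (tail_sqr k L0).
  under [leRHS]eq_Ex do rewrite expr2.
  by rewrite gerBl -expr2 sqr_ge0.
have c0 : 0 <= L `^ (- delta) * Mx by rewrite mulr_ge0 ?powR_ge0.
rewrite -[leRHS](sqr_sqrtr c0) expr2.
by apply: ler_pM; rewrite ?sqrtr_ge0//; exact: ler_wsqrtr.
Qed.

(** Dominated convergence for a series: outside a large ball use [g], inside it the bound vanishing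
    with [L]. *)
Lemma tail_lsum (e : R) : 0 < e -> exists2 L, 0 < L &
  forall N, lsum D (fun n => Num.min (L `^ (- delta) * Mx) (g n)) N <= e.
Proof.
move=> e0; have e2 : 0 < e / 2 by rewrite divr_gt0.
have [m hm] := lsum_tail g0 gG e2.
pose c := (2 * m).+1%:R ^+ D * Mx + 1.
have c0 : 0 < c by rewrite ltr_wpDl// mulr_ge0// exprn_ge0.
(* Chosen so that [L] to the power [- delta] times [Mx], times the number of points of the ball, is
   at most [e / 2]. *)
pose L := (e / 2 / c) `^ (- delta^-1).
have q0 : 0 < e / 2 / c by rewrite divr_gt0.
exists L; first by rewrite powR_gt0.
have -> : L `^ (- delta) = e / 2 / c.
  by rewrite /L -powRrM mulrNN mulVf ?gt_eqF// powRr1// ltW.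
move=> N; rewrite /lsum (bigID (fun z => zd 0 z <= m)%N) /=.
rewrite [leRHS]splitr; apply: lerD; last first.
  apply: le_trans (hm m 0 (zball D N) (leqnn m) (zball_uniq _ _)).
  under [leRHS]eq_bigl do rewrite ltnNge.
  by apply: ler_sum => z _; rewrite ge_min lexx orbT.
apply: (@le_trans _ _ (\sum_(z <- zball D m) (e / 2 / c * Mx))).
  apply: (@le_trans _ _ (\sum_(z <- zball D N | (zd 0 z <= m)%N) (e / 2 / c * Mx))).
    by apply: ler_sum => z _; rewrite ge_min lexx.
  rewrite -[leLHS]big_filter; apply: big_seq_sub.
  - by rewrite filter_uniq// zball_uniq.
  - by move=> z; rewrite mem_filter !mem_zball zdC => /andP[].
  - by move=> z; rewrite mulr_ge0// ltW.
rewrite big_const_seq iter_addr_0 count_predT size_zball -[leLHS]mulr_natl natrX.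
rewrite -[leRHS](divfK (lt0r_neq0 c0)) mulrCA ler_wpM2l ?(ltW q0)//.
by rewrite /c lerDl.
Qed.

(** The normalised sum of tails has second moment at most [eta ^+ 2] uniformly in the set of sites,
    so [charfun_perturb] carries the result over from the truncated field. *)
Lemma field_clt (e : R) : 0 < e -> exists2 rho, 0 < rho &
  forall (s : seq 'rV[int]_D) (r th : R),
  uniq s -> 0 < r -> r <= rho -> r ^+ 2 * (size s)%:R <= 2 ->
  `|Ex (fun w => cos (r * (\sum_(i <- s) ctr P (xi i) w) + th))
    - cos th * expR (- (Ex (fun w => (r * \sum_(i <- s) ctr P (xi i) w) ^+ 2) / 2))| <= e.
Proof.
move=> e0.
pose K := Num.sqrt (2 * G).
have K0 : 0 <= K by exact: sqrtr_ge0.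
have K2 : K ^+ 2 = 2 * G by rewrite sqr_sqrtr// mulr_ge0.
(* Makes the perturbation error [eta + K * eta] equal to [e / 2]. *)
pose eta := e / (2 * (1 + K)).
have eta0 : 0 < eta by rewrite divr_gt0// mulr_gt0// ltr_wpDr.
have [L L0 hL] := tail_lsum (divr_gt0 (exprn_gt0 2 eta0) (ltr0Sn R 1)).
have [rho rho0 hrho] := clt_trunc L0 (divr_gt0 e0 (ltr0Sn R 1)).
exists rho => // s r th us r0 rrho rs.
have mt := @measurable_trunc R L; have ht := @trunc_norm_le R L.
pose S w := r * \sum_(i <- s) ctr P (xi i) w.
pose S' w := r * \sum_(i <- s) ctr P (fun w => trunc L (xi i w)) w.
have L2S : L2 P S by apply: L2Z; apply: L2_sum => i; apply: ctr_L2; exact: field_L2.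
have L2S' : L2 P S' by apply: L2Z; apply: L2_sum => i; apply: ctr_L2; exact: comp_L2.
have scal (F : T -> R) : ig P (fun w => F w ^+ 2) -> Ex (fun w => (r * F w) ^+ 2) = r ^+ 2 * Ex (fun w => F w ^+ 2).
  by move=> iF; under eq_Ex do rewrite exprMn; rewrite ExZ.
have bound (F : 'rV[int]_D -> T -> R) (h : nat -> R) (c : R) :
    (forall i, L2 P (F i)) -> (forall n, 0 <= h n) ->
    (forall N, lsum D h N <= c) ->
    (forall i j, `|Ex (fun w => F i w * F j w)| <= h (zd i j)) ->
    Ex (fun w => (r * \sum_(i <- s) F i w) ^+ 2) <= 2 * c.
  move=> F2 h0 hc hF.
  have c0 : 0 <= c by apply: le_trans (hc 0); apply: sumr_ge0 => i _.
  rewrite scal; last by have [] := L2_sum s xpredT F2.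
  apply: (@le_trans _ _ (r ^+ 2 * ((size s)%:R * c))).
    by rewrite ler_wpM2l ?sqr_ge0//; exact: (var_sum_le F2 h0 hc us hF).
  by rewrite mulrA ler_wpM2r.
apply: le_trans (charfun_perturb th L2S L2S' (ltW eta0) K0 _ _ _) _.
- have -> : (fun w => (S w - S' w) ^+ 2) =
    fun w => (r * \sum_(i <- s) ctr P (fun w => tail L (xi i w)) w) ^+ 2.
    apply/funext => w; rewrite /S /S' -mulrBr -sumrB; congr ((r * _) ^+ 2).
    apply: eq_bigr => i _; rewrite /ctr /tail ExB; first ring.
      by apply: L2_ig; exact: field_L2.
    by apply: L2_ig; exact: comp_L2.
  have := bound (fun i => ctr P (fun w => tail L (xi i w))) _ _ _ _ hL _.
  rewrite (_ : 2 * (eta ^+ 2 / 2) = eta ^+ 2); last by field.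
  apply.
  + by move=> i; apply: ctr_L2; apply: comp_L2; [exact: measurable_tail|exact: tail_norm_le].
  + by move=> n; rewrite le_min g0 mulr_ge0 ?powR_ge0.
  + by move=> i j; exact: tail_cov.
- rewrite K2; apply: (bound (fun i => ctr P (xi i)) g) => //.
    by move=> i; apply: ctr_L2; exact: field_L2.
  by move=> i j; exact: (ctr_cov (u := id) (v := id)).
- rewrite K2; apply: (bound (fun i => ctr P (fun w => trunc L (xi i w))) g) => //.
    by move=> i; apply: ctr_L2; exact: comp_L2.
  by move=> i j; exact: ctr_cov.
have e12 : eta + K * eta = e / 2 by rewrite /eta; field; rewrite gt_eqF// ltr_wpDr.
rewrite e12 [leRHS]splitr lerD2r.
apply: le_trans (hrho s r th us r0 rrho rs).
rewrite /S' scal; last by have [] := L2_sum s xpredT (fun i => ctr_L2 (comp_L2 i mt ht)).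
exact: lexx.
Qed.

End truncation.

(** * Asymptotic variance and limit theorem along growing windows *)

Section window.
Context d (T : measurableType d) (R : realType) (P : probability T R) (D : nat).
Local Notation Ex := (Ex P).
Variables (Z : 'rV[int]_D -> T -> R) (g : nat -> R) (G : R).
Hypothesis Z2 : forall i, L2 P (Z i).
Hypothesis g0 : forall n, 0 <= g n.
Hypothesis gG : forall N, lsum D g N <= G.
Variable gam : 'rV[int]_D -> R.
Hypothesis ZZ : forall i j, Ex (fun w => Z i w * Z j w) = gam (j - i).
Hypothesis gam_g : forall z, `|gam z| <= g (zd 0 z).

Let G0 : 0 <= G.
Proof. by apply: le_trans (gG 0); apply: sumr_ge0 => i _; exact: g0. Qed.

(** Partial sums of the covariance function; their limit is the asymptotic variance. *)
Definition sig (m : nat) : R := \sum_(z <- zball D m) gam z.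

Lemma sig_le m : `|sig m| <= G.
Proof.
apply: le_trans (gG m); apply: le_trans (ler_norm_sum _ _ _) _.
by apply: ler_sum => z _.
Qed.

Lemma gam_sum_split i (s : seq 'rV[int]_D) m :
  \sum_(j <- s) gam (j - i) = \sum_(j <- s | (zd i j <= m)%N) gam (j - i)
   + \sum_(j <- s | (m < zd i j)%N) gam (j - i).
Proof.
rewrite (bigID (fun j => zd i j <= m)%N) /=; congr (_ + _).
by apply: eq_bigl => j; rewrite ltnNge.
Qed.

Lemma gam_le i j : `|gam (j - i)| <= g (zd i j).
Proof.
apply: le_trans (gam_g _) _.
by rewrite -(zd_shift 0 (j - i) i) add0r subrK.
Qed.

Lemma gam_ball i (s : seq 'rV[int]_D) m : uniq s ->
  (forall j, (zd i j <= m)%N -> j \in s) ->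
  \sum_(j <- s | (zd i j <= m)%N) gam (j - i) = sig m.
Proof.
move=> us hs; rewrite -big_filter /sig.
rewrite (perm_big [seq z + i | z <- zball D m]) /=.
  by rewrite big_map; apply: eq_bigr => z _; rewrite addrK.
apply: uniq_perm.
- exact: filter_uniq.
- by rewrite map_inj_uniq ?zball_uniq//; exact: addIr.
move=> j; rewrite mem_filter; apply/andP/mapP => [[ij js]|[z]].
  exists (j - i); last by rewrite subrK.
  by rewrite mem_zball -(zd_shift _ _ i) subrK add0r zdC.
rewrite mem_zball => zm ->.
have h : (zd i (z + i) <= m)%N by rewrite zdC -{2}[i]add0r zd_shift.
by split => //; exact: hs.
Qed.

Lemma sig_cauchy (e : R) : 0 < e -> exists m0, forall m n, (m0 <= m)%N -> (m <= n)%N ->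
  `|sig n - sig m| <= e.
Proof.
move=> e0; have [m0 h] := lsum_tail g0 gG e0.
exists m0 => m n mm mn.
have -> : sig m = \sum_(j <- zball D n | (zd 0 j <= m)%N) gam (j - 0).
  rewrite gam_ball ?zball_uniq// => j; rewrite mem_zball zdC => /leq_trans; exact.
rewrite /sig.
under eq_bigr do rewrite -[z in gam z]subr0.
rewrite (gam_sum_split 0 _ m) addrAC subrr add0r.
apply: le_trans (h m 0 (zball D n) mm (zball_uniq _ _)).
apply: le_trans (ler_norm_sum _ _ _) _.
by apply: ler_sum => j _; exact: gam_le.
Qed.

Lemma sig_cvg : exists sg2 : R, forall e, 0 < e -> exists m0, forall m, (m0 <= m)%N ->
  `|sg2 - sig m| <= e.
Proof.
have : cvg (sig @ \oo).
  apply/cauchy_cvgP/cauchy_exP => e e0.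
  have [m0 h] := sig_cauchy (divr_gt0 e0 (ltr0Sn R 1)).
  exists (sig m0); exists m0 => // n /= mn.
  rewrite /ball /= distrC; apply: le_lt_trans (h m0 n (leqnn _) mn) _.
  by rewrite ltr_pdivrMr// ltr_pMr// ltr1n.
move=> /cvgrPdist_le h; exists (limn sig) => e e0.
by have [m0 _ hm] := h e e0; exists m0 => m; exact: hm.
Qed.

Variables (In Bd : nat -> seq 'rV[int]_D) (eta : nat -> 'rV[int]_D -> T -> R) (v : nat -> R).
Hypothesis uIn : forall k, uniq (In k).
Hypothesis uBd : forall k, uniq (Bd k).
Hypothesis eta2 : forall k i, L2 P (eta k i).
Hypothesis eta_g : forall k i j, `|Ex (fun w => eta k i w * eta k j w)| <= g (zd i j).
Hypothesis v_In : forall k, (size (In k))%:R <= v k.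
Hypothesis v_InBd : forall k, v k <= (size (In k))%:R + (size (Bd k))%:R.
Hypothesis v_large : forall A, \forall k \near \oo, A <= v k.
Hypothesis Bd_small : forall e, 0 < e -> \forall k \near \oo, (size (Bd k))%:R <= e * v k.
Hypothesis bad_small : forall m e, 0 < e -> \forall k \near \oo,
  (size [seq i <- In k | ~~ all (fun z => z + i \in In k) (zball D m)])%:R <= e * v k.
Hypothesis clt : forall e, 0 < e -> exists2 rho, 0 < rho &
  forall (s : seq 'rV[int]_D) (r th : R),
  uniq s -> 0 < r -> r <= rho -> r ^+ 2 * (size s)%:R <= 2 ->
  `|Ex (fun w => cos (r * (\sum_(i <- s) Z i w) + th))
    - cos th * expR (- (Ex (fun w => (r * \sum_(i <- s) Z i w) ^+ 2) / 2))| <= e.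

Definition rk k : R := (Num.sqrt (v k))^-1.
Definition Sk k w : R := rk k * \sum_(i <- In k) Z i w.
Definition Tk k w : R :=
  rk k * (\sum_(i <- In k) Z i w + \sum_(i <- Bd k) eta k i w).

Let rk_sqr k : 0 < v k -> rk k ^+ 2 = (v k)^-1.
Proof. by move=> v0; rewrite /rk exprVn sqr_sqrtr// ltW. Qed.

Let Ex_scal (r : R) (F : T -> R) : L2 P F ->
  Ex (fun w => (r * F w) ^+ 2) = r ^+ 2 * Ex (fun w => F w ^+ 2).
Proof. by move=> [_ iF]; under eq_Ex do rewrite exprMn; rewrite ExZ. Qed.

Lemma Sk_L2 k : L2 P (Sk k).
Proof. by apply: L2Z; exact: L2_sum. Qed.

Lemma Tk_L2 k : L2 P (Tk k).
Proof. by apply: L2Z; apply: L2D; exact: L2_sum. Qed.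

Lemma Sk_var_le k : 0 < v k -> Ex (fun w => Sk k w ^+ 2) <= G.
Proof.
move=> v0; rewrite Ex_scal; last exact: L2_sum.
have h : Ex (fun w => (\sum_(i <- In k) Z i w) ^+ 2) <= (size (In k))%:R * G.
  apply: (var_sum_le Z2 g0 gG (uIn k)) => i j.
  by rewrite ZZ gam_le.
rewrite rk_sqr// ler_pdivrMl//; apply: le_trans h _.
by rewrite ler_wpM2r.
Qed.

(** The boundary cells contribute a variance linear in their number, negligible against [v k]. *)
Lemma Tk_close k (e : R) : 0 < v k -> 0 <= e -> (size (Bd k))%:R <= e * v k ->
  Ex (fun w => (Tk k w - Sk k w) ^+ 2) <= e * G.
Proof.
move=> v0 e0 hB.
have -> : (fun w => (Tk k w - Sk k w) ^+ 2) =
  fun w => (rk k * \sum_(i <- Bd k) eta k i w) ^+ 2.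
  by apply/funext => w; rewrite /Tk /Sk -mulrBr addrAC subrr add0r.
rewrite Ex_scal; last exact: L2_sum.
have h : Ex (fun w => (\sum_(i <- Bd k) eta k i w) ^+ 2) <= (size (Bd k))%:R * G.
  exact: (var_sum_le (eta2 k) g0 gG (uBd k)).
rewrite rk_sqr// ler_pdivrMl//; apply: le_trans h _.
by rewrite mulrCA mulrA ler_wpM2r.
Qed.

(** For a site whose ball of radius [m] lies in [In k], the row sum of covariances is [sig m] up to
    the tail [e1]. Each of the few other sites costs at most [2 * G] more, and [e3] pays for
    dividing by the volume instead of the number of sites. *)
Lemma Sk_var k m e1 e2 e3 : 0 < v k ->
  (forall i (s : seq 'rV[int]_D), uniq s -> \sum_(j <- s | (m < zd i j)%N) g (zd i j) <= e1) ->
  (size [seq i <- In k | ~~ all (fun z => z + i \in In k) (zball D m)])%:R <= e2 * v k ->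
  (size (Bd k))%:R <= e3 * v k ->
  `|Ex (fun w => Sk k w ^+ 2) - sig m| <= e1 + 2 * G * e2 + e3 * G.
Proof.
move=> v0 h1 h2 h3.
have e10 : 0 <= e1 by apply: le_trans (h1 0 [::] _); rewrite ?big_nil.
rewrite Ex_scal; last exact: L2_sum.
rewrite rk_sqr//.
under eq_Ex do rewrite expr2.
rewrite (Ex_sum_mul Z2).
have hi i : i \in In k -> `|\sum_(j <- In k) gam (j - i) - sig m| <=
    e1 + 2 * G * (~~ all (fun z => z + i \in In k) (zball D m))%:R.
  move=> ik; rewrite (gam_sum_split i _ m) addrAC.
  have t1 : `|\sum_(j <- In k | (m < zd i j)%N) gam (j - i)| <= e1.
    apply: le_trans (h1 i (In k) (uIn k)); apply: le_trans (ler_norm_sum _ _ _) _.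
    by apply: ler_sum => j _; exact: gam_le.
  have [/allP ha|_] := boolP (all _ _).
    rewrite gam_ball ?uIn//; first by rewrite subrr add0r mulr0 addr0.
    move=> j ij; have := ha (j - i); rewrite subrK; apply.
    by rewrite mem_zball -(zd_shift _ _ i) subrK add0r zdC.
  have t2 : `|\sum_(j <- In k | (zd i j <= m)%N) gam (j - i)| <= G.
    apply: le_trans (lsum_le i (fun j => (zd i j <= m)%N) (uIn k) g0 gG).
    apply: le_trans (ler_norm_sum _ _ _) _.
    by apply: ler_sum => j _; exact: gam_le.
  have t3 := sig_le m.
  rewrite mulr1; apply: le_trans (ler_normD _ _) _.
  by have := ler_normB (\sum_(j <- In k | (zd i j <= m)%N) gam (j - i)) (sig m); lra.
have hsum : `|\sum_(i <- In k) (\sum_(j <- In k) gam (j - i) - sig m)| <=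
   (size (In k))%:R * e1 + 2 * G * (e2 * v k).
  apply: le_trans (ler_norm_sum _ _ _) _.
  apply: (@le_trans _ _ (\sum_(i <- In k) (e1 + 2 * G *
      (~~ all (fun z => z + i \in In k) (zball D m))%:R))).
    by rewrite big_seq [leRHS]big_seq; apply: ler_sum => i; exact: hi.
  rewrite big_split /= big_const_seq iter_addr_0 count_predT.
  rewrite -[X in X + _ <= _]mulr_natl lerD2l -big_distrr /= ler_wpM2l ?mulr_ge0//.
  apply: le_trans h2; rewrite size_filter -sum1_count natr_sum.
  rewrite [leRHS]big_mkcond /=; apply: ler_sum => i _.
  by case: (all _ _).
have -> : \sum_(i <- In k) \sum_(j <- In k) Ex (fun w => Z i w * Z j w) =
   \sum_(i <- In k) (\sum_(j <- In k) gam (j - i) - sig m) + (size (In k))%:R * sig m.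
  rewrite sumrB big_const_seq iter_addr_0 count_predT -[sig m *+ _]mulr_natl subrK.
  by apply: eq_bigr => i _; apply: eq_bigr => j _.
move: hsum; set A := \sum_(i <- _) _ => hA.
have hn : `|(v k)^-1 * (size (In k))%:R - 1| <= e3.
  have -> : (v k)^-1 * (size (In k))%:R - 1 = ((size (In k))%:R - v k) / v k.
    by field; rewrite gt_eqF.
  rewrite normrM (@ger0_norm _ (v k)^-1) ?invr_ge0 ?(ltW v0)// ler_pdivrMr//.
  apply: le_trans h3; rewrite ler_norml.
  by have := v_In k; have := v_InBd k; have := ler0n R (size (Bd k)); lra.
have -> : (v k)^-1 * (A + (size (In k))%:R * sig m) - sig m =
  (v k)^-1 * A + ((v k)^-1 * (size (In k))%:R - 1) * sig m by ring.
apply: le_trans (ler_normD _ _) _; apply: lerD; last first.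
  by rewrite normrM ler_pM// sig_le.
rewrite normrM (@ger0_norm _ (v k)^-1) ?invr_ge0 ?(ltW v0)// ler_pdivrMl//.
apply: le_trans hA _; rewrite mulrDr; apply: lerD.
  by rewrite ler_wpM2r.
by rewrite mulrA mulrC.
Qed.

Lemma window_var : exists2 sg2 : R, 0 <= sg2 &
  forall e, 0 < e -> \forall k \near \oo, `|Ex (fun w => Sk k w ^+ 2) - sg2| <= e.
Proof.
have [sg2 hsg] := sig_cvg.
have h e : 0 < e -> \forall k \near \oo, `|Ex (fun w => Sk k w ^+ 2) - sg2| <= e.
  move=> e0; have e4 : 0 < e / 4 by rewrite divr_gt0.
  have G1 : 0 < 2 * G + 1 by rewrite ltr_wpDl// mulr_ge0.
  have eG : 0 < e / 4 / (2 * G + 1) by rewrite divr_gt0.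
  have [m1 hm1] := hsg _ e4; have [m2 hm2] := lsum_tail g0 gG e4.
  pose m := maxn m1 m2.
  near=> k.
  have v0 : 0 < v k by apply: (@lt_le_trans _ _ 1) => //; near: k; exact: v_large.
  have := @Sk_var k m (e / 4) (e / 4 / (2 * G + 1)) (e / 4 / (2 * G + 1)) v0
    (fun i s us => hm2 m i s (leq_maxr _ _) us) _ _.
  have -> : Ex (fun w => Sk k w ^+ 2) - sg2 =
    (Ex (fun w => Sk k w ^+ 2) - sig m) - (sg2 - sig m) by ring.
  move=> h; apply: le_trans (ler_normB _ _) _.
  have q1 := hm1 m (leq_maxl _ _).
  have q2 : `|Ex (fun w => Sk k w ^+ 2) - sig m| <=
     e / 4 + 2 * G * (e / 4 / (2 * G + 1)) + e / 4 / (2 * G + 1) * G.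
    by apply: h; near: k; [exact: bad_small|exact: Bd_small].
  have q3 : (2 * G + 1) * (e / 4 / (2 * G + 1)) = e / 4.
    by rewrite mulrCA mulfV ?mulr1// gt_eqF.
  have q4 : 0 <= e / 4 / (2 * G + 1) * G by rewrite mulr_ge0// ltW.
  move: q2 q3 q4; set c := e / 4 / (2 * G + 1) => q2 q3 q4.
  have q5 : 0 <= c := ltW eG.
  have q6 : c * G = G * c by rewrite mulrC.
  lra.
exists sg2 => //; rewrite leNgt; apply/negP => s0.
have hs : 0 < - sg2 / 2 by rewrite divr_gt0// oppr_gt0.
have [k _ /(_ k (leqnn _)) hk] := h _ hs.
have := @Ex_ge0 _ _ _ P (fun w => Sk k w ^+ 2) (fun w => sqr_ge0 _).
by move: hk; rewrite ler_norml => /andP[]; lra.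
Unshelve. all: by end_near.
Qed.

(** The inner sum obeys the field limit theorem because its scale [rk k] tends to 0. Its variance
    can be replaced by the limit [sg2], and the boundary part is negligible in mean square. *)
Lemma window_clt : exists2 sg2 : R, 0 <= sg2 &
  (forall e, 0 < e -> \forall k \near \oo, `|Ex (fun w => Tk k w ^+ 2) - sg2| <= e) /\
  (forall th e, 0 < e -> \forall k \near \oo,
    `|Ex (fun w => cos (Tk k w + th)) - cos th * expR (- (sg2 / 2))| <= e).
Proof.
have [sg2 sg0 hsg] := window_var.
pose K := Num.sqrt (2 * G + 2).
have K0 : 0 <= K by exact: sqrtr_ge0.
have K2 : K ^+ 2 = 2 * G + 2 by rewrite sqr_sqrtr// addr_ge0// mulr_ge0.
have near_close (e : R) : 0 < e -> \forall k \near \oo,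
    Ex (fun w => (Tk k w - Sk k w) ^+ 2) <= e ^+ 2.
  move=> e0; have G1 : 0 < G + 1 by rewrite ltr_wpDl.
  have eG : 0 < e ^+ 2 / (G + 1) by rewrite divr_gt0// exprn_gt0.
  near=> k.
  have v0 : 0 < v k by apply: (@lt_le_trans _ _ 1) => //; near: k; exact: v_large.
  have := @Tk_close k _ v0 (ltW eG) _; move=> h.
  apply: (@le_trans _ _ (e ^+ 2 / (G + 1) * G)).
    by apply: h; near: k; exact: Bd_small.
  rewrite mulrAC ler_pdivrMr// ler_wpM2l ?sqr_ge0//; lra.
exists sg2 => //; split => [e e0|th e e0].
  have eta0 : 0 < Num.min 1 (e / 2 / (2 * K + 1)).
    by rewrite lt_min ltr01 /= !divr_gt0// ltr_wpDl// mulr_ge0.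
  have e2 : 0 < e / 2 by rewrite divr_gt0.
  near=> k.
  have v0 : 0 < v k by apply: (@lt_le_trans _ _ 1) => //; near: k; exact: v_large.
  have hS : Ex (fun w => Sk k w ^+ 2) <= K ^+ 2.
    by apply: le_trans (Sk_var_le v0) _; rewrite K2; have := G0; lra.
  have hc : Ex (fun w => (Tk k w - Sk k w) ^+ 2) <= Num.min 1 (e / 2 / (2 * K + 1)) ^+ 2.
    by near: k; exact: near_close.
  have hT : Ex (fun w => Tk k w ^+ 2) <= K ^+ 2.
    (* A crude bound on the second moment of [Tk] is enough for [second_moment_close]; the 2 in
       [K ^+ 2 = 2 * G + 2] leaves room for it. *)
    have c1 : Ex (fun w => (Tk k w - Sk k w) ^+ 2) <= 1.
      apply: le_trans hc _; rewrite expr_le1// ?ge_min ?lexx//.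
      exact: ltW.
    have [_ i1] := L2B (Tk_L2 k) (Sk_L2 k); have [_ i2] := Sk_L2 k.
    apply: (@le_trans _ _ (Ex (fun w => 2 * (Tk k w - Sk k w) ^+ 2 + 2 * Sk k w ^+ 2))).
      apply: le_Ex; first by have [] := Tk_L2 k.
        by apply: igD; exact: igZ.
      by move=> w; have := sqr_ge0 (Tk k w - 2 * Sk k w); move: (Tk k w) (Sk k w) => x y; nra.
    rewrite ExD ?ExZ//; [|exact: igZ|exact: igZ].
    by rewrite K2; have := Sk_var_le v0; have := G0; lra.
  have h1 := second_moment_close (Tk_L2 k) (Sk_L2 k) (ltW eta0) K0 hc hT hS.
  have h2 : `|Ex (fun w => Sk k w ^+ 2) - sg2| <= e / 2 by near: k; exact: hsg.
  have h3 : 2 * K * Num.min 1 (e / 2 / (2 * K + 1)) <= e / 2.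
    apply: (@le_trans _ _ (2 * K * (e / 2 / (2 * K + 1)))).
      by rewrite ler_wpM2l ?mulr_ge0// ge_min lexx orbT.
    rewrite mulrCA ler_piMr// ?(ltW e2)// ler_pdivrMr ?mul1r; last by rewrite ltr_wpDl// mulr_ge0.
    by rewrite lerDl.
  have -> : Ex (fun w => Tk k w ^+ 2) - sg2 = (Ex (fun w => Tk k w ^+ 2)
    - Ex (fun w => Sk k w ^+ 2)) + (Ex (fun w => Sk k w ^+ 2) - sg2) by ring.
  by apply: le_trans (ler_normD _ _) _; lra.
have e3 : 0 < e / 3 by rewrite divr_gt0.
have [rho rho0 hrho] := clt e3.
near=> k.
have v0 : 0 < v k by apply: (@lt_le_trans _ _ 1) => //; near: k; exact: v_large.
have h1 := charfun_close th (Tk_L2 k) (Sk_L2 k) (ltW e3).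
have {}h1 : `|Ex (fun w => cos (Tk k w + th)) - Ex (fun w => cos (Sk k w + th))| <= e / 3.
  by apply: h1; near: k; exact: near_close.
have rk0 : 0 < rk k by rewrite invr_gt0 sqrtr_gt0.
have rkrho : rk k <= rho.
  rewrite /rk invf_ple ?posrE ?sqrtr_gt0//.
  rewrite -(@ger0_norm _ rho^-1) ?invr_ge0 ?(ltW rho0)// -sqrtr_sqr ler_wsqrtr//.
  by near: k; exact: v_large.
have rs : rk k ^+ 2 * (size (In k))%:R <= 2.
  by rewrite rk_sqr// ler_pdivrMl//; have := v_In k; lra.
have h2 := hrho (In k) (rk k) th (uIn k) rk0 rkrho rs.
have h3 : `|Ex (fun w => Sk k w ^+ 2) - sg2| <= e / 3 by near: k; exact: hsg.
have h4 : `|cos th * expR (- (Ex (fun w => Sk k w ^+ 2) / 2)) - cos th * expR (- (sg2 / 2))| <= e / 3.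
  rewrite -mulrBr normrM; apply: (@le_trans _ _ (1 * (e / 3))); last by rewrite mul1r.
  apply: ler_pM => //; first by rewrite ler_norml cos_geN1 cos_le1.
  apply: le_trans (expRN_lipschitz _ _) _.
  - by rewrite divr_ge0// Ex_ge0// => w; exact: sqr_ge0.
  - by rewrite divr_ge0.
  rewrite -mulrBl normrM (@ger0_norm _ 2^-1) ?invr_ge0//.
  by apply: le_trans h3; rewrite ler_pdivrMr// ler_peMr// ler1n.
pose a := Ex (fun w => cos (Tk k w + th)); pose b := Ex (fun w => cos (Sk k w + th)).
pose c := cos th * expR (- (sg2 / 2)).
pose f := cos th * expR (- (Ex (fun w => Sk k w ^+ 2) / 2)).
rewrite -/a -/b -/c -/f in h1 h2 h4 *.
have -> : a - c = (a - b) + (b - f) + (f - c) by ring.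
have h5 : `|b - f| <= e / 3 by exact: h2.
have := ler_normD (a - b) (b - f); have := ler_normD (a - b + (b - f)) (f - c).
lra.
Unshelve. all: by end_near.
Qed.

End window.

(** * Limit theorem for truncated cell counts *)

Section mpp_truncated.
Context {R : realType} {dO : measure_display} {Omega : measurableType dO}.
Context {d : nat} {M : ptopologicalType}.
Variable P : probability Omega R.
Local Notation E := (borel 'rV[R]_d * borel M)%type.
Local Notation rV := (borel 'rV[R]_d).
Variable X : R.-ker Omega ~> E.
Hypothesis d0 : (0 < d)%N.
Hypothesis mppX : marked_point_process X.
Hypothesis statX : stationary P X.
Variables (bs : R -> R) (delta : R).
Hypothesis delta0 : 0 < delta.
Hypothesis hmom :
  (\int[P]_w ((X w (cube `[0%R, 1%R] `*` setT)) `^ (2 + delta)) < +oo)%E.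
Hypothesis bs0 : forall r, 2^-1 <= r -> 0 <= bs r.
Hypothesis bs_mono : forall r s, 2^-1 <= r -> r <= s -> bs s <= bs r.
Hypothesis bs_int : (\int[lebesgue_measure]_(r in `[1%R, +oo[)
         (r ^+ d.-1 * (bs r) `^ (delta / (2 + delta)))%:E < +oo)%E.
Hypothesis hcoef : forall a b : R, 2^-1 <= a -> a <= b ->
  (beta_mixing P (sigma_restr X (cube `[(- a)%R, a]))
     (sigma_restr X (~` cube `[(- (a + b))%R, (a + b)%R])) <= (bs b)%:E)%E.
Variables (n : nat) (a : 'I_n -> R) (C : 'I_n -> set (borel M)).
Hypothesis mC : forall i, measurable (C i).

Local Notation Ex := (Ex P).
Local Notation th := (delta / (2 + delta)).
Local Notation xi := (fun z => Xi X a C (cell 1 z)).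
Local Notation near_cube m := (cube `[(- (m%:R + 2^-1))%R, (m%:R + 2^-1)%R] : set 'rV[R]_d).
Local Notation far_cube p := (~` cube `[(- p%:R)%R, p%:R] : set 'rV[R]_d).

Lemma cov_cells j m p (f g : Omega -> R) cf cg : (2 * m < p)%N ->
  loc X (zc j) (near_cube m) f -> loc X (zc j) (far_cube p) g ->
  (forall w, `|f w| <= cf) -> (forall w, `|g w| <= cg) ->
  `|Ex (fun w => f w * g w) - Ex f * Ex g| <= 2 * bsn bs (p - m) * cf * cg.
Proof.
move=> mp lf lg hf hg.
apply: (loc_cov_bounded statX _ _ (hcoef_cells hcoef mp) lf lg hf hg).
- exact: measurable_cube.
- by apply: measurableC; exact: measurable_cube.
Qed.

Lemma cov_bounded (f g : Omega -> R) cf cg :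
  measurable_fun setT f -> measurable_fun setT g ->
  (forall w, `|f w| <= cf) -> (forall w, `|g w| <= cg) ->
  `|Ex (fun w => f w * g w) - Ex f * Ex g| <= 2 * cf * cg.
Proof.
move=> mf mg hf hg.
have cf0 : 0 <= cf by apply: le_trans (hf point).
have cg0 : 0 <= cg by apply: le_trans (hg point).
apply: le_trans (ler_normB _ _) _.
have h1 : `|Ex (fun w => f w * g w)| <= cf * cg.
  apply: norm_Ex_bound; first exact: measurable_funM.
  by move=> w; rewrite normrM ler_pM.
have h2 : `|Ex f * Ex g| <= cf * cg by rewrite normrM ler_pM ?norm_Ex_bound.
lra.
Qed.

Lemma measurable_xi z : measurable_fun setT (xi z).
Proof. by apply: measurable_Xi => //; exact: measurable_cell. Qed.

Definition txi (L : R) z : Omega -> R := ctr P (fun w => trunc L (xi z w)).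

Lemma measurable_txi L z : measurable_fun setT (txi L z).
Proof.
apply: measurable_funB => //.
exact: (measurableT_comp (@measurable_trunc _ L) (measurable_xi z)).
Qed.

Lemma txi_le L z w : 0 <= L -> `|txi L z w| <= 2 * L.
Proof.
move=> L0; apply: le_trans (ler_normB _ _) _.
have h1 := trunc_le (xi z w) L0.
have h2 : `|Ex (fun w => trunc L (xi z w))| <= L.
  apply: norm_Ex_bound => [|w']; last exact: trunc_le.
  exact: (measurableT_comp (@measurable_trunc _ L) (measurable_xi z)).
by rewrite mulr2n mulrDl mul1r lerD.
Qed.

Lemma txi_near L j i m : (zd j i <= m)%N -> loc X (zc j) (near_cube m) (txi L i).
Proof.
move=> ji; apply: locB; apply: loc_comp; first exact: measurable_trunc.
by apply: Xi_loc => //; [exact: measurable_cell|move=> x; exact: cell_near].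
Qed.

Lemma txi_far L j i p : (p < zd j i)%N -> loc X (zc j) (far_cube p) (txi L i).
Proof.
move=> ji; apply: locB; apply: loc_comp; first exact: measurable_trunc.
by apply: Xi_loc => //; [exact: measurable_cell|move=> x; exact: cell_far].
Qed.

Lemma Ex_txi L z : 0 <= L -> Ex (txi L z) = 0.
Proof.
move=> L0; apply: Ex_ctr; apply: bm_ig; split.
  exact: (measurableT_comp (@measurable_trunc _ L) (measurable_xi z)).
by exists L => w; exact: trunc_le.
Qed.

Lemma measurable_sum_txi L (s : seq 'rV[int]_d) :
  measurable_fun setT (fun w => \sum_(i <- s) txi L i w).
Proof. by apply: measurable_sum => i; exact: measurable_txi. Qed.

(** Verifies the two decoupling hypotheses of [bounded_field_clt] from mixing, with outer radius
    [3 * m.+1]: this leaves between the near sites and the far ones a gap at least as large as the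
    near neighbourhood. *)
Lemma txi_clt (L e : R) : 0 < L -> 0 < e -> exists2 rho, 0 < rho &
  forall (s : seq 'rV[int]_d) (r th : R),
  uniq s -> 0 < r -> r <= rho -> r ^+ 2 * (size s)%:R <= 2 ->
  `|Ex (fun w => cos (r * (\sum_(i <- s) txi L i w) + th))
    - cos th * expR (- (r ^+ 2 * Ex (fun w => (\sum_(i <- s) txi L i w) ^+ 2) / 2))| <= e.
Proof.
move=> L0 e0.
(* With variables bounded by [2 * L], the first decoupling costs [4 * L] times the rate and the
   second [8 * L ^+ 2] times the rate and the number of near sites. *)
pose c : R := 4 * L + 8 * L ^+ 2.
have LL : 0 < L ^+ 2 by rewrite exprn_gt0.
have c0 : 0 < c by rewrite addr_gt0// mulr_gt0.
have [G hG] := gX_bounded P X d0 delta0 bs0 bs_mono bs_int a.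
have b0 m : 0 <= c * bsn bs m by rewrite mulr_ge0 ?bsn_ge0// ltW.
apply: (@bounded_field_clt _ _ _ P d (txi L) (2 * L) (gX P X bs delta a)
   (fun m => c * bsn bs m) G 2 d0 _ _ _ hG) => //.
- move=> i; split; first exact: measurable_txi.
  by exists (2 * L) => w; apply: txi_le; exact: ltW.
- by move=> i w; apply: txi_le; exact: ltW.
- by move=> k; exact: gX_ge0.
- move=> i j; rewrite /txi Ex_ctrM.
  + apply: (field_cov mppX statX delta0 hmom bs0 hcoef) => //; try exact: measurable_cell.
    * exact: measurable_trunc.
    * exact: trunc_norm_le.
    * exact: measurable_trunc.
    * exact: trunc_norm_le.
  + apply: (Xi_L2 mppX statX delta0 hmom) (@trunc_norm_le _ L) => //.
    * exact: measurable_cell.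
    * exact: subset_refl.
    * exact: measurable_trunc.
  + apply: (Xi_L2 mppX statX delta0 hmom) (@trunc_norm_le _ L) => //.
    * exact: measurable_cell.
    * exact: subset_refl.
    * exact: measurable_trunc.
- move=> e' e'0.
  have th1 : th <= 1 by rewrite ler_pdivrMr ?addr_gt0// mul1r lerDr.
  have [m0 hm] := bsn_decay d0 (divr_gt0 delta0 (addr_gt0 (ltr0Sn R 1) delta0)) th1 bs0 bs_mono bs_int (divr_gt0 e'0 c0).
  exists m0 => m mm; rewrite mulrCA mulrC -ler_pdivlMr//; exact: hm.
- move=> j m s u mu u1 far.
  have mus : measurable_fun setT (fun w => u (\sum_(i <- s) txi L i w)).
    exact: (measurableT_comp mu (measurable_sum_txi L s)).
  have L00 := ltW L0.
  have -> : Ex (fun w => txi L j w * u (\sum_(i <- s) txi L i w)) =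
      Ex (fun w => txi L j w * u (\sum_(i <- s) txi L i w))
      - Ex (txi L j) * Ex (fun w => u (\sum_(i <- s) txi L i w)).
    by rewrite Ex_txi// mul0r subr0.
  (* At radius 0 there is no gap to exploit; the rate is 1 and the trivial covariance bound
     applies. *)
  case: m far => [|m] far.
    apply: le_trans (cov_bounded (measurable_txi L j) mus (fun w => txi_le j w L00) (fun w => u1 _)) _.
    by rewrite /= mulr1 /c; lra.
  apply: (@le_trans _ _ (2 * bsn bs (m.+1 - 0) * (2 * L) * 1)).
    apply: (cov_cells (j := j) (m := 0) (p := m.+1)) => //.
    + by apply: txi_near; rewrite zdii.
    + apply: loc_comp => //; apply: loc_sum => i si; apply: txi_far; exact: far.
    + by move=> w; exact: txi_le.
  rewrite subn0 mulr1; have := bsn_ge0 bs0 m.+1; rewrite /c.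
  by set x := bsn _ _; nra.
- move=> j m s1 s2 u mu u1 us1 nr far.
  have L00 := ltW L0.
  have mus : measurable_fun setT (fun w => u (\sum_(i <- s2) txi L i w)).
    exact: (measurableT_comp mu (measurable_sum_txi L s2)).
  have ms1 : measurable_fun setT (fun w => txi L j w * \sum_(i <- s1) txi L i w).
    by apply: measurable_funM; [exact: measurable_txi|exact: measurable_sum_txi].
  have s1le : (size s1)%:R <= (2 * m).+1%:R ^+ d :> R.
    by rewrite -natrX ler_nat; apply: (size_zd_le (i := j)).
  have b1 w : `|txi L j w * \sum_(i <- s1) txi L i w| <=
      (2 * L) * ((2 * m).+1%:R ^+ d * (2 * L)).
    rewrite normrM ler_pM//; first exact: txi_le.
    apply: (@le_trans _ _ ((size s1)%:R * (2 * L))).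
      apply: le_trans (ler_norm_sum _ _ _) _.
      rewrite mulr_natl -(count_predT s1) -iter_addr_0 -big_const_seq.
      by apply: ler_sum => i _; exact: txi_le.
    by rewrite ler_wpM2r// mulr_ge0.
  have q0 : 0 <= (2 * m).+1%:R ^+ d :> R by rewrite exprn_ge0.
  case: m nr far s1le b1 q0 => [|m] nr far s1le b1 q0.
    apply: le_trans (cov_bounded ms1 mus b1 (fun w => u1 _)) _.
    rewrite /= mulr1; move: q0; set q := _ ^+ d; rewrite /c; nra.
  (* The gap condition of [hcoef_cells]. The resulting rate at [3 * m.+2 - m.+1] is no larger than
     the one at [m.+1]. *)
  have mm : (2 * m.+1 < 3 * m.+2)%N by clear; lia.
  apply: (@le_trans _ _ (2 * bsn bs (3 * m.+2 - m.+1) *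
     ((2 * L) * ((2 * m.+1).+1%:R ^+ d * (2 * L))) * 1)).
    apply: (cov_cells (j := j) mm) => //.
    + apply: locM; first by apply: txi_near; rewrite zdii.
      by apply: loc_sum => i si; apply: txi_near; exact: nr.
    + by apply: loc_comp => //; apply: loc_sum => i si; apply: txi_far; exact: far.
  have h : bsn bs (3 * m.+2 - m.+1) <= bsn bs m.+1.
    by apply: bsn_mono => //; clear; lia.
  rewrite mulr1; have := bsn_ge0 bs0 m.+1; have := bsn_ge0 bs0 (3 * m.+2 - m.+1).
  move: h q0; set x := bsn _ _; set y := bsn _ _; set q := _ ^+ d => h q0 x0 y0.
  apply: (@le_trans _ _ (q * (8 * L ^+ 2 * y))); last first.
    by rewrite ler_wpM2l// ler_wpM2r// /c lerDr mulr_ge0// ltW.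
  have -> : 2 * x * (2 * L * (q * (2 * L))) = q * (8 * L ^+ 2 * x) by ring.
  by rewrite ler_wpM2l// ler_wpM2l// mulr_ge0// ltW.
Qed.

End mpp_truncated.

(** * Inner and boundary cells of a convex averaging sequence *)

Lemma dilation_small (R : realType) (d : nat) (e : R) : 0 < e ->
  exists2 eps0 : R, 0 < eps0 & forall x, 0 <= x -> x <= eps0 ->
    (1 + x) ^+ d - (1 - x) ^+ d <= e.
Proof.
move=> e0.
have c1 : (fun x : R => (1 + x) ^+ d - (1 - x) ^+ d) @ 0 --> (1 + 0) ^+ d - (1 - 0 : R) ^+ d.
  apply: cvgB.
    apply: (@continuous_comp _ _ _ (fun x : R => 1 + x) (fun y => y ^+ d)); last exact: exprn_continuous.
    by apply: cvgD; [exact: cvg_cst|exact: cvg_id].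
  apply: (@continuous_comp _ _ _ (fun x : R => 1 - x) (fun y => y ^+ d)); last exact: exprn_continuous.
  by apply: cvgB; [exact: cvg_cst|exact: cvg_id].
rewrite addr0 subr0 subrr in c1.
have /cvgr0Pnorm_le /(_ _ e0) /nbhs_ballP[r /= r0 hr] := c1.
exists (r / 2); first by rewrite divr_gt0.
move=> x x0 xr; apply: le_trans (ler_norm _) _; apply: hr.
rewrite /ball /= sub0r normrN ger0_norm//; lra.
Qed.

Section window_cells.
Context {R : realType} {d : nat}.
Local Notation rV := (borel 'rV[R]_d).
Hypothesis d0 : (0 < d)%N.

Lemma cell_point (z : 'rV[int]_d) : cell 1 z (map_mx intr z : 'rV[R]_d).
Proof. by apply/cellP => i; rewrite !mxE mul1r lexx /= ltr_int; lia. Qed.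

Lemma cube_eball (x y : 'rV[R]_d) (c : R) : 0 <= c ->
  (forall i, `|y 0 i - x 0 i| <= c) -> eball x (c * d%:R) y.
Proof.
move=> c0 h; rewrite /eball /=.
have cd : 0 <= c * d%:R by rewrite mulr_ge0.
rewrite -[leRHS](ger0_norm cd) -sqrtr_sqr ler_wsqrtr//.
apply: (@le_trans _ _ (\sum_(i < d) c ^+ 2)).
  apply: ler_sum => i _; rewrite -(real_normK (num_real (_ - _))).
  by rewrite lerXn2r ?nnegrE.
rewrite sumr_const card_ord -[leLHS]mulr_natr exprMn ler_wpM2l ?sqr_ge0//.
by rewrite expr2 ler_peMr// ler1n.
Qed.

Lemma inradius_ball (W : nat -> set 'rV[R]_d) : convex_averaging_sequence W ->
  forall A : R, \forall k \near \oo, exists r (x0 : 'rV[R]_d),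
    [/\ A < r, 0 < r, W k x0 & eball x0 r `<=` W k].
Proof.
move=> [_ _ _ /cvgeyPge h] A.
near=> k.
have : ((A + 1)%:E <= inradius (W k))%E by near: k; exact: h.
move=> hk; have : (A%:E < inradius (W k))%E.
  by apply: lt_le_trans hk; rewrite lte_fin ltrDl.
move=> /ereal_sup_gt[_ [r [r0 [x Wx hx]] <-]]; rewrite lte_fin => Ar.
by exists r, x.
Unshelve. all: by end_near.
Qed.

Definition innerb (W : set 'rV[R]_d) (z : 'rV[int]_d) : bool := `[< cell 1 z `<=` W >].

Section measure.
Variables (mu0 : {measure set rV -> \bar R}) (lam0 : R).
Hypothesis lam00 : 0 < lam0.
Hypothesis mu0_cell : forall N z, (0 < N)%N -> mu0 (cell N z) = (lam0 / N%:R ^+ d)%:E.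
Variables (W : nat -> set 'rV[R]_d) (s : nat -> seq 'rV[int]_d).
Hypothesis casW : convex_averaging_sequence W.
Hypothesis us : forall k, uniq (s k).
Hypothesis hs : forall k, outer (W k) 1 = \bigcup_(z in [set` s k]) cell 1 z.

Definition Ins k := [seq z <- s k | innerb (W k) z].
Definition Bds k := [seq z <- s k | ~~ innerb (W k) z].

Let cW k : compact (W k). Proof. by have [] := casW. Qed.

Let mu0W k : mu0 (W k) = (lam0 * vol (W k))%:E.
Proof. by have [_] := lebesgue_compact d0 lam00 mu0_cell (@cW k); exact. Qed.

Let mu0s (t : seq 'rV[int]_d) : uniq t ->
  mu0 (\bigcup_(z in [set` t]) cell 1 z) = ((size t)%:R * lam0)%:E.
Proof. by move=> ut; rewrite (mu_cells mu0_cell (ltn0Sn 0) ut) expr1n divr1. Qed.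

Let mcells (t : seq 'rV[int]_d) : measurable (\bigcup_(z in [set` t]) cell 1 z : set rV).
Proof. by apply: (@fin_bigcup_measurable _ rV) => // z _; exact: measurable_cell. Qed.

Lemma Ins_vol k : (size (Ins k))%:R <= vol (W k).
Proof.
rewrite -(ler_pM2r lam00) [leRHS]mulrC -lee_fin -mu0W -mu0s ?filter_uniq//.
apply: le_measure; rewrite ?inE; [exact: mcells|exact: borel_compact|].
by move=> x [z /=]; rewrite mem_filter => /andP[/asboolP h _]; exact: h.
Qed.

Lemma vol_InsBds k : vol (W k) <= (size (Ins k))%:R + (size (Bds k))%:R.
Proof.
rewrite -natrD !size_filter count_predC.
rewrite -(ler_pM2r lam00) [leLHS]mulrC -lee_fin -mu0W -mu0s//.
apply: le_measure; rewrite ?inE; [exact: borel_compact|exact: mcells|].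
by rewrite -hs; exact: sub_outer.
Qed.

Lemma mem_s k z x : cell 1 z x -> W k x -> z \in s k.
Proof.
move=> zx Wx; have : outer (W k) 1 x by exact: sub_outer.
by rewrite hs => -[z' /= z's xz']; rewrite -zx xz'.
Qed.

Lemma s_meets k z : z \in s k -> exists2 x, cell 1 z x & W k x.
Proof.
move=> zs; have : outer (W k) 1 (map_mx intr z).
  by rewrite hs; exists z => //; exact: cell_point.
move=> [y Wy e]; exists y => //; rewrite /cell /= -e; exact: cell_point.
Qed.

(** In [boundary_count] the relative width [(m + 1) d / r] tends to 0 with the inradius, and with it
    the fraction of cells near the boundary. One threshold on [k] serves every list [t]. *)
Lemma boundary_small m e : 0 < e -> \forall k \near \oo,
  forall t : seq 'rV[int]_d, uniq t ->
  (forall z, z \in t -> z \in s k /\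
     (exists2 j, (zd z j <= m)%N & exists2 q, cell 1 j q & ~ W k q)) ->
  (size t)%:R <= e * vol (W k).
Proof.
move=> e0; have [eps0 eps00 heps] := dilation_small d e0.
pose c := m.+1%:R * d%:R : R.
have c0 : 0 < c by rewrite mulr_gt0// ltr0n.
near=> k => t ut ht.
have [r [x0 [Ar r0 Wx hx]]] : exists r (x0 : 'rV[R]_d),
    [/\ c / eps0 + c < r, 0 < r, W k x0 & eball x0 r `<=` W k].
  by near: k; exact: inradius_ball.
have h1 : c / r <= eps0.
  rewrite ler_pdivrMr// -ler_pdivrMl// mulrC ltW//; lra.
have h2 : c / r < 1.
  rewrite ltr_pdivrMr// mul1r; apply: lt_trans Ar; rewrite ltrDr divr_gt0//.
have convW : convex_set (W k : set (convex_lmodType 'rV[R]_d)) by have [] := casW.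
have := boundary_count d0 lam00 mu0_cell (@cW k) convW Wx r0 hx h2 ut.
move=> h; apply: le_trans (h _) _.
  by move=> z /ht[zs hz]; split => //; exact: s_meets.
rewrite ler_wpM2r ?vol_ge0//; apply: heps => //.
by rewrite divr_ge0// ltW.
Unshelve. all: by end_near.
Qed.

Lemma Bds_small e : 0 < e -> \forall k \near \oo, (size (Bds k))%:R <= e * vol (W k).
Proof.
move=> e0; near=> k.
have : forall t : seq 'rV[int]_d, uniq t ->
  (forall z, z \in t -> z \in s k /\
     (exists2 j, (zd z j <= 0)%N & exists2 q, cell 1 j q & ~ W k q)) ->
  (size t)%:R <= e * vol (W k) by near: k; exact: boundary_small.
apply; first exact: filter_uniq.
move=> z; rewrite mem_filter => /andP[/asboolPn h zs]; split => //.
exists z; first by rewrite zdii.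
by move: h => /existsNP[q /not_implyP[]]; exists q.
Unshelve. all: by end_near.
Qed.

(** An inner cell with a non-inner cell within distance [m] is near the complement of the window, so
    it is counted by [boundary_small]. *)
Lemma bad_Ins_small m e : 0 < e -> \forall k \near \oo,
  (size [seq i <- Ins k | ~~ all (fun z => z + i \in Ins k) (zball d m)])%:R <= e * vol (W k).
Proof.
move=> e0; near=> k.
have : forall t : seq 'rV[int]_d, uniq t ->
  (forall z, z \in t -> z \in s k /\
     (exists2 j, (zd z j <= m)%N & exists2 q, cell 1 j q & ~ W k q)) ->
  (size t)%:R <= e * vol (W k) by near: k; exact: boundary_small.
apply; first by rewrite !filter_uniq.
move=> i; rewrite mem_filter => /andP[/allPn[z zm zi]].
rewrite mem_filter => /andP[_ si]; split => //.
exists (z + i).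
  by rewrite zdC -{2}[i]add0r zd_shift -mem_zball.
have nW : ~ (cell 1 (z + i) `<=` W k).
  move=> h; move: zi; rewrite mem_filter => /negP; apply; apply/andP; split.
    exact/asboolP.
  apply: (mem_s (cell_point _)); apply: h; exact: cell_point.
by move: nW => /existsNP[q /not_implyP[]]; exists q.
Unshelve. all: by end_near.
Qed.

(** A ball of radius beyond [(m + 1) d] contains all the [(2 m + 1)^d] cells around the cell of its
    centre. *)
Lemma vol_large A : \forall k \near \oo, A <= vol (W k).
Proof.
pose m := (Num.truncn `|A|).+1.
near=> k.
have [r [x0 [Ar r0 Wx hx]]] : exists r (x0 : 'rV[R]_d),
    [/\ m.+1%:R * d%:R < r, 0 < r, W k x0 & eball x0 r `<=` W k].
  by near: k; exact: inradius_ball.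
pose z := fl 1 x0.
have sub : {subset [seq j + z | j <- zball d m] <= Ins k}.
  move=> _ /mapP[j jm ->].
  have h : cell 1 (j + z) `<=` W k.
    move=> q qj; apply: hx.
    have : eball x0 (m.+1%:R * d%:R) q.
      apply: cube_eball => // i.
      have /cellP/(_ i) := qj; have /cellP/(_ i) : cell 1 z x0 by [].
      rewrite !mul1r !mxE !intrD => /andP[h1 h2] /andP[h3 h4].
      have : `|(j 0 i)%:~R| <= m%:R :> R.
        rewrite -intr_norm -[m%:R]/((m%:Z)%:~R) ler_int.
        move: jm; rewrite mem_zball => /zdP/(_ i); rewrite mxE.
        by move: (j 0 i) => u; lia.
      rewrite ler_norml => /andP[h5 h6]; rewrite -[m.+1%:R]natr1 ler_norml.
      by apply/andP; split; lra.
    by rewrite /eball /= => /le_trans; apply; exact: ltW.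
  rewrite mem_filter; apply/andP; split; first exact/asboolP.
  apply: (mem_s (cell_point _)); apply: h; exact: cell_point.
apply: le_trans (Ins_vol k).
have usz : uniq [seq j + z | j <- zball d m].
  by rewrite map_inj_uniq ?zball_uniq//; exact: addIr.
have := uniq_leq_size usz sub; rewrite size_map size_zball => hle.
apply: (@le_trans _ _ m%:R).
  by apply: le_trans (ler_norm _) _; apply: ltW; exact: truncnS_gt.
rewrite ler_nat; apply: leq_trans hle.
apply: (@leq_trans (2 * m).+1); first by lia.
by rewrite -{1}(expn1 (2 * m).+1) leq_pexp2l.
Unshelve. all: by end_near.
Qed.

End measure.
End window_cells.

(** * Limit theorem for weighted counts in the windows *)

Section mpp_clt.
Context {R : realType} {dO : measure_display} {Omega : measurableType dO}.
Context {d : nat} {M : ptopologicalType}.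
Variable P : probability Omega R.
Local Notation E := (borel 'rV[R]_d * borel M)%type.
Local Notation rV := (borel 'rV[R]_d).
Variable X : R.-ker Omega ~> E.
Hypothesis d0 : (0 < d)%N.
Hypothesis mppX : marked_point_process X.
Hypothesis statX : stationary P X.
Hypothesis intensity_gt0 : (0 < intensity P X)%E.
Hypothesis intensity_fin : (intensity P X < +oo)%E.
Variables (bs : R -> R) (delta : R).
Hypothesis delta0 : 0 < delta.
Hypothesis hmom :
  (\int[P]_w ((X w (cube `[0%R, 1%R] `*` setT)) `^ (2 + delta)) < +oo)%E.
Hypothesis bs0 : forall r, 2^-1 <= r -> 0 <= bs r.
Hypothesis bs_mono : forall r s, 2^-1 <= r -> r <= s -> bs s <= bs r.
Hypothesis bs_int : (\int[lebesgue_measure]_(r in `[1%R, +oo[)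
         (r ^+ d.-1 * (bs r) `^ (delta / (2 + delta)))%:E < +oo)%E.
Hypothesis hcoef : forall a b : R, 2^-1 <= a -> a <= b ->
  (beta_mixing P (sigma_restr X (cube `[(- a)%R, a]))
     (sigma_restr X (~` cube `[(- (a + b))%R, (a + b)%R])) <= (bs b)%:E)%E.
Variables (n : nat) (a : 'I_n -> R) (C : 'I_n -> set (borel M)).
Hypothesis mC : forall i, measurable (C i).

Local Notation Ex := (Ex P).
Local Notation xi := (fun z => Xi X a C (cell 1 z)).

Lemma xi_sub_L2 (B : set rV) z : measurable B -> B `<=` cell 1 z -> L2 P (Xi X a C B).
Proof.
move=> mB Bz.
exact: (Xi_L2 mppX statX delta0 hmom a mC mB Bz (@measurable_id _ _ setT) (fun x => lexx _)).
Qed.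

Lemma xi_L2 z : L2 P (xi z).
Proof. by apply: (xi_sub_L2 (z := z)) => //; exact: measurable_cell. Qed.

Lemma xi_cov (B B' : set rV) i j : measurable B -> measurable B' ->
  B `<=` cell 1 i -> B' `<=` cell 1 j ->
  `|Ex (fun w => ctr P (Xi X a C B) w * ctr P (Xi X a C B') w)| <= gX P X bs delta a (zd i j).
Proof.
move=> mB mB' Bi Bj; rewrite Ex_ctrM; [|exact: xi_sub_L2 mB Bi|exact: xi_sub_L2 mB' Bj].
exact: (field_cov (u := id) (v := id) mppX statX delta0 hmom bs0 hcoef a mC mB mB' Bi Bj).
Qed.

(** The functional behind [Xi], written on [EV] so that stationarity can be applied to it. *)
Definition XiE (B : set rV) (mu : @EV R d M) : R :=
  \sum_i a i * fine (mu (B `*` C i)).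

Lemma measurable_XiE (B : set rV) : measurable B -> measurable_fun setT (XiE B).
Proof.
move=> mB; apply: measurable_sum => i; apply: measurable_funM => //.
by apply: measurableT_comp => //; apply: measurable_eval; exact: measurableX.
Qed.

Lemma xi_sh i j w : xi j w = XiE (cell 1 (j - i)) (sh (map_mx intr i) (X w)).
Proof.
rewrite /Xi /XiE /sh /pushforward; apply: eq_bigr => k _; congr (_ * fine (X w _)).
have e (x : 'rV[R]_d) : x - map_mx intr i - map_mx intr (j - i) = x - map_mx intr j.
  by apply/rowP => u; rewrite !mxE intrB; ring.
apply/seteqP; split => -[x m] [/= h hC]; split => //=.
  by apply/cell1_shift; rewrite e; exact: (proj1 (cell1_shift j x) h).
by apply: (proj2 (cell1_shift j x)); have /cell1_shift := h; rewrite e.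
Qed.

Lemma xi_stat i j : Ex (fun w => ctr P (xi i) w * ctr P (xi j) w) =
  Ex (fun w => ctr P (xi 0) w * ctr P (xi (j - i)) w).
Proof.
have mE z : measurable_fun setT (XiE (cell 1 z)).
  by apply: measurable_XiE; exact: measurable_cell.
have e0 z w : xi z w = XiE (cell 1 z) (X w) by [].
have st k z : Ex (xi k) = Ex (xi (k - z)).
  under eq_Ex do rewrite (xi_sh z k).
  by rewrite (stat_Ex statX _ (mE _)).
rewrite !Ex_ctrM; try exact: xi_L2.
congr (_ - _ * _); [|by rewrite (st i i) subrr|exact: st].
under eq_Ex do rewrite (xi_sh i i) (xi_sh i j) subrr.
by rewrite (stat_Ex statX (Theta := fun mu => XiE (cell 1 0) mu * XiE (cell 1 (j - i)) mu))//;
  exact: measurable_funM.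
Qed.

Let lam0 : R := mark_intensity P X setT.

Lemma mark_intensityT_gt0 : 0 < mark_intensity P X setT.
Proof. by rewrite fine_gt0// intensity_gt0 intensity_fin. Qed.

Local Notation mu0 := (mean P X (@measurableT _ (borel M))).

Lemma mu0_cell N z : (0 < N)%N ->
  mu0 (cell N z) = (mark_intensity P X setT / N%:R ^+ d)%:E.
Proof. by move=> N0; exact: mean_cell. Qed.

Lemma mean_compact (B : set rV) (D : set (borel M)) (mD : measurable D) :
  compact (B : set 'rV[R]_d) ->
  mean P X mD B = (mark_intensity P X D * vol B)%:E.
Proof.
move=> cB; have [_ h] := lebesgue_compact d0 mark_intensityT_gt0 mu0_cell cB.
by apply: h => N z N0; exact: mean_cell.
Qed.

Lemma X_compact_fin w (B : set rV) (D : set (borel M)) : compact (B : set 'rV[R]_d) ->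
  measurable D -> X w (B `*` D) \is a fin_num.
Proof.
move=> cB mD; have mB : measurable B by exact: borel_compact.
rewrite ge0_fin_numE//; apply: (@le_lt_trans _ _ (X w (B `*` setT))).
  apply: le_measure; rewrite ?inE.
  - exact: measurableX.
  - exact: measurableX.
  - by move=> -[x m] [].
by apply: (proj2 mppX) => //; exact: compact_bounded.
Qed.

Lemma Ex_count (B : set rV) (D : set (borel M)) : compact (B : set 'rV[R]_d) ->
  measurable D -> ig P (fun w => fine (X w (B `*` D))) /\
  Ex (fun w => fine (X w (B `*` D))) = mark_intensity P X D * vol B.
Proof.
move=> cB mD; have h := mean_compact mD cB.
have mB : measurable B by exact: borel_compact.
have e : (\int[P]_w (fine (X w (B `*` D)))%:E)%E = (mark_intensity P X D * vol B)%:E.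
  by rewrite -h; apply: eq_integral => w _; rewrite fineK// X_compact_fin.
split; last by rewrite /Ex /Rintegral e.
apply/integrableP; split; first by apply/measurable_EFinP; exact: measurable_fineX.
rewrite (eq_integral (fun w => (fine (X w (B `*` D)))%:E)); last first.
  by move=> w _; rewrite /= ger0_norm ?fine_ge0.
by rewrite e ltry.
Qed.

(** Mean of the weighted count per unit volume. *)
Definition kappa : R := \sum_i a i * mark_intensity P X (C i).

Lemma Ex_Xi (B : set rV) : compact (B : set 'rV[R]_d) -> Ex (Xi X a C B) = kappa * vol B.
Proof.
move=> cB; rewrite /Xi Ex_sum.
  rewrite /kappa big_distrl /=; apply: eq_bigr => i _.
  by have [i1 i2] := Ex_count cB (mC i); rewrite ExZ// i2 mulrA.
by move=> i; have [i1 i2] := Ex_count cB (mC i); exact: igZ.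
Qed.

Lemma Xi_split (B : set rV) (s : seq 'rV[int]_d) w : measurable B -> uniq s ->
  B `<=` \bigcup_(z in [set` s]) cell 1 z ->
  Xi X a C B w = \sum_(z <- s) Xi X a C (B `&` cell 1 z) w.
Proof.
move=> mB us Bs; rewrite /Xi exchange_big /=; apply: eq_bigr => i _.
rewrite -big_distrr /=; congr (_ * _).
have mBz z : measurable (B `&` cell 1 z : set rV).
  by apply: measurableI => //; exact: measurable_cell.
have -> : B `*` C i = \bigcup_(z in [set` s]) ((B `&` cell 1 z) `*` C i).
  apply/seteqP; split => -[x m] /=.
    move=> [Bx Cm]; have [z zs zx] := Bs x Bx.
    by exists z.
  by move=> [z zs [/= [Bx _] Cm]].
have -> : X w (\bigcup_(z in [set` s]) ((B `&` cell 1 z) `*` C i)) =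
    (\sum_(z <- s) X w ((B `&` cell 1 z) `*` C i))%E.
  rewrite measure_fin_bigcup//.
  - by rewrite -(fsbig_seq _ _ us).
  - exact: finite_seq.
  - by move=> z z' _ _ [[x m] [[/= [_ <-] _] [/= [_ <-] _]]].
  - by move=> z _; exact: measurableX.
have hf z : X w ((B `&` cell 1 z) `*` C i) \is a fin_num.
  by apply: (@X_fin _ _ _ _ _ _ mppX w _ _ z) => // x [].
rewrite (eq_bigr (fun z => (fine (X w ((B `&` cell 1 z) `*` C i)))%:E)).
  by rewrite sumEFin.
by move=> z _; rewrite fineK.
Qed.

Variable W : nat -> set 'rV[R]_d.
Hypothesis casW : convex_averaging_sequence W.

Definition Twin k w : R :=
  (Num.sqrt (vol (W k)))^-1 * (Xi X a C (W k) w - kappa * vol (W k)).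

(** The centred window count splits over the cells meeting the window; complete cells form the
    stationary field and cut cells the boundary part of [window_clt]. *)
Theorem mpp_clt : (forall k, L2 P (Twin k)) /\ exists2 sg2 : R, 0 <= sg2 &
  (forall e, 0 < e -> \forall k \near \oo, `|Ex (fun w => Twin k w ^+ 2) - sg2| <= e) /\
  (forall th e, 0 < e -> \forall k \near \oo,
    `|Ex (fun w => cos (Twin k w + th)) - cos th * expR (- (sg2 / 2))| <= e).
Proof.
have cW k : compact (W k) by have [] := casW.
have mW k : measurable (W k : set rV) by apply: borel_compact; exact: (@cW k).
have [s /all_and2[us hs]] := choice (fun k => outer_seq (@cW k) 1).
have [G hG] := gX_bounded P X d0 delta0 bs0 bs_mono bs_int a.
have mWz k z : measurable (W k `&` cell 1 z : set rV).
  by apply: measurableI => //; exact: measurable_cell.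
have eta2 k i : L2 P (Xi X a C (W k `&` cell 1 i)).
  by apply: (xi_sub_L2 (z := i)) => // x [].
have eT k : Tk (fun z => ctr P (xi z)) (Ins W s) (Bds W s)
    (fun k z => ctr P (Xi X a C (W k `&` cell 1 z))) (fun k => vol (W k)) k = Twin k.
  apply/funext => w; rewrite /Tk /Twin /rk; congr (_ * _).
  rewrite -(Ex_Xi (@cW k)).
  have sp w' : Xi X a C (W k) w' = \sum_(z <- s k) Xi X a C (W k `&` cell 1 z) w'.
    by apply: Xi_split => //; rewrite -hs; exact: sub_outer.
  rewrite sp; under eq_Ex do rewrite sp.
  rewrite Ex_sum; last by move=> i; exact: L2_ig.
  (* For an inner cell, cutting with the window changes nothing. *)
  rewrite -sumrB [RHS](bigID (innerb (W k))) /= /Ins /Bds !big_filter; congr (_ + _).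
  apply: eq_bigr => z /asboolP h; rewrite /ctr.
  by rewrite (_ : W k `&` cell 1 z = cell 1 z)//; apply/setIidPr.
have key := @window_clt _ _ _ P d (fun z => ctr P (xi z)) (gX P X bs delta a) G _ _ hG
  (fun z => Ex (fun w => ctr P (xi 0) w * ctr P (xi z) w)) _ _ (Ins W s) (Bds W s)
  (fun k z => ctr P (Xi X a C (W k `&` cell 1 z))) (fun k => vol (W k)).
split.
  move=> k; rewrite -eT; apply: Tk_L2.
  - by move=> z; apply: ctr_L2; exact: xi_L2.
  - by move=> k' z; apply: ctr_L2.
have -> : Twin = Tk (fun z => ctr P (xi z)) (Ins W s) (Bds W s)
    (fun k z => ctr P (Xi X a C (W k `&` cell 1 z))) (fun k => vol (W k)).
  by apply/funext => k; rewrite eT.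
apply: key.
- by move=> i; apply: ctr_L2; exact: xi_L2.
- by move=> k; exact: gX_ge0.
- by move=> i j; exact: xi_stat.
- by move=> z; apply: xi_cov => //; exact: measurable_cell.
- by move=> k; exact: filter_uniq.
- by move=> k; exact: filter_uniq.
- by move=> k i; apply: ctr_L2.
- by move=> k i j; apply: xi_cov => // x [].
- exact: (Ins_vol d0 mark_intensityT_gt0 mu0_cell casW us).
- exact: (vol_InsBds d0 mark_intensityT_gt0 mu0_cell casW us hs).
- exact: (vol_large d0 mark_intensityT_gt0 mu0_cell casW us hs).
- exact: (Bds_small d0 mark_intensityT_gt0 mu0_cell casW us hs).
- exact: (bad_Ins_small d0 mark_intensityT_gt0 mu0_cell casW us hs).
have th1 : delta / (2 + delta) <= 1 by rewrite ler_pdivrMr ?addr_gt0// mul1r lerDr.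
apply: (@field_clt _ _ _ P d xi (gX P X bs delta a) G delta (Mx P X delta a) delta0 _ _ _ hG).
- by move=> i; apply: measurable_Xi => //; exact: measurable_cell.
- move=> i.
  exact: (mom_Xi mppX statX delta0 hmom a mC (measurable_cell 1 i) (@subset_refl _ _)
    (@measurable_id _ _ setT) (fun x => lexx _)).
- by move=> k; exact: gX_ge0.
- by move=> i j u v mu hu mv hv;
    apply: (field_cov mppX statX delta0 hmom bs0 hcoef) => //; exact: measurable_cell.
- move=> L e; exact: (txi_clt d0 mppX statX delta0 hmom bs0 bs_mono bs_int hcoef a mC).
Qed.

End mpp_clt.

(** * Uniform approximation by trigonometric polynomials on boxes *)

Section trigonometric.
Context {R : realType} {l : nat}.
Local Notation rV := 'rV[R]_l.

Definition dotr (t x : rV) : R := (x *m t^T) 0 0.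

Lemma dotrE t x : dotr t x = \sum_i x 0 i * t 0 i.
Proof. by rewrite /dotr mxE; apply: eq_bigr => i _; rewrite mxE. Qed.

Lemma dotrDl t t' x : dotr (t + t') x = dotr t x + dotr t' x.
Proof. by rewrite !dotrE -big_split; apply: eq_bigr => i _; rewrite mxE mulrDr. Qed.

Lemma dotrBl t t' x : dotr (t - t') x = dotr t x - dotr t' x.
Proof. by rewrite !dotrE -sumrB; apply: eq_bigr => i _; rewrite !mxE mulrBr. Qed.

(** Trigonometric polynomials as lists of triples amplitude, frequency, phase. *)
Definition trig (q : seq (R * rV * R)) (x : rV) : R :=
  \sum_(p <- q) p.1.1 * cos (dotr p.1.2 x + p.2).

(** Product-to-sum formula: frequencies and phases are added in the first half and subtracted in the
    second. *)
Definition trig_mul (q q' : seq (R * rV * R)) : seq (R * rV * R) :=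
  [seq (p.1.1 * p'.1.1 / 2, p.1.2 + p'.1.2, p.2 + p'.2) | p <- q, p' <- q'] ++
  [seq (p.1.1 * p'.1.1 / 2, p.1.2 - p'.1.2, p.2 - p'.2) | p <- q, p' <- q'].

Lemma trig_mulE q q' x : trig (trig_mul q q') x = trig q x * trig q' x.
Proof.
rewrite /trig /trig_mul big_cat /= !big_allpairs_dep -big_split /= big_distrl /=.
apply: eq_bigr => p _; rewrite -big_split big_distrr /=; apply: eq_bigr => p' _.
rewrite dotrDl dotrBl.
have -> : dotr p.1.2 x + dotr p'.1.2 x + (p.2 + p'.2) =
  (dotr p.1.2 x + p.2) + (dotr p'.1.2 x + p'.2) by ring.
have -> : dotr p.1.2 x - dotr p'.1.2 x + (p.2 - p'.2) =
  (dotr p.1.2 x + p.2) - (dotr p'.1.2 x + p'.2) by ring.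
by rewrite cosD cosB; field.
Qed.

Lemma trig_bounded q : exists2 c, 0 <= c & forall x, `|trig q x| <= c.
Proof.
exists (\sum_(p <- q) `|p.1.1|); first exact: sumr_ge0.
move=> x; apply: le_trans (ler_norm_sum _ _ _) _; apply: ler_sum => p _.
by rewrite normrM ler_piMr// ler_norml cos_geN1 cos_le1.
Qed.

Definition almost_trig (f : rV -> R) := forall e, 0 < e ->
  exists q, forall x, `|f x - trig q x| <= e.

Lemma almost_trig_bounded f : almost_trig f -> exists2 c, 0 <= c & forall x, `|f x| <= c.
Proof.
move=> /(_ 1 ltr01)[q hq]; have [c c0 hc] := trig_bounded q.
exists (1 + c); first by rewrite addr_ge0.
move=> x; rewrite -[f x](subrK (trig q x)).
by apply: le_trans (ler_normD _ _) _; exact: lerD.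
Qed.

Lemma almost_trig_cos (t : rV) (a b : R) : almost_trig (fun x => a * cos (dotr t x + b)).
Proof.
by move=> e e0; exists [:: (a, t, b)] => x; rewrite /trig big_seq1 subrr normr0 ltW.
Qed.

Lemma almost_trig_eq f g : f =1 g -> almost_trig f -> almost_trig g.
Proof. by move=> /funext ->. Qed.

Lemma almost_trig_cst (a : R) : almost_trig (fun=> a).
Proof.
apply: (@almost_trig_eq _ _ _ (almost_trig_cos 0 a 0)) => x.
by rewrite dotrE big1 ?addr0 ?cos0 ?mulr1// => i _; rewrite mxE mulr0.
Qed.

Lemma almost_trigD f g : almost_trig f -> almost_trig g -> almost_trig (fun x => f x + g x).
Proof.
move=> hf hg e e0; have e2 : 0 < e / 2 by rewrite divr_gt0.
have [q hq] := hf _ e2; have [q' hq'] := hg _ e2.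
exists (q ++ q') => x; rewrite /trig big_cat /= -/(trig q x) -/(trig q' x).
rewrite opprD addrACA [leRHS]splitr.
by apply: le_trans (ler_normD _ _) _; exact: lerD.
Qed.

Lemma almost_trigM f g : almost_trig f -> almost_trig g -> almost_trig (fun x => f x * g x).
Proof.
move=> hf hg e e0.
have [c c0 hc] := almost_trig_bounded hg.
have e2 : 0 < e / 2 by rewrite divr_gt0.
have c1 : 0 < c + 1 by rewrite ltr_wpDl.
have [q hq] := hf _ (divr_gt0 e2 c1).
have [c' c'0 hc'] := trig_bounded q.
have c'1 : 0 < c' + 1 by rewrite ltr_wpDl.
have [q' hq'] := hg _ (divr_gt0 e2 c'1).
exists (trig_mul q q') => x; rewrite trig_mulE.
have -> : f x * g x - trig q x * trig q' x =
  (f x - trig q x) * g x + trig q x * (g x - trig q' x) by ring.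
rewrite [leRHS]splitr; apply: le_trans (ler_normD _ _) _; rewrite !normrM.
have aux (u v w k : R) : 0 <= u -> 0 <= v -> u <= w -> v <= k / (w + 1) -> 0 <= k -> u * v <= k.
  move=> u0 v0 uw vk k0; have w1 : 0 < w + 1 by rewrite ltr_wpDl// (le_trans u0).
  apply: (@le_trans _ _ ((w + 1) * (k / (w + 1)))).
    by apply: ler_pM => //; apply: le_trans uw _; rewrite lerDl.
  by rewrite mulrC divfK// gt_eqF.
apply: lerD; first by rewrite mulrC; apply: (aux _ _ c) => //; exact: ltW.
by apply: (aux _ _ c') => //; exact: ltW.
Qed.

Lemma almost_trigZ (a : R) f : almost_trig f -> almost_trig (fun x => a * f x).
Proof. by move=> hf; apply: almost_trigM => //; exact: almost_trig_cst. Qed.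

Lemma almost_trigB f g : almost_trig f -> almost_trig g -> almost_trig (fun x => f x - g x).
Proof.
move=> hf hg; apply: (@almost_trig_eq (fun x => f x + (-1) * g x)).
  by move=> x; rewrite mulN1r.
by apply: almost_trigD => //; exact: almost_trigZ.
Qed.

Lemma almost_trig_lim f : (forall e, 0 < e -> exists2 g, almost_trig g &
  forall x, `|f x - g x| <= e) -> almost_trig f.
Proof.
move=> h e e0; have e2 : 0 < e / 2 by rewrite divr_gt0.
have [g hg fg] := h _ e2; have [q hq] := hg _ e2.
exists q => x; rewrite -[f x](subrK (g x)) -addrA [leRHS]splitr.
by apply: le_trans (ler_normD _ _) _; exact: lerD.
Qed.

(* Increases to [`|x|] uniformly on [-1, 1]. *)
Fixpoint abs_iter (n : nat) (x : R) : R :=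
  if n is n'.+1 then abs_iter n' x + (x ^+ 2 - abs_iter n' x ^+ 2) / 2 else 0.

(** With [y = |x|], one step multiplies the gap [y - p] by [1 - (y + p) / 2], hence by at most
    [1 - y / 2]. The product of [1 - y / 2] and [1 + (n + 1) y / 2] is at most [1 + n y / 2], which
    closes the induction. *)
Lemma abs_iter_bound n (x : R) : `|x| <= 1 ->
  0 <= abs_iter n x <= `|x| /\ (`|x| - abs_iter n x) * (1 + n%:R * (`|x| / 2)) <= `|x|.
Proof.
move=> x1; set y := `|x|; have y0 : 0 <= y by rewrite normr_ge0.
have xy : x ^+ 2 = y ^+ 2 by rewrite real_normK// num_real.
elim: n => [|n [/andP[p0 py] IHn]] /=.
  by rewrite lexx y0 subr0 mul0r addr0 mulr1.
rewrite xy; move: p0 py IHn; set p := abs_iter n x => p0 py IHn.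
have y1 : y <= 1 by [].
split; first by apply/andP; split; nra.
have h : y - (p + (y ^+ 2 - p ^+ 2) / 2) <= (y - p) * (1 - y / 2) by nra.
rewrite -[n.+1%:R]natr1; have n0 : 0 <= n%:R :> R by rewrite ler0n.
apply: le_trans _ IHn.
apply: (@le_trans _ _ ((y - p) * (1 - y / 2) * (1 + (n%:R + 1) * (y / 2)))).
  apply: ler_wpM2r => //; nra.
rewrite -mulrA ler_wpM2l ?subr_ge0//.
have : 0 <= n%:R * y ^+ 2 by rewrite mulr_ge0// sqr_ge0.
by have := sqr_ge0 y; lra.
Qed.

Lemma almost_trig_norm1 f : almost_trig f -> (forall x, `|f x| <= 1) ->
  almost_trig (fun x => `|f x|).
Proof.
move=> hf f1; have hn n : almost_trig (fun x => abs_iter n (f x)).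
  elim: n => [|n IHn] /=; first exact: almost_trig_cst.
  apply: almost_trigD => //.
  apply: (@almost_trig_eq (fun x => 2^-1 * (f x * f x - abs_iter n (f x) * abs_iter n (f x)))).
    by move=> x; rewrite !expr2 mulrC.
  by apply: almost_trigZ; apply: almost_trigB; exact: almost_trigM.
apply: almost_trig_lim => e e0.
pose n := (Num.truncn (2 / e)).+1.
have ne : 2 / e < n%:R by exact: truncnS_gt.
exists (fun x => abs_iter n (f x)); first exact: hn.
move=> x; have [/andP[h1 h2] h3] := abs_iter_bound n (f1 x).
rewrite ger0_norm ?subr_ge0//.
rewrite ltr_pdivrMr// in ne.
move: h1 h2 h3; set y := `|f x|; set p := abs_iter _ _ => h1 h2 h3.
rewrite leNgt; apply/negP => he.
have y0 : 0 < y by lra.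
have : e * (n%:R * (y / 2)) < (y - p) * (1 + n%:R * (y / 2)).
  have n0 : 0 <= n%:R * (y / 2) by rewrite mulr_ge0// divr_ge0// ltW.
  nra.
have -> : e * (n%:R * (y / 2)) = (n%:R * e) * y / 2 by ring.
by nra.
Qed.

(** Closure under absolute value turns the algebra into a lattice, as in the Stone-Weierstrass
    theorem. *)
Lemma almost_trig_norm f : almost_trig f -> almost_trig (fun x => `|f x|).
Proof.
move=> hf; have [c c0 hc] := almost_trig_bounded hf.
have c1 : 0 < c + 1 by rewrite ltr_wpDl.
apply: (@almost_trig_eq (fun x => (c + 1) * `|(c + 1)^-1 * f x|)).
  by move=> x; rewrite normrM gtr0_norm ?invr_gt0// mulVKf// gt_eqF.
apply: almost_trigZ; apply: almost_trig_norm1; first exact: almost_trigZ.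
move=> x; rewrite normrM gtr0_norm ?invr_gt0// ler_pdivrMl// mulr1.
by apply: le_trans (hc x) _; rewrite lerDl.
Qed.

Lemma almost_trig_max f g : almost_trig f -> almost_trig g ->
  almost_trig (fun x => Num.max (f x) (g x)).
Proof.
move=> hf hg; apply: (@almost_trig_eq (fun x => 2^-1 * (f x + g x + `|f x - g x|))).
  by move=> x; rewrite maxr_absE mulrC.
apply: almost_trigZ; apply: almost_trigD; first exact: almost_trigD.
by apply: almost_trig_norm; exact: almost_trigB.
Qed.

Lemma almost_trig_min f g : almost_trig f -> almost_trig g ->
  almost_trig (fun x => Num.min (f x) (g x)).
Proof.
move=> hf hg; apply: (@almost_trig_eq (fun x => 2^-1 * (f x + g x - `|f x - g x|))).
  by move=> x; rewrite minr_absE mulrC.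
apply: almost_trigZ; apply: almost_trigB; first exact: almost_trigD.
by apply: almost_trig_norm; exact: almost_trigB.
Qed.

Definition box (A : R) : set rV := [set x | forall i, `|x 0 i| <= A].

Lemma box_compact A : compact (box A).
Proof.
have -> : box A = [set v : rV | forall i, [set` `[- A, A]] (v ord0 i)].
  by apply/seteqP; split => x h i; have := h i; rewrite /= in_itv /= ler_norml.
exact: (@rV_compact R l (fun=> [set` `[- A, A]]) (fun=> @segment_compact R (- A) A)).
Qed.

(* [wave A y] is an almost trigonometric function separating [y] from the other
   points of [box A]. *)
Definition wave (A : R) (y x : rV) : R := \sum_i `|sin ((x 0 i - y 0 i) / (4 * A))|.

Lemma wave_ge0 A y x : 0 <= wave A y x.
Proof. exact: sumr_ge0. Qed.

Lemma waveyy A y : wave A y y = 0.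
Proof. by rewrite /wave big1// => i _; rewrite subrr mul0r sin0 normr0. Qed.

Lemma continuous_wave A y : continuous (wave A y).
Proof.
apply: (@continuous_big R _ +%R 0 xpredT (@add_continuous R)) => i _ x.
have c1 : continuous (fun x : rV => (x 0 i - y 0 i) / (4 * A)).
  move=> z; exact: (cvgM (cvgB (@coord_continuous R 1 l 0 i z) (cvg_cst _)) (cvg_cst _)).
exact: (@cvg_norm R R _ _ (nbhs_filter x) _ _ (continuous_comp (c1 x) (@continuous_sin R _))).
Qed.

Lemma almost_trig_wave A y : almost_trig (wave A y).
Proof.
have h (s : seq 'I_l) : almost_trig (fun x => \sum_(i <- s) `|sin ((x 0 i - y 0 i) / (4 * A))|).
  elim: s => [|i s IHs].
    by apply: (@almost_trig_eq (fun=> 0)); [move=> x; rewrite big_nil|exact: almost_trig_cst].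
  apply: (@almost_trig_eq (fun x => `|1 * cos (dotr ((4 * A)^-1 *: delta_mx 0 i) x
      + (- (y 0 i / (4 * A)) - pi / 2))| +
     \sum_(i <- s) `|sin ((x 0 i - y 0 i) / (4 * A))|)).
    move=> x; rewrite big_cons mul1r; congr (`|_| + _).
    rewrite addrA cosE_sin subrK mulrBl; congr (sin (_ - _)).
    rewrite dotrE (bigD1 i)//= big1 => [|j ji].
      by rewrite !mxE !eqxx mulr1 addr0.
    by rewrite !mxE (negPf ji) andbF !mulr0.
  apply: almost_trigD => //; apply: almost_trig_norm; exact: almost_trig_cos.
exact: (h (index_enum _)).
Qed.

(** Points of the box differ by at most [2 * A] in each coordinate, so the sine is taken at a
    [v <= 1/2], where [sin v >= v - v^2 >= v / 2]. *)
Lemma wave_lower A y x (eta : R) : 0 < A -> box A y -> box A x -> 0 < eta -> eta <= `|x - y| ->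
  eta / (8 * A) <= wave A y x.
Proof.
move=> A0 yA xA eta0; rewrite [X in _ <= X -> _]/Num.norm/= mx_normrE => h.
have [i hi] : exists i, eta <= `|x 0 i - y 0 i|.
  apply/existsP; apply: contraLR h; rewrite negb_exists => /forallP hn.
  rewrite -ltNge; apply/bigmax_ltP; split => // -[u i] _ /=.
  by rewrite !mxE ord1 ltNge.
apply: (@le_trans _ _ `|sin ((x 0 i - y 0 i) / (4 * A))|); last first.
  by rewrite /wave (bigD1 i)//= lerDl sumr_ge0.
have A8 : 0 < 8 * A by rewrite mulr_gt0.
have A4 : 0 < 4 * A by rewrite mulr_gt0.
pose v := `|x 0 i - y 0 i| / (4 * A).
have v0 : 0 <= v by rewrite divr_ge0// ltW.
have v2 : v <= 2^-1.
  rewrite ler_pdivrMr//; apply: le_trans (ler_normB _ _) _.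
  by have := xA i; have := yA i; lra.
have ve : eta / (8 * A) <= v / 2.
  rewrite ler_pdivrMr// /v.
  have -> : `|x 0 i - y 0 i| / (4 * A) / 2 * (8 * A) = `|x 0 i - y 0 i| by field; rewrite gt_eqF.
  exact: hi.
have -> : `|sin ((x 0 i - y 0 i) / (4 * A))| = `|sin v|.
  rewrite /v; case: (ger0P (x 0 i - y 0 i)) => // _.
  by rewrite mulNr sinN normrN.
have := sin_taylor 0 v; rewrite add0r sin0 cos0 mulr1 subr0 ler_norml => /andP[h1 _].
have := ler_norm (sin v); nra.
Qed.

(** Lattice form of Stone-Weierstrass: each [h y] stays below [f + e] on the box and agrees with [f]
    at [y]; by compactness the maximum of finitely many of them also exceeds [f - e]. *)
Lemma almost_trig_approx (f : rV -> R) (c A e : R) : continuous f -> 0 < A -> 0 < e ->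
  (forall x, `|f x| <= c) -> exists g, [/\ almost_trig g, forall x, `|g x| <= c &
    forall x, box A x -> `|f x - g x| <= e].
Proof.
move=> cf A0 e0 fc.
have c0 : 0 <= c by apply: le_trans (fc 0).
have lower y : exists2 L : R, 0 <= L & forall x, box A y -> box A x ->
    f y - L * wave A y x <= f x + e.
  have /cvgrPdist_lt/(_ _ e0)/nbhs_ballP[eta /= eta0 heta] := cf y.
  (* Steep enough for the penalty to exceed the oscillation [2 * c] of [f] once [x] is [eta] away
     from [y]. *)
  exists (2 * c * (8 * A / eta)).
    by rewrite !mulr_ge0// ?invr_ge0 ltW.
  move=> x yA xA; have [h|h] := ltP `|x - y| eta.
    have := heta x; rewrite /ball_ /= => /(_ _)/ltW.
    have hb : ball y eta x by rewrite -ball_normE /= distrC.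
    move=> /(_ hb); rewrite ler_norml => /andP[_ h2].
    have : 0 <= 2 * c * (8 * A / eta) * wave A y x.
      by rewrite mulr_ge0 ?wave_ge0// !mulr_ge0// ?invr_ge0 ltW.
    by lra.
  have h1 := wave_lower A0 yA xA eta0 h.
  have h2 : 2 * c <= 2 * c * (8 * A / eta) * wave A y x.
    have e1 : 2 * c = 2 * c * (8 * A / eta) * (eta / (8 * A)) :> R.
      by field; rewrite !gt_eqF.
    rewrite [leLHS]e1.
    by rewrite ler_wpM2l// !mulr_ge0// ?invr_ge0 ltW.
  have := fc x; have := fc y; rewrite !ler_norml => /andP[? ?] /andP[? ?].
  by lra.
have [L hL] := choice (fun y => let: ex_intro2 L a b := lower y in ex_intro _ L (conj a b)).
pose h y x := f y - L y * wave A y x.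
have ch y : continuous (fun x => h y x - f x).
  move=> x; exact: (cvgB (cvgB (cvg_cst _) (cvgM (cvg_cst _) (@continuous_wave A y x))) (cf x)).
have oU y : open [set x | - e < h y x - f x].
  have /continuousP/(_ [set z | - e < z]) := ch y; apply.
  exact: open_gt.
have := @box_compact A; rewrite compact_cover => /(_ rV (box A) (fun y => [set x | - e < h y x - f x])).
case=> [y _|y yA|D DA hD].
- exact: oU.
- by exists y => //=; rewrite /h waveyy mulr0 subr0 subrr oppr_lt0.
pose G (s : seq rV) x := \big[Num.max/(- c)]_(y <- s) h y x.
have tG s : almost_trig (G s).
  elim: s => [|y s IHs].
    apply: (@almost_trig_eq (fun=> - c)); last exact: almost_trig_cst.
    by move=> x; rewrite /G big_nil.
  apply: (@almost_trig_eq (fun x => Num.max (h y x) (G s x))).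
    by move=> x; rewrite /G big_cons.
  apply: almost_trig_max => //; apply: almost_trigB; first exact: almost_trig_cst.
  by apply: almost_trigZ; exact: almost_trig_wave.
have Gge s x : - c <= G s x.
  rewrite /G; elim: s => [|y s IHs]; first by rewrite big_nil.
  by rewrite big_cons le_max IHs orbT.
pose Ds : seq rV := finmap.enum_fset D.
have DsA : {subset Ds <= box A} := DA.
have Dscov x : box A x -> exists2 y, y \in Ds & - e < h y x - f x.
  by move=> /hD[y /= yD hy]; exists y.
(* Capping at [c], together with the initial value [- c] of the maximum, keeps the approximant
   bounded outside the box too. *)
exists (fun x => Num.min c (G Ds x)); split.
- by apply: almost_trig_min => //; exact: almost_trig_cst.
- by move=> x; rewrite ler_norml le_min ge_min lexx /= Gge andbT; lra.
move=> x xA.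
have Gle : G Ds x <= f x + e.
  move: DsA.
  rewrite /G; move: (Ds) => S; elim: S => [|y s IHs] hs.
    by rewrite big_nil; have := fc x; rewrite ler_norml => /andP[? ?]; lra.
  rewrite big_cons ge_max IHs ?andbT//; last first.
    by move=> z zs; apply: hs; rewrite inE zs orbT.
  have yA : box A y by apply: set_mem; exact: hs (mem_head _ _).
  exact: (hL y).2.
have Glow : f x - e <= G Ds x.
  have [y yD hy] := Dscov x xA.
  have : h y x <= G Ds x.
    move: yD; rewrite /G; move: (Ds) => S; elim: S => [|z s IHs] //.
    rewrite inE big_cons le_max => /orP[/eqP ->|/IHs ->]; first by rewrite lexx.
    by rewrite orbT.
  by lra.
have := fc x; rewrite !ler_norml => /andP[h1 h2].
case: (leP c (G Ds x)) => h3; apply/andP; split; lra.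
Qed.

End trigonometric.

(** * Continuity theorem for characteristic functions *)

Section levy.
Context {R : realType} {l : nat} {d d' : measure_display}.
Context {T : measurableType d} {T' : measurableType d'}.
Variables (P : probability T R) (Q : probability T' R).
Local Notation rV := 'rV[R]_l.
Variables (S : nat -> T -> rV) (S' : T' -> rV).
Hypothesis mS : forall k, measurable_fun setT (S k : T -> borel rV).
Hypothesis mS' : measurable_fun setT (S' : T' -> borel rV).

Definition outbox (A : R) (x : rV) : R := (~~ `[< box A x >])%:R.

Lemma measurable_outbox A : measurable_fun setT (outbox A : borel rV -> R).
Proof.
have mB : measurable (~` box A : set (borel rV)).
  by apply: measurableC; apply: borel_compact; exact: box_compact.
have -> : outbox A = \1_(~` box A).
  apply/funext => x; rewrite /outbox indicE; congr (_%:R).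
  by rewrite in_setC; congr (~~ _); apply/asboolP/idP => [/mem_set|/set_mem].
exact: measurable_indic.
Qed.

Definition near_law (F : rV -> R) := forall e, 0 < e -> \forall k \near \oo,
  `|Ex P (F \o S k) - Ex Q (F \o S')| <= e.

Hypothesis cvg_cos : forall (t : rV) (th : R), near_law (fun x => cos (dotr t x + th)).
Hypothesis tightS : forall e, 0 < e -> exists2 A, 0 < A &
  \forall k \near \oo, Ex P (outbox A \o S k) <= e.
Hypothesis tightS' : forall e, 0 < e -> exists2 A, 0 < A & Ex Q (outbox A \o S') <= e.

Let bm_cf d0 (T0 : measurableType d0) (P0 : probability T0 R) (S0 : T0 -> rV) (f : rV -> R) c :
  measurable_fun setT (S0 : T0 -> borel rV) -> measurable_fun setT (f : borel rV -> R) ->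
  (forall x, `|f x| <= c) -> bm (f \o S0).
Proof.
move=> mS0 mf fc; split; first exact: (measurableT_comp mf mS0).
by exists c => w; exact: fc.
Qed.

Lemma measurable_dotr (t : rV) : measurable_fun setT (dotr t : borel rV -> R).
Proof.
have -> : dotr t = fun x => \sum_i x 0 i * t 0 i by apply/funext => x; rewrite dotrE.
apply: (@measurable_sum _ (borel rV)) => i.
by apply: measurable_funM => //; exact: measurable_coord.
Qed.

Lemma measurable_trig q : measurable_fun setT (trig q : borel rV -> R).
Proof.
apply: (@measurable_sum _ (borel rV)) => p; apply: measurable_funM => //.
apply: measurable_cosf; apply: measurable_funD => //; exact: measurable_dotr.
Qed.

Lemma near_law_trig q : near_law (trig q).
Proof.
have bc d0 (T0 : measurableType d0) (P0 : probability T0 R) (S0 : T0 -> rV) t th :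
    measurable_fun setT (S0 : T0 -> borel rV) -> bm (fun w => cos (dotr t (S0 w) + th)).
  move=> mS0; apply: bm_cosf; apply: measurable_funD => //.
  exact: (measurableT_comp (measurable_dotr t) mS0).
elim: q => [|p q IHq] e e0.
  have h d0 (T0 : measurableType d0) (P0 : probability T0 R) (S0 : T0 -> rV) :
      Ex P0 (trig [::] \o S0) = 0.
    rewrite -[RHS](Ex_cst P0); apply: eq_Ex => w.
    by rewrite /trig /= big_nil.
  by apply: nearW => k; rewrite !h subrr normr0 ltW.
have c0 : 0 < `|p.1.1| + 1 by rewrite ltr_wpDl.
have e2 : 0 < e / 2 by rewrite divr_gt0.
have h1 := cvg_cos p.1.2 p.2 (divr_gt0 e2 c0).
have h2 := IHq _ e2.
have split0 d0 (T0 : measurableType d0) (P0 : probability T0 R) (S0 : T0 -> rV) :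
    measurable_fun setT (S0 : T0 -> borel rV) ->
    Ex P0 (trig (p :: q) \o S0) = p.1.1 * Ex P0 (fun w => cos (dotr p.1.2 (S0 w) + p.2))
      + Ex P0 (trig q \o S0).
  move=> mS0; rewrite -ExZ; last by apply: bm_ig; exact: bc.
  rewrite -ExD.
  - by apply: eq_Ex => w; rewrite /trig /= big_cons.
  - by apply: bm_ig; apply: bmZ; exact: bc.
  - have [c _ hc] := trig_bounded q.
    by apply: bm_ig; apply: (bm_cf P0 mS0 (measurable_trig q) hc).
near=> k.
rewrite !split0// opprD addrACA -mulrBr [leRHS]splitr.
apply: le_trans (ler_normD _ _) _; apply: lerD; last by near: k.
have k1 : `|Ex P (fun w => cos (dotr p.1.2 (S k w) + p.2)) -
  Ex Q (fun w => cos (dotr p.1.2 (S' w) + p.2))| <= e / 2 / (`|p.1.1| + 1) by near: k.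
rewrite normrM; apply: (@le_trans _ _ ((`|p.1.1| + 1) * (e / 2 / (`|p.1.1| + 1)))).
  by apply: ler_pM => //; rewrite lerDl.
by rewrite mulrC divfK// gt_eqF.
Unshelve. all: by end_near.
Qed.

(** On the box the two functions differ by at most [e]; outside it by at most [2 * c], on an event
    of probability at most [e']. *)
Lemma Ex_approx d0 (T0 : measurableType d0) (P0 : probability T0 R) (S0 : T0 -> rV)
    (f g : rV -> R) (c A e e' : R) : measurable_fun setT (S0 : T0 -> borel rV) ->
  measurable_fun setT (f : borel rV -> R) -> measurable_fun setT (g : borel rV -> R) ->
  (forall x, `|f x| <= c) -> (forall x, `|g x| <= c) ->
  (forall x, box A x -> `|f x - g x| <= e) -> 0 <= e ->
  Ex P0 (outbox A \o S0) <= e' -> `|Ex P0 (f \o S0) - Ex P0 (g \o S0)| <= e + 2 * c * e'.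
Proof.
move=> mS0 mf mg fc gc fg e0 he'.
have c0 : 0 <= c by apply: le_trans (fc 0).
have bf := bm_cf P0 mS0 mf fc; have bg := bm_cf P0 mS0 mg gc.
have bo : bm (outbox A \o S0).
  apply: (bm_cf P0 mS0 (@measurable_outbox A) (c := 1)) => x.
  by rewrite /outbox; case: (~~ _); rewrite ?normr1 ?normr0.
rewrite -ExB; [|exact: bm_ig|exact: bm_ig].
apply: (@le_trans _ _ (Ex P0 (fun w => e + (2 * c) * outbox A (S0 w)))).
  apply: norm_Ex_le.
  - by apply: bm_ig; exact: bmB.
  - by apply: bm_ig; apply: bmD; [exact: bm_cst|exact: bmZ].
  - move=> w; rewrite /outbox /=; case: asboolP => [h|_] /=.
      by rewrite mulr0 addr0; exact: fg.
    rewrite mulr1; apply: le_trans (ler_normB _ _) _.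
    by have := fc (S0 w); have := gc (S0 w); lra.
have io := bm_ig P0 bo; have ic := ig_cst P0 e.
rewrite (ExD ic (igZ (2 * c) io)) (ExZ (2 * c) io) Ex_cst.
by rewrite lerD2l ler_wpM2l// mulr_ge0.
Qed.

(** Tightness confines both laws to a box, on which [f] is close to a trigonometric polynomial, and
    for these the convergence is assumed term by term. *)
Theorem levy_continuity (f : rV -> R) c : continuous f -> (forall x, `|f x| <= c) -> near_law f.
Proof.
move=> cf fc e e0.
have c0 : 0 <= c by apply: le_trans (fc 0).
(* Bounds the polynomial everywhere: it is within 1 of a function bounded by [c]. *)
pose c' := c + 2.
have e4 : 0 < e / 8 by rewrite divr_gt0.
have c1 : 0 < 2 * c' by rewrite mulr_gt0// ltr_wpDl.
pose e1 := Num.min 1 (e / 8).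
have e10 : 0 < e1 by rewrite lt_min ltr01.
have [A1 A10 h1] := tightS (divr_gt0 e4 c1).
have [A2 A20 h2] := tightS' (divr_gt0 e4 c1).
pose A := Num.max A1 A2.
have A0 : 0 < A by rewrite lt_max A10.
have [g [tg gc fg]] := almost_trig_approx cf A0 e10 fc.
have [q hq] := tg _ e10.
have qc x : `|trig q x| <= c'.
  have := hq x; have := gc x; rewrite !ler_norml => /andP[? ?] /andP[? ?].
  have : e1 <= 1 by rewrite ge_min lexx.
  by rewrite /c'; move=> ?; apply/andP; split; lra.
have fc' x : `|f x| <= c' by apply: le_trans (fc x) _; rewrite lerDl.
have fq x : box A x -> `|f x - trig q x| <= e / 4.
  move=> /fg h; rewrite -[f x](subrK (g x)) -addrA; apply: le_trans (ler_normD _ _) _.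
  have := hq x; have : e1 <= e / 8 by rewrite ge_min lexx orbT.
  by lra.
have outle B x : B <= A -> outbox A x <= outbox B x.
  move=> BA; rewrite /outbox; case: (asboolP (box A x)) => h1x; case: (asboolP (box B x)) => h2x //=.
  by exfalso; apply: h1x => i; apply: le_trans (h2x i) BA.
have mf := measurable_continuous_R cf.
have mq := measurable_trig q.
have bo d0 (T0 : measurableType d0) (P0 : probability T0 R) (S0 : T0 -> rV) B :
    measurable_fun setT (S0 : T0 -> borel rV) -> ig P0 (outbox B \o S0).
  move=> mS0; apply: bm_ig.
  apply: (bm_cf P0 mS0 (@measurable_outbox B) (c := 1)) => x.
  by rewrite /outbox; case: (~~ _); rewrite ?normr1 ?normr0.
have h3 := near_law_trig q e4.
have e40 : 0 <= e / 4 by rewrite divr_ge0// ltW.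
have q2 : `|Ex Q (f \o S') - Ex Q (trig q \o S')| <= e / 4 + 2 * c' * (e / 8 / (2 * c')).
  apply: (Ex_approx mS' mf mq fc' qc fq e40).
  apply: le_trans h2; apply: le_Ex; [exact: bo|exact: bo|].
  by move=> w; apply: outle; rewrite le_max lexx orbT.
near=> k.
have q1 : `|Ex P (f \o S k) - Ex P (trig q \o S k)| <= e / 4 + 2 * c' * (e / 8 / (2 * c')).
  apply: (Ex_approx (mS k) mf mq fc' qc fq e40).
  apply: (@le_trans _ _ (Ex P (outbox A1 \o S k))); last by near: k.
  apply: le_Ex; [exact: bo|exact: bo|].
  by move=> w; apply: outle; rewrite le_max lexx.
have q3 : `|Ex P (trig q \o S k) - Ex Q (trig q \o S')| <= e / 8 by near: k.
have e2 : 2 * c' * (e / 8 / (2 * c')) = e / 8 by rewrite mulrC divfK// gt_eqF.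
rewrite e2 in q1 q2.
move: q1 q2 q3; rewrite !ler_norml => /andP[? ?] /andP[? ?] /andP[? ?].
by apply/andP; split; lra.
Unshelve. all: by end_near.
Qed.

End levy.

Section tight_law.
Context {R : realType} {l : nat} {d : measure_display} {T : measurableType d}.
Variables (P : probability T R) (V : T -> 'rV[R]_l).
Hypothesis mV : measurable_fun setT (V : T -> borel 'rV[R]_l).

Lemma tight_single (e : R) : 0 < e -> exists2 A, 0 < A & Ex P (outbox A \o V) <= e.
Proof.
move=> e0.
pose F (n : nat) : set T := V @^-1` (~` box n.+1%:R).
have mF n : measurable (F n).
  have mB : measurable (~` box n.+1%:R : set (borel 'rV[R]_l)).
    by apply: measurableC; apply: borel_compact; exact: box_compact.
  by have := mV measurableT mB; rewrite setTI.
have F0 : \bigcap_n F n = set0.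
  rewrite -subset0 => w Fw.
  apply: (Fw (Num.truncn (\sum_i `|V w 0 i|)) I) => i.
  apply: le_trans (ltW (truncnS_gt _)); rewrite (bigD1 i)//= lerDl.
  exact: sumr_ge0.
have cv : P (F n) @[n --> \oo] --> P (\bigcap_n F n).
  apply: nonincreasing_cvg_mu => //.
  - by apply: le_lt_trans (probability_le1 _ _) (ltry _).
  - exact: bigcapT_measurable.
  - apply/nonincreasing_seqP => n; apply/subsetPset => w h1 h2; apply: h1 => i.
    by apply: le_trans (h2 i) _; rewrite ler_nat.
rewrite F0 measure0 in cv.
have /fine_cvgP[_ /cvgr0Pnorm_le /(_ _ e0) [n _ hn]] := cv.
exists n.+1%:R; first by rewrite ltr0n.
have := hn n (leqnn n); rewrite /= ger0_norm ?fine_ge0// => h.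
apply: le_trans h; rewrite -Ex_indic// le_eqVlt; apply/orP; left; apply/eqP.
apply: eq_Ex => w; rewrite /outbox /= indicE; congr ((nat_of_bool _)%:R).
by apply/idP/idP => [/asboolPn h|/set_mem h]; [exact/mem_set|exact/asboolPn].
Qed.

End tight_law.

(** * The normal law: density, Stein identity and characteristic function *)

Section density.
Context d (T : measurableType d) (R : realType).
Variables (mu : {sigma_finite_measure set T -> \bar R}).
Variables (nu : probability T R) (p : T -> R).
Hypothesis p0 : forall x, 0 <= p x.
Hypothesis numu : nu `<< mu.
Hypothesis ip : mu.-integrable setT (EFin \o p).
Hypothesis hp : forall A, measurable A -> nu A = (\int[mu]_(x in A) (p x)%:E)%E.

Let mp : measurable_fun setT (EFin \o p).
Proof. exact: (measurable_int mu). Qed.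

Lemma density_ge0_integral (f : T -> \bar R) : measurable_fun setT f ->
  (forall x, 0 <= f x)%E -> (\int[nu]_x f x = \int[mu]_x (f x * (p x)%:E))%E.
Proof.
move=> mf f0.
rewrite -(Radon_Nikodym_SigmaFinite.change_of_variables numu f0 measurableT mf).
have irn := Radon_Nikodym_SigmaFinite.f_integrable numu.
apply: ae_eq_integral => //.
- apply: emeasurable_funM => //; exact: (measurable_int mu irn).
- exact: emeasurable_funM.
apply: ae_eqe_mul2l; apply: integral_ae_eq => // A _ mA.
exact: (etrans (esym (Radon_Nikodym_SigmaFinite.f_integral numu mA)) (hp mA)).
Qed.

Lemma density_integral (f : T -> R) : ig nu f ->
  mu.-integrable setT (EFin \o (fun x => f x * p x)) /\
  Ex nu f = Rintegral mu setT (fun x => f x * p x).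
Proof.
move=> fi; have mf := ig_meas fi.
have irn := Radon_Nikodym_integrable (nu := charge_of_finite_measure nu) numu.
have aeq : ae_eq mu setT (Radon_Nikodym (charge_of_finite_measure nu) mu) (EFin \o p).
  apply: integral_ae_eq => // A _ mA.
  exact: (etrans (esym (Radon_Nikodym_integral (nu := charge_of_finite_measure nu) numu mA)) (hp mA)).
have e1 := Radon_Nikodym_change_of_variables numu measurableT fi.
split; last first.
  rewrite /Ex /Rintegral -e1; congr fine.
  apply: ae_eq_integral => //.
  - apply: emeasurable_funM; first exact/measurable_EFinP.
    exact: (measurable_int mu irn).
  - by under eq_fun do rewrite EFinM; apply: emeasurable_funM => //; exact/measurable_EFinP.
  - under [X in ae_eq _ _ _ X]eq_fun do rewrite EFinM.
    exact: (ae_eqe_mul2l (fun x => (f x)%:E) aeq).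
apply/integrableP; split.
  by apply/measurable_EFinP; apply: measurable_funM => //; exact/measurable_EFinP.
have /integrableP[_ hfin] := fi.
apply: le_lt_trans hfin.
rewrite (density_ge0_integral (f := fun x => `|(f x)%:E|%E))//; last first.
  by apply: measurableT_comp => //; exact/measurable_EFinP.
rewrite le_eqVlt; apply/orP; left; apply/eqP; apply: eq_integral => x _.
by rewrite /= normrM (ger0_norm (p0 x)) EFinM.
Qed.

End density.

Lemma FTC2_is_derive (R : realType) (F f : R -> R) (a b : R) : a < b ->
  (forall x : R, is_derive x 1 F (f x)) -> continuous f ->
  (\int[lebesgue_measure]_(x in `[a, b]) (f x)%:E = (F b - F a)%:E)%E.
Proof.
move=> ab hF cf; rewrite EFinB; apply: continuous_FTC2 => //.
- exact: continuous_subspaceT.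
- have cF := is_derive_continuous hF; split.
  + by move=> x _; case: (hF x).
  + exact: cvg_at_right_filter (cF a).
  + exact: cvg_at_left_filter (cF b).
- by move=> x _; rewrite derive1E; case: (hF x).
Qed.

Section normal_charfun.
Context (R : realType).
Variable s : R.
Hypothesis s0 : s != 0.
Local Notation Q := (normal_prob (0 : R) s).
Local Notation RT := (measurableTypeR R).
Local Notation lam := (@lebesgue_measure R).
Local Notation p := (normal_pdf (0 : R) s).

Let pE x : p x = normal_peak s * expR (- (x ^+ 2 / (s ^+ 2 *+ 2))).
Proof. by rewrite normal_pdfE// /normal_fun subr0 mulNr. Qed.

Let s2 : 0 < s ^+ 2.
Proof. by rewrite exprn_even_gt0. Qed.

Let Qdens A : measurable A -> Q A = (\int[lam]_(x in A) (p x)%:E)%E.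
Proof. by []. Qed.

Let p0 x : 0 <= p x. Proof. exact: normal_pdf_ge0. Qed.

(** With [u = x^2 / (4 s^2)] the density is a multiple of [exp (- 2 u)]. Since [u * exp (- u) <= 1],
    the function [x^2 p] is dominated by a multiple of the normal density of variance [2 s^2]. *)
Lemma normal_L2 : L2 Q id.
Proof.
split; first exact: measurable_id.
have m2 : measurable_fun setT (fun x : R => x ^+ 2) by exact: measurable_funX.
apply/integrableP; split; first exact/measurable_EFinP.
under eq_integral do rewrite /= ger0_norm ?sqr_ge0//.
rewrite (density_ge0_integral (normal_prob_dominates 0 s) (integrable_normal_pdf 0 s) Qdens)//; last 2 first.
- exact/measurable_EFinP.
- by move=> x; rewrite lee_fin sqr_ge0.
pose s' := Num.sqrt 2 * s.
have s'0 : s' != 0 by rewrite mulf_neq0// gt_eqF// sqrtr_gt0.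
pose K := 4 * s ^+ 2 * normal_peak s / normal_peak s'.
have pk' := normal_peak_gt0 s'0; have pk := normal_peak_gt0 s0.
have K0 : 0 <= K by rewrite divr_ge0 ?(ltW pk')// mulr_ge0 ?(ltW pk)// mulr_ge0 ?(ltW s2)//.
apply: (@le_lt_trans _ _ (\int[lam]_x (K * normal_pdf 0 s' x)%:E)%E); last first.
  under eq_integral do rewrite EFinM.
  rewrite integralZl//; last exact: integrable_normal_pdf.
  by rewrite integral_normal_pdf mule1 ltry.
apply: ge0_le_integral => //.
- by move=> x _; apply: mule_ge0; rewrite lee_fin ?sqr_ge0.
- apply: emeasurable_funM; first exact/measurable_EFinP.
  by apply/measurable_EFinP; exact: measurable_normal_pdf.
- by apply/measurable_EFinP; apply: measurable_funM => //; exact: measurable_normal_pdf.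
move=> x _; rewrite -EFinM lee_fin.
rewrite pE normal_pdfE// /normal_fun subr0 mulNr.
pose u := x ^+ 2 / (4 * s ^+ 2).
have u0 : 0 <= u by rewrite divr_ge0 ?sqr_ge0// mulr_ge0// ltW.
have -> : x ^+ 2 / (s ^+ 2 *+ 2) = u + u by rewrite /u; field; exact: s0.
have -> : x ^+ 2 / (s' ^+ 2 *+ 2) = u.
  by rewrite /u /s' exprMn sqr_sqrtr//; field; exact: s0.
rewrite opprD expRD.
have -> : x ^+ 2 = 4 * s ^+ 2 * u by rewrite /u; field; exact: s0.
have -> : K * (normal_peak s' * expR (- u)) = 4 * s ^+ 2 * normal_peak s * expR (- u).
  by rewrite /K; field; rewrite gt_eqF.
have h : u * expR (- u) <= 1.
  by rewrite expRN ler_pdivrMr ?expR_gt0// mul1r (le_trans _ (expR_ge1Dx u))// lerDr.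
have -> : 4 * s ^+ 2 * u * (normal_peak s * (expR (- u) * expR (- u))) =
  4 * s ^+ 2 * normal_peak s * expR (- u) * (u * expR (- u)) by ring.
by rewrite ler_piMr// mulr_ge0 ?expR_ge0// mulr_ge0 ?(ltW pk)// mulr_ge0 ?(ltW s2).
Qed.

Lemma pdf_derive (x : R) : is_derive x 1 p (- (x / s ^+ 2) * p x).
Proof.
have h1 : is_derive x 1 (fun x : R => - (x ^+ 2 / (s ^+ 2 *+ 2))) (- (x / s ^+ 2)).
  apply: is_derive_eq; rewrite /GRing.scale /=; field; exact: s0.
have h2 := @is_derive1_comp R expR _ x _ _ (is_derive_expR _) h1.
have h3 := is_deriveZ (normal_peak s) h2.
have -> : p = normal_peak s \*: (expR \o (fun x : R => - (x ^+ 2 / (s ^+ 2 *+ 2)))).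
  by apply/funext => y; rewrite pE.
apply: (is_derive_eq h3); rewrite /= /GRing.scale /=; ring.
Qed.

(** The integrand is the derivative of [- s^2 sin (a x + th) p x], which vanishes at infinity. *)
Lemma normal_stein (a th : R) :
  Ex Q (fun x => x * sin (a * x + th)) - s ^+ 2 * Ex Q (fun x => a * cos (a * x + th)) = 0.
Proof.
have ma : measurable_fun setT (fun x : RT => a * x + th) by exact: measurable_affine.
have bs := bm_sinf ma; have bc := bm_cosf ma.
have i1 : ig Q (fun x => x * sin (a * x + th)).
  have := L2_ig (L2_bmM bs normal_L2).
  by under eq_fun do rewrite mulrC.
have i2 : ig Q (fun x => a * cos (a * x + th)) by apply: bm_ig; exact: bmZ.
rewrite -ExZ// -ExB//; last exact: igZ.
pose h x := x * sin (a * x + th) - s ^+ 2 * (a * cos (a * x + th)).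
have ih : ig Q h by apply: igB => //; exact: igZ.
have [ihp ->] := density_integral (mu := lam) (nu := Q) (p := p) p0 (normal_prob_dominates 0 s) (integrable_normal_pdf 0 s) Qdens ih.
pose F x := - s ^+ 2 * (sin (a * x + th) * p x).
have dF (x : R) : is_derive x 1 F (h x * p x).
  have d1 : is_derive x 1 (fun x : R => a * x + th) a.
    by apply: is_derive_eq; rewrite /GRing.scale /=; ring.
  have d2 := @is_derive1_comp R sin _ x _ _ (is_derive_sin _) d1.
  have d3 := @is_deriveM R _ _ _ x 1 _ _ d2 (pdf_derive x).
  have d4 := is_deriveZ (- s ^+ 2) d3.
  apply: (is_derive_eq d4); rewrite /h /GRing.scale /=; field; exact: s0.
have cp : continuous p by exact: is_derive_continuous pdf_derive.
have ca : continuous (fun x : R => a * x + th).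
  move=> x; apply: cvgD; last exact: cvg_cst.
  by apply: cvgM; [exact: cvg_cst|exact: cvg_id].
have cs : continuous (fun x : R => sin (a * x + th)).
  by move=> x; exact: (continuous_comp (ca x) (@continuous_sin R _)).
have cc : continuous (fun x : R => cos (a * x + th)).
  by move=> x; exact: (continuous_comp (ca x) (@continuous_cos R _)).
have chp : continuous (fun x => h x * p x).
  move=> x; apply: cvgM; last exact: cp.
  apply: cvgB; first by apply: cvgM; [exact: cvg_id|exact: cs].
  by apply: cvgM; [exact: cvg_cst|]; apply: cvgM; [exact: cvg_cst|exact: cc].
pose I (n : nat) : set RT := [set` `[- n.+1%:R, n.+1%:R : R]].
have mI n : measurable (I n) by exact: measurable_itv.
pose G (n : nat) (x : RT) : \bar R := ((fun x : RT => (h x * p x)%:E) \_ (I n)) x.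
have mhp : measurable_fun setT (fun x : RT => (h x * p x)%:E).
  exact: (measurable_int _ ihp).
(* The integral over the line is the limit of those over [[-(n+1), n+1]], each computed by the
   fundamental theorem of calculus. *)
have cvG : (\int[lam]_x G n x)%E @[n --> \oo] --> (\int[lam]_x (h x * p x)%:E)%E.
  have := @dominated_convergence _ _ _ lam setT measurableT G (fun x => (h x * p x)%:E)
    (fun x => `|(h x * p x)%:E|%E) _ mhp _ _ _.
  case=> //.
  - move=> n; rewrite /G; apply/(measurable_restrictT _ (mI n)).
    exact: measurable_funTS.
  - apply: aeW => x _; apply: cvg_near_cst.
    exists (Num.truncn `|x|) => // n /= hn; rewrite /G patchE.
    case: ifPn => // /negP; case; apply/mem_set.
    rewrite /I /= in_itv /= -ler_norml.
    by apply: le_trans (ltW (truncnS_gt _)) _; rewrite ler_nat.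
  - exact: integrable_abse.
  - apply: aeW => x n _; rewrite /G patchE; case: ifPn => // _.
    by rewrite abse0.
have eG n : (\int[lam]_x G n x = (F n.+1%:R - F (- n.+1%:R))%:E)%E.
  rewrite /G -integral_mkcond FTC2_is_derive//.
  by rewrite gtrN// ltr0n.
have F0 : (F n.+1%:R - F (- n.+1%:R)) @[n --> \oo] --> (0 : R).
  have Fle x : 1 <= x -> `|F x| <= 2 * s ^+ 4 * normal_peak s / x /\
      `|F (- x)| <= 2 * s ^+ 4 * normal_peak s / x.
    move=> x1; have x0 : 0 < x by exact: lt_le_trans ltr01 x1.
    have pk := normal_peak_gt0 s0.
    have hp : p x <= 2 * s ^+ 2 * normal_peak s / x.
      rewrite pE expRN.
      have u1 := expR_ge1Dx (x ^+ 2 / (s ^+ 2 *+ 2)).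
      have u2 : x / (2 * s ^+ 2) <= expR (x ^+ 2 / (s ^+ 2 *+ 2)).
        apply: le_trans u1; rewrite mulr_natl.
        apply: (@le_trans _ _ (x ^+ 2 / (s ^+ 2 *+ 2))); last by rewrite lerDr.
        by rewrite ler_wpM2r ?invr_ge0 ?mulrn_wge0 ?(ltW s2)// expr2 ler_peMl// ltW.
      rewrite ler_pdivrMr ?expR_gt0//.
      apply: (@le_trans _ _ (2 * s ^+ 2 * normal_peak s / x * (x / (2 * s ^+ 2)))).
        by rewrite le_eqVlt; apply/orP; left; apply/eqP; field; rewrite (gt_eqF x0) s0.
      by rewrite ler_wpM2l// divr_ge0 ?(ltW x0)// mulr_ge0 ?(ltW pk)// mulr_ge0 ?(ltW s2).
    have aux y : p y = p x -> `|F y| <= 2 * s ^+ 4 * normal_peak s / x.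
      move=> py; rewrite /F normrM normrN (ger0_norm (ltW s2)) normrM py (ger0_norm (p0 x)).
      have -> : 2 * s ^+ 4 * normal_peak s / x = s ^+ 2 * (2 * s ^+ 2 * normal_peak s / x).
        by field; rewrite gt_eqF.
      rewrite ler_wpM2l ?(ltW s2)//; apply: le_trans hp; rewrite ler_piMl//.
      by rewrite ler_norml sin_geN1 sin_le1.
    split; first exact: aux.
    by apply: aux; rewrite !pE sqrrN.
  apply/cvgrPdist_le => e e0.
  pose c := 2 * s ^+ 4 * normal_peak s.
  have c0 : 0 <= c by rewrite mulr_ge0 ?normal_peak_ge0// mulr_ge0// exprn_even_ge0.
  exists (Num.truncn (2 * c / e)) => // n /= hn.
  rewrite sub0r normrN; apply: le_trans (ler_normB _ _) _.
  have n1 : 1 <= n.+1%:R :> R by rewrite ler1n.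
  have [h1 h2] := Fle _ n1.
  have n0 : 0 < n.+1%:R :> R by rewrite ltr0n.
  apply: le_trans (lerD h1 h2) _; rewrite -/c -mulrDl ler_pdivrMr//.
  have : 2 * c / e <= n.+1%:R.
    by apply: le_trans (ltW (truncnS_gt _)) _; rewrite ler_nat.
  by rewrite ler_pdivrMr//; lra.
rewrite /Rintegral.
have e : (fun n => \int[lam]_x G n x)%E = fun n => (F n.+1%:R - F (- n.+1%:R))%:E.
  by apply/funext => n; rewrite eG.
rewrite e in cvG.
have cv0 : (F n.+1%:R - F (- n.+1%:R))%:E @[n --> \oo] --> 0%:E.
  by apply/fine_cvgP; split; [exact: nearW|exact: F0].
by rewrite -(cvg_unique _ cv0 cvG).
Qed.

(** The differential equation behind [charfun_of_stein], with error 0. *)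
Lemma normal_charfun (th a : R) :
  Ex Q (fun x => cos (a * x + th)) = cos th * expR (- (a ^+ 2 * s ^+ 2 / 2)).
Proof.
have L2a : L2 Q (fun x => a * x) by apply: L2Z; exact: normal_L2.
have v0 : 0 <= a ^+ 2 * s ^+ 2 by rewrite mulr_ge0 ?sqr_ge0.
apply/eqP; rewrite -subr_eq0 -normr_le0.
apply: (charfun_of_stein L2a (lexx 0) v0) => t _.
have e : Ex Q (fun x => a * x * sin (t * (a * x) + th)) =
    a * Ex Q (fun x => x * sin (t * a * x + th)).
  rewrite -ExZ.
    by apply: eq_Ex => x; rewrite !mulrA.
  have ma : measurable_fun setT (fun x : RT => t * a * x + th) by exact: measurable_affine.
  have := L2_ig (L2_bmM (bm_sinf ma) normal_L2).
  by under eq_fun do rewrite mulrC.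
have e' : Ex Q (fun x => t * cos (t * (a * x) + th)) * a =
    Ex Q (fun x => t * a * cos (t * a * x + th)).
  rewrite mulrC -ExZ.
    by apply: eq_Ex => x; rewrite !mulrA [a * t]mulrC.
  have ma : measurable_fun setT (fun x : RT => t * (a * x) + th).
    by under eq_fun do rewrite mulrA; exact: measurable_affine.
  by apply: bm_ig; apply: bmZ; exact: bm_cosf.
have h := normal_stein (t * a) th.
rewrite e -e' in h *.
have -> : a * Ex Q (fun x => x * sin (t * a * x + th)) -
  a ^+ 2 * s ^+ 2 * Ex Q (fun x => t * cos (t * (a * x) + th)) =
  a * (Ex Q (fun x => x * sin (t * a * x + th)) -
    s ^+ 2 * (Ex Q (fun x => t * cos (t * (a * x) + th)) * a)) by ring.
by rewrite h mulr0 normr0.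
Qed.

End normal_charfun.

(** * A real law is determined by its cosine transforms with phase *)

Section law_uniqueness.
Context {R : realType} {d d' : measure_display}.
Context {T : measurableType d} {T' : measurableType d'}.
Variables (P : probability T R) (Q : probability T' R).
Variables (S : T -> R) (S' : T' -> R).
Hypothesis mS : measurable_fun setT S.
Hypothesis mS' : measurable_fun setT S'.
Hypothesis SS' : forall a th : R,
  Ex P (fun w => cos (a * S w + th)) = Ex Q (fun w => cos (a * S' w + th)).

(** The continuity theorem for a constant sequence in dimension one. *)
Lemma Ex_continuous_eq (f : R -> R) c : continuous f -> (forall x, `|f x| <= c) ->
  Ex P (f \o S) = Ex Q (f \o S').
Proof.
move=> cf fc.
pose V w : 'rV[R]_1 := const_mx (S w); pose V' w : 'rV[R]_1 := const_mx (S' w).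
have mV : measurable_fun setT (V : T -> borel 'rV[R]_1).
  by apply: measurable_rV => i; under eq_fun do rewrite mxE.
have mV' : measurable_fun setT (V' : T' -> borel 'rV[R]_1).
  by apply: measurable_rV => i; under eq_fun do rewrite mxE.
have hc (t : 'rV[R]_1) th : near_law P Q (fun=> V) V' (fun x => cos (dotr t x + th)).
  move=> e e0; apply: nearW => k.
  have E d0 (T0 : measurableType d0) (P0 : probability T0 R) (S0 : T0 -> R) :
    Ex P0 ((fun x => cos (dotr t x + th)) \o (fun w => const_mx (S0 w) : 'rV[R]_1)) =
    Ex P0 (fun w => cos (t 0 0 * S0 w + th)).
    by apply: eq_Ex => w /=; rewrite dotrE big_ord1 mxE mulrC.
  by rewrite !E SS' subrr normr0 ltW.
have cg : continuous (fun x : 'rV[R]_1 => f (x 0 0)).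
  by move=> x; exact: (continuous_comp (@coord_continuous R 1 1 0 0 x) (cf _)).
have tS e : 0 < e -> exists2 A, 0 < A & \forall k \near \oo, Ex P (outbox A \o V) <= e.
  by move=> /(tight_single P mV)[A A0 h]; exists A => //; exact: nearW.
have h := levy_continuity (fun=> mV) mV' hc tS (tight_single Q mV') cg (fun x => fc (x 0 0)).
have E d0 (T0 : measurableType d0) (P0 : probability T0 R) (S0 : T0 -> R) :
  Ex P0 ((fun x : 'rV[R]_1 => f (x 0 0)) \o (fun w => const_mx (S0 w) : 'rV[R]_1)) = Ex P0 (f \o S0).
  by apply: eq_Ex => w /=; rewrite mxE.
apply/eqP; rewrite -subr_eq0 -normr_le0; apply/ler_addgt0Pl => e e0.
have [n _ /(_ n (leqnn n))] := h e e0.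
by rewrite !E addr0.
Qed.

End law_uniqueness.

Section halfline.
Context {R : realType} {d d' : measure_display}.
Context {T : measurableType d} {T' : measurableType d'}.

Lemma halfline_le (P : probability T R) (Q : probability T' R) (S : T -> R) (S' : T' -> R) :
  measurable_fun setT S -> measurable_fun setT S' ->
  (forall a th : R, Ex P (fun w => cos (a * S w + th)) = Ex Q (fun w => cos (a * S' w + th))) ->
  forall x : R, (P (S @^-1` `]x, +oo[) <= Q (S' @^-1` `]x, +oo[))%E.
Proof.
move=> mS mS' SS' x.
have mA (y : R) : measurable (S @^-1` `]y, +oo[).
  by rewrite -[X in measurable X]setTI; apply: mS => //; exact: measurable_itv.
have mA' (y : R) : measurable (S' @^-1` `]y, +oo[).
  by rewrite -[X in measurable X]setTI; apply: mS' => //; exact: measurable_itv.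
have step n : (P (S @^-1` `](x + n.+1%:R^-1)%R, +oo[) <= Q (S' @^-1` `]x, +oo[))%E.
  (* A continuous ramp squeezed between the indicators of the half-lines beyond [x + 1/(n+1)] and
     beyond [x]. *)
  pose f : R -> R := cst 1 \min (cst 0 \max (fun y => n.+1%:R * (y - x))).
  have n0 : 0 < n.+1%:R :> R by rewrite ltr0n.
  have cf : continuous f.
    apply: (@min_fun_continuous _ _ R); first by move=> y; exact: cvg_cst.
    apply: (@max_fun_continuous _ _ R); first by move=> y; exact: cvg_cst.
    move=> y; apply: cvgM; first exact: cvg_cst.
    by apply: cvgB; [exact: cvg_id|exact: cvg_cst].
  have f01 y : 0 <= f y <= 1.
    by rewrite /f /= le_min ler01 le_max lexx /= ge_min lexx.
  have fc y : `|f y| <= 1 by rewrite ger0_norm; have /andP[] := f01 y.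
  have mf : measurable_fun setT f by exact: continuous_measurable_fun.
  have bf d0 (T0 : measurableType d0) (S0 : T0 -> R) : measurable_fun setT S0 -> bm (f \o S0).
    by move=> m0; split; [exact: (measurableT_comp mf m0)|exists 1 => w; exact: fc].
  rewrite -(fineK (fin_num_measure P _ (mA (x + n.+1%:R^-1)))) -(fineK (fin_num_measure Q _ (mA' x))) lee_fin.
  rewrite -!Ex_indic//.
  apply: (@le_trans _ _ (Ex P (f \o S))).
    apply: le_Ex; [by apply: bm_ig; exact: bm_indic|exact/bm_ig/bf|].
    move=> w; rewrite indicE; have /andP[f0 _] := f01 (S w).
    case: (boolP (w \in _)) => // /set_mem /=.
    rewrite in_itv /= andbT => h; rewrite /f /= le_min lexx le_max; apply/orP; right.
    by rewrite -ler_pdivrMl// mulr1 lerBrDl; exact: ltW.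
  rewrite (Ex_continuous_eq mS mS' SS' cf fc).
  apply: le_Ex; [exact/bm_ig/bf|by apply: bm_ig; exact: bm_indic|].
  move=> w; rewrite indicE; have /andP[_ f1] := f01 (S' w).
  case: (boolP (w \in _)) => // /negP h; rewrite /f /= ge_min ge_max lexx /=.
  apply/orP; right; rewrite pmulr_rle0// subr_le0 leNgt; apply/negP => h'; apply: h.
  by apply/mem_set; rewrite /= in_itv /= h'.
have -> : S @^-1` `]x, +oo[ = \bigcup_n (S @^-1` `](x + n.+1%:R^-1)%R, +oo[).
  apply/seteqP; split => w /=; rewrite in_itv /= andbT.
    move=> h; have xw : 0 < S w - x by rewrite subr_gt0.
    exists (Num.truncn (S w - x)^-1) => //=; rewrite in_itv /= andbT -ltrBrDl.
    by rewrite invf_plt ?posrE// truncnS_gt.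
  move=> [n _ /=]; rewrite in_itv /= andbT => h; apply: lt_trans h.
  by rewrite ltrDl invr_gt0 ltr0n.
have cv : P (S @^-1` `](x + n.+1%:R^-1)%R, +oo[) @[n --> \oo] -->
    P (\bigcup_n (S @^-1` `](x + n.+1%:R^-1)%R, +oo[)).
  apply: nondecreasing_cvg_mu => //; first exact: bigcupT_measurable.
  apply/nondecreasing_seqP => n; apply/subsetPset => w /=; rewrite !in_itv /= !andbT.
  by apply: le_lt_trans; rewrite lerD2l lef_pV2 ?posrE ?ltr0n// ler_nat.
rewrite -(cvg_lim _ cv)//; apply: lime_le; first by apply/cvg_ex; eexists; exact: cv.
by apply: nearW => n; exact: step.
Qed.

End halfline.

Section law_unique.
Context {R : realType} {d d' : measure_display}.
Context {T : measurableType d} {T' : measurableType d'}.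

(** Open half-lines are stable under intersection and generate the Borel sets, and [halfline_le] in
    both directions gives equality on them. *)
Theorem law_unique (P : probability T R) (Q : probability T' R) (S : T -> R) (S' : T' -> R) :
  measurable_fun setT S -> measurable_fun setT S' ->
  (forall a th : R, Ex P (fun w => cos (a * S w + th)) = Ex Q (fun w => cos (a * S' w + th))) ->
  forall A : set R, measurable A -> P (S @^-1` A) = Q (S' @^-1` A).
Proof.
move=> mS mS' SS' A mA.
have inS : S \in mfun by exact: mem_set.
have inS' : S' \in mfun by exact: mem_set.
pose m1 := distribution P (mfun_Sub inS); pose m2 := distribution Q (mfun_Sub inS').
suff : m1 A = m2 A by [].
apply: (@measure_unique _ R _ (@RGenOInfty.G R)
  (fun n => `](- n%:R), +oo[%classic) _ _ _ _ m1 m2) => //.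
- exact: RGenOInfty.measurableE.
- move=> _ _ [x ->] [y ->]; exists (Num.max x y).
  apply/seteqP; split => z /=; rewrite !in_itv /= !andbT gt_max; first by move=> [-> ->].
  by move=> /andP.
- by move=> n; exists (- n%:R).
- apply/seteqP; split => // x _; exists (Num.truncn `|x|).+1 => //=.
  rewrite in_itv /= andbT; have := truncnS_gt `|x|; have := ler_norm (- x).
  rewrite normrN; lra.
- move=> _ [x ->]; apply/eqP; rewrite eq_le; apply/andP; split.
    exact: (halfline_le mS mS' SS' x).
  exact: (halfline_le mS' mS (fun a th => esym (SS' a th)) x).
- by move=> n; apply: le_lt_trans (probability_le1 _ _) (ltry _) => //; exact: measurable_itv.
Qed.

End law_unique.

(** * Existence of Gaussian vectors with prescribed covariance *)

Section sum_of_squares.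
Context {R : realType} {l : nat}.
Local Notation rV := 'rV[R]_l.

Definition qf (S : 'M[R]_l) (t u : rV) : R := (t *m S *m u^T) 0 0.

Lemma qfE S t u : qf S t u = \sum_i \sum_j t 0 i * S i j * u 0 j.
Proof.
rewrite /qf mxE exchange_big /=; apply: eq_bigr => j _.
by rewrite mxE big_distrl /=; apply: eq_bigr => i _; rewrite mxE.
Qed.

Lemma qf_delta S t i : qf S t (delta_mx 0 i) = \sum_j t 0 j * S j i.
Proof.
rewrite qfE; apply: eq_bigr => k _; rewrite (bigD1 i)//= big1 => [|j ji].
  by rewrite !mxE !eqxx mulr1 addr0.
by rewrite !mxE (negPf ji) mulr0.
Qed.

Lemma qf_shift (S : 'M[R]_l) (t : rV) (i : 'I_l) (c : R) : S^T = S ->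
  qf S (t - c *: delta_mx 0 i) (t - c *: delta_mx 0 i) =
  qf S t t - 2 * c * qf S t (delta_mx 0 i) + c ^+ 2 * S i i.
Proof.
move=> sS; pose e : rV := delta_mx 0 i.
have sym : qf S e t = qf S t e.
  by rewrite /qf -[in LHS](trmxK (e *m S *m t^T)) [in LHS]mxE !trmx_mul trmxK sS mulmxA.
have ee : qf S e e = S i i.
  rewrite qf_delta (bigD1 i)//= big1 => [|j ji]; first by rewrite !mxE !eqxx mul1r addr0.
  by rewrite !mxE (negPf ji) mul0r.
have -> : qf S (t - c *: e) (t - c *: e) =
   qf S t t - c * qf S t e - c * qf S e t + c * c * qf S e e.
  have tr : (t - c *: e)^T = t^T - c *: e^T by apply/matrixP => p q; rewrite !mxE.
  by rewrite /qf tr !mulmxBl !mulmxBr -!scalemxAr -!scalemxAl !mxE; ring.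
by rewrite sym ee /e; ring.
Qed.

(** Lagrange's completion of squares, by induction on the number [k] of leading rows that may be
    nonzero. *)
Lemma psd_sum_squares (S : 'M[R]_l) : S^T = S -> (forall t, 0 <= qf S t t) ->
  exists vs : seq rV, forall t, qf S t t = \sum_(v <- vs) dotr t v ^+ 2.
Proof.
suff h k : forall S : 'M[R]_l, S^T = S -> (forall t, 0 <= qf S t t) ->
    (forall i j : 'I_l, (k <= i)%N -> S i j = 0) ->
    exists vs : seq rV, forall t, qf S t t = \sum_(v <- vs) dotr t v ^+ 2.
  by move=> sS pS; apply: (h l) => // i j; rewrite leqNgt ltn_ord.
elim: k => [|k IHk] {}S sS pS kS.
  exists [::] => t; rewrite big_nil qfE big1// => i _; rewrite big1// => j _.
  by rewrite kS// mulr0 mul0r.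
have sym i j : S i j = S j i by rewrite -{1}sS mxE.
have [kl|lk] := ltnP k l; last first.
  by apply: (IHk S) => // i j ki; apply: kS; have := ltn_ord i; lia.
pose i := Ordinal kl.
have [a0|an0] := eqVneq (S i i) 0.
  apply: (IHk S) => // i' j; rewrite leq_eqVlt => /orP[/eqP e|]; last exact: kS.
  have -> : i' = i by apply/val_inj.
  (* When the diagonal entry vanishes, the form along [e_j - c e_i] is affine in [c]; being
     non-negative, it has slope 0, so the whole row vanishes. *)
  have hq (c : R) : 0 <= S j j - 2 * c * S i j.
    have := pS (delta_mx 0 j - c *: delta_mx 0 i).
    rewrite qf_shift// a0 mulr0 addr0 !qf_delta.
    rewrite (bigD1 j)//= big1 => [|m mj]; last by rewrite !mxE (negPf mj) mul0r.
    rewrite (bigD1 j)//= big1 => [|m mj]; last by rewrite !mxE (negPf mj) mul0r.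
    by rewrite !mxE !eqxx !mul1r !addr0 (sym j i).
  apply/eqP; apply: contraT => n0.
  have := hq ((S j j + 1) / (2 * S i j)).
  have -> : 2 * ((S j j + 1) / (2 * S i j)) * S i j = S j j + 1 by field.
  by rewrite opprD addrA subrr sub0r oppr_ge0 ler10.
have a_gt0 : 0 < S i i.
  rewrite lt_def an0 /=; have := pS (delta_mx 0 i).
  rewrite qf_delta (bigD1 i)//= big1 => [|j ji]; first by rewrite !mxE !eqxx mul1r addr0.
  by rewrite !mxE (negPf ji) mul0r.
pose a := S i i; pose v : rV := \row_j (S i j / Num.sqrt a).
(* The Schur complement: row [i] is cleared, and positivity persists because its value at [t] is
   that of [S] at the minimiser of the form along the line [t - c e_i]. *)
pose S' : 'M[R]_l := \matrix_(p, q) (S p q - S p i * S i q / a).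
have sqa : Num.sqrt a ^+ 2 = a by rewrite sqr_sqrtr// ltW.
have dv t : dotr t v = qf S t (delta_mx 0 i) / Num.sqrt a.
  rewrite dotrE qf_delta big_distrl /=; apply: eq_bigr => j _.
  by rewrite mxE (sym j i); ring.
have qS' t : qf S' t t = qf S t t - dotr t v ^+ 2.
  rewrite dv exprMn exprVn sqa qf_delta !qfE.
  have -> : (\sum_j t 0 j * S j i) ^+ 2 / a = \sum_p \sum_q t 0 p * (S p i * S i q / a) * t 0 q.
    rewrite expr2 !big_distrl /=; apply: eq_bigr => p _.
    rewrite big_distrr big_distrl /=; apply: eq_bigr => q _.
    by rewrite (sym i q); ring.
  rewrite -sumrB; apply: eq_bigr => p _; rewrite -sumrB; apply: eq_bigr => q _.
  by rewrite mxE; ring.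
have [|||vs hvs] := IHk S'.
- by apply/matrixP => p q; rewrite !mxE (sym q p) (sym q i) (sym i p); ring.
- move=> t; rewrite qS' dv exprMn exprVn sqa.
  have := pS (t - (qf S t (delta_mx 0 i) / a) *: delta_mx 0 i).
  rewrite qf_shift// -/a; set b := qf S t (delta_mx 0 i).
  have -> : qf S t t - 2 * (b / a) * b + (b / a) ^+ 2 * a = qf S t t - b ^+ 2 / a by field.
  by [].
- move=> p q; rewrite leq_eqVlt mxE => /orP[/eqP e|kp].
    have -> : p = i by apply/val_inj.
    by rewrite mulrAC divff// mul1r subrr.
  by rewrite !(kS p)// mul0r mul0r subr0.
by exists (v :: vs) => t; rewrite big_cons -hvs qS' addrC subrK.
Qed.

(** Each [v] adds an independent standard normal multiple of [v]; by Fubini the transform is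
    multiplied by the corresponding Gaussian factor. *)
Lemma gauss_exists (vs : seq rV) : exists mu : probability (borel rV) R,
  forall t th, Ex mu (fun x : borel rV => cos (dotr t x + th)) =
    cos th * expR (- ((\sum_(v <- vs) dotr t v ^+ 2) / 2)).
Proof.
elim: vs => [|v vs [mu hmu]].
  exists (dirac (0 : borel rV)) => t th.
  rewrite big_nil mul0r oppr0 expR0 mulr1 /Ex /Rintegral.
  have mc : measurable_fun setT (fun x : borel rV => cos (dotr t x + th)).
    by apply: measurable_cosf; apply: measurable_funD => //; exact: measurable_dotr.
  rewrite integral_dirac//; last exact/measurable_EFinP.
  by rewrite diracT mul1e /= dotrE big1 ?add0r// => i _; rewrite mxE mul0r.
pose g := normal_prob (0 : R) 1.
pose phi (z : borel rV * measurableTypeR R) : borel rV := (z.1 : rV) + (z.2 : R) *: v.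
have mphi : measurable_fun setT phi.
  apply: measurable_rV => i.
  have -> : (fun w => phi w 0 i) = fun w : borel rV * measurableTypeR R =>
    (w.1 : rV) 0 i + (w.2 : R) * v 0 i by apply/funext => w; rewrite !mxE.
  apply: measurable_funD.
    exact: (measurableT_comp (measurable_coord i) measurable_fst).
  by apply: measurable_funM => //; exact: measurable_snd.
have inphi : phi \in mfun by exact: mem_set.
exists (distribution (mu \x g)%E (mfun_Sub inphi)) => t th.
have mc : measurable_fun setT (fun x : borel rV => cos (dotr t x + th)).
  by apply: measurable_cosf; apply: measurable_funD => //; exact: measurable_dotr.
have -> : Ex (distribution (mu \x g)%E (mfun_Sub inphi)) (fun x : borel rV => cos (dotr t x + th)) =
    Ex (mu \x g)%E (fun z => cos (dotr t (phi z) + th)).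
  have := @equi_Ex _ _ _ _ _ _ R (distribution (mu \x g)%E (mfun_Sub inphi)) (mu \x g)%E id phi
    (@measurable_id _ _ setT) mphi (fun B mB => erefl) (fun x : borel rV => cos (dotr t x + th)) mc.
  exact.
pose f z := (cos (dotr t (phi z) + th))%:E.
have bf : bm (fun z => cos (dotr t (phi z) + th)).
  by apply: bm_cosf; apply: measurable_funD => //; exact: (measurableT_comp (measurable_dotr t) mphi).
have intf : (mu \x g)%E.-integrable setT f by exact: (bm_ig (mu \x g)%E bf).
rewrite {1}/Ex /Rintegral -(integral12_prod_meas1 intf).
have e x : (fubini_F g f x = (cos (dotr t x + th) * expR (- (dotr t v ^+ 2 / 2)))%:E)%E.
  rewrite /fubini_F /f /phi /=.
  have := normal_charfun (oner_neq0 R) (dotr t x + th) (dotr t v).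
  rewrite expr1n mulr1 /Ex /Rintegral => <-.
  rewrite fineK; last first.
    apply: integrable_fin_num => //.
    have ma : measurable_fun setT (fun y : measurableTypeR R => dotr t v * y + (dotr t x + th)).
      exact: measurable_affine.
    exact: (bm_ig g (bm_cosf ma)).
  apply: eq_integral => y _; congr ((cos _)%:E).
  rewrite !dotrE addrA; congr (_ + _); rewrite big_distrl -big_split /=.
  by apply: eq_bigr => i _; rewrite !mxE; ring.
under eq_integral do rewrite e.
transitivity (Ex mu (fun x : borel rV => expR (- (dotr t v ^+ 2 / 2)) * cos (dotr t x + th))).
  by apply: eq_Ex => x; rewrite mulrC.
rewrite ExZ; last by apply: bm_ig; apply: bm_cosf; apply: measurable_funD => //; exact: measurable_dotr.
rewrite hmu big_cons mulrDl opprD expRD; ring.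
Qed.

Lemma gaussian_exists (S : 'M[R]_l) : S^T = S -> (forall t, 0 <= qf S t t) ->
  exists mu : probability (borel rV) R, gaussian_law 0 S mu /\
  forall t th, Ex mu (fun x : borel rV => cos (dotr t x + th)) =
    cos th * expR (- (qf S t t / 2)).
Proof.
move=> sS pS; have [vs hvs] := psd_sum_squares sS pS.
have [mu hmu] := gauss_exists vs.
have hc t th : Ex mu (fun x : borel rV => cos (dotr t x + th)) = cos th * expR (- (qf S t t / 2)).
  by rewrite hmu hvs.
exists mu; split => //; split => // t A mA.
have mt : measurable_fun setT (dotr t : borel rV -> R) by exact: measurable_dotr.
have dZ (a : R) x : dotr (a *: t) x = a * dotr t x.
  by rewrite !dotrE big_distrr /=; apply: eq_bigr => i _; rewrite mxE; ring.
have hq (a : R) : qf S (a *: t) (a *: t) = a ^+ 2 * qf S t t.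
  by rewrite /qf linearZ /= -scalemxAr -!scalemxAl !mxE; ring.
have hca (a th : R) : Ex mu (fun x : borel rV => cos (a * dotr t x + th)) =
    cos th * expR (- (a ^+ 2 * qf S t t / 2)).
  by rewrite -hq -hc; apply: eq_Ex => x; rewrite dZ.
rewrite mul0mx mxE /normal_law -/(qf S t t).
case: eqVneq => [v0|vn0].
  (* Zero variance: the functional is compared with the constant 0, for which any probability space
     would serve. *)
  have := @law_unique R _ _ _ _ mu (normal_prob (0 : R) 1) (dotr t) (fun _ : measurableTypeR R => 0 : R) mt
    (measurable_cst _) _ A mA.
  move=> h; rewrite [LHS]h; last first.
    by move=> a th; rewrite hca v0 mulr0 mul0r oppr0 expR0 mulr1 mulr0 add0r Ex_cst.
  rewrite diracE; have [A0|nA0] := boolP ((0 : R) \in A).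
    rewrite (_ : _ @^-1` A = setT) ?probability_setT//.
    by apply/seteqP; split => // x _; exact: set_mem.
  rewrite (_ : _ @^-1` A = set0) ?measure0//.
  by apply/seteqP; split => // x /= h0; exact: (negP nA0 (mem_set h0)).
have s0 : Num.sqrt (qf S t t) != 0 by rewrite gt_eqF// sqrtr_gt0 lt_def vn0 pS.
apply: (@law_unique R _ _ _ _ mu (normal_prob (0 : R) (Num.sqrt (qf S t t))) (dotr t)
  (fun x : measurableTypeR R => x : R) mt (@measurable_id _ _ setT) _ A mA) => a th.
by rewrite hca normal_charfun// sqr_sqrtr.
Qed.

End sum_of_squares.

(** * From weighted counts to ratios *)

Lemma ratio_identity (R : realType) (v N c p : R) : 0 < v -> 0 < N ->
  Num.sqrt v * (c / N - p) = (Num.sqrt v)^-1 * (c - p * N) / (N / v).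
Proof.
move=> v0 N0; have s0 : 0 < Num.sqrt v by rewrite sqrtr_gt0.
have sv : v = Num.sqrt v ^+ 2 by rewrite sqr_sqrtr// ltW.
by rewrite {3}sv; field; rewrite !gt_eqF.
Qed.

Lemma ratio_close (R : realType) (x D lam eta : R) : 0 < lam -> 0 <= eta -> lam / 2 <= D ->
  `|D - lam| <= eta -> `|x / D - x / lam| <= `|x| * (2 * eta / lam ^+ 2).
Proof.
move=> lam0 eta0 hD h; have D0 : 0 < D by apply: lt_le_trans hD; rewrite divr_gt0.
have -> : x / D - x / lam = x * ((lam - D) / (D * lam)) by field; rewrite !gt_eqF.
rewrite normrM ler_wpM2l// normrM distrC normfV (gtr0_norm (mulr_gt0 D0 lam0)).
rewrite ler_pdivrMr ?mulr_gt0//; apply: le_trans h _.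
have -> : 2 * eta / lam ^+ 2 * (D * lam) = eta * (D / (lam / 2)) by field; rewrite gt_eqF.
by rewrite ler_peMr// ler_pdivlMr ?mul1r// divr_gt0.
Qed.

Lemma Rintegral_indicB d (T : measurableType d) (R : realType)
    (mu : {measure set T -> \bar R}) (A B : set T) (p : R) :
  measurable A -> measurable B -> (mu A < +oo)%E -> (mu B < +oo)%E ->
  (\int[mu]_z (\1_A z - p * \1_B z))%R = fine (mu A) - p * fine (mu B).
Proof.
move=> mA mB fA fB.
have ind D : measurable D -> (mu D < +oo)%E -> mu.-integrable setT (EFin \o (\1_D : T -> R)).
  move=> mD fD; apply/integrableP; split; first by apply/measurable_EFinP; exact: measurable_indic.
  under eq_integral do rewrite /= ger0_norm ?indicE//.
  by rewrite integral_indic// setIT.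
have fin D : (mu D < +oo)%E -> mu D \is a fin_num by move=> h; rewrite ge0_fin_numE.
rewrite /Rintegral.
have -> : (\int[mu]_x (\1_A x - p * \1_B x)%:E = \int[mu]_x ((\1_A x)%:E - (p * \1_B x)%:E))%E.
  by apply: eq_integral => x _; rewrite EFinB.
rewrite (integralB_EFin measurableT (ind A mA fA)); last exact: (integrableZl measurableT p (ind B mB fB)).
rewrite integral_indic// setIT.
under [X in (_ - X)%E]eq_integral do rewrite EFinM.
rewrite (integralZl measurableT (ind B mB fB)) integral_indic// setIT.
by rewrite -(fineK (fin A fA)) -(fineK (fin B fB)).
Qed.

Section final.
Context {R : realType} {dO : measure_display} {Omega : measurableType dO}.
Context {d : nat} {M : ptopologicalType}.
Variable P : probability Omega R.
Local Notation E := (borel 'rV[R]_d * borel M)%type.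
Local Notation rV := (borel 'rV[R]_d).
Variable X : R.-ker Omega ~> E.
Hypothesis d0 : (0 < d)%N.
Hypothesis mppX : marked_point_process X.
Hypothesis statX : stationary P X.
Hypothesis intensity_gt0 : (0 < intensity P X)%E.
Hypothesis intensity_fin : (intensity P X < +oo)%E.
Variables (bs bss : R -> R).
Hypothesis ratesX : mixing_rates P X bs bss.
Hypothesis betaX : condition_beta P X bs bss.
Variable W : nat -> set 'rV[R]_d.
Hypothesis casW : convex_averaging_sequence W.

Local Notation Ex := (Ex P).
Local Notation lam := (fine (intensity P X)).

Let lam0 : 0 < lam.
Proof. by rewrite fine_gt0// intensity_gt0 intensity_fin. Qed.

Lemma mpp_window_clt n (a : 'I_n -> R) (C : 'I_n -> set (borel M)) :
  (forall i, measurable (C i)) ->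
  (forall k, L2 P (Twin P X a C W k)) /\ exists2 sg2 : R, 0 <= sg2 &
  (forall e, 0 < e -> \forall k \near \oo, `|Ex (fun w => Twin P X a C W k w ^+ 2) - sg2| <= e) /\
  (forall th e, 0 < e -> \forall k \near \oo,
    `|Ex (fun w => cos (Twin P X a C W k w + th)) - cos th * expR (- (sg2 / 2))| <= e).
Proof.
move=> mC; have [bs0 bs_mono _ hcoef _] := ratesX.
have [delta delta0 [hmom bs_int _]] := betaX.
have inh (r : R) : 2^-1 <= r -> r \in (`[2^-1, +oo[ : interval R).
  by move=> h; rewrite in_itv /= h.
apply: (mpp_clt d0 mppX statX intensity_gt0 intensity_fin delta0 hmom _ _ bs_int hcoef) => //.
- by move=> r /inh /bs0[].
- move=> r s hr rs; apply: bs_mono => //; apply: inh => //.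
  exact: le_trans hr rs.
Qed.

Let cW k : compact (W k). Proof. by have [] := casW. Qed.
Let mW k : measurable (W k : set rV). Proof. by apply: borel_compact; exact: cW. Qed.

Definition Dk k w : R := fine (X w (W k `*` setT)) / vol (W k).

Lemma vol_near_ge (A : R) : \forall k \near \oo, A <= vol (W k).
Proof.
have [s /all_and2[us hs]] := choice (fun k => outer_seq (@cW k) 1).
exact: (vol_large d0 (mark_intensityT_gt0 intensity_gt0 intensity_fin)
  (mu0_cell statX intensity_fin) casW us hs A).
Qed.

(** The window theorem for the plain count bounds its variance by a multiple of the volume; dividing
    by the volume squared gives convergence in mean square. *)
Lemma Dk_near :
  (forall k, L2 P (fun w => Dk k w - lam)) /\
  forall e, 0 < e -> \forall k \near \oo, Ex (fun w => (Dk k w - lam) ^+ 2) <= e.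
Proof.
have [L2T [sg2 sg0 [hsg _]]] :=
  @mpp_window_clt 1 (fun=> 1) (fun=> setT) (fun=> measurableT).
have TE k w : 0 < vol (W k) -> Dk k w - lam =
    (Num.sqrt (vol (W k)))^-1 * Twin P X (n := 1) (fun=> 1) (fun=> setT) W k w :> R.
  move=> v0; rewrite /Twin /kappa /Xi !big_ord1 !mul1r mulrA -expr2 exprVn sqr_sqrtr ?ltW//.
  rewrite mulrBr mulrC /Dk; congr (_ - _).
  by rewrite mulrCA mulVf ?mulr1// gt_eqF.
split => [k|e e0].
  have [v0|vn0] := eqVneq (vol (W k)) 0.
    have -> : (fun w => Dk k w - lam) = fun=> - lam.
      by apply/funext => w; rewrite /Dk v0 invr0 mulr0 sub0r.
    by apply: bm_L2; exact: bm_cst.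
  have vp : 0 < vol (W k) by rewrite lt_def vn0 vol_ge0.
  have -> : (fun w => Dk k w - lam) = fun w =>
      (Num.sqrt (vol (W k)))^-1 * Twin P X (n := 1) (fun=> 1) (fun=> setT) W k w.
    by apply/funext => w; exact: TE.
  exact: L2Z.
near=> k.
have v0 : 0 < vol (W k) by apply: (@lt_le_trans _ _ 1) => //; near: k; exact: vol_near_ge.
under eq_Ex do rewrite TE// exprMn exprVn sqr_sqrtr ?(ltW v0)//.
have [_ iT] := L2T k.
rewrite ExZ// ler_pdivrMl// mulrC -ler_pdivrMl//.
have h1 : `|Ex (fun w => Twin P X (n := 1) (fun=> 1) (fun=> setT) W k w ^+ 2) - sg2| <= 1.
  by near: k; exact: hsg.
have h2 : (sg2 + 1) / e <= vol (W k) by near: k; exact: vol_near_ge.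
rewrite mulrC; apply: le_trans h2; rewrite ler_wpM2r ?invr_ge0 ?(ltW e0)//.
by move: h1; rewrite ler_norml => /andP[]; lra.
Unshelve. all: by end_near.
Qed.

Variables (l : nat) (C : 'I_l -> set (borel M)).
Hypothesis mC : forall i, measurable (C i).
Local Notation Yi k i := (Y_stat P X (W k) (C i)).
Local Notation Zi k i := (Z_stat P X (W k) (C i)).

Lemma Y_statE k i w : Yi k i w = (Num.sqrt (vol (W k)))^-1 *
  (fine (X w (W k `*` C i)) - palm_mark P X (C i) * fine (X w (W k `*` setT))).
Proof.
rewrite /Y_stat; congr (_ * _).
have fin (D : set (borel M)) : measurable D -> (X w (W k `*` D) < +oo)%E.
  by move=> mD; rewrite -ge0_fin_numE// (X_compact_fin mppX w (@cW k) mD).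
rewrite -Rintegral_indicB; [|exact: measurableX|exact: measurableX|exact: fin|exact: fin].
apply: eq_Rintegral => z _; rewrite !indicE !in_setX in_setT andbT.
case: (z.1 \in _); rewrite /= ?mulr1 ?mul1r// ?mulr0 ?mul0r subr0//.
Qed.

(** Index 0 stands for the whole mark space, whose weight subtracts the Palm probabilities; the
    other indices carry [t]. With [marks], this writes the combination of the [Y_stat] as one
    weighted count. *)
Definition coefs (t : 'rV[R]_l) (j : 'I_l.+1) : R :=
  if unlift ord0 j is Some i then t 0 i else - \sum_i t 0 i * palm_mark P X (C i).

Definition marks (j : 'I_l.+1) : set (borel M) :=
  if unlift ord0 j is Some i then C i else setT.

Lemma measurable_marks j : measurable (marks j).
Proof. by rewrite /marks; case: unlift => [i|]. Qed.

(** Each Palm probability times the total intensity is the corresponding mark intensity. *)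
Lemma kappa0 t : kappa P X (coefs t) marks = 0.
Proof.
rewrite /kappa big_ord_recl /coefs /marks unlift_none.
under [X in _ + X]eq_bigr do rewrite liftK.
rewrite mulNr big_distrl /= addrC -sumrB big1// => i _.
rewrite /palm_mark -/(mark_intensity P X (C i)) -[mark_intensity P X setT]/lam.
by rewrite -mulrA (mulrC lam^-1) mulfVK ?subrr// gt_eqF.
Qed.

Lemma dotr_Y t k w : dotr t (\row_i Yi k i w) = Twin P X (coefs t) marks W k w.
Proof.
rewrite /Twin kappa0 mul0r subr0 dotrE /Xi big_ord_recl /coefs /marks unlift_none.
under [X in _ + X]eq_bigr do rewrite liftK.
rewrite mulNr big_distrl /= addrC -sumrB big_distrr /=; apply: eq_bigr => i _.
by rewrite mxE Y_statE; ring.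
Qed.

Lemma Y_clt t : (forall k, L2 P (fun w => dotr t (\row_i Yi k i w))) /\
  exists2 sg2 : R, 0 <= sg2 &
  (forall e, 0 < e -> \forall k \near \oo,
    `|Ex (fun w => dotr t (\row_i Yi k i w) ^+ 2) - sg2| <= e) /\
  (forall th e, 0 < e -> \forall k \near \oo,
    `|Ex (fun w => cos (dotr t (\row_i Yi k i w) + th)) - cos th * expR (- (sg2 / 2))| <= e).
Proof.
have e k : (fun w => dotr t (\row_i Yi k i w)) = Twin P X (coefs t) marks W k.
  by apply/funext => w; exact: dotr_Y.
have [h1 [sg2 sg0 [h2 h3]]] := mpp_window_clt (coefs t) measurable_marks.
split; first by move=> k; rewrite e.
exists sg2 => //; split => [eps e0|th eps e0].
  by apply: filterS (h2 _ e0) => k; under [X in _ -> `|X - _| <= _]eq_Ex do rewrite dotr_Y.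
by apply: filterS (h3 th _ e0) => k; under [X in _ -> `|X - _| <= _]eq_Ex do rewrite dotr_Y.
Qed.

Lemma dotr_delta i (x : 'rV[R]_l) : dotr (delta_mx 0 i) x = x 0 i.
Proof.
rewrite dotrE (bigD1 i)//= big1 => [|j ji]; first by rewrite !mxE !eqxx mulr1 addr0.
by rewrite !mxE (negPf ji) andbF mulr0.
Qed.

Lemma Y_L2 k i : L2 P (Yi k i).
Proof.
have [h _] := Y_clt (delta_mx 0 i).
by have := h k; under eq_fun do rewrite dotr_delta mxE.
Qed.

Lemma Y_cov : exists Sigma : 'M[R]_l,
  [/\ forall i j, Ex (fun w => Yi k i w * Yi k j w) @[k --> \oo] --> Sigma i j,
      Sigma^T = Sigma, forall t, 0 <= qf Sigma t t &
   forall t th e, 0 < e -> \forall k \near \oo,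
    `|Ex (fun w => cos (dotr t (\row_i Yi k i w) + th)) -
      cos th * expR (- (qf Sigma t t / 2))| <= e].
Proof.
have [s hs] := choice (fun t => let: conj _ (ex_intro2 x a b) := Y_clt t in
  ex_intro (fun x => 0 <= x /\ (forall e, 0 < e -> \forall k \near \oo,
    `|Ex (fun w => dotr t (\row_i Yi k i w) ^+ 2) - x| <= e) /\
  (forall th e, 0 < e -> \forall k \near \oo,
    `|Ex (fun w => cos (dotr t (\row_i Yi k i w) + th)) - cos th * expR (- (x / 2))| <= e)) x (conj a b)).
have cs t : Ex (fun w => dotr t (\row_i Yi k i w) ^+ 2) @[k --> \oo] --> s t.
  apply/cvgrPdist_le => e e0; have [_ [h _]] := hs t.
  by apply: filterS (h e e0) => k; rewrite distrC.
(* Polarisation: [s t] is the limiting second moment of the combination [t], and limiting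
   covariances are recovered from sums and differences of basis vectors. *)
pose Sigma : 'M[R]_l := \matrix_(i, j)
  ((s (delta_mx 0 i + delta_mx 0 j) - s (delta_mx 0 i - delta_mx 0 j)) / 4).
have cS i j : Ex (fun w => Yi k i w * Yi k j w) @[k --> \oo] --> Sigma i j.
  rewrite mxE.
  have -> : (fun k => Ex (fun w => Yi k i w * Yi k j w)) = fun k =>
      (Ex (fun w => dotr (delta_mx 0 i + delta_mx 0 j) (\row_i Yi k i w) ^+ 2) -
       Ex (fun w => dotr (delta_mx 0 i - delta_mx 0 j) (\row_i Yi k i w) ^+ 2)) / 4.
    apply/funext => k.
    have [_ i1] := (Y_clt (delta_mx 0 i + delta_mx 0 j)).1 k.
    have [_ i2] := (Y_clt (delta_mx 0 i - delta_mx 0 j)).1 k.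
    rewrite -ExB// mulrC -ExZ; last exact: igB.
    apply: eq_Ex => w; rewrite dotrDl dotrBl !dotr_delta !mxE.
    by move: (Yi k i w) (Yi k j w) => a b; field.
  by apply: cvgM; [apply: cvgB; exact: cs|exact: cvg_cst].
have sS : Sigma^T = Sigma.
  apply/matrixP => i j; rewrite [LHS]mxE.
  apply: (@cvg_unique _ (@norm_hausdorff R R) _ _ _ _ (cS j i)).
  have -> : (fun k => Ex (fun w => Yi k j w * Yi k i w)) = fun k => Ex (fun w => Yi k i w * Yi k j w).
    by apply/funext => k; apply: eq_Ex => w; rewrite mulrC.
  exact: cS.
(* Expanding the square before the limit gives the quadratic form of [Sigma]; limits are unique. *)
have qS t : qf Sigma t t = s t.
  have cq : Ex (fun w => dotr t (\row_i Yi k i w) ^+ 2) @[k --> \oo] --> qf Sigma t t.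
    have -> : (fun k => Ex (fun w => dotr t (\row_i Yi k i w) ^+ 2)) = fun k =>
       \sum_i \sum_j t 0 i * Ex (fun w => Yi k i w * Yi k j w) * t 0 j.
      apply/funext => k.
      have ii i j : ig P (fun w => Yi k i w * Yi k j w) by apply: L2_igM; exact: Y_L2.
      transitivity (Ex (fun w => \sum_i \sum_j t 0 i * t 0 j * (Yi k i w * Yi k j w))).
        apply: eq_Ex => w; rewrite expr2 dotrE big_distrl /=; apply: eq_bigr => i _.
        rewrite big_distrr /=; apply: eq_bigr => j _; rewrite !mxE; ring.
      rewrite Ex_sum; last by move=> i; apply: ig_sum => j; exact: igZ.
      apply: eq_bigr => i _; rewrite Ex_sum; last by move=> j; exact: igZ.
      by apply: eq_bigr => j _; rewrite ExZ//; ring.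
    rewrite qfE.
    apply: (@cvg_big R _ +%R 0 xpredT (@add_continuous R)) => i _.
    apply: (@cvg_big R _ +%R 0 xpredT (@add_continuous R)) => j _.
    by apply: cvgM; [apply: cvgM; [exact: cvg_cst|exact: cS]|exact: cvg_cst].
  exact: (@cvg_unique _ (@norm_hausdorff R R) _ _ _ _ cq (cs t)).
exists Sigma; split => // [t|t th e e0].
  by rewrite qS; have [] := hs t.
by rewrite qS; have [_ [_ h]] := hs t; exact: h.
Qed.

Lemma Z_statE k i w : 0 < vol (W k) -> lam / 2 <= Dk k w ->
  Zi k i w = Yi k i w / Dk k w.
Proof.
move=> v0 hD; have D0 : 0 < Dk k w by apply: lt_le_trans hD; rewrite divr_gt0.
have N0 : 0 < fine (X w (W k `*` setT)) by move: D0; rewrite /Dk pmulr_lgt0// invr_gt0.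
by rewrite Y_statE /Z_stat /Dk; exact: ratio_identity.
Qed.

Lemma dotr_Z t k w : 0 < vol (W k) -> lam / 2 <= Dk k w ->
  dotr t (\row_i Zi k i w) = dotr t (\row_i Yi k i w) / Dk k w.
Proof.
move=> v0 hD; rewrite !dotrE big_distrl /=; apply: eq_bigr => i _.
by rewrite !mxE Z_statE//; ring.
Qed.

Lemma measurable_Z k : measurable_fun setT (fun w => \row_i Zi k i w : borel 'rV[R]_l).
Proof.
apply: measurable_rV => i; under eq_fun do rewrite mxE.
rewrite /Z_stat.
apply: (measurable_funM (measurable_cst _)).
apply: measurable_funB; last exact: measurable_cst.
apply: measurable_funM; first exact: measurable_fineX.
(* The real power [-1] agrees with the inverse on non-negative numbers, including at 0 where both
   are 0. *)
have -> : (fun w => (fine (X w (W k `*` setT)))^-1) =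
    (fun w => (fine (X w (W k `*` setT))) `^ (-1)).
  by apply/funext => w; rewrite powR_inv1// fine_ge0.
apply: (measurableT_comp (measurable_powR (-1))); exact: measurable_fineX.
Qed.


Let cos_diff (x y : R) : `|cos x - cos y| <= 2.
Proof.
by apply: le_trans (ler_normB _ _) _; rewrite (_ : 2 = 1 + 1)// lerD// ler_norml cos_geN1 cos_le1.
Qed.

Let measurable_D k : measurable_fun setT (fun w => Dk k w).
Proof. by apply: measurable_funM => //; exact: measurable_fineX. Qed.

(** Slutsky's argument at the level of cosines: close to [lam] the ratio is a Lipschitz
    perturbation, and the exceptional event is handled by Chebyshev. *)
Lemma Z_cos_close (t : 'rV[R]_l) th (e : R) : 0 < e -> \forall k \near \oo,
  `|Ex (fun w => cos (dotr t (\row_i Zi k i w) + th)) -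
    Ex (fun w => cos (dotr (lam^-1 *: t) (\row_i Yi k i w) + th))| <= e.
Proof.
move=> e0; have [L2Y [sg2 sg0 [hsg _]]] := Y_clt t; have [L2D hD] := Dk_near.
pose K := sg2 + 2.
have K0 : 0 < K by rewrite ltr_wpDl.
(* The first bound keeps [Dk] above [lam / 2]; the second makes the main contribution at most
   [e / 2], as [K] bounds the mean absolute value of the combination. *)
pose eta := Num.min (lam / 2) (e * lam ^+ 2 / (4 * K)).
have l2 : 0 < lam ^+ 2 by rewrite exprn_gt0.
have eta0 : 0 < eta by rewrite lt_min !divr_gt0// ?mulr_gt0.
have ee : 0 < e * eta ^+ 2 / 4 by rewrite divr_gt0// mulr_gt0// exprn_gt0.
near=> k.
have v0 : 0 < vol (W k) by apply: (@lt_le_trans _ _ 1) => //; near: k; exact: vol_near_ge.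
have hk1 : `|Ex (fun w => dotr t (\row_i Yi k i w) ^+ 2) - sg2| <= 1 by near: k; exact: hsg.
have hk2 : Ex (fun w => (Dk k w - lam) ^+ 2) <= e * eta ^+ 2 / 4 by near: k; exact: hD.
have mZ : measurable_fun setT (fun w => dotr t (\row_i Zi k i w) + th).
  by apply: measurable_funD => //; exact: (measurableT_comp (measurable_dotr t) (measurable_Z k)).
have mY : measurable_fun setT (fun w => dotr (lam^-1 *: t) (\row_i Yi k i w) + th).
  by apply: measurable_funD => //; case: ((Y_clt (lam^-1 *: t)).1 k).
have bZ := bm_cosf mZ; have bY := bm_cosf mY.
rewrite -ExB; [|exact: bm_ig|exact: bm_ig].
have i1 : ig P (fun w => 2 * eta / lam ^+ 2 * `|dotr t (\row_i Yi k i w)|).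
  by apply: igZ; apply: L2_ig; exact: L2_norm.
have i2 : ig P (fun w => 2 / eta ^+ 2 * (Dk k w - lam) ^+ 2).
  by apply: igZ; have [] := L2D k.
apply: (@le_trans _ _ (Ex (fun w => 2 * eta / lam ^+ 2 * `|dotr t (\row_i Yi k i w)| +
    2 / eta ^+ 2 * (Dk k w - lam) ^+ 2))).
  apply: norm_Ex_le.
  - by apply: bm_ig; exact: bmB.
  - exact: igD.
  (* Off the good event the difference of cosines is at most 2, hence at most twice the squared
     deviation over [eta ^+ 2]. *)
  move=> w; have [h|h] := leP `|Dk k w - lam| eta; last first.
    apply: le_trans (cos_diff _ _) _.
    apply: (@le_trans _ _ (2 / eta ^+ 2 * (Dk k w - lam) ^+ 2)).
      rewrite mulrAC ler_pdivlMr ?exprn_gt0// ler_wpM2l//.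
      by rewrite -[leRHS](real_normK (num_real _)) lerXn2r ?nnegrE ?(ltW eta0)// ltW.
    by rewrite lerDr !mulr_ge0 ?invr_ge0 ?sqr_ge0// ltW.
  have hl : lam / 2 <= Dk k w.
    have : eta <= lam / 2 by rewrite ge_min lexx.
    by move: h; rewrite ler_norml => /andP[]; lra.
  apply: (@le_trans _ _ (2 * eta / lam ^+ 2 * `|dotr t (\row_i Yi k i w)|)); last first.
    by rewrite lerDl mulr_ge0 ?sqr_ge0// divr_ge0 ?sqr_ge0.
  apply: le_trans (cos_lipschitz _ _) _.
  rewrite dotr_Z//.
  have -> : dotr (lam^-1 *: t) (\row_i Yi k i w) = dotr t (\row_i Yi k i w) / lam.
    by rewrite !dotrE big_distrl /=; apply: eq_bigr => i _; rewrite !mxE; ring.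
  have := ratio_close (dotr t (\row_i Yi k i w)) lam0 (ltW eta0) hl h.
  by rewrite [leRHS]mulrC opprD addrACA subrr addr0.
rewrite ExD// (ExZ _ (L2_ig (L2_norm (L2Y k)))) (ExZ _ (L2D k).2).
rewrite [leRHS]splitr; apply: lerD; last first.
  rewrite mulrAC ler_pdivrMr ?exprn_gt0//.
  by move: hk2; set u := Ex _; lra.
have hE : Ex (fun w => `|dotr t (\row_i Yi k i w)|) <= K.
  apply: le_trans (Ex_norm_le (L2Y k)) _.
  have h1 : Ex (fun w => dotr t (\row_i Yi k i w) ^+ 2) <= K ^+ 2.
    move: hk1; rewrite ler_norml /K => /andP[_ h]; nra.
  by rewrite -(ger0_norm (ltW K0)) -sqrtr_sqr ler_wsqrtr.
apply: (@le_trans _ _ (2 * (e * lam ^+ 2 / (4 * K)) / lam ^+ 2 * K)).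
  apply: ler_pM => //.
  - by rewrite divr_ge0 ?sqr_ge0// mulr_ge0// ltW.
  - by apply: Ex_ge0.
  - by rewrite ler_wpM2r ?invr_ge0 ?sqr_ge0// ler_wpM2l// ge_min lexx orbT.
by rewrite le_eqVlt; apply/orP; left; apply/eqP; field; rewrite !gt_eqF.
Unshelve. all: by end_near.
Qed.

(** Leaving the box forces either [Dk] to deviate from [lam] by more than [lam / 2] or some [Y] to
    exceed [A * lam / 2]; both are paid by second moments. *)
Lemma Z_tight (e : R) : 0 < e -> exists2 A, 0 < A &
  \forall k \near \oo, Ex (outbox A \o (fun w => \row_i Zi k i w)) <= e.
Proof.
move=> e0; have [L2D hD] := Dk_near.
have /choice[sg hsg] : forall i : 'I_l, exists x : R, 0 <= x /\
    forall e, 0 < e -> \forall k \near \oo, `|Ex (fun w => Yi k i w ^+ 2) - x| <= e.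
  move=> i; have [_ [x x0 [h _]]] := Y_clt (delta_mx 0 i).
  exists x; split => // e' e'0; apply: filterS (h e' e'0) => k.
  by under [X in `|X - _| <= _ -> _]eq_Ex do rewrite dotr_delta mxE.
pose K := \sum_i (sg i + 1).
have K0 : 0 <= K by apply: sumr_ge0 => i _; rewrite addr_ge0//; have [] := hsg i.
have l2 : 0 < lam ^+ 2 by rewrite exprn_gt0.
(* Makes [4 * K / (lam ^+ 2 * A ^+ 2)], the Chebyshev bound for the [Y] part, at most [e / 2]. *)
pose A := Num.sqrt (8 * (K + 1) / (e * lam ^+ 2)).
have K1 : 0 < K + 1 by rewrite ltr_wpDl.
have A2 : A ^+ 2 = 8 * (K + 1) / (e * lam ^+ 2).
  by rewrite sqr_sqrtr// ltW// divr_gt0// mulr_gt0.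
have A0 : 0 < A by rewrite sqrtr_gt0 divr_gt0// mulr_gt0.
exists A => //.
have eD : 0 < e * lam ^+ 2 / 8 by rewrite divr_gt0// mulr_gt0.
have hY : \forall k \near \oo, forall i, Ex (fun w => Yi k i w ^+ 2) <= sg i + 1.
  apply: filter_forall => i; have [_ h] := hsg i.
  apply: filterS (h 1 ltr01) => k; rewrite ler_norml => /andP[_]; lra.
near=> k.
have v0 : 0 < vol (W k) by apply: (@lt_le_trans _ _ 1) => //; near: k; exact: vol_near_ge.
have hk1 : forall i, Ex (fun w => Yi k i w ^+ 2) <= sg i + 1 by near: k; exact: hY.
have hk2 : Ex (fun w => (Dk k w - lam) ^+ 2) <= e * lam ^+ 2 / 8 by near: k; exact: hD.
have i2 : ig P (fun w => 4 / lam ^+ 2 * (Dk k w - lam) ^+ 2).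
  by apply: igZ; have [] := L2D k.
have iY i : ig P (fun w => 4 / (lam ^+ 2 * A ^+ 2) * Yi k i w ^+ 2).
  by apply: igZ; have [] := Y_L2 k i.
have i1 : ig P (fun w => \sum_i 4 / (lam ^+ 2 * A ^+ 2) * Yi k i w ^+ 2) by apply: ig_sum.
have c1 : 0 <= 4 / (lam ^+ 2 * A ^+ 2) by rewrite divr_ge0// mulr_ge0 ?sqr_ge0.
have c2 : 0 <= 4 / lam ^+ 2 by rewrite divr_ge0// sqr_ge0.
apply: (@le_trans _ _ (Ex (fun w => \sum_i 4 / (lam ^+ 2 * A ^+ 2) * Yi k i w ^+ 2 +
    4 / lam ^+ 2 * (Dk k w - lam) ^+ 2))).
  apply: le_Ex.
  - apply: bm_ig; split; first exact: (measurableT_comp (measurable_outbox A) (measurable_Z k)).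
    by exists 1 => w; rewrite /outbox /=; case: (~~ _); rewrite ?normr1 ?normr0.
  - exact: igD.
  move=> w; rewrite /outbox /=.
  have q1 : 0 <= \sum_i 4 / (lam ^+ 2 * A ^+ 2) * Yi k i w ^+ 2.
    by apply: sumr_ge0 => i _; rewrite mulr_ge0 ?sqr_ge0.
  have q2 : 0 <= 4 / lam ^+ 2 * (Dk k w - lam) ^+ 2 by rewrite mulr_ge0 ?sqr_ge0.
  case: asboolP => /= [_|nb]; first exact: addr_ge0.
  have [h|h] := leP `|Dk k w - lam| (lam / 2); last first.
    apply: (@le_trans _ _ (4 / lam ^+ 2 * (Dk k w - lam) ^+ 2)); last by rewrite lerDr.
    rewrite mulrAC ler_pdivlMr// mul1r.
    have l20 : 0 <= lam / 2 by rewrite divr_ge0// ltW.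
    have : (lam / 2) ^+ 2 <= (Dk k w - lam) ^+ 2.
      by rewrite -[leRHS](real_normK (num_real _)) lerXn2r ?nnegrE// ltW.
    by rewrite exprMn exprVn; lra.
  have hl : lam / 2 <= Dk k w by move: h; rewrite ler_norml => /andP[]; lra.
  move: nb => /existsNP[i /negP]; rewrite -ltNge mxE Z_statE// => hi.
  apply: (@le_trans _ _ (4 / (lam ^+ 2 * A ^+ 2) * Yi k i w ^+ 2)); last first.
    apply: (@le_trans _ _ (\sum_i 4 / (lam ^+ 2 * A ^+ 2) * Yi k i w ^+ 2)); last by rewrite lerDl.
    rewrite [leRHS](bigD1 i)//= lerDl; apply: sumr_ge0 => j _.
    by rewrite mulr_ge0 ?sqr_ge0.
  have D0 : 0 < Dk k w by apply: lt_le_trans hl; rewrite divr_gt0.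
  rewrite mulrAC ler_pdivlMr ?mulr_gt0 ?exprn_gt0// mul1r.
  move: hi; rewrite normrM normfV (gtr0_norm D0) ltr_pdivlMr// => hi.
  have h3 : A * (lam / 2) <= `|Yi k i w|.
    by apply: le_trans (ltW hi); rewrite ler_wpM2l// ltW.
  have : (A * (lam / 2)) ^+ 2 <= Yi k i w ^+ 2.
    rewrite -[leRHS](real_normK (num_real _)) lerXn2r ?nnegrE//.
    by rewrite mulr_ge0 ?divr_ge0// ltW.
  by rewrite !exprMn exprVn; lra.
rewrite ExD// (ExZ _ (L2D k).2) Ex_sum//.
rewrite [leRHS]splitr; apply: lerD; last first.
  rewrite mulrAC ler_pdivrMr//; move: hk2; set u := Ex _; lra.
apply: (@le_trans _ _ (\sum_i 4 / (lam ^+ 2 * A ^+ 2) * (sg i + 1))).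
  apply: ler_sum => i _; rewrite ExZ; last by have [] := Y_L2 k i.
  by rewrite ler_wpM2l.
rewrite -big_distrr /= -/K A2.
have -> : 4 / (lam ^+ 2 * (8 * (K + 1) / (e * lam ^+ 2))) * K = e / 2 * (K / (K + 1)).
  by field; rewrite !gt_eqF.
rewrite ler_piMr ?divr_ge0 ?(ltW e0)// ler_pdivrMr// mul1r lerDl.
Unshelve. all: by end_near.
Qed.

End final.

(** * Convergence in distribution of the vector of ratios *)

Lemma expectation_Ex d (T : measurableType d) (R : realType) (P : probability T R) (f : T -> R) :
  ig P f -> ('E_P[f] = (Ex P f)%:E)%E.
Proof.
move=> fi; rewrite unlock /Ex /Rintegral fineK//.
exact: integrable_fin_num.
Qed.

Unset Implicit Arguments.
Set Strict Implicit.
Set Printing Implicit Defensive.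

Theorem corollary3p2 (R : realType) (dO : measure_display)
    (Omega : measurableType dO) (P : probability Omega R)
    (d : nat) (d_gt0 : (0 < d)%N)
    (M : ptopologicalType) (polishM : polish R M)
    (X : R.-ker Omega ~> (borel 'rV[R]_d * borel M)%type)
    (mppX : marked_point_process X) (simpleX : simple_process X)
    (statX : stationary P X)
    (intensity_gt0 : (0 < intensity P X)%E)
    (intensity_fin : (intensity P X < +oo)%E)
    (bs bss : R -> R) (ratesX : mixing_rates P X bs bss)
    (betaX : condition_beta P X bs bss)
    (W : nat -> set 'rV[R]_d) (casW : convex_averaging_sequence W)
    (l : nat) (l_gt0 : (0 < l)%N)
    (C : 'I_l -> set (borel M)) (mC : forall i, measurable (C i)) :
  let lambda := fine (intensity P X) in
  exists Sigma : 'M[R]_l,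
    (forall i j,
      'E_P[(fun w => Y_stat P X (W k) (C i) w * Y_stat P X (W k) (C j) w)%R]%E
        @[k --> \oo] --> (Sigma i j)%:E) /\
    exists mu : probability (borel 'rV[R]_l) R,
      gaussian_law 0 (lambda ^- 2 *: Sigma) mu /\
      cvg_in_distribution P
        (fun k w => \row_i Z_stat P X (W k) (C i) w) mu.

Proof.
move=> lambda.
have lam0 : 0 < lambda by rewrite fine_gt0// intensity_gt0 intensity_fin.
have [Sigma [cS sS pS hS]] := Y_cov d_gt0 mppX statX intensity_gt0 intensity_fin ratesX betaX casW mC.
exists Sigma; split.
  move=> i j.
  have e : (fun k => 'E_P[(fun w => Y_stat P X (W k) (C i) w * Y_stat P X (W k) (C j) w)%R]%E) =
    fun k => (Ex P (fun w => Y_stat P X (W k) (C i) w * Y_stat P X (W k) (C j) w))%:E.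
    apply/funext => k; apply: expectation_Ex; apply: L2_igM;
    exact: (Y_L2 d_gt0 mppX statX intensity_gt0 intensity_fin ratesX betaX casW mC).
  rewrite e; apply/fine_cvgP; split; first exact: nearW.
  exact: cS.
(* Dividing by the limit of [Dk] rescales [t] by the inverse of [lambda], which accounts for the
   covariance of the limit law. *)
have qZ (t : 'rV[R]_l) : qf (lambda ^- 2 *: Sigma) t t = qf Sigma (lambda^-1 *: t) (lambda^-1 *: t).
  by rewrite !qfE; apply: eq_bigr => i _; apply: eq_bigr => j _; rewrite !mxE; field; rewrite gt_eqF.
have sZ : (lambda ^- 2 *: Sigma)^T = lambda ^- 2 *: Sigma by rewrite linearZ /= sS.
have pZ (t : 'rV[R]_l) : 0 <= qf (lambda ^- 2 *: Sigma) t t by rewrite qZ.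
have [mu [gmu hmu]] := gaussian_exists sZ pZ.
exists mu; split => // f cf [c fc].
have mZ k := measurable_Z P X casW mC k.
(* Triangle inequality through the rescaled combination of the [Y_stat]. *)
have near_cos (t : 'rV[R]_l) th : near_law P mu (fun k w => \row_i Z_stat P X (W k) (C i) w)
    (fun x : borel 'rV[R]_l => x) (fun x => cos (dotr t x + th)).
  move=> e e0; have e2 : 0 < e / 2 by rewrite divr_gt0.
  have h1 := Z_cos_close d_gt0 mppX statX intensity_gt0 intensity_fin ratesX betaX casW mC t th e2.
  have h2 := hS (lambda^-1 *: t) th _ e2.
  near=> k.
  rewrite (hmu t th) qZ.
  have k1 : `|Ex P (fun w => cos (dotr t (\row_i Z_stat P X (W k) (C i) w) + th)) -
    Ex P (fun w => cos (dotr (lambda^-1 *: t) (\row_i Y_stat P X (W k) (C i) w) + th))| <= e / 2.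
    by near: k.
  have k2 : `|Ex P (fun w => cos (dotr (lambda^-1 *: t) (\row_i Y_stat P X (W k) (C i) w) + th)) -
    cos th * expR (- (qf Sigma (lambda^-1 *: t) (lambda^-1 *: t) / 2))| <= e / 2 by near: k.
  rewrite [leRHS]splitr; apply: le_trans _ (lerD k1 k2).
  by apply: le_trans _ (ler_normD _ _); rewrite addrA subrK.
have tight := Z_tight d_gt0 mppX statX intensity_gt0 intensity_fin ratesX betaX casW mC.
have mid : measurable_fun setT ((fun x => x) : borel 'rV[R]_l -> borel 'rV[R]_l) by exact: measurable_id.
have lev := levy_continuity mZ mid near_cos tight (tight_single mu mid) cf fc.
have mf : measurable_fun setT (f : borel 'rV[R]_l -> R) by exact: measurable_continuous_R.
have bf : bm (f : borel 'rV[R]_l -> R) by split => //; exists c.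
have -> : (\int[mu]_x (f x)%:E)%E = (Ex mu f)%:E.
  by rewrite /Ex /Rintegral fineK//; apply: integrable_fin_num => //; exact: bm_ig.
have -> : (fun k => 'E_P[f \o (fun w => \row_i Z_stat P X (W k) (C i) w)]%E) =
  fun k => (Ex P (f \o (fun w => \row_i Z_stat P X (W k) (C i) w)))%:E.
  apply/funext => k; apply: expectation_Ex; apply: bm_ig; split.
    exact: (measurableT_comp mf (mZ k)).
  by exists c => w; exact: fc.
apply/fine_cvgP; split; first exact: nearW.
apply/cvgrPdist_le => e e0; apply: filterS (lev e e0) => k /=.
by rewrite distrC.
Unshelve. all: by end_near.
Qed.
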